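(* Let $\beta:\mathbb{R}\to\mathbb{R}$ satisfy Assumption (A) and Assumption (B), and assume that the associated function $\Phi$ is continuous on $\mathbb{R}_+=[0,+\infty)$. Let $u_0\in L^1(\mathbb{R})$ be a probability density ($u_0\ge 0$, $\int_{\mathbb{R}}u_0(x)\,dx=1$) which has locally bounded variation except on a discrete set of points $D_0\subset\mathbb{R}$. Let $T>0$. Then there is a process $Y$ solving in law, on $[0,T]$, the non-linear stochastic differential equation $$ \begin{cases} Y_t = Y_0+\displaystyle\int_0^t \Phi(u(s,Y_s))\,dW_s,\\ u(t,\cdot)=\text{law density of } Y_t,\quad \forall\, t>0,\\ u(0,\cdot)=u_0=\text{law density of } Y_0 . \end{cases} $$
   Context: Assumption (A) on $\beta:\mathbb{R}\to\mathbb{R}$: (i) $\beta|_{\mathbb{R}_+}$ is monotone (increasing); (ii) $\beta(0)=0$ and $\beta$ is continuous at $0$; (iii) there is $\lambda>0$ such that $(\beta+\lambda\,\mathrm{id})(\mathbb{R}_+)=\mathbb{R}_+$, where $\mathrm{id}(x)=x$. (If $\beta$ has jumps it is understood as completed into a graph by filling the jumps; when $\Phi$ is continuous, $\beta|_{\mathbb{R}_+}$ is continuous and no filling is needed.) Assumption (B): there is a constant $c>0$ such that $|\beta(u)|\le c|u|$ for all $u\in\mathbb{R}$. Let $\beta_0:\mathbb{R}\to\mathbb{R}$ be the odd function with $\beta_0|_{\mathbb{R}_+}=\beta|_{\mathbb{R}_+}$. The function $\Phi:\mathbb{R}\to\mathbb{R}_+$ is defined by $\Phi(u)=\sqrt{\beta_0(u)/u}$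 for $u\neq 0$ and $\Phi(0)=C$, where $C$ is a fixed constant in $[\liminf_{u\to0^+}\Phi(u),\limsup_{u\to0^+}\Phi(u)]$. ''$u_0$ has locally bounded variation except on a discrete set of points $D_0$'' means: $D_0$ is a discrete (locally finite) subset of $\mathbb{R}$ and (a version of) $u_0$ has bounded variation on every compact interval contained in $\mathbb{R}\setminus D_0$. ''Solving in law'' means: there exist a filtered probability space $(\Omega,\mathcal{F},(\mathcal{F}_t)_{t\in[0,T]},\mathbb{P})$, an $(\mathcal{F}_t)$-Brownian motion $W$ on it, a continuous $(\mathcal{F}_t)$-adapted process $Y=(Y_t)_{t\in[0,T]}$, and a Borel function $u:[0,T]\times\mathbb{R}\to\mathbb{R}_+$ such that $u(t,\cdot)$ is a density of the law of $Y_t$ with respect to Lebesgue measure for every $t\in(0,T]$, $Y_0$ has law $u_0(x)\,dx$, and $Y_t=Y_0+\int_0^t\Phi(u(s,Y_s))\,dW_s$ for all $t\in[0,T]$ almost surely. *)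

(* Defs.v *)
From HB Require Import structures.
From mathcomp Require Import all_boot all_order all_algebra.
From mathcomp Require Import all_classical all_reals all_analysis.

Set Implicit Arguments.
Unset Strict Implicit.
Unset Printing Implicit Defensive.

Import Order.TTheory GRing.Theory Num.Theory.
Import numFieldNormedType.Exports.

Local Open Scope classical_set_scope.
Local Open Scope ring_scope.

Section coefficient.
Context {R : realType}.
Implicit Types (beta : R -> R) (C : R).

(* The image in the last clause is that of the function [beta] itself, not of
   the graph with filled jumps: both agree when [beta] is continuous on the
   nonnegative half-line, hence as soon as [Phi beta C] is. *)
Definition assumptionA beta : Prop :=
  [/\ forall x y, 0 <= x -> x <= y -> beta x <= beta y,
      beta 0 = 0,
      {for 0, continuous beta} &
      exists2 lambda : R, 0 < lambda &
        [set beta x + lambda * x | x in [set x | 0 <= x]] = [set y | 0 <= y]].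

Definition assumptionB beta : Prop :=
  exists2 c : R, 0 < c & forall u, `|beta u| <= c * `|u|.

Definition beta0 beta (u : R) : R := if 0 <= u then beta u else - beta (- u).

Definition Phi beta C (u : R) : R :=
  if u == 0 then C else Num.sqrt (beta0 beta u / u).

(* [0^'+] does not contain the point 0, so the bounds do not involve [C]. *)
Definition admissible_value0 beta C : Prop :=
  (limf_einf (fun u : R => (Phi beta C u)%:E) 0^'+ <= C%:E)%E /\
  (C%:E <= limf_esup (fun u : R => (Phi beta C u)%:E) 0^'+)%E.

Definition probability_density (u0 : R -> R) : Prop :=
  [/\ lebesgue_measure.-integrable setT (EFin \o u0),
      {ae lebesgue_measure, forall x : R, 0 <= u0 x} &
      (\int[lebesgue_measure]_x (u0 x)%:E = 1)%E].

Definition locally_finite (D : set R) : Prop :=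
  forall a b : R, finite_set (D `&` `[a, b]).

Definition locally_BV_except (D : set R) (u0 : R -> R) : Prop :=
  exists2 v : R -> R, {ae lebesgue_measure, forall x : R, v x = u0 x} &
    forall a b : R, a <= b -> `[a, b] `&` D = set0 -> bounded_variation a b v.

End coefficient.

(* Processes are indexed by all of [R]; only times in [0, T] matter. *)
Section stochastic_calculus.
Context {R : realType} {d : measure_display} {Omega : measurableType d}.
Variables (P : probability Omega R) (F : R -> set (set Omega)) (T : R).
Implicit Types (W Y H M : R -> Omega -> R).

Definition filtration : Prop :=
  [/\ forall t, 0 <= t <= T -> sigma_algebra setT (F t),
      forall t, 0 <= t <= T -> F t `<=` measurable &
      forall s t, 0 <= s -> s <= t -> t <= T -> F s `<=` F t].

Definition measurable_wrt (G : set (set Omega)) (X : Omega -> R) : Prop :=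
  forall A : set R, measurable A -> G (X @^-1` A).

Definition adapted Y : Prop :=
  forall t, 0 <= t <= T -> measurable_wrt (F t) (Y t).

Definition continuous_paths Y : Prop :=
  forall w, {within `[0, T], continuous (fun t => Y t w)}.

(* The increment W_t - W_s is independent of F_s and has law N(0, t - s);
   the second parameter of [normal_prob] is the standard deviation. *)
Definition brownian_motion W : Prop :=
  [/\ adapted W,
      continuous_paths W,
      {ae P, forall w, W 0 w = 0} &
      forall s t : R, 0 <= s -> s < t -> t <= T ->
        let dW := fun w => W t w - W s w in
        (forall (A : set Omega) (B : set R), F s A -> measurable B ->
           P (A `&` dW @^-1` B) = (P A * P (dW @^-1` B))%E) /\
        (forall B : set R, measurable B ->
           P (dW @^-1` B) = normal_prob 0 (Num.sqrt (t - s)) B)].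

(* sum over i < n of xi_i 1_(t_i, t_{i+1}], with xi_i bounded and
   F_{t_i}-measurable *)
Record simple_process := SimpleProcess {
  sp_size : nat;
  sp_time : nat -> R;
  sp_coef : nat -> Omega -> R;
  sp_time_ge0 : 0 <= sp_time 0%N;
  sp_time_leT : sp_time sp_size <= T;
  sp_time_le : forall i, (i < sp_size)%N -> sp_time i <= sp_time i.+1;
  sp_coef_measurable : forall i, (i < sp_size)%N ->
    measurable_wrt (F (sp_time i)) (sp_coef i);
  sp_coef_bounded : forall i, (i < sp_size)%N ->
    exists c : R, forall w, `|sp_coef i w| <= c
}.

Definition sp_val (S : simple_process) : R -> Omega -> R := fun t w =>
  \sum_(i < sp_size S)
    sp_coef S i w * (sp_time S i < t <= sp_time S i.+1)%R%:R.

Definition sp_integral (S : simple_process) W : R -> Omega -> R := fun t w =>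
  \sum_(i < sp_size S) sp_coef S i w *
    (W (Num.min (sp_time S i.+1) t) w - W (Num.min (sp_time S i) t) w).

Definition ito_integrand H : Prop :=
  [/\ measurable_fun (`[0, T] `*` setT) (fun p : R * Omega => H p.1 p.2),
      adapted H &
      (\int[P]_w \int[lebesgue_measure]_(s in `[0%R, T]) (H s w ^+ 2)%:E
         < +oo)%E].

(* [M] is a continuous version of the process t |-> int_0^t H_s dW_s on
   [0, T]: the L^2 limit of the integrals of simple processes approximating
   [H] in L^2([0, T] x Omega). *)
Definition ito_integral W H M : Prop :=
  [/\ ito_integrand H,
      forall t, 0 <= t <= T -> measurable_fun setT (M t),
      continuous_paths M &
      exists S : nat -> simple_process,
        (fun n => \int[P]_w \int[lebesgue_measure]_(s in `[0%R, T])
           ((sp_val (S n) s w - H s w) ^+ 2)%:E)%E @ \oo --> 0%E /\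
        forall t, 0 <= t <= T ->
          (fun n => \int[P]_w
             ((sp_integral (S n) W t w - M t w) ^+ 2)%:E)%E @ \oo --> 0%E].

Definition law_density (X : Omega -> R) (f : R -> R) : Prop :=
  forall A : set R, measurable A ->
    P (X @^-1` A) = (\int[lebesgue_measure]_(x in A) (f x)%:E)%E.

Definition sde_solution (phi u0 : R -> R) W Y (u : R -> R -> R) : Prop :=
  [/\ filtration, brownian_motion W, adapted Y & continuous_paths Y] /\
  [/\ measurable_fun (`[0, T] `*` setT) (fun p : R * R => u p.1 p.2),
      forall t x, 0 <= t <= T -> 0 <= u t x,
      forall t, 0 < t <= T -> law_density (Y t) (u t),
      {ae lebesgue_measure, forall x : R, u 0 x = u0 x} /\
        law_density (Y 0) u0 &
      exists2 M : R -> Omega -> R,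
        ito_integral W (fun s w => phi (u s (Y s w))) M &
        {ae P, forall w, forall t, 0 <= t <= T -> Y t w = Y 0 w + M t w}].

End stochastic_calculus.

Definition solvable_in_law {R : realType} (phi u0 : R -> R) (T : R) : Prop :=
  exists (d : measure_display) (Omega : measurableType d)
    (P : probability Omega R) (F : R -> set (set Omega))
    (W Y : R -> Omega -> R) (u : R -> R -> R),
    sde_solution P F T phi u0 W Y u.

(* Main.v *)
(* Put g = Phi^2, so that u g(u) = beta(u) is nondecreasing on the nonnegative half-line and g is
   bounded. On a torus of mesh delta, consider the random walk X which at step k jumps from a site
   i to i +- 1 with a probability proportional to g_n(u_k(i)), where g_n is a truncation of g and
   delta u_k is the law of X at step k. Then u_k solves the explicit finite difference scheme for
   u_t = (1/2) (u g_n(u))_xx. As u g_n(u) is nondecreasing and Lipschitz, this scheme contracts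
   the l1 norm; as it commutes with translations, the L1 modulus of continuity of u_k in space is
   controlled by that of u_0, uniformly in k and in the mesh.

   The passage to the limit takes place on a Loeb space: the histories of the walks form an
   ultraproduct along a free ultrafilter, and the limits of their expectations define a
   probability on the sigma-algebra generated by the internal sets. Let W be the walk with
   increments dX / Phi_n(u_k(X)), replaced by the tosses of a fair coin where Phi_n is small.
   Fourth moments and a maximal inequality make almost all the paths of X and W S-continuous, and
   their standard parts are continuous processes Y and W; a Lindeberg argument shows that the
   latter is a Brownian motion.

   The averages of u_k over a radius r are Lipschitz in space and regular in time, hence have
   standard parts v_r; these converge as r tends to 0 to a density u(t, .) of the law of Y_t.
   By the discrete isometry, the stochastic integrals of the simple processes
   Phi(v_r(t_i, Y_{t_i})) are close in L^2 to Y - Y_0, up to the sum of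
   delta u_k |g(averages of u_k) - g_n(u_k)|, which is small by the control of the modulus of
   continuity. *)

Require Import Defs.
From HB Require Import structures.
From mathcomp Require Import all_boot all_order all_algebra.
From mathcomp Require Import all_classical all_reals all_analysis.
From mathcomp Require Import measurable_realfun.
From mathcomp Require Import ring lra.

Set Implicit Arguments.
Unset Strict Implicit.
Unset Printing Implicit Defensive.

Import Order.TTheory GRing.Theory Num.Theory.
Import numFieldNormedType.Exports.

Local Open Scope classical_set_scope.
Local Open Scope ring_scope.

(** * Limits along an ultrafilter *)

(** The coefficient sees the density pointwise, so weak convergence of the laws is not enough to
    pass to the limit in $\Phi(u(s,Y_s))$: local averages must be close in $L^1$ to the density
    itself, uniformly in time and in the mesh, and this is what the contraction estimate gives. The
    flux $u g(u)$ is only continuous and nondecreasing, whereas an explicit scheme is monotone only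
    under a CFL condition. Hence $g$ is truncated so that the flux becomes $n$-Lipschitz, and mesh
    and time step are coupled by $\delta^2 = n h$: then the jump probability $g_n/n$ is at most 1
    and the flux divided by $n$ is 1-Lipschitz. The equation may degenerate where $\Phi$ vanishes,
    and there $W$ cannot be recovered from $X$. The coin, independent of the jump, keeps $W$ a
    martingale with the same deterministic variance $h$ at each step, while $X$ hardly moves at such
    sites, so both increments stay compatible up to the cutoff. On the Loeb space $W$, $Y$ and the
    filtration are read off one sample point; standard parts take the place of tightness and of a
    representation theorem. *)

Section ultralimit.
Context {R : realType} (U : set_system nat) {UU : UltraFilter U}.
Hypothesis U_cofinite : (\oo : set_system nat) `<=` U.
Implicit Types (x y : nat -> R).

Definition ulim x : R := lim (x @ U).

(** A bound on a member of [U] suffices: nothing is asked of the other indices, where internal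
    objects may be arbitrary. *)
Definition ubounded x := exists c : R, \forall n \near U, `|x n| <= c.

(** The image of an ultrafilter is an ultrafilter, and one that contains a compact segment
    converges. *)
Lemma ulim_cvg x : ubounded x -> x @ U --> ulim x.
Proof.
move=> [c xc].
have uxU : UltraFilter (x @ U).
  split; first exact: fmap_proper_filter.
  move=> G GF xG; rewrite predeqE => A; split => [GA|]; last exact: xG.
  have [//|nA] := in_ultra_setVsetC (x @^-1` A) UU.
  have GnA : G (~` A) by apply: xG.
  by have /filter_ex [? []] : G (A `&` ~` A) by exact: filterI.
have := @segment_compact R (- c) c; rewrite compact_ultra => /(_ _ uxU).
case; last by move=> p [_ /= xp]; apply: (cvgP p).
by apply: filterS xc => n; rewrite /= in_itv /= ler_norml.
Qed.

Lemma ulim_eq x l : x @ U --> l -> ulim x = l.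
Proof. by move/cvg_lim; apply. Qed.

Lemma ubounded_cvg x (l : R) : x @ U --> l -> ubounded x.
Proof.
move=> xl; exists (`|l| + 1).
have /cvgrPdist_le/(_ 1 ltr01) := xl.
apply: filterS => n h; rewrite -(subrK l (x n)) (le_trans (ler_normD _ _))//.
by rewrite addrC lerD2l distrC.
Qed.

Lemma cvg_oo_U x (l : R) : x @ \oo --> l -> x @ U --> l.
Proof. by move=> xl A /xl; exact: U_cofinite. Qed.

Lemma near_oo_U (P : set nat) : (\forall n \near \oo, P n) -> \forall n \near U, P n.
Proof. exact: U_cofinite. Qed.

Lemma ulim_le x (c : R) : ubounded x -> (\forall n \near U, x n <= c) -> ulim x <= c.
Proof.
move=> /ulim_cvg xl xc; rewrite leNgt; apply/negP => cl.
have /cvgrPdist_lt/(_ (ulim x - c)) := xl.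
rewrite subr_gt0 => /(_ cl) h.
near U => n.
have h1 : `|ulim x - x n| < ulim x - c by near: n.
have h2 : x n <= c by near: n.
move: h1; rewrite ltNge => /negP; apply.
by rewrite (le_trans _ (ler_norm _))// lerB.
Unshelve. all: by end_near. Qed.

Lemma ulim_ge x (c : R) : ubounded x -> (\forall n \near U, c <= x n) -> c <= ulim x.
Proof.
move=> /ulim_cvg xl xc; rewrite leNgt; apply/negP => cl.
have /cvgrPdist_lt/(_ (c - ulim x)) := xl.
rewrite subr_gt0 => /(_ cl) h.
near U => n.
have h1 : `|ulim x - x n| < c - ulim x by near: n.
have h2 : c <= x n by near: n.
move: h1; rewrite ltNge => /negP; apply.
by rewrite distrC (le_trans _ (ler_norm _))// lerB.
Unshelve. all: by end_near. Qed.

Lemma ulim_lt_near x (c : R) : ubounded x -> ulim x < c -> \forall n \near U, x n < c.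
Proof.
move=> /ulim_cvg xl lc; exact: (cvgr_lt _ xl).
Qed.

Lemma near_neg (P : set nat) : ~ (\forall n \near U, P n) -> \forall n \near U, ~ P n.
Proof. by move=> nP; have [] := in_ultra_setVsetC P UU. Qed.

Lemma uboundedD x y : ubounded x -> ubounded y -> ubounded (fun n => x n + y n).
Proof. by move=> /ulim_cvg hx /ulim_cvg hy; apply: ubounded_cvg (cvgD hx hy). Qed.
Lemma uboundedB x y : ubounded x -> ubounded y -> ubounded (fun n => x n - y n).
Proof. by move=> /ulim_cvg hx /ulim_cvg hy; apply: ubounded_cvg (cvgB hx hy). Qed.
Lemma uboundedM x y : ubounded x -> ubounded y -> ubounded (fun n => x n * y n).
Proof. by move=> /ulim_cvg hx /ulim_cvg hy; apply: ubounded_cvg (cvgM hx hy). Qed.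
Lemma ubounded_cst (c : R) : ubounded (fun=> c).
Proof. by exists `|c|; exact: nearW. Qed.

Lemma ulimD x y : ubounded x -> ubounded y ->
  ulim (fun n => x n + y n) = ulim x + ulim y.
Proof. by move=> /ulim_cvg hx /ulim_cvg hy; apply: ulim_eq (cvgD hx hy). Qed.
Lemma ulimB x y : ubounded x -> ubounded y ->
  ulim (fun n => x n - y n) = ulim x - ulim y.
Proof. by move=> /ulim_cvg hx /ulim_cvg hy; apply: ulim_eq (cvgB hx hy). Qed.
Lemma ulimM x y : ubounded x -> ubounded y ->
  ulim (fun n => x n * y n) = ulim x * ulim y.
Proof. by move=> /ulim_cvg hx /ulim_cvg hy; apply: ulim_eq (cvgM hx hy). Qed.
Lemma ulim_cst (c : R) : ulim (fun=> c) = c.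
Proof. exact: ulim_eq (cvg_cst _). Qed.
Lemma ulim_norm x : ubounded x -> ulim (fun n => `|x n|) = `|ulim x|.
Proof. by move=> /ulim_cvg hx; apply: ulim_eq (cvg_norm hx). Qed.
Lemma ubounded_norm x : ubounded x -> ubounded (fun n => `|x n|).
Proof. by move=> [c hc]; exists c; apply: filterS hc => n; rewrite normr_id. Qed.
Lemma ulim_continuous (f : R -> R) x : continuous f -> ubounded x ->
  ulim (f \o x) = f (ulim x).
Proof. by move=> cf /ulim_cvg hx; apply: ulim_eq (cvg_comp _ _ hx (cf _)). Qed.
Lemma ubounded_continuous (f : R -> R) x : continuous f -> ubounded x ->
  ubounded (f \o x).
Proof. by move=> cf /ulim_cvg hx; apply: ubounded_cvg (cvg_comp _ _ hx (cf _)). Qed.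

Lemma ubounded_sum (I : Type) (s : seq I) (x : I -> nat -> R) :
  (forall i, ubounded (x i)) -> ubounded (fun n => \sum_(i <- s) x i n).
Proof.
move=> bx; elim: s => [|i s IH].
  by under eq_fun do rewrite big_nil; exact: ubounded_cst.
by under eq_fun do rewrite big_cons; exact: uboundedD.
Qed.

Lemma ulim_sum (I : Type) (s : seq I) (x : I -> nat -> R) :
  (forall i, ubounded (x i)) ->
  ulim (fun n => \sum_(i <- s) x i n) = \sum_(i <- s) ulim (x i).
Proof.
move=> bx; elim: s => [|i s IH].
  by under eq_fun do rewrite big_nil; rewrite ulim_cst big_nil.
under eq_fun do rewrite big_cons.
by rewrite ulimD ?IH ?big_cons//; exact: ubounded_sum.
Qed.

Lemma ubounded_le x y : ubounded y -> (\forall n \near U, `|x n| <= y n) -> ubounded x.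
Proof.
move=> [c yc] xy; exists c; near=> n.
apply: (@le_trans _ _ (y n)); first by near: n.
by apply: (@le_trans _ _ `|y n|); [exact: ler_norm|near: n].
Unshelve. all: by end_near. Qed.

Lemma ler_ulim x y : ubounded x -> ubounded y -> (\forall n \near U, x n <= y n) ->
  ulim x <= ulim y.
Proof.
move=> bx by_ xy; rewrite -subr_ge0 -ulimB//; apply: ulim_ge; first exact: uboundedB.
by apply: filterS xy => n; rewrite subr_ge0.
Qed.

Lemma eq_ulim x y : (\forall n \near U, x n = y n) -> ulim x = ulim y.
Proof.
move=> xy; rewrite /ulim; congr lim.
by rewrite predeqE => A; split; apply: filterS2 xy => n /= ->.
Qed.

End ultralimit.

(** * Loeb probability spaces *)

Section expectation_functional.
Context {R : realType} {T0 : Type}.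
Implicit Types (f g : T0 -> R).

(** The finite weighted sums over the histories of a walk are used only through these three
    properties; this keeps the Loeb construction independent of the walk and requires no measurable
    structure on [T0]. *)
Record mean_functional (E : (T0 -> R) -> R) : Prop := MeanFunctional {
  expect_lin : forall (a : R) f g, E (fun s => a * f s + g s) = a * E f + E g;
  expect_ge0 : forall f, (forall s, 0 <= f s) -> 0 <= E f;
  expect_cst1 : E (fun=> 1) = 1 }.

Variable E : (T0 -> R) -> R.
Hypothesis hE : mean_functional E.

Lemma expectD f g : E (fun s => f s + g s) = E f + E g.
Proof.
have := expect_lin hE 1 f g; rewrite mul1r => <-.
by congr E; apply/funext => s; rewrite mul1r.
Qed.

Lemma expect0 : E (fun=> 0) = 0.
Proof. by have := expectD (fun=> 0) (fun=> 0); rewrite addr0 => h; lra. Qed.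

Lemma expectZ a f : E (fun s => a * f s) = a * E f.
Proof.
have := expect_lin hE a f (fun=> 0); rewrite expect0 addr0 => <-.
by congr E; apply/funext => s; rewrite addr0.
Qed.

Lemma expectB f g : E (fun s => f s - g s) = E f - E g.
Proof.
have := expect_lin hE (-1) g f; rewrite mulN1r addrC => <-.
by congr E; apply/funext => s; rewrite mulN1r addrC.
Qed.

Lemma expect_cst (c : R) : E (fun=> c) = c.
Proof.
have h := expectZ c (fun=> 1); rewrite expect_cst1// mulr1 in h.
by rewrite -[RHS]h; congr E; apply/funext => s; rewrite mulr1.
Qed.

Lemma expect_le f g : (forall s, f s <= g s) -> E f <= E g.
Proof.
by move=> fg; rewrite -subr_ge0 -expectB; apply: expect_ge0 => // s; rewrite subr_ge0.
Qed.

Lemma expect_norm f : `|E f| <= E (fun s => `|f s|).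
Proof.
rewrite ler_norml lerNl -mulN1r -expectZ; apply/andP; split.
  by apply: expect_le => s; rewrite mulN1r -normrN ler_norm.
by apply: expect_le => s; rewrite ler_norm.
Qed.

Lemma expect_sum (I : Type) (r : seq I) (f : I -> T0 -> R) :
  E (fun s => \sum_(i <- r) f i s) = \sum_(i <- r) E (f i).
Proof.
elim: r => [|i r IH].
  by under eq_fun do rewrite big_nil; rewrite expect0 big_nil.
by under eq_fun do rewrite big_cons; rewrite expectD IH big_cons.
Qed.

End expectation_functional.

(** * The Loeb measure of an ultraproduct *)

Section loeb.
Context {R : realType} (U : set_system nat) {UU : UltraFilter U}.
Hypothesis U_cofinite : (\oo : set_system nat) `<=` U.
Context {T0 : Type} (x0 : T0).
Variable E : nat -> (T0 -> R) -> R.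
Hypothesis hE : forall n, mean_functional (E n).

(** Sequences are not identified along [U]: internal sets are saturated for that equivalence, so the
    quotient would carry the same events. *)
Definition loeb_space := nat -> T0.

Definition internal (B : nat -> set T0) : set loeb_space :=
  [set w | \forall n \near U, B n (w n)].

Lemma internal0 : internal (fun=> set0) = set0.
Proof.
rewrite predeqE => w; split => // h.
by have [] := @filter_ex _ U _ _ h.
Qed.

Lemma internalT : internal (fun=> setT) = setT.
Proof. by rewrite predeqE => w; split => // _; exact: nearW. Qed.

Lemma internalC B : internal (fun n => ~` B n) = ~` internal B.
Proof.
rewrite predeqE => w; split => [h h'|].
  near U => n.
  have : (~` B n) (w n) by near: n.
  by apply; near: n.
exact: near_neg.
Unshelve. all: by end_near. Qed.

Lemma internalI B C : internal (fun n => B n `&` C n) = internal B `&` internal C.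
Proof.
rewrite predeqE => w; split => [h|[h1 h2]]; last exact: filterS2 h1 h2.
by split; apply: filterS h => n [].
Qed.

Lemma internalU B C : internal (fun n => B n `|` C n) = internal B `|` internal C.
Proof.
rewrite -[RHS]setCK setCU -!internalC -internalI -internalC; congr internal.
by apply/funext => n; rewrite setCI !setCK.
Qed.

(** If the inclusion failed on a member of [U], a choice of counterexamples at these indices would
    be a single sequence in [internal B] and outside of [internal C]. *)
Lemma internal_sub B C : internal B `<=` internal C ->
  \forall n \near U, B n `<=` C n.
Proof.
move=> BC; have [//|nBC] := in_ultra_setVsetC [set n | B n `<=` C n] UU.
pose w n := if pselect (exists x, B n x /\ ~ C n x) is left h then projT1 (cid h) else x0.
have hw n : ~ (B n `<=` C n) -> B n (w n) /\ ~ C n (w n).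
  move=> h; rewrite /w; case: pselect => [e|]; first by case: (cid e).
  by move=> ne; exfalso; apply: h => x Bx; apply: contrapT => nCx; apply: ne; exists x.
have Bw : internal B w by apply: filterS nBC => n /hw [].
near U => n.
have [_] : B n (w n) /\ ~ C n (w n) by apply: hw; near: n.
by case; near: n; exact: BC.
Unshelve. all: by end_near. Qed.

Definition internal_sets : set (set loeb_space) := [set A | exists B, A = internal B].

HB.instance Definition _ := gen_eqMixin loeb_space.
HB.instance Definition _ := gen_choiceMixin loeb_space.
HB.instance Definition _ := isPointed.Build loeb_space (fun=> x0).

Lemma internal_sets0 : internal_sets set0.
Proof. by exists (fun=> set0); rewrite internal0. Qed.
Lemma internal_setsU : setU_closed internal_sets.
Proof. by move=> _ _ [A ->] [B ->]; exists (fun n => A n `|` B n); rewrite internalU. Qed.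
Lemma internal_setsC : setC_closed internal_sets.
Proof. by move=> _ [A ->]; exists (fun n => ~` A n); rewrite internalC. Qed.

HB.instance Definition _ := @isAlgebraOfSets.Build (sigma_display internal_sets)
  loeb_space internal_sets internal_sets0 internal_setsU internal_setsC.

Definition iprob n (A : set T0) : R := E n (\1_A).

Lemma iprob_ge0 n A : 0 <= iprob n A.
Proof. by apply: expect_ge0 => // s; rewrite indicE. Qed.

Lemma iprob_le n A B : A `<=` B -> iprob n A <= iprob n B.
Proof.
move=> AB; apply: expect_le => // s; rewrite !indicE ler_nat.
by case: (boolP (s \in A)) => //; rewrite inE => /AB; rewrite -inE => ->.
Qed.

Lemma iprob_le1 n A : iprob n A <= 1.
Proof.
rewrite -[leRHS](expect_cst1 (hE n)); apply: expect_le => // s.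
Qed.

Lemma ubounded_iprob (B : nat -> set T0) : ubounded U (fun n => iprob n (B n)).
Proof. by exists 1; apply: nearW => n; rewrite ger0_norm ?iprob_ge0 ?iprob_le1. Qed.

Definition loeb_content (A : set loeb_space) : \bar R :=
  if pselect (exists B, A = internal B) is left h
  then (ulim U (fun n => iprob n (projT1 (cid h) n)))%:E else 0%E.

(** The content picks some representative; by [internal_sub] two representatives include each other
    at almost every index, so the limit does not depend on the choice. *)
Lemma loeb_contentE B : loeb_content (internal B) = (ulim U (fun n => iprob n (B n)))%:E.
Proof.
rewrite /loeb_content; case: pselect => [h|[]]; last by exists B.
case: (cid h) => C /= BC; congr EFin; apply/eqP; rewrite eq_le; apply/andP; split;
  apply: ler_ulim; try exact: ubounded_iprob.
- by have : internal C `<=` internal B by [rewrite BC]; move/internal_sub;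
    apply: filterS => n /iprob_le.
- by have : internal B `<=` internal C by [rewrite BC]; move/internal_sub;
    apply: filterS => n /iprob_le.
Qed.

Lemma loeb_content0 : loeb_content set0 = 0%E.
Proof.
rewrite -internal0 loeb_contentE /iprob; congr EFin.
by under eq_fun do rewrite indic0 expect0//; rewrite ulim_cst.
Qed.

Lemma loeb_content_ge0 (A : set loeb_space) : (0 <= loeb_content A)%E.
Proof.
rewrite /loeb_content; case: pselect => // h; rewrite lee_fin; apply: ulim_ge.
  exact: ubounded_iprob.
by apply: nearW => n; exact: iprob_ge0.
Qed.

Lemma loeb_content_semi_additive : @measure_function.semi_additive _ R loeb_space loeb_content.
Proof.
apply/additive2P; first exact: loeb_content0.
move=> _ _ [A ->] [B ->]; rewrite -internalI -internal0 => AB0.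
have AB : \forall n \near U, A n `&` B n `<=` set0.
  by apply: internal_sub; rewrite AB0.
rewrite -internalU !loeb_contentE -EFinD; congr EFin.
rewrite -ulimD; [|exact: ubounded_iprob..].
apply: eq_ulim; apply: filterS AB => n ABn; rewrite /iprob -expectD//.
congr (E n _); apply/funext => s; rewrite !indicE in_setU.
have : ~ (A n `&` B n) s by move/ABn.
rewrite /setI /=; case: (boolP (s \in A n)); case: (boolP (s \in B n)); rewrite ?inE ?addr0 ?add0r//.
by move=> ? ? [].
Qed.

HB.instance Definition _ := isContent.Build _ loeb_space R loeb_content
  loeb_content_ge0 loeb_content_semi_additive.

(** Diagonal argument: at index [n] the sequence satisfies as many of the first constraints, up to
    the [n]-th, as one point can satisfy together. A given finite set of constraints is compatible
    at almost every index, hence satisfied there. *)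
Lemma internal_saturation (B : nat -> nat -> set T0) :
  (forall k, \bigcap_(j in [set j | (j <= k)%N]) internal (B j) !=set0) ->
  \bigcap_j internal (B j) !=set0.
Proof.
move=> h; pose C j n := [set x | forall i, (i <= j)%N -> B i n x].
have hC n m : exists x, forall j, (j <= m)%N -> C j n !=set0 -> C j n x.
  elim: m => [|m [x hx]].
    have [[x Cx]|nC] := pselect (C 0 n !=set0).
      by exists x => j; rewrite leqn0 => /eqP ->.
    by exists x0 => j; rewrite leqn0 => /eqP ->.
  have [[y Cy]|nC] := pselect (C m.+1 n !=set0).
    by exists y => j jm _ i ij; apply: Cy; exact: leq_trans ij jm.
  by exists x => j; rewrite leq_eqVlt => /predU1P[-> //|jm]; exact: hx.
pose w n := projT1 (cid (hC n n)); exists w => j _.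
have [v hv] := h j.
have vC : \forall n \near U, C j n !=set0.
  have vv : \forall n \near U, forall i, (i < j.+1)%N -> B i n (v n).
    elim: {-2}(j.+1) (leqnn j.+1) => [_|k IH kj]; first exact: nearW.
    have /= := hv k (kj : (k <= j)%N); apply: filterS2 (IH (ltnW kj)) => n h1 h2 i.
    by rewrite ltnS leq_eqVlt => /predU1P[->//|/h1].
  by apply: filterS vv => n hn; exists (v n) => i ij; apply: hn; rewrite ltnS.
have jn : \forall n \near U, (j <= n)%N by apply: near_oo_U => //; exact: nbhs_infty_ge.
apply: filterS2 vC jn => n Cjn jn.
by rewrite /w; case: cid => x /= /(_ j jn Cjn j (leqnn j)).
Qed.

(** By saturation, a countable union of internal sets that is itself internal is already a finite
    union, so countable additivity reduces to finite additivity. *)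
Lemma loeb_content_sigma_additive : semi_sigma_additive loeb_content.
Proof.
move=> F mF tF [B FB].
have [A FA] := choice mF.
have [k hk] : exists k, \bigcup_n F n `<=` \big[setU/set0]_(i < k) F i.
  apply: contrapT => nk.
  (* Constraint 0 is membership in the union and constraint [i.+1] is avoidance of [F i]; without a
     finite subcover these are finitely compatible, and a common point is absurd. *)
  have [] := @internal_saturation (fun j n => if j is i.+1 then ~` A i n else B n).
    move=> k; apply: contrapT => /set0P/negP; rewrite negbK => /eqP e0; apply: nk.
    exists k => w Fw; rewrite -bigcup_mkord; apply: contrapT => nw.
    suff : set0 w by [].
    rewrite -e0 => -[_|i ik]; first by rewrite -FB.
    by rewrite internalC -FA => Fi; apply: nw; exists i.
  move=> w hw; have := hw 0%N I; rewrite -FB => -[i _ Fi].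
  by have := hw i.+1 I; rewrite internalC -FA.
have Fk i : (k <= i)%N -> F i = set0.
  move=> ki; rewrite predeqE => w; split => // Fi.
  have /hk : (\bigcup_n F n) w by exists i.
  rewrite -bigcup_mkord => -[j jk Fj].
  have := (@trivIsetP _ _ setT F).1 tF i j I I; rewrite neq_ltn (leq_trans jk ki) orbT.
  by move=> /(_ isT); rewrite predeqE => /(_ w) [] /(_ (conj Fi Fj)).
have -> : \bigcup_n F n = \big[setU/set0]_(i < k) F i.
  apply/seteqP; split => //; rewrite -bigcup_mkord => w [i _ Fi]; exists i => //.
rewrite measure_bigsetU//; apply: cvg_near_cst.
near=> n.
have kn : (k <= n)%N by near: n; exact: nbhs_infty_ge.
rewrite (big_cat_nat (leq0n _) kn) /= big_mkord [X in (_ + X)%E]big_nat_cond [X in (_ + X)%E]big1 ?adde0//.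
by move=> i /andP[/andP[ki _] _]; rewrite Fk//; exact: loeb_content0.
Unshelve. all: by end_near. Qed.

HB.instance Definition _ := Content_isMeasure.Build _ loeb_space R loeb_content
  loeb_content_sigma_additive.

Definition loeb_measurable : measurableType _ := g_sigma_algebraType (@measurable _ loeb_space).

Definition loeb : set loeb_measurable -> \bar R := measure_extension loeb_content.

HB.instance Definition _ := Measure.on loeb.

Lemma loebE B : loeb (internal B) = (ulim U (fun n => iprob n (B n)))%:E.
Proof.
have mB : @measurable _ loeb_space (internal B) by exists B.
by rewrite -loeb_contentE; exact: (@measurable_mu_extE _ _ _ loeb_content _ mB).
Qed.

Lemma loeb_setT : loeb setT = 1%E.
Proof.
rewrite -internalT loebE; congr EFin; rewrite -[RHS](@ulim_cst _ U _ 1).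
apply: eq_ulim; apply: nearW => n; rewrite /iprob indicT; exact: (expect_cst1 (hE n)).
Qed.

HB.instance Definition _ := @Measure_isProbability.Build _ loeb_measurable R loeb loeb_setT.

Lemma measurable_internal B : measurable (internal B : set loeb_measurable).
Proof. by apply: sub_sigma_algebra; exists B. Qed.

(** The remainder of the development uses the space only in this form, [ev w n] being the [n]-th
    coordinate of the sample point. *)
Theorem loeb_probability :
  exists (d : measure_display) (Omega : measurableType d) (P : probability Omega R)
    (ev : Omega -> nat -> T0),
    forall B : nat -> set T0, let A := [set w | \forall n \near U, B n (ev w n)] in
      measurable A /\ P A = (ulim U (fun n => E n (\1_(B n))))%:E.
Proof.
exists _, loeb_measurable, (loeb : probability _ _), (fun w => w) => B A.
by split; [exact: measurable_internal|exact: loebE].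
Qed.

End loeb.

(** * Standard parts of internal random variables *)

Section measurable_wrt_theory.
Context {R : realType} {d : measure_display} {Omega : measurableType d}.
Variable (G : set (set Omega)).
Hypothesis sG : sigma_algebra setT G.

Lemma sigma_algebra_compl A : G A -> G (~` A).
Proof. by case: sG => _ h _ /h; rewrite setTD. Qed.

Lemma sigma_algebra_cup (F : (set Omega)^nat) : (forall i, G (F i)) -> G (\bigcup_i F i).
Proof. by case: sG => _ _; apply. Qed.

Lemma sigma_algebra_union A B : G A -> G B -> G (A `|` B).
Proof.
move=> GA GB; rewrite -bigcup2E; apply: sigma_algebra_cup => -[//|[//|/= _]].
by case: sG.
Qed.

Lemma sigma_algebra_inter A B : G A -> G B -> G (A `&` B).
Proof.
move=> GA GB; rewrite -[X in G X]setCK setCI; apply: sigma_algebra_compl.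
by apply: sigma_algebra_union; exact: sigma_algebra_compl.
Qed.

Lemma measurable_wrt_rays (X : Omega -> R) :
  (forall a, G [set w | X w < a]) -> measurable_wrt G X.
Proof.
move=> h A mA.
have : <<s (@RGenInftyO.G R) >> A.
  by have := @RGenInftyO.measurableE R; rewrite /measurable /= => <-.
apply: (@smallest_sub _ (sigma_algebra setT) _ [set B | G (X @^-1` B)]); last first.
  by move=> _ [a ->] /=; rewrite preimage_itvNyo; exact: h.
split; first by case: sG.
- by move=> B GB; rewrite setTD preimage_setC; exact: sigma_algebra_compl.
- by move=> F GF; rewrite /= preimage_bigcup; exact: sigma_algebra_cup.
Qed.

Lemma measurable_wrt_comp (X : Omega -> R) (f : R -> R) :
  measurable_fun setT f -> measurable_wrt G X -> measurable_wrt G (f \o X).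
Proof.
move=> mf mX A mA; rewrite comp_preimage; apply: mX.
by rewrite -[X in measurable X]setTI; exact: mf.
Qed.

End measurable_wrt_theory.

Lemma measurable_fun_wrt (R : realType) (d : measure_display) (Omega : measurableType d)
    (X : Omega -> R) : measurable_fun setT X <-> measurable_wrt measurable X.
Proof.
split => [mX A mA|mX _ A mA]; last by rewrite setTI; exact: mX.
by rewrite -[X in measurable X]setTI; exact: mX.
Qed.

Section standard_part.
Context {R : realType} (U : set_system nat) {UU : UltraFilter U}.
Hypothesis U_cofinite : (\oo : set_system nat) `<=` U.
Context {T0 : Type}.
Variable E : nat -> (T0 -> R) -> R.
Hypothesis hE : forall n, mean_functional (E n).
Context {d : measure_display} {Omega : measurableType d} (P : probability Omega R).
Variable ev : Omega -> nat -> T0.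

Definition iset (B : nat -> set T0) := [set w : Omega | \forall n \near U, B n (ev w n)].

Hypothesis hP : forall B, measurable (iset B) /\
  P (iset B) = (ulim U (fun n => E n (\1_(B n))))%:E.

Lemma measurable_iset B : measurable (iset B).
Proof. by have [] := hP B. Qed.

Lemma isetC B : iset (fun n => ~` B n) = ~` iset B.
Proof.
rewrite predeqE => w; split => [h h'|]; last exact: near_neg.
near U => n.
have : (~` B n) (ev w n) by near: n.
by apply; near: n.
Unshelve. all: by end_near. Qed.

(** The default 0 at unbounded points makes [std Z] total, and measurable because the set of bounded
    points is. *)
Definition std (Z : nat -> T0 -> R) (w : Omega) : R :=
  if `[< ubounded U (fun n => Z n (ev w n)) >] then ulim U (fun n => Z n (ev w n)) else 0.

Definition stbounded (Z : nat -> T0 -> R) : set Omega :=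
  [set w | ubounded U (fun n => Z n (ev w n))].

Lemma stdE Z w : stbounded Z w -> std Z w = ulim U (fun n => Z n (ev w n)).
Proof. by move=> h; rewrite /std asboolT. Qed.

Lemma stboundedE Z :
  stbounded Z = \bigcup_m iset (fun n => [set s | `|Z n s| <= m%:R]).
Proof.
apply/seteqP; split => [w [c h]|w [m _ h]]; last by exists m%:R.
exists (Num.truncn `|c|).+1 => //; apply: filterS h => n /= /le_trans; apply.
by apply: (le_trans (ler_norm _)); apply/ltW; exact: truncnS_gt.
Qed.

Lemma measurable_stbounded Z : measurable (stbounded Z).
Proof. by rewrite stboundedE; apply: bigcupT_measurable => m; exact: measurable_iset. Qed.

(** A strict inequality on the limit means the inequality with some margin [1 / m.+1] at almost
    every index, hence a countable union of internal sets. [G] is arbitrary so as to serve both for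
    measurability and for adaptedness. *)
Lemma std_lt (G : set (set Omega)) (D : set Omega) Z (a : R) : sigma_algebra setT G ->
  D `<=` stbounded Z -> G D ->
  (forall b, G (iset (fun n => [set s | Z n s < b]))) ->
  G (D `&` [set w | std Z w < a]).
Proof.
move=> sG Db GD hZ.
suff -> : D `&` [set w | std Z w < a] =
    D `&` \bigcup_m iset (fun n => [set s | Z n s < a - m.+1%:R^-1]).
  by apply: (sigma_algebra_inter sG) => //; apply: sigma_algebra_cup.
apply/seteqP; split => w [Dw] /=; rewrite stdE; try exact: Db.
  move=> za; split => //; have /ltr_add_invr[m hm] := za.
  exists m => //; rewrite /iset /=; apply: ulim_lt_near; first exact: Db.
  by rewrite ltrBrDr.
move=> [m _ /= h]; split => //; apply: (@le_lt_trans _ _ (a - m.+1%:R^-1)).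
  by apply: ulim_le; [exact: Db|apply: filterS h => n /ltW].
by rewrite ltrBlDr ltrDl invr_gt0.
Qed.

Lemma measurable_std_on (D : set Omega) Z : measurable D -> D `<=` stbounded Z ->
  measurable_fun setT (fun w => std Z w * \1_D w).
Proof.
move=> mD DZ; apply/measurable_fun_wrt.
have sM : sigma_algebra setT (@measurable _ Omega).
  split=> //; first by move=> A mA; rewrite setTD; exact: measurableC.
  by move=> F mF; exact: bigcupT_measurable.
apply: measurable_wrt_rays => // a.
have -> : [set w | std Z w * \1_D w < a] =
    (D `&` [set w | std Z w < a]) `|` (if 0 < a then ~` D else set0).
  apply/seteqP; split => w /=; rewrite indicE.
    case: (boolP (w \in D)); rewrite ?mulr1 ?mulr0 ?inE; first by left.
    by rewrite notin_setE => nD a0; right; rewrite a0.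
  move=> [[Dw]|]; first by rewrite mem_set// mulr1.
  by case: ifP => // a0 nDw; rewrite memNset// mulr0.
apply: measurableU; last by case: ifP => // _; exact: measurableC.
by apply: std_lt => // b; exact: measurable_iset.
Qed.

Lemma measurable_std Z : measurable_fun setT (std Z).
Proof.
have := measurable_std_on (measurable_stbounded Z) (@subset_refl _ (stbounded Z)).
congr measurable_fun; apply/funext => w; rewrite indicE.
case: (boolP (w \in _)); rewrite ?mulr1// notin_setE mulr0 => nb.
by rewrite /std asboolF.
Qed.

Lemma stbounded_bd Z (K : R) w : (forall n s, `|Z n s| <= K) -> stbounded Z w.
Proof. by move=> h; exists K; exact: nearW. Qed.

Lemma ulim_indic B w : ulim U (fun n => \1_(B n) (ev w n)) = \1_(iset B) w :> R.
Proof.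
rewrite [RHS]indicE; case: (boolP (w \in iset B)); rewrite ?notin_setE ?inE => h.
  rewrite -[RHS](@ulim_cst _ U _ 1); apply: eq_ulim; apply: filterS h => n h.
  by rewrite indicE mem_set.
rewrite -[RHS](@ulim_cst _ U _ 0); apply: eq_ulim.
by apply: filterS (near_neg h) => n h'; rewrite indicE memNset.
Qed.

Lemma ubounded_indic B w : ubounded U (fun n => \1_(B n) (ev w n) : R).
Proof. by exists 1; apply: nearW => n; rewrite indicE; case: (_ \in _); rewrite ?normr1 ?normr0. Qed.

Lemma ubounded_expect (Z : nat -> T0 -> R) K : (forall n s, `|Z n s| <= K) ->
  ubounded U (fun n => E n (Z n)).
Proof.
move=> h; exists K; apply: nearW => n; apply: (le_trans (expect_norm (hE n) _)).
by rewrite -[leRHS](expect_cst (hE n)); apply: expect_le.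
Qed.

(* Layer-cake count: [x <= #|{j < M | j <= m x}| / m <= x + 1/m] for [0 <= x < M/m]. *)
Lemma layer_count (m M : nat) (x : R) : (0 < m)%N -> 0 <= x -> m%:R * x < M%:R ->
  x <= m%:R^-1 * \sum_(j < M) ((j : nat)%:R <= m%:R * x)%R%:R <= x + m%:R^-1.
Proof.
move=> m0 x0 xM; set S := _ * \sum_(_ < _) _.
have m0' : (0 : R) < m%:R by rewrite ltr0n.
have mx0 : 0 <= m%:R * x by rewrite mulr_ge0// ltW.
set k := Num.truncn (m%:R * x).
have /andP[k1 k2] := truncn_itv mx0.
have kM : (k < M)%N by rewrite -(ltr_nat R); exact: le_lt_trans k1 xM.
have SE : S = m%:R^-1 * k.+1%:R.
  rewrite /S; congr (_ * _).
  rewrite -(big_mkord xpredT (fun j => ((j : nat)%:R <= m%:R * x)%R%:R)) (big_cat_nat (leq0n k.+1) kM)/=.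
  rewrite big_nat (eq_bigr (fun=> 1)); last first.
    move=> j /andP[_ jk]; suff -> : j%:R <= m%:R * x by [].
    by apply: le_trans k1; rewrite ler_nat -ltnS.
  rewrite -big_nat sumr_const_nat subn0 big_nat big1 ?addr0// => j /andP[kj _].
  suff /negbTE -> : ~~ (j%:R <= m%:R * x) by [].
  by rewrite -ltNge; apply: lt_le_trans k2 _; rewrite ler_nat.
rewrite SE mulrC ler_pdivlMr// ler_pdivrMr// mulrDl mulVf ?gt_eqF// ![x * _]mulrC.
by rewrite (ltW k2)/= -natr1 lerD2r.
Qed.

(** By the layer-cake formula [Z] is within [1 / m] of a finite combination of internal indicators,
    for which the integral is known by [hP]; then [m] tends to infinity. *)
Theorem integral_std (Z : nat -> T0 -> R) K : (forall n s, 0 <= Z n s <= K) ->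
  (\int[P]_w (std Z w)%:E = (ulim U (fun n => E n (Z n)))%:E)%E.
Proof.
move=> ZK; pose K' := (Num.truncn K).+1.
have KK' : K < K'%:R by exact: truncnS_gt.
have Zb n s : `|Z n s| <= K by have /andP[z0 zK] := ZK n s; rewrite ger0_norm.
have bE := ubounded_expect Zb.
have bw w := stbounded_bd w Zb.
have z0 w : 0 <= std Z w.
  by rewrite stdE//; apply: ulim_ge; [exact: bw|apply: nearW => n; case/andP: (ZK n (ev w n))].
have approx m : (0 < m)%N ->
    ((ulim U (fun n => E n (Z n)) - m%:R^-1)%:E <= \int[P]_w (std Z w)%:E <=
     (ulim U (fun n => E n (Z n)) + m%:R^-1)%:E)%E.
  (* The [M] layers of height [1 / m] cover the range of [Z], since [K < K']. *)
  move=> m0; pose M := (m * K')%N.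
  pose B j n := [set s | j%:R <= m%:R * Z n s].
  pose S n s : R := m%:R^-1 * \sum_(j < M) \1_(B j n) s.
  have m0' : (0 : R) < m%:R by rewrite ltr0n.
  have mS n s : Z n s <= S n s <= Z n s + m%:R^-1.
    have /andP[h0 h1] := ZK n s.
    have := @layer_count m M (Z n s) m0 h0.
    rewrite natrM ltr_pM2l// => /(_ (le_lt_trans h1 KK')).
    suff -> : \sum_(j < M) (j%:R <= m%:R * Z n s)%R%:R = \sum_(j < M) \1_(B j n) s :> R by [].
    apply: eq_bigr => j _; rewrite indicE; congr (_%:R); congr nat_of_bool.
    by apply/idP/idP; rewrite inE.
  pose s w : R := m%:R^-1 * \sum_(j < M) \1_(iset (B j)) w.
  have sE w : s w = ulim U (fun n => S n (ev w n)).
    rewrite /s; under eq_bigr do rewrite -ulim_indic.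
    rewrite -ulim_sum; last by move=> j; exact: ubounded_indic.
    rewrite -[X in X * _](@ulim_cst _ U) -ulimM//; first exact: ubounded_cst.
    by apply: ubounded_sum => j; exact: ubounded_indic.
  have bS w : ubounded U (fun n => S n (ev w n)).
    apply: (ubounded_le (y := fun n => Z n (ev w n) + m%:R^-1)).
      by apply: uboundedD; [exact: bw|exact: ubounded_cst].
    apply: nearW => n; have /andP[h1 h2] := mS n (ev w n).
    by rewrite ger0_norm//; apply: le_trans h1; case/andP: (ZK n (ev w n)).
  have zs w : std Z w <= s w <= std Z w + m%:R^-1.
    rewrite stdE// sE -[X in _ + X](@ulim_cst _ U) -ulimD; [|exact: bw|exact: ubounded_cst].
    apply/andP; split; apply: ler_ulim => //; try exact: bw.
    - by apply: nearW => n; case/andP: (mS n (ev w n)).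
    - by apply: uboundedD; [exact: bw|exact: ubounded_cst].
    - by apply: nearW => n; case/andP: (mS n (ev w n)).
  have ms : measurable_fun setT s.
    apply: measurable_funM => //; apply: measurable_sum => j.
    by apply: measurable_indic; exact: measurable_iset.
  have is_ : (\int[P]_w (s w)%:E = (ulim U (fun n => E n (S n)))%:E)%E.
    under eq_integral do rewrite /s EFinM -sumEFin.
    rewrite ge0_integralZl//=; last 2 first.
    - apply: emeasurable_sum => j; apply/measurable_EFinP.
      by apply: measurable_indic; exact: measurable_iset.
    - by move=> w _; apply: sume_ge0 => j _; rewrite lee_fin indicE.
    rewrite ge0_integral_sum//=; last first.
      by move=> j; apply/measurable_EFinP; apply: measurable_indic; exact: measurable_iset.
    rewrite (eq_bigr (fun j : 'I_M => (ulim U (fun n => E n (\1_(B j n))))%:E)); last first.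
      move=> j _; rewrite integral_indic ?setIT; [exact: (hP (B j)).2|by []|exact: measurable_iset].
    rewrite sumEFin -EFinM; congr EFin.
    have bI j : ubounded U (fun n => E n (\1_(B j n))).
      apply: (@ubounded_expect _ 1) => n t.
      by rewrite indicE; case: (_ \in _); rewrite ?normr1 ?normr0.
    rewrite -ulim_sum// -[X in X * _](@ulim_cst _ U) -ulimM; [|exact: ubounded_cst|exact: ubounded_sum].
    by congr ulim; apply/funext => n; rewrite /S expectZ// expect_sum.
  have bSE : ubounded U (fun n => E n (S n)).
    apply: (@ubounded_expect _ (K + m%:R^-1)) => n t.
    have /andP[h1 h2] := mS n t; have /andP[h3 h4] := ZK n t.
    by rewrite ger0_norm ?(le_trans h3 h1)// (le_trans h2)// lerD2r.
  have iz1 : (\int[P]_w (std Z w)%:E <= \int[P]_w (s w)%:E)%E.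
    apply: ge0_le_integral => //.
    - by move=> w _; rewrite lee_fin.
    - by apply/measurable_EFinP; exact: measurable_std.
    - by apply/measurable_EFinP.
    - by move=> w _; rewrite lee_fin; case/andP: (zs w).
  have iz2 : (\int[P]_w (s w)%:E <= \int[P]_w (std Z w)%:E + (m%:R^-1)%:E)%E.
    have -> : ((m%:R^-1)%:E = \int[P]_w (m%:R^-1 : R)%:E)%E.
      by rewrite (@integral_cst _ _ _ P setT measurableT) [X in (_ * X)%E]probability_setT mule1.
    rewrite -ge0_integralD//; last 2 first.
    - by move=> w _; rewrite lee_fin.
    - by apply/measurable_EFinP; exact: measurable_std.
    apply: ge0_le_integral => //.
    - by move=> w _; rewrite lee_fin; apply: le_trans (z0 w) _; case/andP: (zs w).
    - by apply/measurable_EFinP.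
    - by apply: emeasurable_funD => //; apply/measurable_EFinP; exact: measurable_std.
    - by move=> w _; rewrite -EFinD lee_fin; case/andP: (zs w).
  have eS1 : ulim U (fun n => E n (Z n)) <= ulim U (fun n => E n (S n)).
    apply: ler_ulim => //; apply: nearW => n; apply: expect_le => // t.
    by case/andP: (mS n t).
  have eS2 : ulim U (fun n => E n (S n)) <= ulim U (fun n => E n (Z n)) + m%:R^-1.
    rewrite -[X in _ + X](@ulim_cst _ U) -ulimD//; last exact: ubounded_cst.
    apply: ler_ulim => //; first by apply: uboundedD => //; exact: ubounded_cst.
    apply: nearW => n; rewrite -[X in _ + X](expect_cst (hE n)) -expectD//.
    by apply: expect_le => // t; case/andP: (mS n t).
  apply/andP; split; last by apply: (le_trans iz1); rewrite is_ lee_fin.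
  rewrite EFinB leeBlDr//; apply: le_trans iz2; rewrite is_ lee_fin//.
have hfin : (\int[P]_w (std Z w)%:E \is a fin_num)%E.
  have /andP[h1 h2] := approx 1%N isT.
  by rewrite fin_numE -ltNye -ltey (lt_le_trans _ h1) ?ltNyr// (le_lt_trans h2)// ltry.
rewrite -(fineK hfin); congr EFin; apply/eqP; rewrite eq_le; apply/andP; split.
  apply/ler_addgt0Pr => e e0.
  have [m hm] := ltr_add_invr (ltr_pwDr e0 (lexx (0:R))).
  have /andP[_] := approx m.+1 isT; rewrite -(fineK hfin) lee_fin => /le_trans; apply.
  by rewrite lerD2l; apply/ltW; move: hm; rewrite !add0r.
apply/ler_addgt0Pr => e e0.
have [m hm] := ltr_add_invr (ltr_pwDr e0 (lexx (0:R))).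
have /andP[+ _] := approx m.+1 isT; rewrite -(fineK hfin) lee_fin lerBlDr => /le_trans; apply.
by rewrite lerD2l; apply/ltW; move: hm; rewrite !add0r.
Qed.

(** A Fatou-type inequality: the squares are not uniformly integrable and part of their mass may
    escape to infinite values. They are truncated at level [m], and monotone convergence removes the
    truncation. *)
Theorem integral_std_sqr (Z : nat -> T0 -> R) K :
  (\forall n \near U, E n (fun s => Z n s ^+ 2) <= K) ->
  (\int[P]_w (std Z w ^+ 2)%:E <= K%:E)%E.
Proof.
move=> ZK.
pose Zm m n s := Num.min (Z n s ^+ 2) m%:R.
have Zm_itv m n s : 0 <= Zm m n s <= m%:R.
  by rewrite le_min sqr_ge0 ler0n ge_min lexx orbT.
have step m : (\int[P]_w (Num.min (std Z w ^+ 2) m%:R)%:E <= K%:E)%E.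
  have bm w : stbounded (Zm m) w.
    apply: (@stbounded_bd _ m%:R) => n s; have /andP[h1 h2] := Zm_itv m n s.
    by rewrite ger0_norm.
  apply: (@le_trans _ _ (\int[P]_w (std (Zm m) w)%:E)%E).
    apply: ge0_le_integral => //.
    - by move=> w _; rewrite lee_fin le_min sqr_ge0 ler0n.
    - apply/measurable_EFinP; apply: measurable_minr => //; apply: measurable_funX.
      exact: measurable_std.
    - by apply/measurable_EFinP; exact: measurable_std.
    move=> w _; rewrite lee_fin [in leRHS]stdE//.
    (* At an unbounded point [std Z] is 0 by default while the truncated variable is nonnegative, so
       only an inequality survives. *)
    rewrite {1}/std; case: asboolP => [bw|_].
      have c : continuous (fun x : R => Num.min (x ^+ 2) m%:R).
        move=> x; apply: (@continuous_min R R (fun x => x ^+ 2) (fun=> m%:R)); [exact: sqr_continuous|exact: cvg_cst].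
      by have := ulim_continuous c bw; rewrite /= => <-.
    rewrite expr0n/= min_l//; apply: ulim_ge; first exact: bm.
    by apply: nearW => n; case/andP: (Zm_itv m n (ev w n)).
  rewrite (integral_std (Zm_itv m)) lee_fin; apply: ulim_le.
    apply: (@ubounded_expect _ m%:R) => n s; have /andP[h1 h2] := Zm_itv m n s.
    by rewrite ger0_norm.
  apply: filterS ZK => n; apply: le_trans; apply: expect_le => // s.
  by rewrite ge_min lexx.
have mz m : measurable_fun setT (fun w => (Num.min (std Z w ^+ 2) m%:R)%:E : \bar R).
  apply/measurable_EFinP; apply: measurable_minr => //; apply: measurable_funX.
  exact: measurable_std.
have := @cvg_monotone_convergence _ _ _ P setT measurableT
  (fun m w => (Num.min (std Z w ^+ 2) m%:R)%:E) mz.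
have -> : (fun w => limn (fun m => (Num.min (std Z w ^+ 2) m%:R)%:E : \bar R)) =
    (fun w => (std Z w ^+ 2)%:E).
  apply/funext => w; apply/cvg_lim => //; apply: cvg_near_cst.
  near=> m; congr EFin; apply/min_l.
  apply: (@le_trans _ _ (Num.truncn (std Z w ^+ 2)).+1%:R); first by apply/ltW; exact: truncnS_gt.
  rewrite ler_nat; near: m; exact: nbhs_infty_ge.
move=> cv; apply: (cvge_le _ (cv _ _)).
- by apply: nearW => m; exact: step.
- by move=> m w _; rewrite lee_fin le_min sqr_ge0 ler0n.
- move=> w _ m1 m2 m12; rewrite lee_fin le_min !ge_min lexx/=.
  by rewrite ler_nat m12 orbT.
Unshelve. all: by end_near. Qed.

End standard_part.

(** * Martingales on finite chains *)

Section finite_chain.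
Context {R : realType} {E : finType}.

(* A starting site and the list of the moves, the most recent one at the head. *)
Definition history : Type := (nat * seq E)%type.
Implicit Types (s : history) (f g : history -> R).

Definition extend s e : history := (s.1, e :: s.2).
(** The past of the history up to time [k]: the newest moves are at the head and are dropped. A
    history shorter than [k] is left unchanged. *)
Definition trunc k s : history := (s.1, drop (size s.2 - k) s.2).

Lemma size_trunc k s : (k <= size s.2)%N -> size (trunc k s).2 = k.
Proof. by move=> ks; rewrite size_drop subKn. Qed.

Lemma trunc_extend k s e : (k <= size s.2)%N -> trunc k (extend s e) = trunc k s.
Proof. by move=> ks; rewrite /trunc/= subSn. Qed.

Lemma trunc_size s : trunc (size s.2) s = s.
Proof. by rewrite /trunc subnn drop0; case: s. Qed.

Lemma trunc_trunc k l s : (k <= l)%N -> trunc k (trunc l s) = trunc k s.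
Proof.
move=> kl; rewrite /trunc/= size_drop drop_drop; congr (_, drop _ _).
have [ls|/ltnW sl] := leqP l (size s.2); first by rewrite subKn// addnC addnBA// subnK.
by rewrite (eqP sl) subn0 addn0.
Qed.

Variables (m : nat) (p0 : nat -> R) (wt : history -> E -> R).
Hypothesis p0_ge0 : forall i, 0 <= p0 i.
Hypothesis p0_sum : \sum_(i < m) p0 i = 1.
Hypothesis wt_ge0 : forall s e, 0 <= wt s e.
Hypothesis wt_sum : forall s, \sum_e wt s e = 1.

Definition cexp f s : R := \sum_e wt s e * f (extend s e).
(** [cexp] is the conditional expectation one step ahead; by the tower property its [k]-th iterate
    at the empty history is the mean over the histories of length [k]. *)
Definition chain_mean k f : R := \sum_(i < m) p0 i * iter k cexp f (i : nat, [::]).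

Lemma chain_meanS k f : chain_mean k.+1 f = chain_mean k (cexp f).
Proof. by apply: eq_bigr => i _; rewrite iterSr. Qed.

Lemma cexp_lin a f g s : cexp (fun t => a * f t + g t) s = a * cexp f s + cexp g s.
Proof.
rewrite /cexp mulr_sumr -big_split/=; apply: eq_bigr => e _.
by rewrite mulrDr mulrCA.
Qed.

Lemma le_cexp f g s : (forall e, f (extend s e) <= g (extend s e)) -> cexp f s <= cexp g s.
Proof. by move=> fg; apply: ler_sum => e _; rewrite ler_wpM2l. Qed.

Lemma cexp_cst c s : cexp (fun=> c) s = c.
Proof. by rewrite /cexp -mulr_suml wt_sum mul1r. Qed.

Lemma le_chain_mean k f g : (forall s, size s.2 = k -> f s <= g s) ->
  chain_mean k f <= chain_mean k g.
Proof.
move=> fg; apply: ler_sum => i _; rewrite ler_wpM2l//.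
elim: k f g fg => [|k IH] f g fg; first exact: fg.
rewrite !iterSr; apply: IH => s sk; apply: le_cexp => e; apply: fg.
by rewrite /= sk.
Qed.

Lemma eq_chain_mean k f g : (forall s, size s.2 = k -> f s = g s) ->
  chain_mean k f = chain_mean k g.
Proof. by move=> fg; apply/eqP; rewrite eq_le !le_chain_mean// => s /fg ->. Qed.

Lemma chain_mean_functional k : mean_functional (chain_mean k).
Proof.
split.
- move=> a f g; rewrite /chain_mean mulr_sumr -big_split/=; apply: eq_bigr => i _.
  rewrite mulrCA -mulrDr; congr (_ * _).
  elim: k f g => // k IH f g; rewrite !iterSr -IH; congr (iter _ _ _ _).
  by apply/funext => s; rewrite cexp_lin.
- move=> f f0; apply: sumr_ge0 => i _; apply: mulr_ge0 => //.
  elim: k f f0 => [|k IH] f f0; first exact: f0.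
  by rewrite iterSr; apply: IH => s; apply: sumr_ge0 => e _; rewrite mulr_ge0.
- rewrite /chain_mean (eq_bigr (fun i : 'I_m => p0 i))// => i _.
  suff -> : iter k cexp (fun=> 1) (i : nat, [::]) = 1 by rewrite mulr1.
  elim: k => // k IH; rewrite iterSr -[RHS]IH; congr (iter _ _ _ _).
  by apply/funext => s; rewrite cexp_cst.
Qed.

(** A function of the past is constant in the last move, whose weights sum to 1. *)
Lemma chain_mean_trunc k N f : (k <= N)%N ->
  chain_mean N (f \o trunc k) = chain_mean k f.
Proof.
elim: N => [|N IH].
  rewrite leqn0 => /eqP ->; apply: eq_chain_mean => s s0 /=.
  by rewrite -[in trunc 0](s0) trunc_size.
rewrite leq_eqVlt => /predU1P[->|]; last rewrite ltnS => kN.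
  by apply: eq_chain_mean => s sN /=; rewrite -[in trunc _](sN) trunc_size.
rewrite chain_meanS -IH//; apply: eq_chain_mean => s sN.
rewrite -[RHS](cexp_cst (f (trunc k s)) s); apply: eq_bigr => e _ /=.
by rewrite trunc_extend// sN.
Qed.

(** The means of a submartingale increase; the one-step inequality is used only from time [k0]
    on. *)
Lemma chain_mean_step k0 k f : (k0 <= k)%N ->
  (forall s, (k0 <= size s.2)%N -> f s <= cexp f s) ->
  chain_mean k0 f <= chain_mean k f.
Proof.
move=> k0k hf; elim: k k0k => [|k IH]; first by rewrite leqn0 => /eqP ->.
rewrite leq_eqVlt => /predU1P[->//|]; rewrite ltnS => kk.
rewrite chain_meanS (le_trans (IH kk))//; apply: le_chain_mean => s sk.
by apply: hf; rewrite sk.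
Qed.

(** * Moments of martingale increments and a maximal inequality *)

Section martingale.
Variables (d : history -> E -> R) (M V : history -> R) (k0 : nat).
Hypothesis dM : forall s e, (k0 <= size s.2)%N -> M (extend s e) = M s + d s e.
Hypothesis d0 : forall s, \sum_e wt s e * d s e = 0.
Hypothesis dV : forall s, \sum_e wt s e * d s e ^+ 2 <= V s.

(** The cross term [2 * M * d] has conditional mean zero, so only the conditional variances add up.
    [V] may depend on the history, as needed for the discrete isometry. *)
Lemma martingale_sqr k : (k0 <= k)%N ->
  chain_mean k (fun s => M s ^+ 2) <=
  chain_mean k0 (fun s => M s ^+ 2) + \sum_(k0 <= j < k) chain_mean j V.
Proof.
elim: k => [|k IH]; first by rewrite leqn0 => /eqP ->; rewrite big_geq// addr0.
rewrite leq_eqVlt => /predU1P[<-|]; first by rewrite big_geq ?addr0.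
rewrite ltnS => kk; rewrite big_nat_recr//= addrA chain_meanS.
apply: (@le_trans _ _ (chain_mean k (fun s => M s ^+ 2 + V s))); last first.
  by rewrite (expectD (chain_mean_functional k)) lerD2r IH.
apply: le_chain_mean => s sk.
have -> : cexp (fun t => M t ^+ 2) s =
    \sum_e (wt s e * M s ^+ 2 + (2 * M s * (wt s e * d s e) + wt s e * d s e ^+ 2)).
  by apply: eq_bigr => e _; rewrite dM ?sk//; ring.
by rewrite !big_split/= -mulr_suml wt_sum mul1r -mulr_sumr d0 mulr0 add0r lerD2l.
Qed.

End martingale.

Section bounded_martingale.
Variables (d : history -> E -> R) (M : history -> R) (C kappa : R).
Hypothesis dM : forall s e, M (extend s e) = M s + d s e.
Hypothesis d0 : forall s, \sum_e wt s e * d s e = 0.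
Hypothesis dC : forall s, \sum_e wt s e * d s e ^+ 2 <= C.
Hypothesis dk : forall s e, `|d s e| <= kappa.
Hypothesis C0 : 0 <= C.

Let D k0 s := M s - M (trunc k0 s).

Let dD k0 s e : (k0 <= size s.2)%N -> D k0 (extend s e) = D k0 s + d s e.
Proof. by move=> ks; rewrite /D dM trunc_extend//; ring. Qed.

Let D0 k0 s : size s.2 = k0 -> D k0 s = 0.
Proof. by move=> sk; rewrite /D -[in trunc k0](sk) trunc_size subrr. Qed.

Let mean_D0 k0 n : (0 < n)%N -> chain_mean k0 (fun s => D k0 s ^+ n) = 0.
Proof.
move=> n0; rewrite -[RHS](expect0 (chain_mean_functional k0)).
by apply: eq_chain_mean => s sk; rewrite D0// expr0n gtn_eqF.
Qed.

Lemma martingale_increment_sqr k0 k : (k0 <= k)%N ->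
  chain_mean k (fun s => (M s - M (trunc k0 s)) ^+ 2) <= C * (k - k0)%:R.
Proof.
move=> kk; have := @martingale_sqr d (D k0) (fun=> C) k0 (@dD k0) d0 dC k kk.
rewrite mean_D0// add0r => /le_trans; apply.
under eq_bigr do rewrite (expect_cst (chain_mean_functional _)).
by rewrite sumr_const_nat mulr_natr.
Qed.

(** In the expansion of [(D + d) ^+ 4] the term linear in [d] is centred, and what remains is at
    most [d ^+ 2 * (8 * D ^+ 2 + 3 * kappa ^+ 2)]. The second moment of [D] being linear in time,
    the sum is quadratic up to a term that vanishes with the size of the jumps. *)
Lemma martingale_increment_pow4 k0 k : (k0 <= k)%N ->
  chain_mean k (fun s => (M s - M (trunc k0 s)) ^+ 4) <=
  8 * (C * (k - k0)%:R) ^+ 2 + 3 * kappa ^+ 2 * (C * (k - k0)%:R).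
Proof.
elim: k => [|k IH].
  rewrite leqn0 => /eqP ->; rewrite (@mean_D0 0 4)// subnn.
  by rewrite !mulr0 expr0n/= mulr0 addr0.
rewrite leq_eqVlt => /predU1P[<-|].
  by rewrite (@mean_D0 k0 4)// subnn !mulr0 expr0n/= mulr0 addr0.
rewrite ltnS => kk; rewrite chain_meanS.
apply: (@le_trans _ _ (chain_mean k (fun s => D k0 s ^+ 4 +
    (8 * C * D k0 s ^+ 2 + 3 * kappa ^+ 2 * C)))).
  apply: le_chain_mean => s sk.
  have -> : cexp (fun s => D k0 s ^+ 4) s = \sum_e (wt s e * D k0 s ^+ 4 +
      (4 * D k0 s ^+ 3 * (wt s e * d s e) +
      (wt s e * (d s e ^+ 2 * (6 * D k0 s ^+ 2 + 4 * D k0 s * d s e + d s e ^+ 2))))).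
    by apply: eq_bigr => e _; rewrite dD ?sk//; ring.
  rewrite !big_split/= -mulr_suml wt_sum mul1r -mulr_sumr d0 mulr0 add0r lerD2l.
  apply: (@le_trans _ _ (\sum_e wt s e * d s e ^+ 2 *
      (8 * D k0 s ^+ 2 + 3 * kappa ^+ 2))).
    apply: ler_sum => e _; rewrite mulrA ler_wpM2l ?(mulr_ge0 (wt_ge0 _ _) (sqr_ge0 _))//.
    have h1 : d s e ^+ 2 <= kappa ^+ 2.
      rewrite -(real_normK (num_real (d s e))) lerXn2r ?nnegrE//.
      exact: le_trans (normr_ge0 _) (dk s e).
    have h2 : 4 * D k0 s * d s e <= 2 * D k0 s ^+ 2 + 2 * d s e ^+ 2.
      by have := sqr_ge0 (D k0 s - d s e); rewrite sqrrB; lra.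
    by move: h1 h2; lra.
  rewrite -mulr_suml [leLHS]mulrC [leRHS](_ : _ = (8 * D k0 s ^+ 2 + 3 * kappa ^+ 2) * C).
    by rewrite ler_wpM2l// addr_ge0// mulr_ge0// sqr_ge0.
  by ring.
rewrite (expectD (chain_mean_functional k)) (expectD (chain_mean_functional k)).
rewrite (expectZ (chain_mean_functional k)) (expect_cst (chain_mean_functional k)).
have h2 := martingale_increment_sqr kk.
have h4 := IH kk.
rewrite subSn// -[(k - k0).+1%:R]natr1.
set n : R := (k - k0)%:R in h2 h4 *.
have h5 : 8 * C * chain_mean k (fun s => D k0 s ^+ 2) <= 8 * C * (C * n).
  by rewrite ler_wpM2l// mulr_ge0.
apply: (le_trans (lerD h4 (lerD h5 (lexx _)))).
rewrite -subr_ge0 (_ : _ - _ = 8 * C ^+ 2 * (n + 1)); last by ring.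
by rewrite mulr_ge0 ?mulr_ge0 ?sqr_ge0// addr_ge0.
Qed.

(** The event that [M] has moved by at least [eps] from its position at time [k0], at some time
    between [k0] and the present; a recursion on the list of moves examines each prefix of the
    path. *)
Fixpoint hit_seq (eps : R) (k0 i : nat) (l : seq E) : bool :=
  ((k0 <= size l)%N && (eps <= `|D k0 (i, l)|)) ||
  (if l is _ :: l' then hit_seq eps k0 i l' else false).

Definition hit eps k0 s := hit_seq eps k0 s.1 s.2.

Lemma hitPn eps k0 s j : ~~ hit eps k0 s -> (k0 <= j <= size s.2)%N ->
  `|M (trunc j s) - M (trunc k0 s)| < eps.
Proof.
case: s => i l; rewrite /hit /=; elim: l => [|e l IH] /=.
  rewrite orbF negb_and -ltNge => h /andP[kj]; rewrite leqn0 => /eqP j0.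
  by move: h; rewrite j0 in kj *; rewrite kj.
rewrite negb_or negb_and -ltNge => /andP[h1 h2] /andP[kj].
rewrite leq_eqVlt => /predU1P[jE|].
  move: h1; rewrite -jE kj /= {1}jE.
  by rewrite /D -[(size l).+1]/(size (i, e :: l).2) trunc_size.
rewrite ltnS => jl; have := IH h2; rewrite kj jl => /(_ isT).
by rewrite -(@trunc_extend j (i, l) e)// -(@trunc_extend k0 (i, l) e)// (leq_trans kj jl).
Qed.

(** Doob's maximal inequality for [D ^+ 4], obtained by exhibiting a submartingale that starts at
    0. *)
Lemma hit_pow4 eps k0 k : 0 < eps -> (k0 <= k)%N ->
  eps ^+ 4 * chain_mean k (fun s => (hit eps k0 s)%:R) <=
  chain_mean k (fun s => (M s - M (trunc k0 s)) ^+ 4).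
Proof.
move=> e0 kk; rewrite -(expectZ (chain_mean_functional k)).
(* Before the hitting time [f] is 0, when the path first hits [f] becomes nonnegative, and
   afterwards it is the convex function [D ^+ 4] of a martingale, up to a constant. *)
pose f s := (hit eps k0 s)%:R * (D k0 s ^+ 4 - eps ^+ 4).
have f0 : chain_mean k0 f = 0.
  rewrite -[RHS](expect0 (chain_mean_functional k0)); apply: eq_chain_mean => -[i l] /= lk.
  have -> : f (i, l) = (hit eps k0 (i, l))%:R * (D k0 (i, l) ^+ 4 - eps ^+ 4) by [].
  suff -> : hit eps k0 (i, l) = false by rewrite mul0r.
  rewrite /hit /=.
  have short l' : (size l' < k0)%N -> hit_seq eps k0 i l' = false.
    elim: l' => [|e' l' IH] /= h; rewrite leqNgt h//= IH//; exact: ltn_trans h.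
  case: l lk => [|e l] /= lk; rewrite D0//= normr0 leNgt e0/= ?andbF//= short//.
  by rewrite -lk.
have : chain_mean k0 f <= chain_mean k f.
  apply: chain_mean_step => // s sk.
  (* The fourth power lies above its tangent at [D k0 s]; the linear term then averages to 0. *)
  have pow4 e : D k0 s ^+ 4 + 4 * D k0 s ^+ 3 * d s e <= D k0 (extend s e) ^+ 4.
    rewrite dD// -subr_ge0.
    rewrite (_ : _ - _ = d s e ^+ 2 * ((d s e + 2 * D k0 s) ^+ 2 + 2 * D k0 s ^+ 2)); last by ring.
    by rewrite mulr_ge0 ?sqr_ge0// addr_ge0 ?sqr_ge0// mulr_ge0// sqr_ge0.
  rewrite /f; case hs : (hit eps k0 s); last first.
    rewrite mul0r; apply: sumr_ge0 => e _; apply: mulr_ge0 => //.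
    rewrite /hit /= -/(hit eps k0 s) hs orbF.
    case: (boolP (_ && _)) => //=; last by rewrite mul0r.
    move=> /andP[_ h]; rewrite mul1r subr_ge0.
    have h' : eps ^+ 2 <= D k0 (extend s e) ^+ 2.
      rewrite -(real_normK (num_real (D k0 (extend s e)))) lerXn2r ?nnegrE//; exact: ltW.
    by rewrite (_ : 4 = 2 * 2)%N// !exprM lerXn2r ?nnegrE ?sqr_ge0.
  apply: (@le_trans _ _ (\sum_e (wt s e * (D k0 s ^+ 4 - eps ^+ 4)
      + 4 * D k0 s ^+ 3 * (wt s e * d s e)))).
    by rewrite big_split/= -mulr_suml wt_sum -mulr_sumr d0 mulr0 addr0.
  apply: ler_sum => e _; rewrite /hit /= -/(hit eps k0 s) hs orbT mul1r.
  by have := ler_wpM2l (wt_ge0 s e) (pow4 e); rewrite !mulrDr; lra.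
rewrite f0 => h; rewrite -subr_ge0 -(expectB (chain_mean_functional k)).
apply: (le_trans h); apply: le_chain_mean => s _; rewrite /f -/(D k0 s) mulrBr lerB//.
  case: (hit _ _ _); rewrite ?mul1r ?mul0r//.
  by rewrite (_ : 4 = 2 * 2)%N// exprM sqr_ge0.
by rewrite mulrC.
Qed.

End bounded_martingale.

End finite_chain.

(** * The explicit scheme and its contraction property *)

Lemma free_ultrafilter : exists U : set_system nat,
  UltraFilter U /\ (\oo : set_system nat) `<=` U.
Proof. exact: ultraFilterLemma. Qed.

(** Pairs of counterexamples for [rho = 1 / n.+1] have a common ultralimit, at which continuity is
    contradicted. *)
Lemma continuous_uniform_segment (R : realType) (f : R -> R) (K eps : R) :
  continuous f -> 0 < eps ->
  exists2 rho : R, 0 < rho &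
    forall a b, `|a| <= K -> `|b| <= K -> `|a - b| <= rho -> `|f a - f b| <= eps.
Proof.
move=> cf e0; apply: contrapT => nrho.
have hn (n : nat) : exists ab : R * R, [/\ `|ab.1| <= K, `|ab.2| <= K,
    `|ab.1 - ab.2| <= n.+1%:R^-1 & eps < `|f ab.1 - f ab.2|].
  apply: contrapT => nab; apply: nrho; exists n.+1%:R^-1; rewrite ?invr_gt0// => a b aK bK ab.
  by rewrite leNgt; apply/negP => h; apply: nab; exists (a, b).
have [ab hab] := choice hn.
have [U [UU Uoo]] := free_ultrafilter.
pose x n := (ab n).1; pose y n := (ab n).2.
have bx : ubounded U x by exists K; apply: nearW => n; case: (hab n).
have by_ : ubounded U y by exists K; apply: nearW => n; case: (hab n).
have xy : ulim U x = ulim U y.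
  apply/eqP; rewrite -subr_eq0 -ulimB//; apply/eqP; apply: ulim_eq; apply: cvg_oo_U => //.
  apply/cvgr0Pnorm_le => e1 e10; have := near_infty_natSinv_lt (PosNum e10).
  apply: filterS => n /= /ltW; apply: le_trans; by case: (hab n).
have : eps <= ulim U (fun n => `|(f \o x) n - (f \o y) n|).
  apply: ulim_ge.
    by apply: ubounded_norm; apply: uboundedB; exact: ubounded_continuous.
  by apply: nearW => n; case: (hab n) => _ _ _ /ltW.
rewrite ulim_norm; last by apply: uboundedB; exact: ubounded_continuous.
rewrite ulimB; [|exact: ubounded_continuous..].
by rewrite !ulim_continuous// xy subrr normr0 leNgt e0.
Qed.

(** * Lipschitz truncation of the flux *)

Section lipschitz_truncation.
Context {R : realType}.
Variables (g : R -> R) (c : R).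
Hypothesis g_cont : continuous g.
Hypothesis g_ge0 : forall u, 0 <= g u.
Hypothesis g_le : forall u, g u <= c.
Hypothesis ug_nd : forall u v, 0 <= u -> u <= v -> u * g u <= v * g v.

(** The substitution [v = l * u] removes the division by [u], so the truncated coefficient makes
    sense at [u = 0] as well. *)
Let gset n (u : R) : set R := [set l * g (l * u) + (1 - l) * n%:R | l in [set l : R | 0 <= l <= 1]].

(* For [u > 0], [u * trunc_coef n u] is the infimum of [v * g v + n * (u - v)] over
   [0 <= v <= u], an [n]-Lipschitz minorant of the flux [u * g u]. *)
Definition trunc_coef n u : R := inf (gset n u).

Let gset_ge0 n u : lbound (gset n u) 0.
Proof.
move=> _ [l /andP[l0 l1] <-]; rewrite addr_ge0 ?mulr_ge0// ?subr_ge0//.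
Qed.

Let gset_neq0 n u : gset n u !=set0.
Proof. by exists (1 * g (1 * u) + (1 - 1) * n%:R); exists 1 => //=; rewrite ler01 lexx. Qed.

Lemma trunc_coef_ge0 n u : 0 <= trunc_coef n u.
Proof. exact: lb_le_inf. Qed.

Lemma trunc_coef_le_at n u l : 0 <= l <= 1 ->
  trunc_coef n u <= l * g (l * u) + (1 - l) * n%:R.
Proof. by move=> l01; apply: ge_inf; [exists 0|exists l]. Qed.

Lemma trunc_coef_le n u : trunc_coef n u <= g u.
Proof.
have := @trunc_coef_le_at n u 1; rewrite ler01 lexx !mul1r subrr mul0r addr0.
exact.
Qed.

Lemma trunc_coef_le_nat n u : trunc_coef n u <= n%:R.
Proof.
have := @trunc_coef_le_at n u 0; rewrite ler01 lexx !mul0r add0r subr0 mul1r.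
exact.
Qed.

Definition trunc_flux n u := u * trunc_coef n u.

Lemma trunc_flux_le_at n u v : 0 <= v <= u ->
  trunc_flux n u <= v * g v + n%:R * (u - v).
Proof.
move=> /andP[v0 vu]; have u0 := le_trans v0 vu.
have [u00|un0] := eqVneq u 0.
  have -> : v = 0 by apply/eqP; rewrite eq_le v0 -u00 vu.
  by rewrite /trunc_flux u00 !mul0r subrr mulr0 addr0.
have up : 0 < u by rewrite lt_neqAle eq_sym un0.
have := @trunc_coef_le_at n u (v / u).
rewrite divr_ge0// ler_pdivrMr// mul1r vu => /(_ isT).
move=> /(ler_wpM2l u0) /le_trans; apply.
by rewrite divfK// le_eqVlt; apply/orP; left; apply/eqP; field.
Qed.

Lemma trunc_flux_ge n u a : 0 <= u ->
  (forall v, 0 <= v <= u -> a <= v * g v + n%:R * (u - v)) -> a <= trunc_flux n u.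
Proof.
move=> u0 h; have [u00|un0] := eqVneq u 0.
  have := h 0; rewrite lexx u0 => /(_ isT).
  by rewrite /trunc_flux u00 !mul0r subrr mulr0 addr0.
have up : 0 < u by rewrite lt_neqAle eq_sym un0.
rewrite /trunc_flux mulrC -ler_pdivrMr//; apply: lb_le_inf => // _ [l /andP[l0 l1] <-].
rewrite ler_pdivrMr//; have := h (l * u); rewrite mulr_ge0// ler_piMl// => /(_ isT).
by move=> /le_trans; apply; rewrite le_eqVlt; apply/orP; left; apply/eqP; ring.
Qed.

(** Let [v] compete in the infimum at [w]. If [v <= u], it competes at [u] too, with a smaller
    penalty; otherwise [u] itself does, because [u * g u <= v * g v]. *)
Lemma trunc_flux_nd n u w : 0 <= u -> u <= w -> trunc_flux n u <= trunc_flux n w.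
Proof.
move=> u0 uw; apply: trunc_flux_ge; first exact: le_trans uw.
move=> v /andP[v0 vw]; have [vu|/ltW uv] := leP v u.
  apply: (le_trans (@trunc_flux_le_at n u v _)); first by rewrite v0.
  by rewrite lerD2l ler_wpM2l// lerB.
apply: (@le_trans _ _ (u * g u)); first by rewrite ler_wpM2l// trunc_coef_le.
by apply: (le_trans (ug_nd u0 uv)); rewrite lerDl mulr_ge0// subr_ge0.
Qed.

(** A competitor at [u] also competes at [w], and its penalty grows by exactly [n * (w - u)]. *)
Lemma trunc_flux_lip n u w : 0 <= u -> u <= w ->
  trunc_flux n w <= trunc_flux n u + n%:R * (w - u).
Proof.
move=> u0 uw; rewrite -lerBlDr; apply: trunc_flux_ge => // v /andP[v0 vu].
rewrite lerBlDr; apply: (le_trans (@trunc_flux_le_at n w v _)).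
  by rewrite v0 (le_trans vu).
by rewrite le_eqVlt; apply/orP; left; apply/eqP; ring.
Qed.

(** When [l] is far from 1 the penalty [(1 - l) * n] alone exceeds [c], hence [g u]; when [l] is
    close to 1 uniform continuity compares [g (l * u)] with [g u]. *)
Lemma trunc_coef_cvg K eps : 0 < eps -> exists N : nat, forall n u, (N <= n)%N ->
  0 <= u <= K -> `|trunc_coef n u - g u| <= eps.
Proof.
move=> e0; have e20 : 0 < eps / 2 by rewrite divr_gt0.
have [rho rho0 hrho] := continuous_uniform_segment `|K| g_cont e20.
have c0 : 0 <= c by exact: le_trans (g_ge0 0) (g_le 0).
(* The second bound makes [u - l * u] at most [rho] for [l >= 1 - kap], the third makes the lost
   part [(1 - l) * g (l * u)] at most [eps / 2]. *)
pose kap := Num.min 1 (Num.min (rho / (`|K| + 1)) (eps / 2 / (c + 1))).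
have K1 : 0 < `|K| + 1 by rewrite ltr_wpDl.
have c1 : 0 < c + 1 by rewrite ltr_wpDl.
have kap0 : 0 < kap by rewrite !lt_min ltr01 !divr_gt0.
exists (Num.truncn (c / kap)).+1 => n u Nn /andP[u0 uK].
have cn : c <= kap * n%:R.
  rewrite mulrC -ler_pdivrMr//; apply/ltW/(lt_le_trans (truncnS_gt _)).
  by rewrite ler_nat.
rewrite distrC ger0_norm ?subr_ge0 ?trunc_coef_le// lerBlDl -lerBlDr.
apply: lb_le_inf => // _ [l /andP[l0 l1] <-].
have [lk|kl] := leP (1 - kap) l; last first.
  apply: (@le_trans _ _ c); first by rewrite lerBlDr (le_trans (g_le u))// lerDl ltW.
  apply: (le_trans cn); rewrite -[leLHS]add0r lerD ?mulr_ge0// ler_wpM2r//.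
  by rewrite lerBrDl -lerBrDr ltW.
have uK' : `|u| <= `|K| by rewrite ger0_norm// (le_trans uK)// ler_norm.
have luK : `|l * u| <= `|K|.
  by rewrite normrM (le_trans _ uK')// ler_piMl// ger0_norm.
have dl : `|u - l * u| <= rho.
  rewrite -{1}(mul1r u) -mulrBl normrM ger0_norm ?subr_ge0//.
  apply: (@le_trans _ _ (kap * `|K|)); first by rewrite ler_pM ?subr_ge0// lerBlDl -lerBlDr.
  apply: (@le_trans _ _ (rho / (`|K| + 1) * (`|K| + 1))); last by rewrite divfK// gt_eqF.
  by rewrite ler_pM ?(ltW kap0)// ?lerDl// /kap !ge_min lexx orbT.
have := hrho _ _ uK' luK dl; rewrite ler_norml => /andP[_ h].
have kc : kap * c <= eps / 2.
  apply: (@le_trans _ _ (eps / 2 / (c + 1) * (c + 1))); last by rewrite divfK// gt_eqF.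
  by rewrite ler_pM ?(ltW kap0)// ?lerDl// /kap !ge_min lexx !orbT.
have h2 : (1 - l) * g (l * u) <= kap * c.
  by rewrite ler_pM ?subr_ge0// lerBlDl -lerBlDr.
have h3 : 0 <= (1 - l) * n%:R by rewrite mulr_ge0// subr_ge0.
by move: h kc h2 h3; rewrite mulrBl mul1r; lra.
Qed.

End lipschitz_truncation.

Lemma sum_shift (R : realType) (I : finZmodType) (f : I -> R) (a : I) :
  \sum_i f (i + a) = \sum_i f i.
Proof. by rewrite [RHS](reindex_inj (addIr a)). Qed.

(** * The explicit scheme and its l1 contraction *)

Section scheme.
Context {R : realType} {I : finZmodType}.
Variables (e : I) (bt : R -> R).
Hypothesis bt_nd : forall x y, 0 <= x -> x <= y -> bt x <= bt y.
Hypothesis bt_lip : forall x y, 0 <= x -> x <= y -> bt y <= bt x + (y - x).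
Hypothesis bt_itv : forall x, 0 <= x -> 0 <= bt x <= x.
Implicit Types u v : I -> R.

Definition scheme_step u i : R := u i + (bt (u (i + e)) + bt (u (i - e))) / 2 - bt (u i).

Definition scheme u k := iter k scheme_step u.

Lemma schemeS u k : scheme u k.+1 = scheme_step (scheme u k).
Proof. by []. Qed.

Lemma scheme_ge0 u k : (forall i, 0 <= u i) -> forall i, 0 <= scheme u k i.
Proof.
move=> u0; elim: k => // k IH i; rewrite schemeS /scheme_step.
have /andP[h1 h2] := bt_itv (IH i).
have /andP[h3 _] := bt_itv (IH (i + e)).
have /andP[h4 _] := bt_itv (IH (i - e)); lra.
Qed.

(** Both [bt] and [x - bt x] are nondecreasing, so the distance of [x] and [y] splits exactly into a
    part that stays and a part that moves. *)
Lemma bt_dist x y : 0 <= x -> 0 <= y ->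
  `|x - bt x - (y - bt y)| = `|x - y| - `|bt x - bt y|.
Proof.
wlog xy : x y / x <= y => [H x0 y0|x0 y0].
  have [xy|/ltW yx] := leP x y; first exact: H.
  by rewrite distrC H// (distrC x) (distrC (bt x)).
have h1 := bt_nd x0 xy; have h2 := bt_lip x0 xy.
rewrite ler0_norm; last by lra.
rewrite (ler0_norm (_ : x - y <= 0)); last by lra.
by rewrite (ler0_norm (_ : bt x - bt y <= 0)); lra.
Qed.

(* Since [bt] is nondecreasing and 1-Lipschitz, what a site loses in the l1 distance is
   exactly what it may pass on to its two neighbours. *)
Lemma scheme_step_contract u v : (forall i, 0 <= u i) -> (forall i, 0 <= v i) ->
  \sum_i `|scheme_step u i - scheme_step v i| <= \sum_i `|u i - v i|.
Proof.
move=> u0 v0; pose b i := `|bt (u i) - bt (v i)|.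
apply: (@le_trans _ _ (\sum_i ((`|u i - v i| - b i) + (2^-1 * b (i + e) + 2^-1 * b (i - e))))).
  apply: ler_sum => i _; rewrite -bt_dist//.
  have -> : scheme_step u i - scheme_step v i = (u i - bt (u i) - (v i - bt (v i)))
     + (2^-1 * (bt (u (i + e)) - bt (v (i + e))) + 2^-1 * (bt (u (i - e)) - bt (v (i - e)))).
    by rewrite /scheme_step; field.
  apply: (le_trans (ler_normD _ _)); rewrite lerD2l (le_trans (ler_normD _ _))//.
  by rewrite !normrM (@ger0_norm _ 2^-1)// invr_ge0.
rewrite big_split/= big_split/= sumrN big_split/= -!mulr_sumr.
rewrite (sum_shift b e) (sum_shift b (- e)); lra.
Qed.

Lemma scheme_contract u v k : (forall i, 0 <= u i) -> (forall i, 0 <= v i) ->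
  \sum_i `|scheme u k i - scheme v k i| <= \sum_i `|u i - v i|.
Proof.
move=> u0 v0; elim: k => // k; apply: le_trans.
by rewrite !schemeS scheme_step_contract//; exact: scheme_ge0.
Qed.

Lemma scheme_shift u a k i : scheme (fun j => u (j + a)) k i = scheme u k (i + a).
Proof.
elim: k i => // k IH i; rewrite !schemeS /scheme_step !IH.
by rewrite (addrAC i e) (addrAC i (- e)).
Qed.

Lemma scheme_translation u a k : (forall i, 0 <= u i) ->
  \sum_i `|scheme u k (i + a) - scheme u k i| <= \sum_i `|u (i + a) - u i|.
Proof.
move=> u0; under eq_bigr do rewrite -scheme_shift.
exact: scheme_contract.
Qed.

End scheme.

(** * The lattice walk *)

(* Whether the walk jumps, in which direction, and a fair coin which drives the Brownian walk
   where the coefficient is too small to be divided by. *)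
Definition move : finType := (bool * bool * bool)%type.

Lemma sum_move (R : realType) (F : move -> R) :
  \sum_e F e = F (true, true, true) + F (true, true, false) + F (true, false, true)
    + F (true, false, false) + F (false, true, true) + F (false, true, false)
    + F (false, false, true) + F (false, false, false).
Proof.
rewrite (eq_bigr (fun e : move => F ((e.1.1, e.1.2), e.2))); last by move=> [[]].
rewrite -(pair_bigA _ (fun (a : bool * bool) b => F ((a.1, a.2), b)))/=.
rewrite -(pair_bigA _ (fun a b => \sum_c F ((a, b), c)))/=.
by rewrite !big_bool/=; ring.
Qed.

Section lattice_chain.
Context {R : realType}.
Variables (m : nat) (n : R) (gam : R -> R) (delta eta : R).
Variable (u0 : 'I_m.+2 -> R).
Hypothesis n0 : 0 < n.
Hypothesis gam_itv : forall x, 0 <= gam x <= n.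
Hypothesis delta0 : 0 < delta.
Hypothesis eta0 : 0 < eta.
Hypothesis u0_ge0 : forall i, 0 <= u0 i.
Hypothesis u0_sum : \sum_i delta * u0 i = 1.

(** The time step: a jump of size [delta] with probability [gam / n] has variance [h * gam]. *)
Let h : R := delta ^+ 2 / n.
Definition flux x := x * gam x / n.
(* [delta * density k] turns out to be the law of the walk at step [k]: the transition
   probabilities of the walk depend on its own law through this deterministic sequence. *)
Definition density k := scheme 1 flux u0 k.

Definition jump (e : move) : int := if e.1.1 then (if e.1.2 then 1 else -1) else 0.

(** The position is followed in the integers, without wrapping around, so that it is a martingale;
    the torus only serves to evaluate the density. *)
Fixpoint site_seq (i : nat) (l : seq move) : int :=
  if l is e :: l' then site_seq i l' + jump e else i.
Definition site (s : history (E := move)) : int := site_seq s.1 s.2.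
Definition torus_site s : 'I_m.+2 := (site s)%:~R.

Definition local_density s : R := density (size s.2) (torus_site s).
Definition sigma s : R := Num.sqrt (gam (local_density s)).
Definition jump_prob s : R := gam (local_density s) / n.
(** Direction and coin are independent fair bits, whence the division by 4. *)
Definition chain_wt s (e : move) : R :=
  (if e.1.1 then jump_prob s else 1 - jump_prob s) / 4.
Definition chain_init (i : nat) : R := delta * u0 i%:R.

Definition dX (e : move) : R := delta * (jump e)%:~R.
Definition dW s (e : move) : R :=
  if eta <= sigma s then dX e / sigma s else (if e.2 then 1 else -1) * Num.sqrt h.

Fixpoint brownian_seq (i : nat) (l : seq move) : R :=
  if l is e :: l' then brownian_seq i l' + dW (i, l') e else 0.
Definition brownian_walk (s : history (E := move)) := brownian_seq s.1 s.2.

Lemma brownian_walk_extend s e : brownian_walk (extend s e) = brownian_walk s + dW s e.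
Proof. by case: s. Qed.

Lemma site_extend s e : site (extend s e) = site s + jump e.
Proof. by []. Qed.

Lemma jump_prob_itv s : 0 <= jump_prob s <= 1.
Proof.
have /andP[h1 h2] := gam_itv (local_density s).
by rewrite divr_ge0 ?ler_pdivrMr ?mul1r// ltW.
Qed.

Lemma chain_wt_ge0 s e : 0 <= chain_wt s e.
Proof.
have /andP[h1 h2] := jump_prob_itv s.
by rewrite divr_ge0//; case: ifP => // _; rewrite subr_ge0.
Qed.

Lemma chain_wt_sum s : \sum_e chain_wt s e = 1.
Proof. by rewrite sum_move /chain_wt/=; field. Qed.

Lemma chain_init_ge0 i : 0 <= chain_init i.
Proof. by rewrite mulr_ge0// ltW. Qed.

Lemma chain_init_sum : \sum_(i < m.+2) chain_init i = 1.
Proof. by rewrite -u0_sum; apply: eq_bigr => i _; rewrite /chain_init natr_Zp. Qed.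

Let sqr_sigma s : sigma s ^+ 2 = gam (local_density s).
Proof. by rewrite sqr_sqrtr//; case/andP: (gam_itv (local_density s)). Qed.

Let h0 : 0 < h. Proof. by rewrite divr_gt0// exprn_gt0. Qed.

Let sqrt_h : Num.sqrt h ^+ 2 = h. Proof. by rewrite sqr_sqrtr// ltW. Qed.

Let hq s : delta ^+ 2 * jump_prob s = h * sigma s ^+ 2.
Proof. by rewrite sqr_sigma /h /jump_prob; field; rewrite gt_eqF. Qed.

Lemma dX_mean s : \sum_e chain_wt s e * dX e = 0.
Proof. by rewrite sum_move /chain_wt /dX /jump /=; field. Qed.

Lemma dX_var s : \sum_e chain_wt s e * dX e ^+ 2 = h * sigma s ^+ 2.
Proof. by rewrite -hq sum_move /chain_wt /dX /jump /=; field. Qed.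

Lemma dW_mean s : \sum_e chain_wt s e * dW s e = 0.
Proof.
rewrite /dW; case: (boolP (eta <= _)) => _; rewrite sum_move /chain_wt /dX /jump /=; last by field.
by move: (sigma s)^-1 => x; field.
Qed.

Let sigma_neq0 s : eta <= sigma s -> sigma s != 0.
Proof. by move=> h1; rewrite gt_eqF// (lt_le_trans eta0). Qed.

Lemma dW_var s : \sum_e chain_wt s e * dW s e ^+ 2 = h.
Proof.
rewrite /dW; case: (boolP (eta <= _)) => [/sigma_neq0 s0|_].
  under eq_bigr do rewrite expr_div_n mulrA.
  by rewrite -mulr_suml dX_var mulfK// sqrf_eq0.
under eq_bigr do rewrite exprMn sqrt_h mulrA.
by rewrite -mulr_suml sum_move /chain_wt/= [X in X * _](_ : _ = 1) ?mul1r//; field.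
Qed.

(** At a nondegenerate site [dX] is [sigma s * dW] and the sum is [h * (S - sigma s) ^+ 2]. At a
    degenerate one the coin is independent of [dX], which gives [h * (S ^+ 2 + sigma s ^+ 2)]; this
    fits the same bound thanks to [sigma s < eta] and the square [(S - 2 * sigma s) ^+ 2]. *)
Lemma dW_dX_var s (S : R) :
  \sum_e chain_wt s e * (S * dW s e - dX e) ^+ 2 <= h * (2 * (S - sigma s) ^+ 2 + 3 * eta ^+ 2).
Proof.
rewrite /dW; case: (boolP (eta <= _)) => [/sigma_neq0 s0|].
  rewrite (eq_bigr (fun e => chain_wt s e * dX e ^+ 2 * (S / sigma s - 1) ^+ 2)); last first.
    by move=> e _; ring.
  rewrite -mulr_suml dX_var [leLHS](_ : _ = h * (S - sigma s) ^+ 2); last by field.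
  rewrite ler_wpM2l ?(ltW h0)//.
  by have := sqr_ge0 (S - sigma s); have := sqr_ge0 eta; lra.
rewrite -ltNge => s_eta.
have -> : \sum_e chain_wt s e * (S * ((if e.2 then 1 else -1) * Num.sqrt h) - dX e) ^+ 2 =
    S ^+ 2 * Num.sqrt h ^+ 2 + h * sigma s ^+ 2.
  by rewrite -hq sum_move /chain_wt /dX /jump /=; field.
rewrite sqrt_h mulrC -mulrDr ler_wpM2l ?(ltW h0)//.
have se : sigma s ^+ 2 <= eta ^+ 2.
  by rewrite lerXn2r ?nnegrE ?sqrtr_ge0 ?(ltW eta0)// ltW.
by have := sqr_ge0 (S - 2 * sigma s); move: se; lra.
Qed.

Lemma dX_bound e : `|dX e| <= delta.
Proof.
rewrite /dX normrM (gtr0_norm delta0) ler_piMr ?(ltW delta0)// /jump.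
by case: e => [[[] []] b] /=; rewrite ?normrN ?normr1 ?normr0.
Qed.

Lemma dW_bound s e : `|dW s e| <= delta / eta + Num.sqrt h.
Proof.
rewrite /dW; case: ifP => [es|_].
  apply: (@le_trans _ _ (delta / eta)); last by rewrite lerDl sqrtr_ge0.
  rewrite normrM normfV ler_pM ?dX_bound// ger0_norm ?sqrtr_ge0// lef_pV2// posrE//.
  exact: lt_le_trans es.
apply: (@le_trans _ _ (Num.sqrt h)); last by rewrite lerDr divr_ge0// ltW.
by rewrite normrM (ger0_norm (sqrtr_ge0 _)); case: e.2; rewrite ?normrN normr1 mul1r.
Qed.

(** Duality: one step of the chain acting on the test function becomes, after translating the sums
    over the torus, one step of the scheme acting on the density. *)
Lemma chain_law k (f : 'I_m.+2 -> R) :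
  chain_mean m.+2 chain_init chain_wt k (f \o torus_site) =
  \sum_i delta * density k i * f i.
Proof.
elim: k f => [|k IH] f.
  by apply: eq_bigr => i _; rewrite /= /torus_site /site/= -pmulrn natr_Zp /chain_init natr_Zp.
pose q i := gam (density k i) / n.
(* The transition operator of step [k] applied to [f]. *)
pose F i := (1 - q i) * f i + q i / 2 * f (i + 1) + q i / 2 * f (i - 1).
rewrite chain_meanS (_ : chain_mean _ _ _ _ _ =
    chain_mean m.+2 chain_init chain_wt k (F \o torus_site)); last first.
  apply: eq_chain_mean => //; first exact: chain_init_ge0.
  - exact: chain_wt_ge0.
  move=> s sk; rewrite /cexp sum_move /chain_wt/= /torus_site !site_extend /jump/=.
  rewrite addr0 !rmorphD/= rmorphN/= !rmorph1.
  by rewrite /F /q /jump_prob /local_density sk /torus_site; field; rewrite gt_eqF.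
rewrite IH /density schemeS -/(density k).
have fl i : density k i * q i = flux (density k i) by rewrite /q /flux mulrA.
rewrite (eq_bigr (fun i => delta * (density k i - flux (density k i)) * f i +
   (delta / 2 * flux (density k i) * f (i + 1) +
    delta / 2 * flux (density k i) * f (i - 1)))); last first.
  by move=> i _; rewrite -!fl /F; field.
rewrite big_split big_split/=.
rewrite -(sum_shift (fun i => delta / 2 * flux (density k i) * f (i + 1)) (- 1)).
rewrite -(sum_shift (fun i => delta / 2 * flux (density k i) * f (i - 1)) 1).
rewrite -!big_split/=; apply: eq_bigr => i _; rewrite subrK addrK /scheme_step.
by field.
Qed.

End lattice_chain.

(** * Double averages of a lattice density *)

Section double_average.
Context {R : realType}.
Variables (m J : nat) (delta : R).
Hypothesis J0 : (0 < J)%N.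
Hypothesis Jm : (J <= m.+2)%N.
Hypothesis delta0 : 0 < delta.
Implicit Types (u : 'I_m.+2 -> R) (y : 'I_m.+2).

(* One average of a density of mass 1 is bounded; the second one makes it Lipschitz in space,
   uniformly in the mesh. *)
Definition avg u i : R := (J%:R ^+ 2)^-1 * \sum_(a < J) \sum_(b < J) u (i + a%:R + b%:R).

(** The convolution with itself of the indicator of the sites [0, ..., J - 1]: a discrete tent of
    height at most [J]. *)
Definition tent y : R := \sum_(a < J) (nat_of_ord (y - a%:R)%R < J)%N%:R.

Let JR0 : (0 : R) < J%:R. Proof. by rewrite ltr0n. Qed.

Let sum_eq y : \sum_(b < J) (y == b%:R)%:R = (y < J)%N%:R :> R.
Proof.
have e b : (b < J)%N -> (y == b%:R) = ((y : nat) == b).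
  move=> bJ; apply/eqP/eqP => [->|<-]; last by rewrite natr_Zp.
  by rewrite Zp_nat /= modn_small// (leq_trans bJ).
have [yJ|Jy] := ltnP y J.
  rewrite (bigD1 (Ordinal yJ))//= e// eqxx big1 ?addr0// => b /negbTE bn.
  by rewrite e// -[y : nat]/(nat_of_ord (Ordinal yJ)) val_eqE eq_sym bn.
by rewrite big1// => b _; rewrite e// gtn_eqF// (leq_trans _ Jy).
Qed.

(** In convolution form all the regularity can be taken from the kernel and none from [u]. *)
Lemma avgE u i : avg u i = (J%:R ^+ 2)^-1 * \sum_x u x * tent (x - i).
Proof.
rewrite /avg; congr (_ * _); rewrite /tent.
under [RHS]eq_bigr do rewrite mulr_sumr.
rewrite [RHS]exchange_big; apply: eq_bigr => a _.
transitivity (\sum_x \sum_(b < J) u x * (x - i - a%:R == b%:R)%:R); last first.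
  by apply: eq_bigr => x _; rewrite -sum_eq mulr_sumr.
rewrite exchange_big; apply: eq_bigr => b _.
rewrite (bigD1 (i + a%:R + b%:R))//= big1 ?addr0.
  have -> : i + a%:R + b%:R - i - a%:R = b%:R :> 'I_m.+2 by ring.
  by rewrite eqxx mulr1.
move=> x xn; case: eqP => [e|]; rewrite ?mulr0//.
by exfalso; move/eqP: xn; apply; rewrite -e; ring.
Qed.

Lemma tent_itv y : 0 <= tent y <= J%:R.
Proof.
apply/andP; split; first by apply: sumr_ge0.
rewrite -[J in leRHS]card_ord -sumr_const; apply: ler_sum => a _.
by case: (_ < _)%N.
Qed.

(** The shifted sum telescopes to the difference of two indicators. *)
Lemma tentS y : `|tent (y + 1) - tent y| <= 1.
Proof.
rewrite /tent; case: J J0 => // j _.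
have tele (F : 'I_m.+2 -> R) : \sum_(a < j.+1) F (y + 1 - a%:R) - \sum_(a < j.+1) F (y - a%:R) =
    F (y + 1) - F (y - j%:R).
  rewrite big_ord_recl big_ord_recr/= mulr0n subr0.
  rewrite (eq_bigr (fun i : 'I_j => F (y - i%:R))); first by ring.
  by move=> i _; rewrite /bump leq0n -natr1; congr F; ring.
rewrite (tele (fun z => (nat_of_ord z < j.+1)%N%:R)).
by case: (_ < _)%N; case: (_ < _)%N; rewrite ?subrr ?subr0 ?sub0r ?normrN ?normr1 ?normr0.
Qed.

Lemma tentD_nat y k : `|tent (y + k%:R) - tent y| <= k%:R.
Proof.
elim: k => [|k IH]; first by rewrite addr0 subrr normr0.
rewrite -natr1 addrA -(subrKA (tent (y + k%:R))) -natr1.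
by rewrite (le_trans (ler_normD _ _))// [leRHS]addrC lerD// tentS.
Qed.

Lemma tentD_int y (z : int) : `|tent (y + z%:~R) - tent y| <= (absz z)%:R.
Proof.
case: z => k; first by rewrite -pmulrn; exact: tentD_nat.
rewrite NegzE abszN absz_nat rmorphN/= -pmulrn.
have := tentD_nat (y - k.+1%:R) k.+1; by rewrite subrK distrC.
Qed.

Section fixed_density.
Variable u : 'I_m.+2 -> R.
Hypothesis u_ge0 : forall i, 0 <= u i.
Hypothesis u_sum : \sum_i delta * u i = 1.

Let u_sumV : \sum_i u i = delta^-1.
Proof. by apply: (mulfI (lt0r_neq0 delta0)); rewrite mulr_sumr u_sum mulfV ?gt_eqF. Qed.

Lemma avg_ge0 i : 0 <= avg u i.
Proof.
by rewrite mulr_ge0// ?invr_ge0 ?exprn_ge0//; do 2 apply: sumr_ge0 => ? _.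
Qed.

Lemma avg_le i : avg u i <= (J%:R * delta)^-1.
Proof.
have -> : (J%:R * delta)^-1 = (J%:R ^+ 2)^-1 * \sum_x u x * J%:R.
  by rewrite -mulr_suml u_sumV; field; rewrite !gt_eqF.
rewrite avgE ler_wpM2l ?invr_ge0 ?exprn_ge0//; apply: ler_sum => x _.
by rewrite ler_wpM2l//; case/andP: (tent_itv (x - i)).
Qed.

Lemma avg_shift_int i (z : int) :
  `|avg u (i + z%:~R) - avg u i| <= (absz z)%:R / (J%:R ^+ 2 * delta).
Proof.
have -> : (absz z)%:R / (J%:R ^+ 2 * delta) = (J%:R ^+ 2)^-1 * \sum_x u x * (absz z)%:R.
  by rewrite -mulr_suml u_sumV; field; rewrite !gt_eqF.
rewrite !avgE -mulrBr -sumrB normrM ger0_norm ?invr_ge0 ?exprn_ge0//.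
rewrite ler_wpM2l ?invr_ge0 ?exprn_ge0//.
rewrite (le_trans (ler_norm_sum _ _ _))//; apply: ler_sum => x _.
rewrite -mulrBr normrM ger0_norm// ler_wpM2l//.
by have := tentD_int (x - i) (- z); rewrite abszN rmorphN/= opprD addrA.
Qed.

(** The two successive shifts by less than [J] sites cost [w] each, since the sum over the torus is
    translation invariant. *)
Lemma avg_l1 w : (forall a, (a < J)%N -> \sum_i `|u (i + a%:R) - u i| <= w) ->
  \sum_i `|avg u i - u i| <= 2 * w.
Proof.
move=> hw; have J2 : (J%:R ^+ 2 : R) != 0 by rewrite expf_neq0 ?gt_eqF.
have uE i : u i = (J%:R ^+ 2)^-1 * \sum_(a < J) \sum_(b < J) u i.
  by rewrite !sumr_const card_ord -mulrnA -[u i *+ _]mulr_natr natrM -expr2 mulrC mulfK.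
apply: (@le_trans _ _ (\sum_i (J%:R ^+ 2)^-1 *
     \sum_(a < J) \sum_(b < J) `|u (i + a%:R + b%:R) - u i|)).
  apply: ler_sum => i _; rewrite [in X in _ - X]uE -mulrBr -sumrB normrM.
  rewrite ger0_norm ?invr_ge0 ?exprn_ge0// ler_wpM2l ?invr_ge0 ?exprn_ge0//.
  rewrite (le_trans (ler_norm_sum _ _ _))//; apply: ler_sum => a _.
  by rewrite -sumrB ler_norm_sum.
rewrite -mulr_sumr mulrC ler_pdivrMr ?exprn_gt0// exchange_big/=.
apply: (@le_trans _ _ (\sum_(a < J) \sum_(b < J) (2 * w))); last first.
  by rewrite !sumr_const card_ord -mulrnA -[_ *+ (J * J)]mulr_natr natrM -expr2.
apply: ler_sum => a _; rewrite exchange_big/=; apply: ler_sum => b _.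
apply: (@le_trans _ _ (\sum_i (`|u (i + a%:R + b%:R) - u (i + a%:R)| + `|u (i + a%:R) - u i|))).
  apply: ler_sum => i _; rewrite -(subrKA (u (i + a%:R))).
  by rewrite (le_trans (ler_normD _ _)).
rewrite big_split/= (sum_shift (fun i => `|u (i + b%:R) - u i|) a%:R).
have := hw _ (ltn_ord a); have := hw _ (ltn_ord b); lra.
Qed.

End fixed_density.

End double_average.

(** * From l1 closeness of densities to closeness of coefficients *)

Section density_comparison.
Context {R : realType} {I : finType}.
Variables (delta : R) (u v w : I -> R) (g gam : R -> R).
Hypothesis delta0 : 0 < delta.
Hypothesis u_ge0 : forall i, 0 <= u i.
Hypothesis v_ge0 : forall i, 0 <= v i.
Hypothesis u_sum : \sum_i delta * u i = 1.

(* [w] is a bounded function l1-close to [u] and only serves to control the mass that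
   [u] carries where it is large. *)
Lemma coef_comparison (c K rho eps e1 e2 : R) : 0 < rho -> 0 <= c ->
  (forall x, 0 <= g x <= c) -> (forall x, 0 <= gam x <= c) ->
  (forall i, w i <= K) -> 0 < K ->
  (forall x y, 0 <= x <= 2 * K -> 0 <= y <= 2 * K + rho -> `|x - y| <= rho ->
     `|g y - gam x| <= eps) ->
  \sum_i delta * `|w i - u i| <= e1 -> \sum_i delta * `|v i - u i| <= e2 ->
  \sum_i delta * u i * `|g (v i) - gam (u i)| <= eps + c * (2 * e1 + 2 * K / rho * e2).
Proof.
move=> rho0 c0 gc gamc wK K0 hg he1 he2.
have eps0 : 0 <= eps.
  have := hg 0 0; rewrite lexx !mulr_ge0 ?addr_ge0 ?mulr_ge0 ?(ltW K0) ?(ltW rho0)// subrr normr0.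
  by move=> /(_ isT isT (ltW rho0)); exact: le_trans.
(* Pointwise there are three cases. If [u <= 2 * K] and [u] is [rho]-close to [v], continuity
   applies. If [u <= 2 * K] but they are not close, then [u <= 2 * K / rho * |v - u|]. If
   [u > 2 * K], then [w <= K] forces [u <= 2 * |w - u|]. *)
apply: (@le_trans _ _ (\sum_i (eps * (delta * u i) + c * (2 * (delta * `|w i - u i|) +
    2 * K / rho * (delta * `|v i - u i|))))).
  apply: ler_sum => i _.
  have du : 0 <= delta * u i by rewrite mulr_ge0// ltW.
  have K2 : 0 <= 2 * K / rho by rewrite divr_ge0 ?mulr_ge0 ?ltW.
  have h1 : 0 <= delta * `|w i - u i| by rewrite mulr_ge0// ltW.
  have h2 : 0 <= delta * `|v i - u i| by rewrite mulr_ge0// ltW.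
  have le3 : c * (2 * K / rho * (delta * `|v i - u i|)) <= eps * (delta * u i) +
      c * (2 * (delta * `|w i - u i|) + 2 * K / rho * (delta * `|v i - u i|)).
    apply: ler_wpDl; first exact: mulr_ge0.
    by rewrite ler_wpM2l// lerDr mulr_ge0.
  have le2 : c * (2 * (delta * `|w i - u i|)) <= eps * (delta * u i) +
      c * (2 * (delta * `|w i - u i|) + 2 * K / rho * (delta * `|v i - u i|)).
    apply: ler_wpDl; first exact: mulr_ge0.
    by rewrite ler_wpM2l// lerDl mulr_ge0.
  have gle : `|g (v i) - gam (u i)| <= c.
    have /andP[a1 a2] := gc (v i); have /andP[a3 a4] := gamc (u i).
    by rewrite ler_norml; apply/andP; split; lra.
  have [uK|Ku] := leP (u i) (2 * K).
    have [uv|vu] := leP `|u i - v i| rho.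
      apply: (@le_trans _ _ (eps * (delta * u i))).
        rewrite mulrC ler_wpM2r// hg// ?u_ge0// v_ge0/=.
        by move: uv; rewrite ler_norml => /andP[]; lra.
      by rewrite lerDl mulr_ge0// addr_ge0// mulr_ge0.
    apply: (@le_trans _ _ (c * (2 * K / rho * (delta * `|v i - u i|)))).
      rewrite mulrC ler_pM//.
      rewrite mulrCA ler_wpM2l ?(ltW delta0)// (le_trans uK)//.
      rewrite -[leLHS]mulr1 -[leRHS]mulrA ler_wpM2l ?mulr_ge0 ?(ltW K0)// ler_pdivlMl// mulr1 distrC.
      exact: ltW.
    exact: le3.
  apply: (@le_trans _ _ (c * (2 * (delta * `|w i - u i|)))).
    rewrite mulrC ler_pM// mulrCA ler_wpM2l ?(ltW delta0)//.
    have := wK i; have := ler_norm (u i - w i); rewrite distrC; move: Ku K0; lra.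
  exact: le2.
rewrite big_split/= -mulr_sumr u_sum mulr1 lerD2l -mulr_sumr ler_wpM2l// big_split/=.
by rewrite lerD// -mulr_sumr ler_wpM2l// divr_ge0 ?mulr_ge0 ?ltW.
Qed.

End density_comparison.

(** * Discretisation of the initial density *)

Lemma integrable_sub (d : measure_display) (T : measurableType d) (R : realType)
    (mu : {measure set T -> \bar R}) (D : set T) (f g : T -> R) : measurable D ->
  mu.-integrable D (EFin \o f) -> mu.-integrable D (EFin \o g) ->
  mu.-integrable D (EFin \o (fun x => f x - g x)).
Proof. by move=> mD fi gi; exact: (integrableB mD fi gi). Qed.

Section integral_over_cells.
Context {R : realType}.
Notation mu := (@lebesgue_measure R).
Implicit Types (f g : R -> R) (a b : R).

Lemma measurable_itvR (i : interval R) : measurable ([set` i] : set (measurableTypeR R)).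
Proof. exact: measurable_itv. Qed.

Definition itv_mass f a b : R := \int[mu]_(x in `[a, b[) f x.

Lemma integrable_itv f a b : mu.-integrable setT (EFin \o f) ->
  mu.-integrable `[a, b[ (EFin \o f).
Proof. by move=> fi; apply: integrableS fi. Qed.

Lemma itv_massD f a b c : mu.-integrable setT (EFin \o f) -> a <= b -> b <= c ->
  itv_mass f a c = itv_mass f a b + itv_mass f b c.
Proof.
move=> fi ab bc; rewrite /itv_mass -Rintegral_setU//=.
- by congr (\int[mu]_(x in _) _); rewrite -itv_bndbnd_setU ?bnd_simp.
- by apply: integrableS fi => //; exact: measurableU.
- by apply/disj_setPS => x [] /=; rewrite !in_itv/= => /andP[_ h1] /andP[h2 _]; move: (lt_le_trans h1 h2); rewrite ltxx.
Qed.

Lemma itv_mass_ge0 f a b : (forall x, 0 <= f x) -> 0 <= itv_mass f a b.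
Proof. by move=> f0; apply: Rintegral_ge0. Qed.

Lemma itv_mass_cst (c : R) a b : a <= b -> itv_mass (fun=> c) a b = c * (b - a).
Proof.
move=> ab; rewrite /itv_mass Rintegral_cst//= lebesgue_measure_itv/= lte_fin.
by move: ab; rewrite le_eqVlt => /predU1P[->|->]; rewrite ?ltxx ?subrr.
Qed.

Lemma itv_mass_le f g a b : mu.-integrable setT (EFin \o f) -> mu.-integrable setT (EFin \o g) ->
  (forall x, a <= x < b -> f x <= g x) -> itv_mass f a b <= itv_mass g a b.
Proof.
move=> fi gi fg; apply: le_Rintegral => //; exact: integrable_itv.
Qed.

Lemma itv_mass_le_total f a b : mu.-integrable setT (EFin \o f) -> (forall x, 0 <= f x) ->
  itv_mass f a b <= \int[mu]_x f x.
Proof.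
move=> fi f0; rewrite /itv_mass /Rintegral fine_le//.
- by apply: integrable_fin_num => //; exact: integrable_itv.
- exact: integrable_fin_num.
- apply: ge0_subset_integral => //; first by case/integrableP: fi.
  by move=> x _; rewrite lee_fin.
Qed.

Lemma sum_itv_mass f (x0 delta : R) M : mu.-integrable setT (EFin \o f) -> 0 <= delta ->
  \sum_(i < M) itv_mass f (x0 + i%:R * delta) (x0 + i.+1%:R * delta) =
  itv_mass f x0 (x0 + M%:R * delta).
Proof.
move=> fi d0; elim: M => [|M IH].
  rewrite big_ord0 mul0r addr0 /itv_mass set_itvco0// ?Rintegral_set0//.
rewrite big_ord_recr/= IH -itv_massD//; first by rewrite lerDl mulr_ge0.
by rewrite lerD2l ler_wpM2r// ler_nat.
Qed.

Lemma itv_mass_setT_cvg f eps : mu.-integrable setT (EFin \o f) -> (forall x, 0 <= f x) ->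
  0 < eps -> exists2 B : R, 0 < B & \int[mu]_x f x - eps <= itv_mass f (- B) B.
Proof.
move=> fi f0 e0.
have mf : measurable_fun setT f by case/integrableP : fi => /measurable_EFinP.
have := @ge0_nondecreasing_set_cvg_integral _ (measurableTypeR R) R (fun n : nat => `[- n%:R, n%:R[%classic : set R)
  (EFin \o f) mu.
have -> : \bigcup_i `[(- i%:R : R), i%:R[%classic = setT.
  rewrite predeqE => x; split => // _; exists (Num.truncn `|x|).+1 => //=.
  have h := truncnS_gt `|x|; rewrite in_itv/=; apply/andP; split.
    by rewrite lerNl ltW// (le_lt_trans _ h)// -normrN ler_norm.
  by rewrite (le_lt_trans _ h)// ler_norm.
move=> h; have {}h := h _ _ _ _.
have /fine_cvgP[_ /cvgrPdist_le/(_ _ e0)] :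
    (\int[mu]_(x in `[(- i%:R)%R, i%:R[) (f x)%:E)%E @[i --> \oo] --> (\int[mu]_x f x)%:E.
  rewrite /Rintegral fineK; last exact: integrable_fin_num.
  apply: h => //.
  - move=> n m nm; apply/subsetPset => x /=; rewrite !in_itv/= => /andP[h1 h2].
    by rewrite (le_trans _ h1) ?lerN2 ?ler_nat//= (lt_le_trans h2)// ler_nat.
  - by move=> i; apply/measurable_EFinP; exact: measurable_funTS.
  - by move=> i x _; rewrite lee_fin.
move=> [N _ hN]; exists N.+1%:R => //; have := hN N.+1 (leqnSn N).
by rewrite /= ler_distl => /andP[_]; rewrite /itv_mass /Rintegral lerBlDr.
Qed.

(** Continuous functions are dense in L1 of a segment; a cutoff then gives compact support. The
    error is the approximation error on the segment plus the tail of [f], [eps / 2] each. *)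
Lemma compactly_supported_approx f eps : mu.-integrable setT (EFin \o f) ->
  (forall x, 0 <= f x) -> 0 < eps ->
  exists B : R, exists G : R -> R, [/\ 0 < B, \int[mu]_x f x - eps <= itv_mass f (- B) B,
    (continuous G) /\ (forall x, B <= `|x| -> G x = 0),
    mu.-integrable setT (EFin \o G) &
    \int[mu]_x `|f x - G x| <= eps].
Proof.
move=> fi f0 e0; have e20 : 0 < eps / 2 by rewrite divr_gt0.
have mf : measurable_fun setT f by case/integrableP : fi => /measurable_EFinP.
have [B B0 hB] := itv_mass_setT_cvg fi f0 e20.
pose E : set R := `[- (B + 1), (B + 1)]%classic.
have mE : measurable (E : set (measurableTypeR R)) by exact: measurable_itv.
have muE : (mu E < +oo)%E.
  by rewrite /E /= lebesgue_measure_itv/=; case: ifP; rewrite ?ltry// -EFinB ltry.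
have fiE : mu.-integrable E (EFin \o f) by apply: integrableS fi.
have [g_ [cg ig cvg0]] := approximation_continuous_integrable mE muE fiE.
have [n hn] : exists n, (\int[mu]_(z in E) `|(f z - g_ n z)%:E| <= (eps / 2)%:E)%E.
  have /fine_cvgP[fin /cvgr0Pnorm_le/(_ _ e20) le] := cvg0.
  have [N _ hN] := filterI fin le; exists N; have [/= h1 h2] := hN N (leqnn N).
  by rewrite -(fineK h1) lee_fin (le_trans (ler_norm _)).
set g := g_ n in hn; have {}cg : continuous g := cg n.
have {}ig : mu.-integrable E (EFin \o g) := ig n.
(* A continuous cutoff equal to 1 on the ball of radius [B] and to 0 outside the ball of radius
   [B + 1]. *)
pose chi (x : R) : R := Num.max 0 (Num.min 1 (B + 1 - `|x|)).
have chi01 x : 0 <= chi x <= 1.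
  by rewrite /chi le_max lexx/= ge_max ler01 ge_min lexx.
have cchi : continuous chi.
  move=> x; apply: (@continuous_max R R (fun=> 0) (fun x => Num.min 1 (B + 1 - `|x|))); first exact: cvg_cst.
  apply: (@continuous_min R R (fun=> 1) (fun x => B + 1 - `|x|)); first exact: cvg_cst.
  apply: cvgB; first exact: cvg_cst.
  exact: norm_continuous.
have chi0 x : B + 1 <= `|x| -> chi x = 0.
  by move=> h; rewrite /chi max_l// ge_min subr_le0 h orbT.
have chi1 x : `|x| <= B -> chi x = 1.
  move=> h; rewrite /chi min_l; last by rewrite lerBrDr addrC lerD2r.
  by rewrite max_r.
pose G x := g x * chi x.
have cG : continuous G by move=> x; apply: cvgM; [exact: cg|exact: cchi].
have G0 x : B + 1 <= `|x| -> G x = 0 by move=> h; rewrite /G chi0// mulr0.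
have nE x : ~ E x -> B + 1 <= `|x|.
  move=> h; rewrite leNgt; apply/negP => h'; apply: h.
  by rewrite /E /= in_itv/= -ler_norml ltW.
have iG : mu.-integrable setT (EFin \o G).
  have -> : EFin \o G = (EFin \o G) \_ E.
    apply/funext => x; rewrite /restrict; case: ifPn => //; rewrite notin_setE => /nE h.
    by rewrite /= G0.
  apply/(integrable_mkcond _ mE); apply: continuous_compact_integrable.
    exact: segment_compact.
  by apply: continuous_subspaceT.
have mono : itv_mass f (- B) B <= itv_mass f (- (B + 1)) (B + 1).
  rewrite (@itv_massD f (- (B + 1)) (- B))// ?lerN2 ?lerDl//; last by lra.
  rewrite (@itv_massD f (- B) B (B + 1))// ?lerDl//; last by lra.
  by have := itv_mass_ge0 (- (B + 1)) (- B) f0; have := itv_mass_ge0 B (B + 1) f0; lra.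
exists (B + 1), G; split => //; first by rewrite addr_gt0.
  by apply: le_trans mono; apply: le_trans hB; lra.
pose I : set R := `[- B, B[%classic.
have mI : measurable (I : set (measurableTypeR R)) by exact: measurable_itv.
have fE : mu.-integrable E (EFin \o (fun x => `|f x - g x|)).
  exact: (integrable_norm (integrable_sub mE fiE ig)).
have h1 : mu.-integrable setT (EFin \o ((fun x => `|f x - g x|) \_ E)).
  by rewrite -restrict_EFin; apply/(integrable_mkcond _ mE).
have fI : mu.-integrable (~` I) (EFin \o f).
  by apply: integrableS fi => //; exact: measurableC.
have h2 : mu.-integrable setT (EFin \o (f \_ (~` I))).
  by rewrite -restrict_EFin; apply/(integrable_mkcond _ (measurableC mI)).
have h12 := integrableD measurableT h1 h2.
have ifG : mu.-integrable setT (EFin \o (fun x => `|f x - G x|)).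
  exact: (integrable_norm (integrable_sub measurableT fi iG)).
apply: (@le_trans _ _ (\int[mu]_x (((fun x => `|f x - g x|) \_ E) x + (f \_ (~` I)) x))).
  apply: le_Rintegral => // x _; rewrite /restrict.
  have /andP[c0 c1] := chi01 x.
  case: ifPn; rewrite ?notin_setE ?inE => hE; case: ifPn; rewrite ?notin_setE ?inE => hI.
  - rewrite /G.
    have -> : f x - g x * chi x = chi x * (f x - g x) + (1 - chi x) * f x by ring.
    apply: (le_trans (ler_normD _ _)); rewrite !normrM lerD//.
      by rewrite ler_piMl// ger0_norm.
    by rewrite (ger0_norm (f0 x)) ler_piMl// ger0_norm ?subr_ge0// lerBlDr lerDl.
  - rewrite addr0 /G chi1 ?mulr1//.
    move: hI; rewrite /I /= in_itv/= => /contrapT /andP[h3 h4].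
    by rewrite ler_norml h3 ltW.
  - by rewrite (G0 _ (nE _ hE)) subr0 (ger0_norm (f0 x)) lerDr.
  - exfalso; apply: hE; move: hI; rewrite /I /E /= !in_itv/= => /contrapT /andP[h3 h4].
    by apply/andP; split; lra.
rewrite RintegralD//; rewrite -!Rintegral_mkcond.
have -> : \int[mu]_(x in ~` I) f x = \int[mu]_x f x - itv_mass f (- B) B.
  have := @Rintegral_setU _ _ _ mu I (~` I) f mI (measurableC mI).
  rewrite setUv => /(_ fi) ->; first by rewrite /itv_mass; ring.
  by apply/disj_setPS; rewrite setICr.
have h3 : \int[mu]_(x in E) `|f x - g x| <= eps / 2.
  rewrite -lee_fin /Rintegral fineK; last exact: integrable_fin_num.
  by apply: le_trans hn; rewrite le_eqVlt; apply/orP; left; apply/eqP; apply: eq_integral.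
rewrite [leRHS](splitr eps) lerD// lerBlDr.
by move: hB; rewrite lerBlDl.
Qed.

Lemma itv_mass_close (f G : R -> R) (eps x delta : R) : mu.-integrable setT (EFin \o f) ->
  mu.-integrable setT (EFin \o G) -> 0 <= delta ->
  (forall y, x <= y < x + delta -> `|G y - G x| <= eps) ->
  `|itv_mass f x (x + delta) - delta * G x| <=
    itv_mass (fun y => `|f y - G y|) x (x + delta) + delta * eps.
Proof.
move=> fi Gi d0 hG; have xd : x <= x + delta by rewrite lerDl.
have -> : delta * G x = itv_mass (fun=> G x) x (x + delta).
  by rewrite itv_mass_cst// addrAC subrr add0r mulrC.
have -> : delta * eps = itv_mass (fun=> eps) x (x + delta).
  by rewrite itv_mass_cst// addrAC subrr add0r mulrC.
have mI : measurable (`[x, x + delta[%classic : set R) by exact: measurable_itv.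
have ic (c : R) : mu.-integrable `[x, x + delta[ (EFin \o (fun=> c)).
  apply: measurable_bounded_integrable => //; last first.
    exists `|c|; split; rewrite ?num_real// => M cM y _; exact: ltW.
  by rewrite /= lebesgue_measure_itv/=; case: ifP; rewrite ?ltry// -EFinB ltry.
have fi' := integrable_itv x (x + delta) fi.
have Gi' := integrable_itv x (x + delta) Gi.
have fG : mu.-integrable `[x, x + delta[ (EFin \o (fun y => `|f y - G y|)).
  by apply: integrable_norm; exact: integrable_sub.
have fc (c : R) : mu.-integrable `[x, x + delta[ (EFin \o (fun y => f y - c)).
  by apply: integrable_sub.
rewrite /itv_mass -(RintegralB (measurable_itvR _) fi' (ic _)).
apply: (le_trans (le_normr_Rintegral _ _)) => //.
rewrite -(RintegralD (measurable_itvR _) fG (ic _)).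
apply: le_Rintegral => //.
- exact: (integrable_norm (fc _)).
- exact: (integrableD (measurable_itvR _) fG (ic _)).
move=> y; rewrite /= in_itv/= => yx.
rewrite -(subrKA (G y)) (le_trans (ler_normD _ _))// lerD2l; exact: hG.
Qed.

(** Counts the integers of a segment below [M]. The truncations by 0 and [M - 1] are what makes the
    induction on [M] go through. *)
Lemma count_window M (al ga : R) :
  \sum_(i < M) (al <= i%:R <= ga)%R%:R <= Num.max 0 (Num.min (M%:R - 1) ga - al + 1) :> R.
Proof.
elim: M => [|M IH]; first by rewrite big_ord0 le_max lexx.
rewrite big_ord_recr/=; have [/andP[h1 h2]|h] := boolP (al <= M%:R <= ga).
  apply: (@le_trans _ _ (M%:R - al + 1)); last first.
    by rewrite le_max -natr1 addrK (min_l h2) lexx orbT.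
  rewrite lerD2r (le_trans IH)// ge_max subr_ge0 h1/=.
  have hm : Num.min (M%:R - 1) ga <= M%:R - 1 by rewrite ge_min lexx.
  by rewrite -lerBrDr lerBlDr (le_trans hm)//; lra.
rewrite addr0 (le_trans IH)// ge_max le_max lexx/= le_max !lerD2r.
apply/orP; right; rewrite le_min !ge_min -natr1 lexx orbT andbT.
by apply/orP; left; lra.
Qed.

Definition node (delta L : R) (i : nat) : R := - L + i%:R * delta.

Lemma nodeS delta L i : node delta L i.+1 = node delta L i + delta.
Proof. by rewrite /node -natr1 mulrDl mul1r addrA. Qed.

Lemma count_nodes (delta L B : R) M : 0 < delta -> 0 <= B ->
  \sum_(i < M) delta * (`|node delta L i| <= B)%R%:R <= 2 * B + delta.
Proof.
move=> d0 B0; rewrite -mulr_sumr mulrC -ler_pdivlMr//.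
apply: le_trans (_ : Num.max 0 (Num.min (M%:R - 1) ((L + B) / delta) - (L - B) / delta + 1) <= _); last first.
  rewrite ge_max; apply/andP; split.
    by rewrite divr_ge0 ?(ltW d0)// addr_ge0 ?(ltW d0)// mulr_ge0.
  apply: (@le_trans _ _ ((L + B) / delta - (L - B) / delta + 1)).
    by rewrite !lerD2r ge_min lexx orbT.
  by rewrite le_eqVlt; apply/orP; left; apply/eqP; field; rewrite gt_eqF.
apply: le_trans (count_window _ _ _); apply: ler_sum => i _.
rewrite ler_nat; case: (boolP (`|node delta L i| <= B)) => //.
rewrite ler_norml /node => /andP[h1 h2].
by rewrite ler_pdivrMr// ler_pdivlMr// (_ : _ && _ = true)//; apply/andP; split; lra.
Qed.

(** * Cell masses of the initial density and their translations *)

Section cell_density.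
Variable f : R -> R.
Hypothesis fi : mu.-integrable setT (EFin \o f).
Hypothesis f0 : forall x, 0 <= f x.
Hypothesis f1 : \int[mu]_x f x = 1.

(* The mass lying outside of the window is put into the first cell. *)
Definition cell_mass (delta L : R) (M i : nat) : R :=
  itv_mass f (node delta L i) (node delta L i.+1) +
  (i == 0)%N%:R * (1 - itv_mass f (node delta L 0) (node delta L M)).

Lemma sum_cells g delta L M : mu.-integrable setT (EFin \o g) -> 0 <= delta ->
  \sum_(i < M) itv_mass g (node delta L i) (node delta L i.+1) =
  itv_mass g (node delta L 0) (node delta L M).
Proof. by move=> gi d0; rewrite /node mul0r addr0 sum_itv_mass. Qed.

Lemma tail_ge0 delta L M : 0 <= 1 - itv_mass f (node delta L 0) (node delta L M).
Proof. by rewrite subr_ge0 -f1 itv_mass_le_total. Qed.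

Lemma cell_mass_ge0 delta L M i : 0 <= cell_mass delta L M i.
Proof. by rewrite addr_ge0 ?itv_mass_ge0// mulr_ge0// tail_ge0. Qed.

Lemma cell_mass_sum delta L M : 0 <= delta -> (0 < M)%N ->
  \sum_(i < M) cell_mass delta L M i = 1.
Proof.
move=> d0; case: M => // M _; rewrite big_split/= sum_cells//.
rewrite big_ord_recl/= mul1r big1 ?addr0; last by move=> i _; rewrite mul0r.
by rewrite addrC subrK.
Qed.

(** A cell whose left node is in [[A, B]] is contained in [[A, B + delta[]; the outer mass stored in
    the first cell is paid in full. *)
Lemma cell_mass_window delta L M (A B : R) : 0 <= delta ->
  \sum_(i < M) cell_mass delta L M i * (A <= node delta L i <= B)%R%:R <=
  itv_mass f A (B + delta) + (1 - itv_mass f (node delta L 0) (node delta L M)).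
Proof.
move=> d0; pose I : set R := `[A, B + delta[%classic; pose g := f \_ I.
have gE x : I x -> g x = f x by move=> Ix; rewrite /g /restrict mem_set.
have g0 x : 0 <= g x by rewrite /g /restrict; case: ifP.
have gi : mu.-integrable setT (EFin \o g).
  rewrite -restrict_EFin; apply/(integrable_mkcond _ (measurable_itvR _)).
  exact: integrable_itv.
apply: (@le_trans _ _ (\sum_(i < M) (itv_mass g (node delta L i) (node delta L i.+1) +
    (i == 0 :> nat)%N%:R * (1 - itv_mass f (node delta L 0) (node delta L M))))).
  apply: ler_sum => i _; rewrite mulrDl lerD//; last first.
    by case: (_ <= _ <= _); rewrite ?mulr1// mulr0 mulr_ge0// tail_ge0.
  have [/andP[h1 h2]|_] := boolP (A <= _ <= B); last by rewrite mulr0 itv_mass_ge0.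
  rewrite mulr1 itv_mass_le// => x; rewrite nodeS => /andP[h3 h4]; rewrite gE//.
  by rewrite /I /= in_itv/= (le_trans h1)//= (lt_le_trans h4)// lerD2r.
rewrite big_split/= sum_cells// lerD//.
  apply: (le_trans (itv_mass_le_total _ _ gi g0)).
  by rewrite /itv_mass [X in _ <= X]Rintegral_mkcond.
case: M => [|M]; first by rewrite big_ord0 tail_ge0.
rewrite big_ord_recl/= mul1r big1 ?addr0// => i _; by rewrite mul0r.
Qed.

Lemma tail_le B delta L M : 0 <= B -> node delta L 0 <= - B -> B <= node delta L M ->
  1 - itv_mass f (node delta L 0) (node delta L M) <= 1 - itv_mass f (- B) B.
Proof.
move=> B0 h1 h2; rewrite lerD2l lerN2.
rewrite (@itv_massD f (node delta L 0) (- B))//; last by lra.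
rewrite (@itv_massD f (- B) B (node delta L M))//; last by lra.
by have := itv_mass_ge0 (node delta L 0) (- B) f0; have := itv_mass_ge0 B (node delta L M) f0; lra.
Qed.

(** Continuity of translations in L1, discretised uniformly in the mesh: the cell masses are
    l1-close to the samples [delta * G] of a continuous compactly supported function, for which
    uniform continuity suffices. *)
Lemma cell_mass_translation eps : 0 < eps -> exists r : R, exists B : R, [/\ 0 < r, 0 < B &
  forall m (delta L : R), 0 < delta -> delta <= r -> B <= L -> m.+2%:R * delta = 2 * L ->
  forall a : nat, a%:R * delta <= r -> (a < m.+2)%N ->
  \sum_(i < m.+2) `|cell_mass delta L m.+2 ((i + a%:R)%R : 'I_m.+2) - cell_mass delta L m.+2 i| <= eps].
Proof.
(* The approximation by samples costs [3 * e1] and is used twice, the shift of the samples costs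
   [e1]: seven in all. *)
move=> e0; pose e1 := eps / 8; have e10 : 0 < e1 by rewrite divr_gt0.
have [B [G [B0 hB [cG G0] Gi hG]]] := compactly_supported_approx fi f0 e10.
rewrite f1 in hB.
(* An upper bound for the total length of the cells where [G] may oscillate, see [count_nodes]. *)
pose S := 2 * (B + 1) + 1; have S0 : 0 < S by rewrite addr_gt0// mulr_gt0// addr_gt0.
pose e2 := e1 / S; have e20 : 0 < e2 by rewrite divr_gt0.
have [rho rho0 hrho] := continuous_uniform_segment (B + 2) cG e20.
pose r := Num.min rho 1; have r0 : 0 < r by rewrite lt_min rho0 ltr01.
have r1 : r <= 1 by rewrite ge_min lexx orbT.
have rr : r <= rho by rewrite ge_min lexx.
(* Beyond [B + 1] both values vanish because the shift is at most 1, so the oscillation is charged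
   only to finitely much length. *)
have osc x y : `|y - x| <= r -> `|G y - G x| <= e2 * (`|x| <= B + 1)%R%:R.
  move=> xy; have n1 : `|y| <= `|x| + `|y - x|.
    by rewrite -{1}(_ : x + (y - x) = y) ?ler_normD//; ring.
  have n2 : `|x| <= `|y| + `|y - x|.
    by rewrite distrC -{1}(_ : y + (x - y) = x) ?ler_normD//; ring.
  case: (boolP (`|x| <= B + 1)) => [xB|]; rewrite ?mulr1 ?mulr0.
    by apply: hrho; [lra|lra|exact: le_trans xy rr].
  by rewrite -ltNge => xB; rewrite !G0 ?subrr ?normr0//; lra.
exists r, (B + 2); split => //; first by rewrite addr_gt0.
move=> m delta L d0 dr BL ML a ar am.
set M := m.+2 in ML am *.
pose x i := node delta L i; pose p i := cell_mass delta L M i.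
pose q i := delta * G (x i).
have cnt : \sum_(i < M) delta * (e2 * (`|x i| <= B + 1)%R%:R) <= e1.
  under eq_bigr do rewrite mulrCA; rewrite -mulr_sumr.
  apply: (@le_trans _ _ (e2 * S)); last by rewrite /e2 divfK// gt_eqF.
  rewrite ler_wpM2l ?(ltW e20)//.
  apply: (le_trans (count_nodes _ _ d0 _)); first by rewrite addr_ge0// ltW.
  by rewrite /S lerD2l (le_trans dr).
have nM : node delta L M = L by rewrite /node ML; ring.
have n0 : node delta L 0 = - L by rewrite /node mul0r addr0.
have pq : \sum_(i < M) `|p i - q i| <= 3 * e1.
  apply: (@le_trans _ _ (\sum_(i < M) (itv_mass (fun y => `|f y - G y|) (x i) (x i.+1) +
     delta * (e2 * (`|x i| <= B + 1)%R%:R) +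
     (i == 0 :> nat)%N%:R * (1 - itv_mass f (x 0%N) (x M))))).
    apply: ler_sum => i _; rewrite /p /cell_mass addrAC.
    apply: (le_trans (ler_normD _ _)); rewrite lerD//; last first.
      by rewrite ger0_norm// mulr_ge0// tail_ge0.
    rewrite /x nodeS; apply: itv_mass_close => //; first exact: ltW.
    move=> y /andP[h1 h2]; apply: osc; rewrite ger0_norm ?subr_ge0//.
    by rewrite lerBlDl (le_trans (ltW h2))// lerD2l.
  have fGi : mu.-integrable setT (EFin \o (fun y => `|f y - G y|)).
    by apply: integrable_norm; exact: integrable_sub.
  rewrite !big_split/= (sum_cells _ _ fGi) ?(ltW d0)//.
  rewrite (_ : 3 * e1 = e1 + e1 + e1); last by ring.
  rewrite lerD// ?lerD//.
    by apply: (le_trans (itv_mass_le_total _ _ fGi _)).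
  rewrite big_ord_recl/= mul1r big1 ?addr0; last by move=> i _; rewrite mul0r.
  apply: (@le_trans _ _ (1 - itv_mass f (- B) B)); last by rewrite lerBlDr -lerBlDl.
  by apply: tail_le; rewrite ?(ltW B0)// ?nM ?n0; lra.
have qq : \sum_(i < M) `|q ((i + a%:R)%R : 'I_M) - q i| <= e1.
  apply: le_trans cnt; apply: ler_sum => i _.
  rewrite /q -mulrBr normrM (gtr0_norm d0) ler_wpM2l ?(ltW d0)//.
  have aE : ((a%:R : 'I_m.+2) : nat) = a by rewrite Zp_nat /= modn_small.
  have iE : ((i + a%:R)%R : 'I_m.+2) = ((i + a) %% M)%N :> nat by rewrite -[in RHS]aE.
  rewrite iE; have [iaM|Mia] := ltnP (i + a) M.
    rewrite modn_small//; apply: osc; rewrite /x /node natrD.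
    have -> : - L + (i%:R + a%:R) * delta - (- L + i%:R * delta) = a%:R * delta by ring.
    by rewrite ger0_norm// mulr_ge0// ltW.
  have iM := ltn_ord i; rewrite -/M in iM.
  have -> : ((i + a) %% M = i + a - M)%N.
    rewrite -{1}(subnK Mia) modnDr modn_small// ltn_subLR//.
    by rewrite -addnS leq_add// ltnW.
  (* Here the shift wraps around the torus: both nodes are within [r <= 1] of the ends of the
     window, where [G] vanishes as [B + 2 <= L]. *)
  have z1 : G (x i) = 0.
    apply: G0; have h : M%:R - a%:R <= i%:R :> R by rewrite lerBlDr -natrD ler_nat.
    have := ler_wpM2r (ltW d0) h; rewrite mulrBl ML => h'.
    by apply: le_trans (ler_norm _); rewrite /x /node; lra.
  have z2 : G (x (i + a - M)%N) = 0.
    apply: G0; have h : (i + a - M)%N%:R <= a%:R :> R.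
      by rewrite ler_nat leq_subLR leq_add2r ltnW.
    have h' := ler_wpM2r (ltW d0) h.
    by rewrite -normrN; apply: le_trans (ler_norm _); rewrite /x /node; lra.
  by rewrite z1 z2 subrr normr0; apply: mulr_ge0 => //; exact: ltW.
apply: (@le_trans _ _ (\sum_(i < M) (`|p ((i + a%:R)%R : 'I_M) - q ((i + a%:R)%R : 'I_M)| +
   `|q ((i + a%:R)%R : 'I_M) - q i| + `|p i - q i|))).
  apply: ler_sum => i _; rewrite (distrC (p i)).
  rewrite -(subrKA (q i)) (le_trans (ler_normD _ _))// lerD2r.
  by rewrite -(subrKA (q ((i + a%:R)%R : 'I_M))) (le_trans (ler_normD _ _)).
rewrite !big_split/= (sum_shift (fun i : 'I_m.+2 => `|p i - q i|) a%:R).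
by move: pq qq; rewrite /e1; lra.
Qed.

End cell_density.

End integral_over_cells.

(** * A Lindeberg step for the Gaussian distribution function *)

Section taylor.
Context {R : realType}.
Implicit Types f g k : R -> R.

Lemma mean_value f g (x y : R) : (forall z : R, is_derive z (1 : R) f (g z)) ->
  exists2 c, `|c - x| <= `|y - x| & f y - f x = g c * (y - x).
Proof.
move=> fg; have cf (a b : R) : {within `[a, b], continuous f}.
  apply: continuous_subspaceT => z; apply: differentiable_continuous.
  by apply/derivable1_diffP; case: (fg z).
have [xy|/ltW yx] := leP x y.
  have [c cxy ->] := MVT_segment xy (fun z _ => fg z) (cf x y); exists c => //.
  move: cxy; rewrite in_itv/= => /andP[h1 h2].
  by rewrite !ger0_norm ?subr_ge0// lerD2r.
have [c cxy e] := MVT_segment yx (fun z _ => fg z) (cf y x); exists c.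
  move: cxy; rewrite in_itv/= => /andP[h1 h2].
  by rewrite !ler0_norm ?subr_le0// lerN2 lerD2r.
by rewrite -opprB e; ring.
Qed.

Lemma taylor1 f g (x y B : R) : (forall z : R, is_derive z (1 : R) f (g z)) -> 
  (forall z, `|z - x| <= `|y - x| -> `|g z - g x| <= B * `|z - x|) -> 0 <= B ->
  `|f y - f x - g x * (y - x)| <= B * `|y - x| ^+ 2.
Proof.
move=> fg gB B0; have [c cx ->] := mean_value x y fg.
rewrite -mulrBl normrM expr2 mulrA ler_wpM2r// (le_trans (gB _ cx))// ler_wpM2l//.
Qed.

(** The derivative of the second order remainder of [f] is the first order remainder of [g], so the
    mean value theorem reduces to [taylor1]. *)
Lemma taylor2 f g k (x y B : R) : (forall z : R, is_derive z (1 : R) f (g z)) ->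
  (forall z : R, is_derive z (1 : R) g (k z)) ->
  (forall z, `|k z - k x| <= B * `|z - x|) -> 0 <= B ->
  `|f y - f x - g x * (y - x) - k x / 2 * (y - x) ^+ 2| <= B * `|y - x| ^+ 3.
Proof.
move=> fg gk kB B0.
pose r z := f z - f x - g x * (z - x) - k x / 2 * (z - x) ^+ 2.
have dr (z : R) : is_derive z (1 : R) r (g z - g x - k x * (z - x)).
  have fz := fg z; rewrite /r.
  by apply: is_derive_eq; rewrite /GRing.scale/=; field.
have [c cx] := mean_value x y dr.
have rx : r x = 0 by rewrite /r !subrr mulr0 expr0n/= mulr0 !subr0.
rewrite rx subr0 /r => ->; rewrite normrM exprSr mulrA ler_wpM2r//.
apply: le_trans (_ : B * `|c - x| ^+ 2 <= _); last first.
  by rewrite ler_wpM2l// lerXn2r ?nnegrE.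
by apply: taylor1 => // z _; exact: kB.
Qed.

End taylor.

(** * Expansions of the Gaussian distribution function *)

Section gaussian_cdf.
Context {R : realType}.
Notation mu := (@lebesgue_measure R).

Definition npdf (x : R) : R := normal_pdf 0 1 x.
Definition ncdf (y : R) : R := \int[mu]_(x in `]-oo, y]) npdf x.

Let p : R := normal_peak 1.

Let p0 : 0 < p. Proof. by apply: normal_peak_gt0; rewrite oner_neq0. Qed.

Lemma npdfE x : npdf x = p * expR (- (x ^+ 2 / 2)).
Proof.
rewrite /npdf normal_pdfE ?oner_neq0// /normal_fun; congr (_ * expR _).
by rewrite subr0 expr1n mulNr.
Qed.

Lemma integrable_npdf : mu.-integrable setT (EFin \o npdf).
Proof. exact: integrable_normal_pdf. Qed.

Lemma ncdf_derive (y : R) : is_derive y (1 : R) ncdf (npdf y).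
Proof.
have yy : y < y + 1 by rewrite ltrDl.
have int : mu.-integrable [set` Interval -oo%O (BRight (y + 1))] (EFin \o npdf).
  by apply: integrableS integrable_npdf => //; exact: measurable_itvR.
have cn : {for y, continuous npdf} by apply: continuous_normal_pdf; rewrite oner_neq0.
have [h1 h2] := continuous_FTC1 yy int (ltNyr y) cn.
by apply: DeriveDef => //; rewrite -derive1E.
Qed.

Lemma npdf_derive (y : R) : is_derive y (1 : R) npdf (- (y * npdf y)).
Proof.
have -> : npdf = (fun x => p * expR (- (x ^+ 2 / 2))) by apply/funext => x; exact: npdfE.
have h : is_derive y (1 : R) (fun x : R => - (x ^+ 2 / 2)) (- y).
  by apply: is_derive_eq; rewrite /GRing.scale/=; field.
have h2 : is_derive y (1 : R) (fun x : R => expR (- (x ^+ 2 / 2))) (expR (- (y ^+ 2 / 2)) * - y).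
  exact: (@is_derive1_comp R expR (fun x : R => - (x ^+ 2 / 2)) y _ _ (is_derive_expR _) h).
by apply: is_derive_eq; rewrite /GRing.scale/=; ring.
Qed.

Lemma ynpdf_derive (y : R) : is_derive y (1 : R) (fun y => - (y * npdf y)) ((y ^+ 2 - 1) * npdf y).
Proof.
have h := npdf_derive y; apply: is_derive_eq.
by rewrite /GRing.scale/=; ring.
Qed.

Lemma npdf_gt0 y : 0 < npdf y.
Proof. by rewrite npdfE mulr_gt0// expR_gt0. Qed.

(** Twice the inequality [1 + t <= expR t] at [t = y ^+ 2 / 4]. The numerical constants of the
    following bounds come from here. *)
Lemma npdf_poly_bound y : npdf y * (1 + y ^+ 2 / 4) ^+ 2 <= p.
Proof.
rewrite npdfE -mulrA ler_piMr ?(ltW p0)//.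
have -> : - (y ^+ 2 / 2) = - (y ^+ 2 / 4 + y ^+ 2 / 4) by field.
rewrite expRN expRD mulrC ler_pdivrMr ?mulr_gt0 ?expR_gt0// mul1r expr2.
have h : 1 + y ^+ 2 / 4 <= expR (y ^+ 2 / 4) by exact: expR_ge1Dx.
have h0 : 0 <= 1 + y ^+ 2 / 4 by rewrite addr_ge0// divr_ge0// sqr_ge0.
by rewrite ler_pM.
Qed.

Lemma npdf_pow3 y : `|y| ^+ 3 * npdf y <= 16 * p.
Proof.
have h := npdf_poly_bound y; have n0 := npdf_gt0 y.
have y2 : y ^+ 2 = `|y| ^+ 2 by rewrite real_normK// num_real.
apply: (@le_trans _ _ (16 * (npdf y * (1 + y ^+ 2 / 4) ^+ 2))); last by rewrite ler_wpM2l.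
rewrite mulrCA mulrC ler_wpM2l ?(ltW n0)// y2.
set z := `|y|; have z0 : 0 <= z by exact: normr_ge0.
rewrite -subr_ge0.
rewrite (_ : _ - _ = (z ^+ 2 - z / 2) ^+ 2 + 31 / 4 * z ^+ 2 + 16); last by field.
by rewrite addr_ge0// addr_ge0 ?sqr_ge0// mulr_ge0 ?sqr_ge0// divr_ge0.
Qed.

Lemma npdf_dd_bound y : `|(y ^+ 2 - 1) * npdf y| <= 16 * p.
Proof.
have h := npdf_poly_bound y; have n0 := npdf_gt0 y.
apply: (@le_trans _ _ (16 * (npdf y * (1 + y ^+ 2 / 4) ^+ 2))); last by rewrite ler_wpM2l.
rewrite normrM (gtr0_norm n0) mulrCA mulrC ler_wpM2l ?(ltW n0)//.
have y2 : 0 <= y ^+ 2 by exact: sqr_ge0.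
have y4 : 0 <= (y ^+ 2) ^+ 2 by exact: sqr_ge0.
set q := y ^+ 2 in y2 y4 *.
rewrite ler_norml; apply/andP; split; rewrite -subr_ge0.
  rewrite (_ : _ - _ = q ^+ 2 + 9 * q + 15); last by field.
  by rewrite !addr_ge0// mulr_ge0.
rewrite (_ : _ - _ = q ^+ 2 + 7 * q + 17); last by field.
by rewrite !addr_ge0// mulr_ge0.
Qed.

Lemma ncdf_taylor (z a : R) :
  `|ncdf (z - a) - ncdf z + a * npdf z + a ^+ 2 / 2 * (z * npdf z)| <= 16 * p * `|a| ^+ 3.
Proof.
have kB w : `|- (w * npdf w) - - (z * npdf z)| <= 16 * p * `|w - z|.
  have [c _ ->] := mean_value z w ynpdf_derive.
  by rewrite normrM ler_wpM2r// npdf_dd_bound.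
have := @taylor2 _ ncdf npdf (fun y => - (y * npdf y)) z (z - a) (16 * p)
  ncdf_derive npdf_derive kB.
rewrite mulr_ge0 ?(ltW p0)// => /(_ isT).
rewrite (_ : z - a - z = - a) ?normrN; last by ring.
by congr (_ <= _); congr (`|_|); field.
Qed.

(** Expansion of [x -> ncdf (x * z)] at 1. Its second derivative is
    [|x * z| ^+ 3 * npdf (x * z) / x ^+ 2] in absolute value, bounded uniformly in [z] because
    [rho >= 1 / 2] keeps [x] away from 0. *)
Lemma ncdf_scale (z rho : R) : 1 / 2 <= rho <= 1 ->
  `|ncdf (rho * z) - ncdf z + (1 - rho) * (z * npdf z)| <= 64 * p * (1 - rho) ^+ 2.
Proof.
move=> /andP[r1 r2].
pose f x := ncdf (x * z); pose g x := z * npdf (x * z).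
have dm (x : R) : is_derive x (1 : R) (fun x : R => x * z) z.
  by apply: is_derive_eq; rewrite /GRing.scale/=; ring.
have fg (x : R) : is_derive x (1 : R) f (g x).
  by rewrite /g (mulrC z); exact: (@is_derive1_comp R ncdf (fun x => x * z) x _ _ (ncdf_derive _) (dm x)).
have gk (x : R) : is_derive x (1 : R) g (- (x * z * npdf (x * z)) * z * z).
  have h : is_derive x (1 : R) (fun x => npdf (x * z)) (- (x * z * npdf (x * z)) * z).
    exact: (@is_derive1_comp R npdf (fun x => x * z) x _ _ (npdf_derive _) (dm x)).
  by rewrite /g; apply: is_derive_eq; rewrite /GRing.scale/=; ring.
have := @taylor1 _ f g 1 rho (64 * p) fg.
rewrite /f /g !mul1r => h.
have -> : (1 - rho) ^+ 2 = `|rho - 1| ^+ 2 by rewrite real_normK ?num_real//; ring.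
have -> : ncdf (rho * z) - ncdf z + (1 - rho) * (z * npdf z) =
   ncdf (rho * z) - ncdf z - z * npdf z * (rho - 1) by ring.
apply: h; last by rewrite mulr_ge0// ltW.
move=> x x1.
have [c c1 e] := mean_value 1 x gk.
have := e; rewrite /g mul1r => ->; rewrite normrM ler_wpM2r//.
have c12 : 1 / 2 <= c <= 3 / 2.
  move: (le_trans c1 x1); rewrite (ler0_norm (_ : rho - 1 <= 0)) ?subr_le0//.
  by rewrite ler_norml => /andP[h1 h2]; apply/andP; split; lra.
have /andP[c2 _] := c12; have c0 : 0 < c by lra.
have h3 := npdf_pow3 (c * z).
have -> : `|- (c * z * npdf (c * z)) * z * z| = `|c * z| ^+ 3 * npdf (c * z) / c ^+ 2.
  rewrite !normrM normrN !normrM (gtr0_norm c0) (gtr0_norm (npdf_gt0 _)).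
  by field; rewrite gt_eqF.
rewrite ler_pdivrMr ?exprn_gt0// (le_trans h3)//.
have -> : 64 * p * c ^+ 2 = 16 * p * (2 * c) ^+ 2 by ring.
rewrite ler_peMr ?mulr_ge0 ?(ltW p0)// -[X in X <= _](expr1n _ 2).
by rewrite lerXn2r ?nnegrE// ?mulr_ge0//; lra.
Qed.

(* One Lindeberg step: [ncdf ((c - w) / sqrt v)] solves the heat equation in [(v, w)]. *)
Lemma ncdf_heat_step (sig : R) : 0 < sig -> exists2 K : R, 0 <= K &
  forall (E : finType) (wt d : E -> R) (h kappa c w v : R),
  (forall e, 0 <= wt e) -> \sum_e wt e = 1 -> \sum_e wt e * d e = 0 ->
  \sum_e wt e * d e ^+ 2 = h -> (forall e, `|d e| <= kappa) -> 0 <= h -> h <= sig ^+ 2 ->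
  sig ^+ 2 <= v ->
  `|\sum_e wt e * ncdf ((c - (w + d e)) / Num.sqrt v) - ncdf ((c - w) / Num.sqrt (v + h))|
   <= K * h * (kappa + h).
Proof.
move=> sig0.
(* [K1] comes from the third order remainder in space, [K2] from the change of variance: [64 * p]
   from [ncdf_scale], the other summand from replacing [1 - rho] by half the relative variance. *)
pose K1 := 16 * p / sig ^+ 3; pose K2 := (64 * p + 3 / 2 * (2 * (16 * p))) / sig ^+ 4.
have K10 : 0 <= K1 by rewrite divr_ge0 ?exprn_ge0 ?(ltW sig0)// mulr_ge0 ?(ltW p0).
have K20 : 0 <= K2.
  rewrite divr_ge0 ?exprn_ge0 ?(ltW sig0)// addr_ge0 ?mulr_ge0 ?(ltW p0)//.
exists (K1 + K2); first exact: addr_ge0.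
move=> E wt d h kappa c w v wt0 wt1 wtd wtd2 dk h0 hsig vsig.
have v0 : 0 < v by apply: lt_le_trans vsig; rewrite exprn_gt0.
set s := Num.sqrt v; have s0 : 0 < s by rewrite sqrtr_gt0.
have s2 : s ^+ 2 = v by rewrite sqr_sqrtr// ltW.
have ss : sig <= s by rewrite -(@ler_pXn2r _ 2) ?nnegrE ?(ltW sig0) ?(ltW s0)// s2.
pose z := (c - w) / s.
set s' := Num.sqrt (v + h).
have vh0 : 0 < v + h by rewrite ltr_wpDr.
have s'0 : 0 < s' by rewrite sqrtr_gt0.
have s'2 : s' ^+ 2 = v + h by rewrite sqr_sqrtr// ltW.
pose rho := s / s'; have rho0 : 0 < rho by rewrite divr_gt0.
pose th := h / v; have th0 : 0 <= th by rewrite divr_ge0// ltW.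
have rho2 : rho ^+ 2 * (1 + th) = 1.
  by rewrite /rho expr_div_n s2 s'2 /th; field; rewrite !gt_eqF.
have th1 : th <= 1 by rewrite ler_pdivrMr// mul1r (le_trans hsig).
have rle1 : rho <= 1.
  rewrite -(@ler_pXn2r _ 2) ?nnegrE ?(ltW rho0)// expr1n -rho2 ler_peMr ?sqr_ge0//.
  by rewrite lerDl.
have rge : 1 / 2 <= rho.
  rewrite -(@ler_pXn2r _ 2) ?nnegrE ?(ltW rho0) ?divr_ge0//.
  have : rho ^+ 2 * (1 + th) <= rho ^+ 2 * 2.
    by rewrite ler_wpM2l ?sqr_ge0//; lra.
  rewrite rho2 => h1; lra.
have zE e : (c - (w + d e)) / s = z - d e / s by rewrite /z; field; rewrite gt_eqF.
have z'E : (c - w) / s' = rho * z by rewrite /rho /z; field; rewrite !gt_eqF.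
(* Averaging over the increment and adding its variance both move [ncdf z] by
   [- h / (2 * v) * (z * npdf z)] up to the allowed error ([A1] and [A2]); this common first order
   term is the heat equation. *)
have A1 : `|\sum_e wt e * ncdf ((c - (w + d e)) / s) - ncdf z + h / (2 * v) * (z * npdf z)|
    <= 16 * p / sig ^+ 3 * h * kappa.
  have -> : \sum_e wt e * ncdf ((c - (w + d e)) / s) - ncdf z + h / (2 * v) * (z * npdf z) =
      \sum_e wt e * (ncdf (z - d e / s) - ncdf z + d e / s * npdf z +
         (d e / s) ^+ 2 / 2 * (z * npdf z)).
    rewrite [RHS](eq_bigr (fun e => wt e * ncdf ((c - (w + d e)) / s) +
       ((- (wt e * ncdf z) + wt e * d e * (npdf z / s)) + wt e * d e ^+ 2 *
          ((z * npdf z) / (2 * v))))); last first.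
      by move=> e _; rewrite zE -s2; field; rewrite gt_eqF.
    rewrite !big_split/= sumrN -!mulr_suml wt1 wtd wtd2.
    by set S := \sum_e _; field; rewrite ?gt_eqF.
  apply: (le_trans (ler_norm_sum _ _ _)).
  apply: (@le_trans _ _ (\sum_e wt e * d e ^+ 2 * (16 * p / sig ^+ 3 * kappa))); last first.
    by rewrite -mulr_suml wtd2 mulrC mulrAC.
  apply: ler_sum => e _; rewrite normrM (ger0_norm (wt0 e)) -[leRHS]mulrA ler_wpM2l//.
  apply: (le_trans (ncdf_taylor _ _)).
  rewrite normrM normfV (gtr0_norm s0) expr_div_n.
  rewrite -(real_normK (num_real (d e))) (exprS _ 2).
  have -> : 16 * p * (`|d e| * `|d e| ^+ 2 / s ^+ 3) =
     `|d e| ^+ 2 * (16 * p / s ^+ 3 * `|d e|) by field; rewrite gt_eqF.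
  rewrite ler_wpM2l ?sqr_ge0// ler_pM//; first by rewrite divr_ge0 ?exprn_ge0 ?mulr_ge0 ?ltW.
  rewrite ler_wpM2l ?mulr_ge0 ?(ltW p0)// lef_pV2 ?posrE ?exprn_gt0//.
  by rewrite lerXn2r ?nnegrE ?(ltW sig0) ?(ltW s0).
have A2 : `|ncdf ((c - w) / s') - ncdf z + h / (2 * v) * (z * npdf z)| <=
    (64 * p + 3 / 2 * (2 * (16 * p))) / sig ^+ 4 * h * h.
  have zz : `|z * npdf z| <= 2 * (16 * p).
    rewrite normrM (gtr0_norm (npdf_gt0 z)).
    have [z1|z1] := leP `|z| 1.
      apply: (@le_trans _ _ p); last by have := p0; lra.
      apply: (@le_trans _ _ (npdf z)); first by rewrite ler_piMl// ltW// npdf_gt0.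
      by rewrite npdfE ler_piMr ?(ltW p0)// -[leRHS]expR0 ler_expR oppr_le0 divr_ge0// sqr_ge0.
    apply: (@le_trans _ _ (16 * p)); last by have := p0; lra.
    apply: le_trans (npdf_pow3 z); rewrite ler_wpM2r ?(ltW (npdf_gt0 z))//.
    by rewrite -[leLHS]expr1 ler_weXn2l// ltW.
  have rth : rho ^+ 2 * th = 1 - rho ^+ 2.
    by rewrite -[X in X - _]rho2; ring.
  have th1r : 1 - rho <= th.
    have : (1 - rho) * (1 + rho) = rho ^+ 2 * th by rewrite rth; ring.
    move=> e; have h1 : rho ^+ 2 * th <= th.
      by rewrite ler_piMl// expr_le1// ltW.
    apply: le_trans h1; rewrite -e ler_peMr ?subr_ge0//; lra.
  have r0' : 0 <= 1 - rho by rewrite subr_ge0.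
  rewrite z'E.
  have -> : ncdf (rho * z) - ncdf z + h / (2 * v) * (z * npdf z) =
     (ncdf (rho * z) - ncdf z + (1 - rho) * (z * npdf z)) + (th / 2 - (1 - rho)) * (z * npdf z).
    by rewrite /th; field; rewrite gt_eqF.
  have hd : `|th / 2 - (1 - rho)| <= 3 / 2 * th ^+ 2.
    have e : (th / 2 - (1 - rho)) * (1 + rho) = th * (2 * rho + 1) * (1 - rho) / 2.
      have e := rth; rewrite (_ : _ * (1 + rho) = th / 2 * (1 + rho) - (1 - rho ^+ 2)); last by ring.
      by rewrite -e; field.
    have e2 : th / 2 - (1 - rho) = th * (2 * rho + 1) * (1 - rho) / 2 / (1 + rho).
      by rewrite -e mulfK// gt_eqF// ltr_pwDl// ltW.
    have a1 : 0 <= 2 * rho + 1 by lra.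
    have r1 : 0 < 1 + rho by rewrite ltr_pwDl// ltW.
    rewrite e2 ger0_norm; last first.
      apply: divr_ge0; last exact: ltW.
      by apply: divr_ge0 => //; apply: mulr_ge0 => //; exact: mulr_ge0.
    rewrite ler_pdivrMr//.
    apply: (@le_trans _ _ (th * 3 * th / 2)).
      rewrite ler_wpM2r ?invr_ge0// ler_pM//; first exact: mulr_ge0.
      by rewrite ler_wpM2l//; lra.
    have -> : th * 3 * th / 2 = 3 / 2 * th ^+ 2 by field.
    apply: ler_peMr; last by rewrite lerDl ltW.
    by apply: mulr_ge0; [rewrite divr_ge0|exact: sqr_ge0].
  apply: (le_trans (ler_normD _ _)); rewrite normrM.
  have hth : th ^+ 2 <= h ^+ 2 / sig ^+ 4.
    rewrite /th expr_div_n ler_wpM2l ?sqr_ge0// lef_pV2 ?posrE ?exprn_gt0//.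
    by rewrite (_ : 4 = 2 * 2)%N// exprM lerXn2r ?nnegrE ?sqr_ge0// ltW.
  apply: (@le_trans _ _ ((64 * p + 3 / 2 * (2 * (16 * p))) * th ^+ 2)); last first.
    rewrite -[leRHS]mulrA -expr2 -[leRHS]mulrA ler_wpM2l//.
      by rewrite addr_ge0 ?mulr_ge0 ?divr_ge0 ?(ltW p0).
    by rewrite mulrC.
  rewrite [leRHS]mulrDl; apply: lerD.
    apply: (le_trans (ncdf_scale _ _)); first by rewrite rge rle1.
    by rewrite ler_wpM2l ?mulr_ge0 ?(ltW p0)// lerXn2r ?nnegrE.
  have -> : 3 / 2 * (2 * (16 * p)) * th ^+ 2 = 3 / 2 * th ^+ 2 * (2 * (16 * p)) by ring.
  by rewrite ler_pM.
have -> : \sum_e wt e * ncdf ((c - (w + d e)) / s) - ncdf ((c - w) / s') =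
  (\sum_e wt e * ncdf ((c - (w + d e)) / s) - ncdf z + h / (2 * v) * (z * npdf z)) -
  (ncdf ((c - w) / s') - ncdf z + h / (2 * v) * (z * npdf z)) by ring.
apply: (le_trans (ler_normB _ _)); apply: (le_trans (lerD A1 A2)).
have kap0 : 0 <= kappa.
  case: (pickP (fun _ : E => true)) => [e _|E0]; first exact: le_trans (dk e).
  by move: wt1; rewrite big_pred0// => /eqP; rewrite eq_sym oner_eq0.
rewrite -/K1 -/K2 -subr_ge0 (_ : _ - _ = K1 * h * h + K2 * h * kappa); last by ring.
by apply: addr_ge0; apply: mulr_ge0 => //; exact: mulr_ge0.
Qed.

End gaussian_cdf.

(** * Laws determined by rays *)

Lemma measure_rays (R : realType) (m1 m2 : {measure set (measurableTypeR R) -> \bar R}) :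
  (forall c, m1 `]-oo, c[%classic = m2 `]-oo, c[%classic) ->
  (forall c, (m1 `]-oo, c[%classic < +oo)%E) ->
  forall B, measurable B -> m1 B = m2 B.
Proof.
move=> m12 fin; apply: (@measure_unique _ R (measurableTypeR R) (@RGenInftyO.G R) (fun k => `]-oo, k%:R[%classic)).
- by have := @RGenInftyO.measurableE R.
- move=> _ _ [a ->] [b ->]; exists (Num.min a b); rewrite predeqE => x /=.
  by rewrite !in_itv/= lt_min; split => [[-> ->]|/andP[-> ->]].
- by move=> k; exists k%:R.
- rewrite predeqE => x; split => // _; exists (Num.truncn x).+1 => //=.
  by rewrite in_itv/= truncnS_gt.
- by move=> _ [a ->]; exact: m12.
- by move=> k; exact: fin.
Qed.

Section restricted_law.
Context {R : realType} d {Omega : measurableType d} (P : probability Omega R).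
Variables (A : set Omega) (X : Omega -> R).
Hypothesis mA : measurable A.
Hypothesis mX : measurable_fun setT X.

Definition restricted_law (B : set (measurableTypeR R)) : \bar R := P (A `&` X @^-1` B).

Let mXB (B : set (measurableTypeR R)) : measurable B -> measurable (A `&` X @^-1` B).
Proof.
by move=> mB; apply: measurableI => //; rewrite -[X in measurable X]setTI; exact: mX.
Qed.

Let restricted_law0 : restricted_law set0 = 0%E.
Proof. by rewrite /restricted_law preimage_set0 setI0 measure0. Qed.

Let restricted_law_ge0 B : (0 <= restricted_law B)%E.
Proof. exact: measure_ge0. Qed.

Let restricted_law_sigma_additive : semi_sigma_additive restricted_law.
Proof.
move=> F mF tF mUF; rewrite /restricted_law preimage_bigcup setI_bigcupr.
apply: measure_semi_sigma_additive.
- by move=> n; exact: mXB.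
- apply/trivIsetP => /= i j _ _ ij; rewrite setIACA -preimage_setI.
  by move/trivIsetP : tF => /(_ _ _ _ _ ij) ->//; rewrite preimage_set0 setI0.
- by rewrite -setI_bigcupr -preimage_bigcup; exact: mXB.
Qed.

HB.instance Definition _ := isMeasure.Build _ _ _ restricted_law
  restricted_law0 restricted_law_ge0 restricted_law_sigma_additive.

Lemma restricted_law_rays (m2 : {measure set (measurableTypeR R) -> \bar R}) :
  (forall c, P (A `&` X @^-1` `]-oo, c[) = m2 `]-oo, c[%classic) ->
  forall B : set R, measurable B -> P (A `&` X @^-1` B) = m2 B.
Proof.
move=> h B mB; apply: (@measure_rays R restricted_law m2) => // c.
rewrite (@le_lt_trans _ _ 1%E) ?ltry//; apply: probability_le1; apply: mXB.
exact: measurable_itv.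
Qed.

End restricted_law.

Section density_measure.
Context {R : realType}.
Variable f : R -> R.
Hypothesis mf : measurable_fun setT f.
Hypothesis f0 : forall x, 0 <= f x.

Definition density_measure (B : set (measurableTypeR R)) : \bar R :=
  (\int[lebesgue_measure]_(x in B) (f x)%:E)%E.

Let density_measure0 : density_measure set0 = 0%E.
Proof. by rewrite /density_measure integral_set0. Qed.

Let density_measure_ge0 B : (0 <= density_measure B)%E.
Proof. by apply: integral_ge0 => x _; rewrite lee_fin. Qed.

Let density_measure_sigma_additive : semi_sigma_additive density_measure.
Proof.
move=> F mF tF mUF; rewrite /density_measure ge0_integral_bigcup//; last first.
- by move=> x _; rewrite lee_fin.
- by apply/measurable_EFinP; exact: measurable_funTS.
by apply: is_cvg_ereal_nneg_natsum_cond => n _ _; exact: density_measure_ge0.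
Qed.

HB.instance Definition _ := isMeasure.Build _ _ _ density_measure
  density_measure0 density_measure_ge0 density_measure_sigma_additive.

Definition density_law : {measure set (measurableTypeR R) -> \bar R} := density_measure.

End density_measure.

(** * Gaussian laws recognised from smoothed indicators *)

Section gaussian_rays.
Context {R : realType}.
Notation mu := (@lebesgue_measure R).

Lemma normal_prob_ray (s c : R) : 0 < s ->
  normal_prob 0 s `]-oo, c]%classic = (ncdf (c / s))%:E.
Proof.
move=> s0; have s0' : s != 0 by rewrite gt_eqF.
rewrite /ncdf /Rintegral fineK; last first.
  by apply: integrable_fin_num => //; apply: integrableS integrable_npdf => //; exact: measurable_itvR.
have dF (x : R) : is_derive x (1 : R) (fun x => x / s) s^-1.
  by apply: is_derive_eq; rewrite /GRing.scale/=; ring.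
have F' : (fun x : R => x / s)^`()%classic = cst s^-1.
  by apply/funext => x; rewrite derive1E; apply: derive_val.
rewrite (@increasing_ge0_integration_by_substitutionNy R (fun x => x / s)).
- rewrite /normal_prob; apply: eq_integral => x _; congr EFin.
  rewrite F' /= /npdf normal_pdfE// normal_pdfE ?oner_neq0// /normal_fun /normal_peak.
  rewrite !subr0 expr1n mul1r -(mulrnAr (s ^+ 2) pi 2) sqrtrM ?sqr_ge0// sqrtr_sqr (gtr0_norm s0).
  have -> : - x ^+ 2 / (s ^+ 2 *+ 2) = - (x / s) ^+ 2 / 2 :> R.
    by rewrite -[s ^+ 2 *+ 2]mulr_natr; field.
  have -> : forall f : R -> R, ((f \o (fun x => x / s)) * cst s^-1) x = f (x / s) * s^-1 by [].
  by rewrite subr0 invfM; ring.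
- by move=> x y _ _ xy; rewrite ltr_pM2r// invr_gt0.
- by rewrite F' => x _; exact: cvg_cst.
- by rewrite F'; exact: is_cvg_cst.
- by rewrite F'; exact: cvg_cst.
- split; first by move=> x _; case: (dF x).
  by apply: cvg_at_left_filter; apply: cvgM; [exact: cvg_id|exact: cvg_cst].
- by apply/gt0_cvgMlNy; [rewrite invr_gt0|exact: cvg_id].
- by apply: continuous_subspaceT; apply: continuous_normal_pdf; rewrite oner_neq0.
- by move=> x _; rewrite ltW// npdf_gt0.
Qed.

Lemma ncdf_continuous : continuous (@ncdf R).
Proof.
move=> y; apply: differentiable_continuous; apply/derivable1_diffP.
by case: (ncdf_derive y).
Qed.

Lemma ncdf_itv y : 0 <= @ncdf R y <= 1.
Proof.
have n0 (x : R) : 0 <= npdf x by rewrite ltW// npdf_gt0.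
rewrite /ncdf; apply/andP; split; first by apply: Rintegral_ge0.
rewrite -lee_fin /Rintegral fineK; last first.
  by apply: integrable_fin_num => //; apply: integrableS integrable_npdf => //; exact: measurable_itvR.
rewrite -(@integral_normal_pdf R 0 1); apply: ge0_subset_integral => //.
- by apply/measurable_EFinP; exact: measurable_normal_pdf.
- by move=> x _; rewrite lee_fin normal_pdf_ge0.
Qed.

Lemma ncdf_nd (x y : R) : x <= y -> ncdf x <= ncdf y.
Proof.
move=> xy; rewrite -subr_ge0; have [c _ ->] := mean_value x y ncdf_derive.
by rewrite mulr_ge0 ?subr_ge0// ltW// npdf_gt0.
Qed.

Lemma ncdf_tails (eps : R) : 0 < eps -> exists2 M : R, 0 < M &
  ncdf (- M) <= eps /\ 1 - eps <= ncdf M.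
Proof.
move=> e0; have n0 (x : R) : 0 <= npdf x by rewrite ltW// npdf_gt0.
have [M M0 hM] := itv_mass_setT_cvg integrable_npdf n0 e0; exists M => //.
have i1 : \int[mu]_x (@npdf R x) = 1 by rewrite /Rintegral integral_normal_pdf.
rewrite i1 in hM.
have h : itv_mass npdf (- M) M = ncdf M - ncdf (- M).
  rewrite /ncdf /itv_mass.
  have ic (c : R) : mu.-integrable `]-oo, c] (EFin \o npdf).
    by apply: integrableS integrable_npdf => //; exact: measurable_itvR.
  rewrite -(Rintegral_itv_bndo_bndc (a := -oo%O)); last first.
    apply: integrableS (ic M) => //; try exact: measurable_itvR.
    by move=> x /=; rewrite !in_itv/= => /ltW.
  rewrite -(Rintegral_itv_bndo_bndc (a := -oo%O)); last first.
    apply: integrableS (ic (- M)) => //; try exact: measurable_itvR.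
    by move=> x /=; rewrite !in_itv/= => /ltW.
  have -> : `]-oo, M[%classic = `]-oo, (- M)[%classic `|` `[(- M), M[%classic :> set R.
    by rewrite -itv_bndbnd_setU// bnd_simp; lra.
  rewrite Rintegral_setU; [by rewrite addrC addKr| | | |]; try exact: measurable_itvR.
    by apply: integrableS integrable_npdf => //; apply: measurableU; exact: measurable_itvR.
  apply/disj_setPS => x [] /=; rewrite !in_itv/= => h1 /andP[h2 _].
  by move: (lt_le_trans h1 h2); rewrite ltxx.
have /andP[h1 h2] := ncdf_itv M; have /andP[h3 h4] := ncdf_itv (- M).
by split; move: hM; rewrite h; lra.
Qed.

(** Smoothing by a Gaussian of deviation [sig] plays the part of characteristic functions: it is
    exactly what the Lindeberg step computes, and as [sig] tends to 0 it recovers the distribution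
    function of [X] on [A]. *)
Lemma gaussian_law d (Omega : measurableType d) (P : probability Omega R) (A : set Omega)
    (X : Omega -> R) (tau : R) : measurable A -> measurable_fun setT X -> 0 < tau ->
  (forall sig c, 0 < sig -> (\int[P]_(w in A) (ncdf ((c - X w) / sig))%:E =
     P A * (ncdf (c / Num.sqrt (sig ^+ 2 + tau)))%:E)%E) ->
  forall B : set R, measurable B ->
  P (A `&` X @^-1` B) = (P A * normal_prob 0 (Num.sqrt tau) B)%E.
Proof.
move=> mA mX tau0 hyp.
have mrays c : measurable (X @^-1` `]-oo, c[).
  by rewrite -[X in measurable X]setTI; exact: mX.
have mrayc c : measurable (X @^-1` `]-oo, c]).
  by rewrite -[X in measurable X]setTI; exact: mX.
pose a := fine (P A); have PA : P A = a%:E by rewrite fineK// fin_num_measure.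
have a0 : 0 <= a by rewrite fine_ge0.
have a1 : a <= 1 by rewrite -lee_fin -PA probability_le1.
have mAo c : measurable (A `&` X @^-1` `]-oo, c[) by exact: measurableI.
have mAc c : measurable (A `&` X @^-1` `]-oo, c]) by exact: measurableI.
pose Fo c := fine (P (A `&` X @^-1` `]-oo, c[)).
pose Fc c := fine (P (A `&` X @^-1` `]-oo, c])).
have PFo c : P (A `&` X @^-1` `]-oo, c[) = (Fo c)%:E by rewrite fineK// fin_num_measure.
have PFc c : P (A `&` X @^-1` `]-oo, c]) = (Fc c)%:E by rewrite fineK// fin_num_measure.
have iI c : (\int[P]_(x in A) (\1_(X @^-1` `]-oo, c]) x)%:E = (Fc c)%:E)%E.
  by rewrite integral_indic// -PFc; congr (P _); exact: setIC.
pose N c := a * ncdf (c / Num.sqrt tau).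
have cN : continuous N.
  move=> c; apply: cvgM; first exact: cvg_cst.
  apply: (cvg_comp (fun c => c / Num.sqrt tau) (@ncdf R)); last exact: ncdf_continuous.
  by apply: cvgM; [exact: cvg_id|exact: cvg_cst].
have mn c sig : measurable_fun setT (fun w => ncdf ((c - X w) / sig)).
  apply: (measurableT_comp (f := @ncdf R)).
    by apply: continuous_measurable_fun; exact: ncdf_continuous.
  by apply: measurable_funM => //; apply: measurable_funB.
(* Once [sig * M <= eta], the smoothed indicator is at least [1 - eps] where [X <= c - eta] and at
   most [eps] where [X > c + eta]. *)
have key c eta eps : 0 < eta -> 0 < eps ->
    (1 - eps) * Fc (c - eta) <= N c /\ N c <= Fc (c + eta) + eps.
  move=> eta0 eps0; have [M M0 [hM1 hM2]] := ncdf_tails eps0.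
  have cv : (fun sig : R => a * ncdf (c / Num.sqrt (sig ^+ 2 + tau))) sig @[sig --> 0^'+] --> N c.
    apply: cvg_at_right_filter.
    have -> : N c = a * ncdf (c / Num.sqrt (0 ^+ 2 + tau)) by rewrite expr0n add0r.
    apply: cvgM; first exact: cvg_cst.
    apply: (cvg_comp (fun sig => c / Num.sqrt (sig ^+ 2 + tau)) (@ncdf R)); last exact: ncdf_continuous.
    apply: cvgM; first exact: cvg_cst.
    apply: cvgV; first by rewrite expr0n add0r gt_eqF// sqrtr_gt0.
    apply: (cvg_comp (fun sig => sig ^+ 2 + tau) (@Num.sqrt R)); last exact: sqrt_continuous.
    by apply: cvgD; [exact: sqr_continuous|exact: cvg_cst].
  have bnd : \forall sig \near 0^'+, (1 - eps) * Fc (c - eta) <= a * ncdf (c / Num.sqrt (sig ^+ 2 + tau)) /\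
     a * ncdf (c / Num.sqrt (sig ^+ 2 + tau)) <= Fc (c + eta) + eps.
    near=> sig.
    have sig0 : 0 < sig by near: sig; exact: nbhs_right_gt.
    have sigM : sig * M <= eta.
      rewrite -ler_pdivlMr//; near: sig; apply: nbhs_right_le.
      by rewrite divr_gt0.
    have := hyp sig c sig0; rewrite PA -EFinM => hE.
    have n0 x : (0 <= (ncdf x : R)%:E)%E by rewrite lee_fin; case/andP: (ncdf_itv x).
    split; rewrite -lee_fin -hE.
      have -> : (((1 - eps) * Fc (c - eta))%:E =
          \int[P]_(w in A) ((1 - eps) * \1_(X @^-1` `]-oo, (c - eta)]) w)%:E)%E.
        under eq_integral do rewrite EFinM.
        rewrite integralZl//=; last first.
          apply: measurable_bounded_integrable => //.
          + by rewrite (le_lt_trans (probability_le1 P mA))// ltry.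
          + exists 1; split => // x x1 y _ /=; rewrite indicE.
            by case: (_ \in _); rewrite ?normr1 ?normr0 ltW// (lt_trans _ x1).
        by rewrite iI.
      apply: le_integral => //.
      - apply: measurable_bounded_integrable => //.
        + by rewrite (le_lt_trans (probability_le1 P mA))// ltry.
        + by apply: measurable_funM => //; exact: measurable_indic.
        + exists (`|1 - eps|); split => // x x1 y _ /=; rewrite normrM indicE.
          by case: (_ \in _); rewrite ?normr1 ?normr0 ?mulr1 ?mulr0 ltW// (le_lt_trans _ x1).
      - apply: measurable_bounded_integrable => //.
        + by rewrite (le_lt_trans (probability_le1 P mA))// ltry.
        + exact: measurable_funTS.
        + exists 1; split => // x x1 y _ /=; have /andP[q1 q2] := ncdf_itv ((c - X y) / sig).
          by rewrite ger0_norm// ltW// (le_lt_trans q2).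
      - move=> w _; rewrite lee_fin indicE.
        case: (boolP (w \in _)); rewrite ?notin_setE ?inE/= in_itv/= => hX; last first.
          by rewrite mulr0; case/andP: (ncdf_itv ((c - X w) / sig)).
        rewrite mulr1 (le_trans hM2)// ncdf_nd// ler_pdivlMr// mulrC (le_trans sigM)//; lra.
    have -> : ((Fc (c + eta) + eps)%:E =
        \int[P]_(w in A) (\1_(X @^-1` `]-oo, (c + eta)]) w)%:E + eps%:E)%E.
      by rewrite iI.
    apply: (@le_trans _ _ (\int[P]_(w in A) (\1_(X @^-1` `]-oo, (c + eta)]) w)%:E + \int[P]_(w in A) eps%:E)%E).
      rewrite -ge0_integralD//.
      + apply: ge0_le_integral => //.
        * by apply/measurable_EFinP; exact: measurable_funTS.
        * by apply: emeasurable_funD => //; apply/measurable_EFinP; exact: measurable_indic.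
        * move=> w _; rewrite -EFinD lee_fin indicE.
          case: (boolP (w \in _)); rewrite ?notin_setE ?inE/= in_itv/= => hX.
            have /andP[_ q] := ncdf_itv ((c - X w) / sig).
            by rewrite (le_trans q)// lerDl ltW.
          rewrite add0r (le_trans _ hM1)// ncdf_nd// ler_pdivrMr// mulNr mulrC.
          by move/negP: hX; rewrite -ltNge => hX; lra.
      + by apply/measurable_EFinP; exact: measurable_indic.
      + by move=> w _; rewrite lee_fin ltW.
    rewrite integral_cst// leeD2l// -[leRHS]mule1 lee_wpmul2l ?lee_fin ?(ltW eps0)//.
    exact: probability_le1.
  split.
    apply: (cvgr_to_ge cv); by apply: filterS bnd => sig [].
  apply: (cvgr_to_le cv); by apply: filterS bnd => sig [].
have Fnd x y : x <= y -> Fc x <= Fc y.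
  move=> xy; rewrite -lee_fin -!PFc le_measure ?inE// => w [Aw]/=; rewrite !in_itv/= => h.
  by split => //=; rewrite (le_trans h).
have sandwich c eta : 0 < eta -> Fc (c - eta) <= N c /\ N c <= Fc (c + eta).
  move=> eta0; split; apply/ler_addgt0Pr => eps eps0; last by have [] := key c eta eps eta0 eps0.
  have [+ _] := key c eta eps eta0 eps0; rewrite mulrBl mul1r lerBlDr => /le_trans; apply.
  rewrite lerD2l ler_piMr ?(ltW eps0)//.
  by rewrite -lee_fin -PFc probability_le1.
have FN c : Fo c = N c.
  apply/eqP; rewrite eq_le; apply/andP; split; apply/ler_addgt0Pr => eps eps0.
    have /cvgrPdist_le/(_ _ eps0)[/= r /= r0 hr] := cN c.
    have r20 : 0 < r / 2 by rewrite divr_gt0.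
    have [+ _] := sandwich (c + r / 2) (r / 2) r20.
    rewrite addrK => h; apply: (@le_trans _ _ (N (c + r / 2))).
      apply: le_trans h; rewrite -lee_fin -PFo -PFc le_measure ?inE// => w [Aw]/=.
      by rewrite !in_itv/= => /ltW.
    have := hr (c + r / 2); rewrite /ball/= opprD addrA subrr add0r normrN gtr0_norm//.
    by rewrite ltr_pdivrMr// ltr_pMr// ltr1n => /(_ isT); rewrite ler_distl => /andP[]; lra.
  have /cvgrPdist_le/(_ _ eps0)[/= r /= r0 hr] := cN c.
  have r20 : 0 < r / 2 by rewrite divr_gt0.
  have r40 : 0 < r / 4 by rewrite divr_gt0.
  have [_ h] := sandwich (c - r / 2) (r / 4) r40.
  apply: (@le_trans _ _ (N (c - r / 2) + eps)).
    have := hr (c - r / 2); rewrite /ball/= opprB addrCA subrr addr0 gtr0_norm//.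
    by rewrite ltr_pdivrMr// ltr_pMr// ltr1n => /(_ isT); rewrite ler_distl => /andP[]; lra.
  rewrite lerD2r (le_trans h)// -lee_fin -PFo -PFc le_measure ?inE// => w [Aw]/=.
  by rewrite !in_itv/= => h'; split => //=; lra.
have st0 : 0 < Num.sqrt tau by rewrite sqrtr_gt0.
move=> B mB; rewrite PA.
apply: (restricted_law_rays mA mX (m2 := mscale (NngNum a0) (normal_prob 0 (Num.sqrt tau)))) => // c.
rewrite PFo FN /mscale/= EFinM -normal_prob_ray//; congr (_ * _)%E.
rewrite /normal_prob; apply/esym/integral_itv_bndo_bndc/measurable_EFinP.
by apply: measurable_funTS; exact: measurable_normal_pdf.
Unshelve. all: by end_near. Qed.

End gaussian_rays.

(** * The discretised problem *)

(** [beta] enters only through [pg], the square of [Phi] extended to the line; [pf] is a version of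
    the initial density that is nonnegative everywhere. *)
Record porous_data (R : realType) := PorousData {
  pg : R -> R; pc : R; pf : R -> R; pT : R;
  pg_cont : continuous pg;
  pg_ge0 : forall u, 0 <= pg u;
  pg_le : forall u, pg u <= pc;
  pg_nd : forall u v, 0 <= u -> u <= v -> u * pg u <= v * pg v;
  pf_int : (@lebesgue_measure R).-integrable setT (EFin \o pf);
  pf_ge0 : forall x, 0 <= pf x;
  pf_mass : \int[@lebesgue_measure R]_x pf x = 1;
  pT_gt0 : 0 < pT }.

Section discretisation.
Context {R : realType}.
Variable D : porous_data R.
Notation g := (pg D).
Notation c := (pc D).
Notation T := (pT D).
Implicit Types (n k : nat).

(* Parabolic scaling [mesh n ^ 2 = n.+1 * step n]: a jump has probability [gam n u / n.+1],
   and the half-length [n.+1 * sqrt T] of the torus tends to infinity. *)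
Definition mesh n : R := Num.sqrt T / n.+1%:R ^+ 2.
Definition steps n : nat := (n.+1 ^ 5)%N.
Definition step n : R := T / (steps n)%:R.
(** The torus ['I_(cells n).+2] has [2 * n.+1 ^ 3] sites; the offset suits the additive structure of
    ['I_m.+2]. *)
Definition cells n : nat := (2 * n.+1 ^ 3 - 2)%N.
Definition halfL n : R := (n.+1 ^ 3)%:R * mesh n.
(** Tends to 0, but slowly enough that [mesh n / cutoff n], which governs the jumps of [Wwalk],
    tends to 0 too. *)
Definition cutoff n : R := n.+1%:R^-1.
Definition gam n : R -> R := trunc_coef g n.+1.
Definition u0d n (i : 'I_(cells n).+2) : R :=
  cell_mass (pf D) (mesh n) (halfL n) (cells n).+2 i / mesh n.
Arguments u0d : clear implicits.
Definition dens n k : 'I_(cells n).+2 -> R := density n.+1%:R (gam n) (u0d n) k.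
Arguments dens : clear implicits.
Definition mean_at n k : (history -> R) -> R :=
  chain_mean (cells n).+2 (chain_init (mesh n) (u0d n))
    (chain_wt n.+1%:R (gam n) (u0d n)) k.
Definition Emean n := mean_at n (steps n).
Definition torus n (s : history (E := move)) : 'I_(cells n).+2 := torus_site (cells n) s.
Definition Xwalk n (s : history (E := move)) : R := - halfL n + mesh n * (site s)%:~R.
Definition Wwalk n : history -> R :=
  brownian_walk n.+1%:R (gam n) (mesh n) (cutoff n) (u0d n).
Definition sig n : history -> R := sigma n.+1%:R (gam n) (u0d n).
Definition kap n : R := mesh n / cutoff n + Num.sqrt (step n).

Let n1 n : (0 : R) < n.+1%:R. Proof. by rewrite ltr0n. Qed.

Lemma pc_ge0 : 0 <= c. Proof. exact: le_trans (pg_ge0 D 0) (pg_le D 0). Qed.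

Lemma mesh_gt0 n : 0 < mesh n.
Proof. by rewrite divr_gt0 ?sqrtr_gt0 ?pT_gt0 ?exprn_gt0. Qed.

Lemma step_gt0 n : 0 < step n.
Proof. by rewrite divr_gt0 ?pT_gt0// ltr0n expn_gt0. Qed.

Lemma steps_step n : (steps n)%:R * step n = T.
Proof. by rewrite /step mulrC divfK// pnatr_eq0 -lt0n expn_gt0. Qed.

Lemma mesh_step n : mesh n ^+ 2 / n.+1%:R = step n.
Proof.
rewrite /mesh /step /steps natrX exprMn sqr_sqrtr ?ltW ?pT_gt0//.
by rewrite exprVn -exprM -mulrA -invfM -exprSr.
Qed.

Lemma cellsE n : (cells n).+2 = (2 * n.+1 ^ 3)%N.
Proof. 
rewrite /cells; have : (0 < n.+1 ^ 3)%N by rewrite expn_gt0.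
by case: (_ ^ _)%N => // k _; rewrite mulnS addKn.
Qed.

Lemma cells_mesh n : (cells n).+2%:R * mesh n = 2 * halfL n.
Proof. by rewrite cellsE natrM /halfL mulrA. Qed.

Lemma halfLE n : halfL n = n.+1%:R * Num.sqrt T.
Proof.
rewrite /halfL /mesh natrX.
have := lt0r_neq0 (n1 n); move: (n.+1%:R : R) (Num.sqrt T) => x y x0.
by field.
Qed.

Lemma cutoff_gt0 n : 0 < cutoff n. Proof. by rewrite invr_gt0. Qed.

Lemma gam_itv n x : 0 <= gam n x <= n.+1%:R.
Proof.
apply/andP; split; first exact: trunc_coef_ge0 (pg_ge0 D) _ _.
exact: trunc_coef_le_nat (pg_ge0 D) _ _.
Qed.

Lemma gam_le n x : gam n x <= c.
Proof. exact: le_trans (trunc_coef_le (pg_ge0 D) _ _) (pg_le D _). Qed.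

Lemma u0d_ge0 n i : 0 <= u0d n i.
Proof.
rewrite divr_ge0 ?(ltW (mesh_gt0 n))//.
exact: (cell_mass_ge0 (pf_int D) (pf_ge0 D) (pf_mass D)).
Qed.

Lemma mesh_u0d n i : mesh n * u0d n i = cell_mass (pf D) (mesh n) (halfL n) (cells n).+2 i.
Proof. by rewrite /u0d mulrC divfK// gt_eqF// mesh_gt0. Qed.

Lemma u0d_sum n : \sum_i mesh n * u0d n i = 1.
Proof.
under eq_bigr do rewrite mesh_u0d.
by apply: (cell_mass_sum (pf_int D)); rewrite ?(ltW (mesh_gt0 n)).
Qed.

Let flux_nd n x y : 0 <= x -> x <= y -> flux n.+1%:R (gam n) x <= flux n.+1%:R (gam n) y.
Proof.
move=> x0 xy; rewrite /flux ler_pM2r ?invr_gt0//.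
exact: trunc_flux_nd (pg_ge0 D) (pg_nd D) _ _ _ x0 xy.
Qed.

Let flux_lip n x y : 0 <= x -> x <= y ->
  flux n.+1%:R (gam n) y <= flux n.+1%:R (gam n) x + (y - x).
Proof.
move=> x0 xy; have := trunc_flux_lip (pg_ge0 D) n.+1 x0 xy.
rewrite /flux ler_pdivrMr// mulrDl divfK ?gt_eqF// [(y - x) * _]mulrC.
by [].
Qed.

Let flux_itv n x : 0 <= x -> 0 <= flux n.+1%:R (gam n) x <= x.
Proof.
move=> x0; have /andP[g0 g1] := gam_itv n x.
apply/andP; split; first by rewrite divr_ge0 ?mulr_ge0.
by rewrite /flux ler_pdivrMr// ler_wpM2l.
Qed.

Let p0_ge0 n i : 0 <= chain_init (mesh n) (u0d n) i.
Proof. exact: chain_init_ge0 (mesh_gt0 n) (@u0d_ge0 n) i. Qed.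
Let p0_sum n : \sum_(i < (cells n).+2) chain_init (mesh n) (u0d n) i = 1.
Proof. exact: chain_init_sum (u0d_sum n). Qed.
Let wt_ge0 n s e : 0 <= chain_wt n.+1%:R (gam n) (u0d n) s e.
Proof. exact: chain_wt_ge0 (n1 n) (gam_itv n) s e. Qed.
Let wt_sum n s : \sum_e chain_wt n.+1%:R (gam n) (u0d n) s e = 1.
Proof. exact: chain_wt_sum. Qed.

Lemma mean_at_functional n k : mean_functional (mean_at n k).
Proof. exact: chain_mean_functional (@p0_ge0 n) (p0_sum n) (@wt_ge0 n) (@wt_sum n) k. Qed.

Lemma Emean_functional n : mean_functional (Emean n).
Proof. exact: mean_at_functional. Qed.

Lemma mean_at_trunc n k N f : (k <= N)%N -> mean_at n N (f \o trunc k) = mean_at n k f.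
Proof. by move=> kN; apply: chain_mean_trunc (@p0_ge0 n) (@wt_ge0 n) (@wt_sum n) _ _ _ kN. Qed.

Lemma eq_mean_at n k f f' : (forall s, size s.2 = k -> f s = f' s) ->
  mean_at n k f = mean_at n k f'.
Proof. exact: eq_chain_mean (@p0_ge0 n) (@wt_ge0 n) _ _ _. Qed.

Lemma le_mean_at n k f f' : (forall s, size s.2 = k -> f s <= f' s) ->
  mean_at n k f <= mean_at n k f'.
Proof. exact: le_chain_mean (@p0_ge0 n) (@wt_ge0 n) _ _ _. Qed.

Lemma mean_at_law n k (f : 'I_(cells n).+2 -> R) :
  mean_at n k (fun s => f (torus n s)) = \sum_i mesh n * dens n k i * f i.
Proof. exact: (chain_law (n1 n) (gam_itv n) (mesh_gt0 n) (@u0d_ge0 n) k f). Qed.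

Lemma dens_ge0 n k i : 0 <= dens n k i.
Proof. by apply: (scheme_ge0 1 (flux_itv n)) => j; exact: u0d_ge0. Qed.

Lemma dens_sum n k : \sum_i mesh n * dens n k i = 1.
Proof.
rewrite -(expect_cst1 (mean_at_functional n k)).
rewrite (mean_at_law (n:=n) k (fun=> 1)).
by apply: eq_bigr => i _; rewrite mulr1.
Qed.

Lemma dens_translation n k (a : 'I_(cells n).+2) :
  \sum_i mesh n * `|dens n k (i + a) - dens n k i| <=
  \sum_(i < (cells n).+2) `|cell_mass (pf D) (mesh n) (halfL n) (cells n).+2 (i + a)%R -
           cell_mass (pf D) (mesh n) (halfL n) (cells n).+2 i|.
Proof.
have := scheme_translation 1 (@flux_nd n) (@flux_lip n) (@flux_itv n) a k (@u0d_ge0 n).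
rewrite -(ler_pM2l (mesh_gt0 n)) !mulr_sumr => /le_trans; apply.
apply: ler_sum => i _; rewrite -{1}(gtr0_norm (mesh_gt0 n)) -normrM mulrBr.
by rewrite !mesh_u0d.
Qed.

Lemma Xwalk_extend n s e : Xwalk n (extend s e) = Xwalk n s + dX (mesh n) e.
Proof. by rewrite /Xwalk site_extend /dX rmorphD /= mulrDr addrA. Qed.

Let dXC n s : \sum_e chain_wt n.+1%:R (gam n) (u0d n) s e * dX (mesh n) e ^+ 2 <= c * step n.
Proof.
rewrite (dX_var (mesh n) (u0d n) (n1 n) (gam_itv n)) mesh_step mulrC ler_wpM2r ?(ltW (step_gt0 n))//.
rewrite /sigma sqr_sqrtr ?gam_le//.
by have /andP[] := gam_itv n (local_density n.+1%:R (gam n) (u0d n) s).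
Qed.

Let dWC n s : \sum_e chain_wt n.+1%:R (gam n) (u0d n) s e *
  dW n.+1%:R (gam n) (mesh n) (cutoff n) (u0d n) s e ^+ 2 = step n.
Proof. by rewrite (dW_var (u0d n) (n1 n) (gam_itv n) (mesh_gt0 n) (cutoff_gt0 n)) mesh_step. Qed.

Let cstep0 n : 0 <= c * step n. Proof. by rewrite mulr_ge0 ?pc_ge0 ?(ltW (step_gt0 n)). Qed.

Lemma dW_kap n s e : `|dW n.+1%:R (gam n) (mesh n) (cutoff n) (u0d n) s e| <= kap n.
Proof.
rewrite /kap -mesh_step.
exact: (dW_bound n.+1%:R (gam n) (u0d n) (mesh_gt0 n) (cutoff_gt0 n) s e).
Qed.

Lemma Xwalk_sqr n k0 k : (k0 <= k)%N ->
  mean_at n k (fun s => (Xwalk n s - Xwalk n (trunc k0 s)) ^+ 2) <= c * step n * (k - k0)%:R.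
Proof.
apply: (martingale_increment_sqr (@p0_ge0 n) (p0_sum n) (@wt_ge0 n) (@wt_sum n)
  (d := fun=> dX (mesh n))) => [s e|s|s]; [exact: Xwalk_extend|exact: dX_mean|exact: dXC].
Qed.

Lemma Xwalk_hit n eps k0 k : 0 < eps -> (k0 <= k)%N ->
  eps ^+ 4 * mean_at n k (fun s => (hit (Xwalk n) eps k0 s)%:R) <=
  8 * (c * step n * (k - k0)%:R) ^+ 2 + 3 * mesh n ^+ 2 * (c * step n * (k - k0)%:R).
Proof.
move=> e0 kk; apply: le_trans (hit_pow4 (@p0_ge0 n) (p0_sum n) (@wt_ge0 n) (@wt_sum n)
  (d := fun=> dX (mesh n)) _ _ e0 kk) _; [exact: Xwalk_extend|exact: dX_mean|].
apply: (martingale_increment_pow4 (@p0_ge0 n) (p0_sum n) (@wt_ge0 n) (@wt_sum n)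
  (d := fun=> dX (mesh n))) => // [s e|s|s e]; [exact: Xwalk_extend|exact: dX_mean|].
exact: dX_bound (mesh_gt0 n) e.
Qed.

Lemma Wwalk_hit n eps k0 k : 0 < eps -> (k0 <= k)%N ->
  eps ^+ 4 * mean_at n k (fun s => (hit (Wwalk n) eps k0 s)%:R) <=
  8 * (step n * (k - k0)%:R) ^+ 2 + 3 * kap n ^+ 2 * (step n * (k - k0)%:R).
Proof.
move=> e0 kk; apply: le_trans (hit_pow4 (@p0_ge0 n) (p0_sum n) (@wt_ge0 n) (@wt_sum n)
  (d := dW n.+1%:R (gam n) (mesh n) (cutoff n) (u0d n)) _ _ e0 kk) _.
- exact: brownian_walk_extend.
- exact: dW_mean.
apply: (martingale_increment_pow4 (@p0_ge0 n) (p0_sum n) (@wt_ge0 n) (@wt_sum n)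
  (d := dW n.+1%:R (gam n) (mesh n) (cutoff n) (u0d n))) => //.
- exact: dW_mean.
- by move=> s; rewrite dWC.
- exact: dW_kap.
- exact/ltW/step_gt0.
Qed.

(** The Lindeberg exchange: at each step one increment of [Wwalk] is traded for its variance
    [step n] in the Gaussian. The past event only multiplies by a factor at most 1, and [K] depends
    on [sg] alone, so the errors add up over the steps. *)
Lemma Wwalk_heat (sg : R) : 0 < sg -> exists2 K : R, 0 <= K & forall n, step n <= sg ^+ 2 ->
  forall (B : set history) a k0 k1, (k0 <= k1)%N ->
  `|mean_at n k1 (fun s => \1_B (trunc k0 s) *
      ncdf ((a - (Wwalk n s - Wwalk n (trunc k0 s))) / sg)) -
    mean_at n k0 (\1_B) * ncdf (a / Num.sqrt (sg ^+ 2 + step n * (k1 - k0)%:R))|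
  <= K * (step n * (k1 - k0)%:R) * (kap n + step n).
Proof.
move=> sg0; have [K K0 hK] := ncdf_heat_step sg0; exists K => // n hn B a k0 k1 k01.
pose W s := Wwalk n s - Wwalk n (trunc k0 s).
pose v j : R := sg ^+ 2 + step n * j%:R.
have v_ge j : sg ^+ 2 <= v j by rewrite lerDl mulr_ge0 ?(ltW (step_gt0 n)).
(* [j] counts the steps already converted into variance. *)
pose F j s := \1_B (trunc k0 s) * ncdf ((a - W s) / Num.sqrt (v j)).
rewrite -{1}(subnKC k01).
(* Generalised over the variance [i] already added, since each step of the induction on [j] raises
   it by one. *)
suff main j i : `|mean_at n (k0 + j) (F i) - mean_at n k0 (F (i + j)%N)| <=
    K * (step n * j%:R) * (kap n + step n).
  have := main (k1 - k0)%N 0%N; rewrite add0n.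
  have -> : F 0%N = (fun s => \1_B (trunc k0 s) * ncdf ((a - W s) / sg)).
    by apply: funext => s; rewrite /F /v mulr0 addr0 sqrtr_sqr gtr0_norm.
  suff -> : mean_at n k0 (F (k1 - k0)%N) = mean_at n k0 \1_B *
      ncdf (a / Num.sqrt (sg ^+ 2 + step n * (k1 - k0)%:R)) by [].
  rewrite mulrC -(expectZ (mean_at_functional n k0)).
  apply: eq_mean_at => s sk; have tk : trunc k0 s = s by rewrite -sk trunc_size.
  by rewrite /F /W !tk subrr subr0 mulrC.
elim: j i => [|j IH] i.
  by rewrite !addn0 subrr normr0 !mulr0 mul0r.
rewrite addnS /mean_at chain_meanS -/(mean_at n (k0 + j)) -/(mean_at n k0).
set f := cexp _ _; rewrite -addSnnS.
have step1 : `|mean_at n (k0 + j) f - mean_at n (k0 + j) (F i.+1)| <=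
    K * step n * (kap n + step n).
  rewrite -(expectB (mean_at_functional n _)).
  apply: le_trans (expect_norm (mean_at_functional n _) _) _.
  rewrite -[leRHS](expect_cst (mean_at_functional n (k0 + j))).
  apply: le_mean_at => s ss; have k0s : (k0 <= size s.2)%N by rewrite ss leq_addr.
  rewrite /f /cexp /F; under eq_bigr do rewrite trunc_extend// mulrCA.
  rewrite -mulr_sumr -mulrBr normrM.
  have hb : `|\1_B (trunc k0 s) : R| <= 1.
    by rewrite ger0_norm ?indicE// lern1 leq_b1.
  apply: le_trans (ler_wpM2r (normr_ge0 _) hb) _; rewrite mul1r.
  have := hK _ (chain_wt n.+1%:R (gam n) (u0d n) s)
    (dW n.+1%:R (gam n) (mesh n) (cutoff n) (u0d n) s) (step n) (kap n) a (W s) (v i)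
    (@wt_ge0 n s) (@wt_sum n s) (dW_mean _ _ _ _ _ _) (dWC n s) (@dW_kap n s)
    (ltW (step_gt0 n)) hn (v_ge i).
  have -> : v i + step n = v i.+1 by rewrite /v -(natr1 i) mulrDr mulr1 addrA.
  under eq_bigr do rewrite /W.
  under [in X in _ -> X]eq_bigr do rewrite /W trunc_extend// [Wwalk n (extend _ _)]brownian_walk_extend addrAC.
  by [].
rewrite (le_trans (ler_distD (mean_at n (k0 + j) (F i.+1)) _ _))//.
apply: le_trans (lerD step1 (IH i.+1)) _.
by rewrite -(natr1 j) -mulrDl -mulrDr -[X in X + _ * _]mulr1 -mulrDr addrC.
Qed.

End discretisation.
Arguments dens {R} D n k _.
Arguments u0d {R} D n _.

Lemma expect_sqr (R : realType) (T0 : Type) (E : (T0 -> R) -> R) (f : T0 -> R) :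
  mean_functional E -> E (fun s => `|f s|) ^+ 2 <= E (fun s => f s ^+ 2).
Proof.
move=> hE; set a := E _.
have := expect_ge0 hE (f := fun s => (`|f s| - a) ^+ 2) (fun s => sqr_ge0 _).
have -> : (fun s => (`|f s| - a) ^+ 2) = (fun s => (f s ^+ 2 + a ^+ 2) - (2 * a) * `|f s|).
  by apply: funext => s; rewrite -[f s ^+ 2]real_normK ?num_real//; ring.
rewrite (expectB hE) (expectD hE) (expect_cst hE) (expectZ hE) -/a; nra.
Qed.

Lemma sqrD_le (R : realType) (x y : R) : (x + y) ^+ 2 <= 2 * x ^+ 2 + 2 * y ^+ 2.
Proof. by have := sqr_ge0 (x - y); rewrite !sqrrD sqrrN; lra. Qed.

(** Because the difference of two square roots is at most their sum. It turns L1 control of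
    [g = Phi ^ 2] into L2 control of [Phi], with no lower bound on [g]. *)
Lemma sqrt_dist_sqr (R : realType) (a b : R) : 0 <= a -> 0 <= b ->
  (Num.sqrt a - Num.sqrt b) ^+ 2 <= `|a - b|.
Proof.
move=> a0 b0; rewrite -{2}(sqr_sqrtr a0) -{2}(sqr_sqrtr b0).
have := sqrtr_ge0 a; have := sqrtr_ge0 b.
move: (Num.sqrt a) (Num.sqrt b) => x y y0 x0.
rewrite subr_sqr normrM (ger0_norm (addr_ge0 x0 y0)) -real_normK ?num_real// expr2.
rewrite ler_wpM2l//; apply: le_trans (ler_normB _ _) _; rewrite !ger0_norm//.
Qed.

(** * Estimates on densities and coefficients, uniform in the mesh *)

Section lattice_estimates.
Context {R : realType}.
Variable D : porous_data R.
Notation g := (pg D).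
Notation c := (pc D).
Notation T := (pT D).
Implicit Types (n k : nat) (r eps : R).

Let n1 n : (0 : R) < n.+1%:R. Proof. by rewrite ltr0n. Qed.

Lemma cutoff_cvg : @cutoff R @ \oo --> (0 : R). Proof. exact: cvg_harmonic. Qed.

Lemma mesh_le n : mesh D n <= Num.sqrt T * cutoff n.
Proof.
rewrite /mesh /cutoff ler_wpM2l ?sqrtr_ge0// lef_pV2 ?posrE ?exprn_gt0//.
by rewrite expr2 ler_peMl ?(ltW (n1 n))// ler1n.
Qed.

Lemma step_le n : step D n <= mesh D n ^+ 2.
Proof. by rewrite -mesh_step ler_pdivrMr// ler_peMr ?sqr_ge0// ler1n. Qed.

Let cvg_dom (x : nat -> R) (b : R) : (forall n, 0 <= x n <= b * cutoff n) -> x @ \oo --> (0 : R).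
Proof.
move=> h; apply: (@squeeze_cvgr _ _ _ _ (fun=> 0) (fun n => b * @cutoff R n)).
- by apply: nearW.
- exact: cvg_cst.
- by rewrite -[X in _ --> X](mulr0 b); apply: cvgM; [exact: cvg_cst|exact: cutoff_cvg].
Qed.

Lemma mesh_cvg : mesh D @ \oo --> (0 : R).
Proof. by apply: (@cvg_dom _ (Num.sqrt T)) => n; rewrite (ltW (mesh_gt0 D n)) mesh_le. Qed.

Lemma step_cvg : step D @ \oo --> (0 : R).
Proof.
have h2 : (fun n => mesh D n ^+ 2) @ \oo --> (0 : R).
  by rewrite -[X in _ --> X](mulr0 0); apply: cvgM mesh_cvg mesh_cvg.
apply: (@squeeze_cvgr _ _ _ _ (fun=> 0) _ _ _ _ _ h2); last exact: cvg_cst.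
by apply: nearW => n; rewrite (ltW (step_gt0 D n)) step_le.
Qed.

Lemma kap_ge0 n : 0 <= kap D n.
Proof. by rewrite addr_ge0 ?sqrtr_ge0// divr_ge0 ?(ltW (mesh_gt0 D n))// (ltW (cutoff_gt0 n)). Qed.

Lemma kap_cvg : kap D @ \oo --> (0 : R).
Proof.
apply: (@cvg_dom _ (2 * Num.sqrt T)) => n; rewrite kap_ge0 /= /kap.
have h1 : mesh D n / cutoff n = Num.sqrt T * cutoff n.
  rewrite /mesh /cutoff invrK.
  by have := lt0r_neq0 (n1 n); move: (n.+1%:R : R) (Num.sqrt T) => x y x0; field.
have h2 : Num.sqrt (step D n) <= mesh D n.
  rewrite -(ler_sqr (x := Num.sqrt _)) ?nnegrE ?sqrtr_ge0 ?(ltW (mesh_gt0 D n))//.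
  by rewrite sqr_sqrtr ?step_le// ltW// step_gt0.
by rewrite h1; have := mesh_le n; lra.
Qed.

Lemma halfL_near (B : R) : \forall n \near \oo, B <= halfL D n.
Proof.
have sT : 0 < Num.sqrt T by rewrite sqrtr_gt0 pT_gt0.
near=> n; rewrite halfLE -ler_pdivrMr//.
have : B / Num.sqrt T <= n%:R by near: n; exact: nbhs_infty_ger.
by move/le_trans; apply; rewrite ler_nat.
Unshelve. all: by end_near. Qed.

Lemma near_le0 (x : nat -> R) eps : x @ \oo --> (0 : R) -> 0 < eps ->
  \forall n \near \oo, x n <= eps.
Proof.
move=> x0 e0; have : \forall n \near \oo, `|x n| <= eps by apply: cvgr0_norm_le.
by apply: filterS => n; apply: le_trans; exact: ler_norm.
Qed.

Definition width r n : nat := Num.truncn (r / mesh D n).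
Definition vav r n k : 'I_(cells n).+2 -> R := avg (width r n) (dens D n k).

(** The width is at least 1 and does not exceed the torus; [r / 2] gives the bounds on the averages,
    [r] limits the translations involved. *)
Definition good_width r n : Prop :=
  [/\ (0 < width r n)%N, (width r n <= (cells n).+2)%N &
      r / 2 <= (width r n)%:R * mesh D n <= r].

Lemma good_width_near r : 0 < r -> \forall n \near \oo, good_width r n.
Proof.
move=> r0; near=> n.
have m0 := mesh_gt0 D n.
have mr : mesh D n <= r / 2 by near: n; apply: near_le0 mesh_cvg _; lra.
have Lr : r <= halfL D n by near: n; exact: halfL_near.
have rm0 : 0 <= r / mesh D n by rewrite ltW// divr_gt0.
have /andP[h1 h2] := truncn_itv rm0.
rewrite -/(width r n) in h1 h2.
have h1' : (width r n)%:R * mesh D n <= r by rewrite -ler_pdivlMr.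
have h2' : r < (width r n)%:R * mesh D n + mesh D n.
  by rewrite -{2}(mul1r (mesh D n)) -mulrDl natr1 -ltr_pdivrMr.
split.
- by rewrite /width truncn_gt0 ler_pdivlMr// mul1r; lra.
- by rewrite -(ler_nat R) -(ler_pM2r m0) cells_mesh; lra.
- by rewrite h1'; lra.
Unshelve. all: by end_near. Qed.

Section fixed_width.
Variables (r : R) (n : nat).
Hypothesis r0 : 0 < r.
Hypothesis gw : good_width r n.
Let m0 := mesh_gt0 D n.

Let w0 : (0 < width r n)%N. Proof. by case: gw. Qed.
Let wc : (width r n <= (cells n).+2)%N. Proof. by case: gw. Qed.
Let wr : r / 2 <= (width r n)%:R * mesh D n. Proof. by case: gw => _ _ /andP[]. Qed.

Lemma vav_ge0 k i : 0 <= @vav r n k i.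
Proof. by apply: avg_ge0 => j; exact: dens_ge0. Qed.

Lemma vav_le k i : @vav r n k i <= 2 / r.
Proof.
apply: le_trans (avg_le w0 wc m0 (@dens_ge0 _ D n k) (dens_sum D n k) i) _.
by rewrite -[2 / r]invf_div lef_pV2 ?posrE ?divr_gt0// (lt_le_trans _ wr)// divr_gt0.
Qed.

Let inv_width : ((width r n)%:R ^+ 2 * mesh D n)^-1 <= 4 / r ^+ 2 * mesh D n.
Proof.
have rn : r != 0 by rewrite gt_eqF.
have h : (r / 2) ^+ 2 <= ((width r n)%:R * mesh D n) ^+ 2.
  by rewrite ler_sqr ?nnegrE// ?(le_trans _ wr)// divr_ge0// ltW.
have -> : 4 / r ^+ 2 = ((r / 2) ^+ 2)^-1 by field.
have w0' : (0 : R) < (width r n)%:R by rewrite ltr0n.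
have -> : ((width r n)%:R ^+ 2 * mesh D n)^-1 =
    (((width r n)%:R * mesh D n) ^+ 2)^-1 * mesh D n.
  by have := gt_eqF w0'; have := gt_eqF m0; move: (mesh D n) (_%:R) => x y /negbT ? /negbT ?; field; apply/andP; split.
rewrite ler_wpM2r ?(ltW m0)// lef_pV2 ?posrE//; apply: exprn_gt0; first exact: mulr_gt0.
exact: divr_gt0.
Qed.

Lemma vav_space k i (z : int) :
  `|@vav r n k (i + z%:~R) - vav r k i| <= 4 / r ^+ 2 * ((absz z)%:R * mesh D n).
Proof.
apply: le_trans (avg_shift_int w0 wc m0 (@dens_ge0 _ D n k) (dens_sum D n k) i z) _.
by rewrite [leRHS]mulrCA ler_wpM2l.
Qed.

Let absz_site (s t : history) :
  (absz (site s - site t))%:R * mesh D n = `|Xwalk D n s - Xwalk D n t|.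
Proof.
have -> : Xwalk D n s - Xwalk D n t = (site s - site t)%:~R * mesh D n.
  by rewrite /Xwalk rmorphB /=; ring.
by rewrite normrM (gtr0_norm m0) -intr_norm -abszE.
Qed.

Let torusB (s t : history) : torus n s = torus n t + (site s - site t)%:~R.
Proof. by rewrite /torus /torus_site rmorphB /= addrC subrK. Qed.

Lemma vav_site k (s t : history) :
  `|vav r k (torus n s) - vav r k (torus n t)| <= 4 / r ^+ 2 * `|Xwalk D n s - Xwalk D n t|.
Proof. by rewrite (torusB s t) -absz_site; exact: vav_space. Qed.

(** The average is the mean of a Lipschitz kernel along the walk, so its variation in time is
    controlled by the mean displacement of the walk, hence by the square root of the elapsed
    time. *)
Lemma vav_time k0 k i : (k0 <= k)%N ->
  `|@vav r n k i - vav r k0 i| <= 4 / r ^+ 2 * Num.sqrt (c * step D n * (k - k0)%:R).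
Proof.
move=> kk; have hE := mean_at_functional D n k.
have vE j : @vav r n j i = ((width r n)%:R ^+ 2 * mesh D n)^-1 *
    mean_at D n j (fun s => tent (width r n) (torus n s - i)).
  rewrite (mean_at_law D j (fun x => tent (width r n) (x - i))).
  rewrite /vav avgE//; under [in RHS]eq_bigr do rewrite -mulrA.
  rewrite -mulr_sumr mulrA; congr (_ * _).
  by rewrite [in RHS]invfM divfK// gt_eqF.
rewrite !vE -mulrBr -(mean_at_trunc D n _ kk) -(expectB hE) normrM ger0_norm; last first.
  by rewrite invr_ge0 mulr_ge0 ?sqr_ge0 ?ltW.
have rr : 0 <= 4 / r ^+ 2 by rewrite divr_ge0 ?sqr_ge0.
apply: le_trans (ler_wpM2r (normr_ge0 _) inv_width) _.
rewrite -[leLHS]mulrA; apply: ler_wpM2l => //; apply: le_trans (ler_wpM2l (ltW m0) (expect_norm hE _)) _.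
rewrite -(expectZ hE).
set f := (X in mean_at _ _ _ X).
apply: (@le_trans _ _ (mean_at D n k (fun s => `|Xwalk D n s - Xwalk D n (trunc k0 s)|))).
  apply: (expect_le hE) => s; rewrite /f -absz_site [leLHS]mulrC.
  apply: ler_wpM2r; first exact: ltW.
  by rewrite /= (torusB s (trunc k0 s)) addrAC tentD_int.
set b := mean_at _ _ _ _.
have b0 : 0 <= b by apply: (expect_ge0 hE) => s.
rewrite -[b]ger0_norm// -sqrtr_sqr; apply: ler_wsqrtr; apply: le_trans (expect_sqr _ hE) _; exact: Xwalk_sqr.
Qed.

End fixed_width.

(** Contraction transports the translation modulus of the initial cell masses to every time [k];
    [eps / 2] absorbs the factor 2 of [avg_l1]. *)
Lemma vav_l1 eps : 0 < eps -> exists2 r0, 0 < r0 & forall r, 0 < r <= r0 ->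
  \forall n \near \oo, forall k,
  \sum_i mesh D n * `|@vav r n k i - dens D n k i| <= eps.
Proof.
move=> e0; have e2 : 0 < eps / 2 by lra.
have [r1 [B [r10 B0 tr]]] := cell_mass_translation (pf_int D) (@pf_ge0 _ D) (pf_mass D) e2.
exists r1 => // r /andP[r0 rr1]; near=> n => k.
have gw : good_width r n by near: n; exact: good_width_near.
have m0 := mesh_gt0 D n; have [w0 wc /andP[_ wr]] := gw.
rewrite -mulr_sumr -ler_pdivlMl//.
apply: (@le_trans _ _ (2 * ((mesh D n)^-1 * (eps / 2)))); last by rewrite mulrCA (mulrC 2) divfK.
apply: (avg_l1 w0) => a aw; rewrite ler_pdivlMl// mulr_sumr.
apply: le_trans (dens_translation _ _ _) _.
apply: tr => //.
- near: n; exact: near_le0 mesh_cvg _.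
- near: n; exact: halfL_near.
- exact: cells_mesh.
- apply: le_trans rr1; apply: le_trans wr; rewrite ler_wpM2r ?(ltW m0)// ler_nat.
  exact: ltnW.
- exact: leq_trans aw wc.
Unshelve. all: by end_near. Qed.

(** Two radii occur: the averages of fixed radius [r1] are bounded by [2 / r1] and control the mass
    at high densities, while those of radius [r], whose own bound blows up as [r] tends to 0,
    approximate the coefficient. *)
Lemma vav_coef eps : 0 < eps -> exists2 r0, 0 < r0 & forall r, 0 < r <= r0 ->
  \forall n \near \oo, forall k, mean_at D n k (fun s =>
    (Num.sqrt (g (vav r k (torus n s))) - sig D n s) ^+ 2) <= eps.
Proof.
move=> e0; have c0 := pc_ge0 D.
pose c1 := c + 1; have c10 : 0 < c1 by rewrite /c1; lra.
(* This precision and that of [r2] make each of the two l1 terms of [coef_comparison] equal to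
   [eps / 4]. *)
have [r1 r10 h1] := @vav_l1 (eps / (8 * c1)) ltac:(by rewrite divr_gt0// mulr_gt0).
pose K := 2 / r1; have K0 : 0 < K by rewrite divr_gt0.
have e4 : 0 < eps / 4 by lra.
have [rho rho0 hrho] := continuous_uniform_segment (2 * K + 1) (@pg_cont _ D) e4.
have [N hN] := trunc_coef_cvg (@pg_cont _ D) (@pg_ge0 _ D) (@pg_le _ D) (2 * K) e4.
pose rho1 := Num.min rho 1.
have rho10 : 0 < rho1 by rewrite lt_min rho0 ltr01.
have [r2 r20 h2] := @vav_l1 (eps / 4 / c1 / (2 * K / rho1)) ltac:(by rewrite !divr_gt0// mulr_gt0).
exists r2 => // r hr; have /andP[r0 _] := hr; near=> n => k.
have m0 := mesh_gt0 D n.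
have gw1 : good_width r1 n by near: n; exact: good_width_near.
apply: (@le_trans _ _ (mean_at D n k (fun s =>
    `|g (vav r k (torus n s)) - gam D n (dens D n k (torus n s))|))).
  apply: le_mean_at => s sk; rewrite /sig /sigma /local_density sk.
  apply: sqrt_dist_sqr; first exact: pg_ge0.
  by have /andP[] := gam_itv D n (dens D n k (torus n s)).
rewrite (mean_at_law D k (fun x => `|g (vav r k x) - gam D n (dens D n k x)|)).
have gc x : 0 <= g x <= c1.
  by rewrite pg_ge0 (le_trans (pg_le D x))// lerDl.
have gamc x : 0 <= gam D n x <= c1.
  by have /andP[-> _] := gam_itv D n x; rewrite (le_trans (gam_le D n x))// lerDl.
have hw : forall k, \sum_i mesh D n * `|@vav r1 n k i - dens D n k i| <= eps / (8 * c1).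
  by near: n; apply: h1; rewrite r10 lexx.
have hv : forall k, \sum_i mesh D n * `|@vav r n k i - dens D n k i| <=
    eps / 4 / c1 / (2 * K / rho1).
  by near: n; apply: h2.
have hg x y : 0 <= x <= 2 * K -> 0 <= y <= 2 * K + rho1 -> `|x - y| <= rho1 ->
    `|g y - gam D n x| <= eps / 2.
  move=> /andP[x0 xK] /andP[y0 yK] xy.
  have rho11 : rho1 <= 1 by rewrite ge_min lexx orbT.
  have A : `|g y - g x| <= eps / 4.
    apply: hrho; rewrite ?(ger0_norm x0) ?(ger0_norm y0); [lra|lra|].
    by rewrite distrC (le_trans xy)// ge_min lexx.
  have B : `|gam D n x - g x| <= eps / 4.
    by apply: hN; rewrite ?x0 ?xK//; apply: ltnW; near: n; exact: nbhs_infty_ge.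
  have := ler_distD (g x) (g y) (gam D n x); rewrite (distrC (g x)) => /le_trans; apply.
  by rewrite (le_trans (lerD A B))//; lra.
have := coef_comparison m0 (@dens_ge0 _ D n k) (fun i => @vav_ge0 r n k i) (dens_sum D n k)
  rho10 (ltW c10) gc gamc (fun i => vav_le r10 gw1 k i) K0 hg (hw k) (hv k).
move/le_trans; apply.
have -> : 2 * K / rho1 * (eps / 4 / c1 / (2 * K / rho1)) = eps / 4 / c1.
  by rewrite mulrC divfK// gt_eqF// divr_gt0// mulr_gt0.
rewrite mulrDr [c1 * (eps / 4 / c1)]mulrC divfK ?gt_eqF//.
have -> : c1 * (2 * (eps / (8 * c1))) = eps / 4.
  by have := lt0r_neq0 c10; generalize c1 => x ?; field.
by lra.
Unshelve. all: by end_near. Qed.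

(** A quadratic form of uniform continuity, in the manner of Chebyshev's inequality, so that second
    moments of the increments suffice. *)
Lemma pg_modulus (K eps : R) : 0 < eps -> exists2 C : R, 0 <= C &
  forall a b, 0 <= a <= K -> 0 <= b <= K -> `|g a - g b| <= eps + C * (a - b) ^+ 2.
Proof.
move=> e0; have [rho rho0 hr] := continuous_uniform_segment K (@pg_cont _ D) e0.
have C0 : 0 <= c / rho ^+ 2 by rewrite divr_ge0 ?sqr_ge0 ?pc_ge0.
exists (c / rho ^+ 2) => // a b /andP[a0 aK] /andP[b0 bK].
have [ab|ab] := leP `|a - b| rho.
  apply: le_trans (hr a b _ _ ab) _; rewrite ?ger0_norm//.
  by rewrite lerDl mulr_ge0// sqr_ge0.
apply: (@le_trans _ _ c).
  have := pg_ge0 D a; have := pg_ge0 D b; have := pg_le D a; have := pg_le D b.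
  by rewrite ler_norml; lra.
apply: (@le_trans _ _ (c / rho ^+ 2 * (a - b) ^+ 2)); last by rewrite lerDr ltW.
rewrite -[leLHS](divfK (x := rho ^+ 2)) ?gt_eqF ?exprn_gt0// ler_wpM2l//.
by rewrite -[(a - b) ^+ 2]real_normK ?num_real// ler_sqr ?nnegrE// ltW.
Qed.

Lemma vav_increment r eps : 0 < r -> 0 < eps -> exists2 C : R, 0 <= C &
  forall n, good_width r n -> forall k0 k, (k0 <= k)%N -> mean_at D n k (fun s =>
    `|g (vav r k0 (torus n (trunc k0 s))) - g (vav r k (torus n s))|) <=
    eps + C * (step D n * (k - k0)%:R).
Proof.
move=> r0 e0; have [C C0 hC] := pg_modulus (2 / r) e0.
have c0 := pc_ge0 D.
pose q := 4 / r ^+ 2; have q0 : 0 <= q by rewrite divr_ge0 ?sqr_ge0.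
exists (C * (4 * q ^+ 2 * c)); first by rewrite mulr_ge0// mulr_ge0// mulr_ge0// exprn_ge0.
move=> n gw k0 k kk; have hE := mean_at_functional D n k.
pose h := step D n * (k - k0)%:R.
have h0 : 0 <= h by rewrite mulr_ge0// ltW// step_gt0.
apply: (@le_trans _ _ (mean_at D n k (fun s => (C * (2 * q ^+ 2)) *
    (Xwalk D n s - Xwalk D n (trunc k0 s)) ^+ 2 + (eps + C * (2 * q ^+ 2 * (c * h)))))).
  apply: (expect_le hE) => s.
  have v2 k' s' : 0 <= vav r k' (torus n s') <= 2 / r by rewrite vav_ge0 vav_le.
  apply: le_trans (hC _ _ (v2 _ _) (v2 _ _)) _.
  set a := vav r k0 (torus n (trunc k0 s)); set b := vav r k (torus n s).
  (* The increment is split at the new time and the old site: [A] is regularity in time, [B]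
     regularity in space. *)
  pose d := vav r k (torus n (trunc k0 s)).
  have A : (a - d) ^+ 2 <= q ^+ 2 * (c * h).
    have := vav_time r0 gw (torus n (trunc k0 s)) kk; rewrite -/a -/d -/q => hd.
    have ch : 0 <= c * step D n * (k - k0)%:R by rewrite -mulrA mulr_ge0.
    rewrite -[(a - d) ^+ 2]real_normK ?num_real// distrC.
    apply: (@le_trans _ _ ((q * Num.sqrt (c * step D n * (k - k0)%:R)) ^+ 2)).
      by rewrite ler_sqr ?nnegrE// mulr_ge0// sqrtr_ge0.
    by rewrite exprMn sqr_sqrtr// /h mulrA.
  have B : (d - b) ^+ 2 <= q ^+ 2 * (Xwalk D n s - Xwalk D n (trunc k0 s)) ^+ 2.
    have := vav_site r0 gw k s (trunc k0 s); rewrite -/b -/d -/q => hd.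
    rewrite -[(d - b) ^+ 2]real_normK ?num_real// distrC -exprMn.
    rewrite -[(q * _) ^+ 2]real_normK ?num_real// normrM (ger0_norm q0).
    by rewrite ler_sqr ?nnegrE// mulr_ge0.
  have AB : (a - b) ^+ 2 <= 2 * (q ^+ 2 * (c * h)) +
      2 * (q ^+ 2 * (Xwalk D n s - Xwalk D n (trunc k0 s)) ^+ 2).
    apply: (@le_trans _ _ (2 * (a - d) ^+ 2 + 2 * (d - b) ^+ 2)); last by lra.
    have -> : a - b = (a - d) + (d - b) by ring.
    exact: sqrD_le.
  by have := ler_wpM2l C0 AB; lra.
rewrite (expect_lin hE) (expect_cst hE).
have := ler_wpM2l (mulr_ge0 C0 (mulr_ge0 (ler0n R 2) (sqr_ge0 q))) (Xwalk_sqr D n kk).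
by rewrite -[c * _ * _]mulrA -/h; lra.
Qed.

(** [C] depends on the radius and is not controlled as [r] tends to 0; hence the radius is fixed
    first and the time partition refined afterwards. *)
Lemma coef_error eps : 0 < eps -> exists2 r0, 0 < r0 & forall r, 0 < r <= r0 ->
  exists2 C : R, 0 <= C & \forall n \near \oo, forall k0 k, (k0 <= k)%N ->
  mean_at D n k (fun s =>
    (Num.sqrt (g (vav r k0 (torus n (trunc k0 s)))) - sig D n s) ^+ 2) <=
  eps + C * (step D n * (k - k0)%:R).
Proof.
move=> e0; have e4 : 0 < eps / 4 by lra.
have [r0 r00 h0] := vav_coef e4; exists r0 => // r hr; have /andP[rp _] := hr.
have [C C0 hC] := vav_increment rp e4.
exists (2 * C); first by rewrite mulr_ge0.
near=> n => k0 k kk; have hE := mean_at_functional D n k.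
have gw : good_width r n by near: n; exact: good_width_near.
have hA := hC n gw k0 k kk.
have hB : forall k, mean_at D n k (fun s =>
    (Num.sqrt (g (vav r k (torus n s))) - sig D n s) ^+ 2) <= eps / 4.
  by near: n; exact: h0.
apply: (@le_trans _ _ (mean_at D n k (fun s =>
   2 * `|g (vav r k0 (torus n (trunc k0 s))) - g (vav r k (torus n s))| +
   2 * (Num.sqrt (g (vav r k (torus n s))) - sig D n s) ^+ 2))).
  apply: (expect_le hE) => s.
  have := sqrt_dist_sqr (pg_ge0 D (vav r k0 (torus n (trunc k0 s))))
    (pg_ge0 D (vav r k (torus n s))).
  set x := Num.sqrt _; set y := Num.sqrt _; set z := sig D n s => hxy.
  have := sqrD_le (x - y) (y - z); rewrite subrKA; lra.
rewrite (expect_lin hE) (expectZ hE); have := hB k; lra.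
Unshelve. all: by end_near. Qed.

(** * The discrete isometry for a stochastic sum against the walk *)

Section mixed_isometry.
Variables (n q : nat) (kk : nat -> nat) (S : nat -> history (E := move) -> R) (B : R).
Hypothesis kk0 : kk 0%N = 0%N.
Hypothesis kkS : forall i, (kk i <= kk i.+1)%N.
Hypothesis SB : forall i j, (i < q)%N -> (kk i <= j < kk i.+1)%N ->
  mean_at D n j (fun s => (S i (trunc (kk i) s) - sig D n s) ^+ 2) <= B.

Definition ito_sum l (s : history) : R := \sum_(i < q) S i (trunc (kk i) s) *
  (Wwalk D n (trunc (minn (kk i.+1) l) s) - Wwalk D n (trunc (minn (kk i) l) s)).

Let active i (s : history (E := move)) : R := (kk i <= size s.2 < kk i.+1)%N%:R.
Let Sbar s : R := \sum_(i < q) S i (trunc (kk i) s) * active i s.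
Let d s e := Sbar s * dW n.+1%:R (gam D n) (mesh D n) (cutoff n) (u0d D n) s e - dX (mesh D n) e.
Let M s := ito_sum (size s.2) s - (Xwalk D n s - Xwalk D n (trunc 0 s)).

Let dM s e : (0 <= size s.2)%N -> M (extend s e) = M s + d s e.
Proof.
move=> _; rewrite /M Xwalk_extend trunc_extend//.
rewrite (_ : ito_sum _ (extend s e) = ito_sum (size s.2) s +
    Sbar s * dW n.+1%:R (gam D n) (mesh D n) (cutoff n) (u0d D n) s e).
  by rewrite /d; ring.
rewrite /ito_sum /Sbar mulr_suml -big_split /=; apply: eq_bigr => i _.
rewrite /active; set k := size s.2.
have tS : trunc k.+1 (extend s e) = extend s e by rewrite -[in RHS](trunc_size (extend s e)).
have tk : trunc k s = s by exact: trunc_size.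
(* The [i]-th interval is over, current, or not yet begun; only the current one receives the new
   increment. *)
have /orP[k1|k1] : (kk i.+1 <= k)%N || (k < kk i.+1)%N by rewrite leqNgt orNb.
  have k0 := leq_trans (kkS i) k1.
  rewrite (minn_idPl (leqW k1)) (minn_idPl k1) (minn_idPl k0) (minn_idPl (leqW k0)).
  by rewrite !trunc_extend// [(k < _)%N]ltnNge k1 andbF mulr0 mul0r addr0.
have /orP[k0|k0] : (kk i <= k)%N || (k < kk i)%N by rewrite leqNgt orNb.
  rewrite (minn_idPr k1) (minn_idPr (ltnW k1)) (minn_idPl k0) (minn_idPl (leqW k0)).
  rewrite [trunc (kk i) (extend s e)]trunc_extend// tS tk [Wwalk D n (extend _ _)]brownian_walk_extend.
  by rewrite k0 k1 -/(Wwalk D n s) /=; ring.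
rewrite (minn_idPr k1) (minn_idPr (ltnW k1)) (minn_idPr (ltnW k0)) (minn_idPr k0).
by rewrite tS tk [(_ <= k)%N]leqNgt k0 !subrr !mulr0 mul0r addr0.
Qed.

Let find_active j : (j < kk q)%N -> exists2 i : 'I_q, (kk i <= j < kk i.+1)%N &
  forall i', i' != i -> (kk (i' : 'I_q) <= j < kk i'.+1)%N = false.
Proof.
have mono a b : (a <= b)%N -> (kk a <= kk b)%N.
  exact: homo_leq leqnn leq_trans kkS _ _.
have ex p : (j < kk p)%N -> exists2 i, (i < p)%N & (kk i <= j < kk i.+1)%N.
  elim: p => [|p IH]; first by rewrite kk0.
  by have [/IH[i ip h] _|pj jp] := ltnP j (kk p); [exists i => //; exact: leqW|exists p; rewrite ?pj].
move=> /ex[i iq /andP[i1 i2]]; exists (Ordinal iq); first by rewrite /= i1 i2.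
move=> i' /eqP ne; apply/negbTE/negP => /andP[h1 h2]; apply: ne; apply/val_inj => /=.
apply/eqP; rewrite eqn_leq; apply/andP; split; rewrite leqNgt; apply/negP => /mono h.
  by have := leq_ltn_trans (leq_trans h h1) i2; rewrite ltnn.
by have := leq_ltn_trans (leq_trans h i1) h2; rewrite ltnn.
Qed.

(** The difference of the stochastic sum and of [Xwalk] is a single martingale, whose conditional
    variance is bounded by [dW_dX_var] at degenerate sites as well. *)
Lemma mixed_isometry l : (l <= kk q)%N ->
  mean_at D n l (fun s => (ito_sum l s - (Xwalk D n s - Xwalk D n (trunc 0 s))) ^+ 2) <=
  (step D n * l%:R) * (2 * B + 3 * cutoff n ^+ 2).
Proof.
move=> lq.
pose V s := step D n * (2 * (Sbar s - sig D n s) ^+ 2 + 3 * @cutoff R n ^+ 2).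
have wd0 s : \sum_e chain_wt n.+1%:R (gam D n) (u0d D n) s e * d s e = 0.
  under eq_bigr do rewrite mulrBr mulrCA; rewrite sumrB -mulr_sumr dX_mean subr0.
  by rewrite dW_mean mulr0.
have wdV s : \sum_e chain_wt n.+1%:R (gam D n) (u0d D n) s e * d s e ^+ 2 <= V s.
  rewrite /V -mesh_step.
  exact: (dW_dX_var (u0d D n) (n1 n) (gam_itv D n) (mesh_gt0 D n) (cutoff_gt0 n) s (Sbar s)).
have := martingale_sqr (chain_init_ge0 (mesh_gt0 D n) (@u0d_ge0 _ D n))
  (chain_init_sum (u0d_sum D n)) (chain_wt_ge0 (u0d D n) (n1 n) (gam_itv D n))
  (chain_wt_sum _ _ _) dM wd0 wdV (leq0n l).
rewrite -/(mean_at D n l) -/(mean_at D n 0).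
have -> : mean_at D n 0 (fun s => M s ^+ 2) = 0.
  rewrite -[RHS](expect0 (mean_at_functional D n 0)); apply: eq_mean_at => s s0.
  have ts : trunc 0 s = s by rewrite -s0 trunc_size.
  rewrite (_ : M s = 0) ?expr0n// /M ts [X in _ - X]subrr s0 subr0 /ito_sum big1// => i _.
  by rewrite !minn0 subrr mulr0.
rewrite add0r => h.
have -> : mean_at D n l (fun s => (ito_sum l s - (Xwalk D n s - Xwalk D n (trunc 0 s))) ^+ 2) =
    mean_at D n l (fun s => M s ^+ 2).
  by apply: eq_mean_at => s sl; rewrite /M sl.
apply: le_trans h _; rewrite big_mkord.
apply: (@le_trans _ _ (\sum_(j < l) step D n * (2 * B + 3 * @cutoff R n ^+ 2))); last first.
  by rewrite sumr_const card_ord -[_ *+ l]mulr_natr mulrAC.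
apply: ler_sum => j _; have hE := mean_at_functional D n j.
rewrite -/(mean_at D n j) /V (expectZ hE) ler_wpM2l ?(ltW (step_gt0 D n))//.
rewrite (expect_lin hE) (expect_cst hE) lerD2r ler_wpM2l//.
have [i hi hi'] := find_active (leq_trans (ltn_ord j) lq).
apply: le_trans (SB (ltn_ord i) hi); apply: le_mean_at => s sj.
rewrite /Sbar (bigD1 i)//= /active sj hi mulr1 big1 ?addr0// => i' ne.
by rewrite hi'// mulr0.
Qed.

End mixed_isometry.

End lattice_estimates.
Arguments vav {R} D r n k _.

(** * Limit paths and their filtration *)

Section approximable_sets.
Context {R : realType} {d : measure_display} {Omega : measurableType d}.
Variables (P : probability Omega R) (C : set (set Omega)).

Definition symdiff (A B : set Omega) := (A `\` B) `|` (B `\` A).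

(** The closure of [C] for the pseudo-distance [P (symdiff A B)]. Internal events form an algebra
    but not a sigma-algebra; their closure is one. *)
Definition approximable : set (set Omega) := [set A | measurable A /\
  forall eps : R, 0 < eps -> exists2 B, C B & (P (symdiff A B) <= eps%:E)%E].

Hypothesis mC : C `<=` measurable.

Lemma measurable_symdiff A B : measurable A -> measurable B -> measurable (symdiff A B).
Proof. by move=> mA mB; apply: measurableU; exact: measurableD. Qed.

Lemma sub_approximable : C `<=` approximable.
Proof.
move=> B CB; split; first exact: mC.
move=> eps e0; exists B => //.
by rewrite /symdiff setDv setU0 measure0 lee_fin ltW.
Qed.

Hypothesis C0 : C set0.
Hypothesis CC : forall A, C A -> C (~` A).
Hypothesis CU : forall A B, C A -> C B -> C (A `|` B).

(** A countable union is cut after [n] sets, leaving mass at most [eps / 2], and each of these is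
    approximated up to [eps / (2 * n.+1)]. *)
Lemma sigma_algebra_approximable : sigma_algebra setT approximable.
Proof.
split; first exact: sub_approximable.
- move=> A [mA hA]; rewrite setTD; split; first exact: measurableC.
  move=> eps /hA[B CB hB]; exists (~` B); first exact: CC.
  suff -> : symdiff (~` A) (~` B) = symdiff A B by [].
  by rewrite /symdiff !setDE !setCK setUC; congr (_ `|` _); rewrite setIC.
move=> A hA; have mA i : measurable (A i) by case: (hA i).
have mUA : measurable (\bigcup_k A k) by exact: bigcupT_measurable.
split => // eps e0.
pose F n := \big[setU/set0]_(i < n) A i.
have mF n : measurable (F n) by apply: bigsetU_measurable => i _.
pose Dn n := (\bigcup_k A k) `\` F n.
have mD n : measurable (Dn n) by exact: measurableD.
have cap0 : \bigcap_n Dn n = set0.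
  rewrite -subset0 => w Dw; have [[k _ Aw] _] := Dw 0%N I.
  by have [_ ] := Dw k.+1 I; apply; rewrite /F big_ord_recr /=; right.
have : (P \o Dn) x @[x --> \oo] --> P (\bigcap_n Dn n).
  apply: nonincreasing_cvg_mu => [|//||m n mn].
  - by apply: le_lt_trans (probability_le1 P (mD 0%N)) _; exact: ltry.
  - by rewrite cap0.
  - apply/subsetPset => w [Aw Fw]; split => //; apply: contra_not Fw.
    by rewrite /F -!(bigcup_mkord _ A) => -[i /= im Ai]; exists i => //=; exact: leq_trans im mn.
rewrite cap0 measure0 => cvD.
have [n hn] : exists n, (P (Dn n) <= (eps / 2)%:E)%E.
  have : nbhs (0%E : \bar R) [set x | (x < (eps / 2)%:E)%E].
    by apply: open_nbhs_nbhs; split; [exact: open_ereal_lt_ereal|rewrite /= lte_fin divr_gt0].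
  move=> /cvD [N _ /(_ N (leqnn N))] /= h.
  by exists N; exact: ltW.
have hB i : exists B, C B /\ (P (symdiff (A i) B) <= (eps / (2 * n.+1%:R))%:E)%E.
  have [|B CB hB] := (hA i).2 (eps / (2 * n.+1%:R)); first by rewrite divr_gt0// mulr_gt0.
  by exists B.
pose B i := projT1 (cid (hB i)).
have [CB PB] : (forall i, C (B i)) /\
    forall i, (P (symdiff (A i) (B i)) <= (eps / (2 * n.+1%:R))%:E)%E.
  by split => i; rewrite /B; case: cid => ? [].
have mB i : measurable (B i) by exact: mC.
have CF m : C (\big[setU/set0]_(i < m) B i).
  by elim: m => [|m IH]; rewrite ?big_ord0// big_ord_recr /=; exact: CU.
exists (\big[setU/set0]_(i < n) B i) => //.
have mE i : measurable (symdiff (A i) (B i)) by exact: measurable_symdiff.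
apply: (@le_trans _ _ (P (Dn n `|` \big[setU/set0]_(i < n) symdiff (A i) (B i)))).
  apply: le_measure; rewrite ?inE.
  - by apply: measurable_symdiff => //; exact: mC.
  - apply: measurableU; first exact: measurableD.
    by apply: bigsetU_measurable => i _.
  rewrite -!bigcup_mkord => w [[[k _ Aw] Bw]|[[k /= kn Bw] Aw]].
    have [h|h] := pselect (F n w); last by left; split => //; exists k.
    right; move: h; rewrite /F -bigcup_mkord => -[j /= jn Aj].
    by rewrite -(bigcup_mkord n (fun i => symdiff (A i) (B i))); exists j => //; left; split => // Bj; apply: Bw; exists j.
  by right; rewrite -(bigcup_mkord n (fun i => symdiff (A i) (B i))); exists k => //; right; split => // Ak; apply: Aw; exists k.
apply: le_trans (measureU2 _ _ _) _ => //.
  by apply: bigsetU_measurable => i _.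
have -> : eps = eps / 2 + eps / 2 by lra.
rewrite EFinD; apply: leeD => //.
apply: le_trans (@le_mu_bigsetU _ _ _ P (fun i => symdiff (A i) (B i)) n (fun i _ => mE i)) _.
apply: (@le_trans _ _ (\sum_(i < n) (eps / (2 * n.+1%:R))%:E)); first by apply: lee_sum => i _; exact: PB.
rewrite sumEFin lee_fin sumr_const card_ord -[_ *+ n]mulr_natr invfM.
rewrite (_ : _ * n%:R = eps / 2 * (n%:R / n.+1%:R)); last first.
  by move: (n.+1%:R^-1) (2^-1) => x y; ring.
rewrite -[leRHS]mulr1 ler_wpM2l ?divr_ge0 ?(ltW e0)//.
by rewrite ler_pdivrMr// mul1r ler_nat.
Qed.

Lemma approximable_full A : measurable A -> P A = 1%E -> approximable A.
Proof.
move=> mA PA; split => // eps e0; exists setT; first by rewrite -setC0; exact: CC.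
by rewrite /symdiff setDT set0U setTD probability_setC// PA subee// lee_fin ltW.
Qed.

End approximable_sets.

Lemma sub_approximable_of (R : realType) (d : measure_display) (Omega : measurableType d)
  (P : probability Omega R) (C C' : set (set Omega)) :
  C `<=` C' -> approximable P C `<=` approximable P C'.
Proof. by move=> CC' A [mA hA]; split => // eps /hA[B /CC' CB hB]; exists B. Qed.

(** * Real times and discrete times *)

Section time_grid.
Context {R : realType}.
Variable D : porous_data R.
Notation T := (pT D).
Implicit Types (n k : nat) (s t : R).

(** Times outside [[0, T]] are projected, so that the limit processes are defined and continuous on
    the whole line. *)
Definition clip t : R := Num.min (Num.max t 0) T.
Definition grid n t : nat := Num.truncn (clip t / step D n).

Lemma clip_itv t : 0 <= clip t <= T.
Proof. by rewrite /clip le_min le_max lexx orbT (ltW (pT_gt0 D)) ge_min lexx orbT. Qed.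

Lemma clip_id t : 0 <= t <= T -> clip t = t.
Proof. by move=> /andP[t0 tT]; rewrite /clip max_l// min_l. Qed.

Lemma clip_nd s t : s <= t -> clip s <= clip t.
Proof. by move=> st; apply: le_min2; rewrite ?le_max2. Qed.

Lemma clip_lip s t : `|clip s - clip t| <= `|s - t|.
Proof.
wlog st : s t / s <= t => [h|].
  by have [/h//|/ltW/h] := leP s t; rewrite distrC (distrC t).
rewrite distrC (distrC s) !ger0_norm ?subr_ge0// ?clip_nd//.
rewrite lerBlDr /clip addr_minr addr_maxr.
apply: le_min2; last by rewrite lerDr subr_ge0.
by apply: le_max2; rewrite ?subrK ?addr0 ?subr_ge0.
Qed.

Let cs0 n t : 0 <= clip t / step D n.
Proof. by have /andP[c0 _] := clip_itv t; rewrite divr_ge0// ltW// step_gt0. Qed.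

Lemma grid_itv n t : step D n * (grid n t)%:R <= clip t < step D n * (grid n t)%:R + step D n.
Proof.
have h0 := step_gt0 D n; have /andP[h1 h2] := truncn_itv (cs0 n t).
rewrite mulrC -ler_pdivlMr// h1 /= -{2}(mul1r (step D n)) -mulrDl natr1.
by rewrite -ltr_pdivrMr.
Qed.

Lemma grid_le n t : (grid n t <= steps n)%N.
Proof.
rewrite -(ler_nat R) -(ler_pM2l (step_gt0 D n)).
have /andP[h _] := grid_itv n t; apply: le_trans h _.
by rewrite mulrC steps_step; have /andP[] := clip_itv t.
Qed.

Lemma grid_mono n s t : s <= t -> (grid n s <= grid n t)%N.
Proof.
move=> st; by apply: le_truncn; rewrite ler_pM2r ?invr_gt0 ?step_gt0// clip_nd.
Qed.

Lemma grid_min n s t : grid n (Num.min s t) = minn (grid n s) (grid n t).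
Proof.
by have [st|/ltW st] := leP s t; have h := grid_mono n st; [rewrite (minn_idPl h)|rewrite (minn_idPr h)].
Qed.

Lemma grid0 n : grid n 0 = 0%N.
Proof. by rewrite /grid clip_id ?mul0r ?truncn0// lexx ltW// pT_gt0. Qed.

Lemma gridT n : grid n T = steps n.
Proof.
rewrite /grid clip_id ?lexx ?(ltW (pT_gt0 D))//.
by rewrite -{1}(steps_step D n) mulfK ?natrK// gt_eqF// step_gt0.
Qed.

Lemma grid_increment n s t : s <= t ->
  `|step D n * (grid n t - grid n s)%:R - (clip t - clip s)| <= step D n.
Proof.
move=> st; rewrite natrB ?grid_mono//.
have := grid_itv n s; have := grid_itv n t.
rewrite mulrBr; move: (step D n * _) (step D n * _) => x y /andP[? ?] /andP[? ?].
by rewrite ler_norml; lra.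
Qed.

Lemma grid_increment_cvg s t : 0 <= s -> s <= t -> t <= T ->
  (fun n => step D n * (grid n t - grid n s)%:R) @ \oo --> t - s.
Proof.
move=> s0 st tT; apply/cvgrPdist_le => e e0.
have h := near_le0 (step_cvg D) e0.
apply: filterS h => n h; rewrite distrC.
have := grid_increment n st; rewrite !clip_id ?s0 ?tT ?(le_trans s0 st) ?(le_trans st tT)//.
by move=> /le_trans; apply.
Qed.

End time_grid.

Lemma null_of_bounds (R : realType) (d : measure_display) (Omega : measurableType d)
    (P : probability Omega R) (A : set Omega) (K : R) : measurable A ->
  (forall m : nat, (P A <= (K / m.+1%:R)%:E)%E) -> P A = 0%E.
Proof.
move=> mA h; apply/eqP; rewrite eq_le measure_ge0 andbT; apply/lee_addgt0Pr => e e0.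
rewrite add0e; pose m := Num.truncn (K / e).
apply: le_trans (h m) _; rewrite lee_fin ler_pdivrMr ?ltr0n// mulrC -ler_pdivrMr//.
have [Ke|Ke] := leP 0 (K / e); last exact: le_trans (ltW Ke) _.
by have /andP[_ /ltW] := truncn_itv Ke.
Qed.

(** * S-continuity of the walks *)

Section s_continuity.
Context {R : realType}.
Variable D : porous_data R.
Notation T := (pT D).
Context (U : set_system nat) {UU : UltraFilter U}.
Hypothesis U_cofinite : (\oo : set_system nat) `<=` U.
Context {d : measure_display} {Omega : measurableType d}.
Variables (P : probability Omega R) (ev : Omega -> nat -> history (E := move)).
Hypothesis hP : forall B, measurable (iset U ev B) /\
  P (iset U ev B) = (ulim U (fun n => Emean D n (\1_(B n))))%:E.
Implicit Types (n k : nat) (s t : R).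

Section one_walk.
Variables (M : nat -> history (E := move) -> R) (C : R) (kp : nat -> R).
Hypothesis C0 : 0 <= C.
Hypothesis kp0 : kp @ \oo --> (0 : R).
Hypothesis hit4 : forall n eps k0 k, 0 < eps -> (k0 <= k)%N ->
  eps ^+ 4 * mean_at D n k (fun h => (hit (M n) eps k0 h)%:R) <=
  8 * (C * step D n * (k - k0)%:R) ^+ 2 + 3 * kp n ^+ 2 * (C * step D n * (k - k0)%:R).

(** [eps] and [rho] are standard, whereas the indices where the bound holds may depend on [s] and
    [t]: this is enough for the standard part to be continuous. The first clause makes truncation at
    grid times meaningful. *)
Definition s_continuous w := [/\ \forall n \near U, size (ev w n).2 = steps n,
  exists K : R, \forall n \near U, forall j, (j <= steps n)%N ->
    `|M n (trunc j (ev w n)) - M n (trunc 0 (ev w n))| <= K &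
  forall eps : R, 0 < eps -> exists2 rho : R, 0 < rho & forall s t, 0 <= s -> s <= t -> t <= T ->
    t - s <= rho -> \forall n \near U,
    `|M n (trunc (grid D n t) (ev w n)) - M n (trunc (grid D n s) (ev w n))| <= eps].

Let hitset (eps t0 t1 : R) n : set (history (E := move)) :=
  [set h | hit (M n) eps (grid D n t0) (trunc (grid D n t1) h)].
Let A eps t0 t1 := iset U ev (hitset eps t0 t1).

Let mA eps t0 t1 : measurable (A eps t0 t1). Proof. exact: (hP _).1. Qed.

Let prob_hit eps t0 t1 b : 0 < eps -> t0 <= t1 ->
  (\forall n \near \oo, let x := C * step D n * (grid D n t1 - grid D n t0)%:R in
     8 * x ^+ 2 + 3 * kp n ^+ 2 * x <= eps ^+ 4 * b) ->
  (P (A eps t0 t1) <= b%:E)%E.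
Proof.
move=> e0 t01 h; rewrite (hP _).2 lee_fin.
apply: ulim_le.
  apply: (ubounded_expect (Emean_functional D) (K := 1)) => n s.
  rewrite ger0_norm; first by rewrite indicE lern1 leq_b1.
  by rewrite indicE.
apply: near_oo_U => //; apply: filterS h => n /=.
have e40 : 0 < eps ^+ 4 by rewrite exprn_gt0.
set x := C * _ * _ => h; rewrite -(ler_pM2l e40); apply: le_trans h.
rewrite /Emean (_ : \1_(hitset eps t0 t1 n) =
  (fun h => (hit (M n) eps (grid D n t0) h)%:R) \o trunc (grid D n t1)).
  rewrite mean_at_trunc ?grid_le//; apply: hit4 => //; exact: grid_mono.
apply: funext => h; rewrite indicE /=.
by have [hh|/negP hh] := boolP (hit _ _ _ _); [rewrite mem_set|rewrite memNset].
Qed.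

Let tt m j : R := j%:R * (T / m.+1%:R).
Let bad_size := iset U ev (fun n => [set h | size h.2 <> steps n]).
Let bad_bound := \bigcap_K A K.+1%:R 0 T.
(** The intervals overlap, each spanning two parts, so that any two times at distance at most
    [T / m.+1] lie in a common one. *)
Let bad_mesh p m := \big[setU/set0]_(j < m.+1) A (p.+1%:R^-1) (tt m j) (tt m j.+2).
Let bad_cont := \bigcup_p \bigcap_m bad_mesh p m.

Let T0 : 0 < T := pT_gt0 D.

Let kp_near (e : R) : 0 < e -> \forall n \near \oo, kp n ^+ 2 <= e.
Proof.
move=> e0; apply: near_le0 => //.
by rewrite -[X in _ --> X](mulr0 0); apply: cvgM kp0 kp0.
Qed.

Let null_size : P bad_size = 0%E.
Proof.
rewrite (hP _).2; congr (_%:E).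
rewrite -[RHS](@ulim_cst R U _ 0); apply: eq_ulim => //; apply: nearW => n.
rewrite -[RHS](expect0 (mean_at_functional D n (steps n))); apply: eq_mean_at => h hs.
by rewrite indicE memNset//= hs.
Qed.

Let inc_ge0 n k : 0 <= C * step D n * k%:R.
Proof. by rewrite !mulr_ge0// ltW// step_gt0. Qed.

Let null_bound : P bad_bound = 0%E.
Proof.
have mB : measurable bad_bound by exact: bigcapT_measurable.
apply: (@null_of_bounds _ _ _ _ _ (8 * (C * T) ^+ 2 + 3 * (C * T))) => // m.
apply: (@le_trans _ _ (P (A m.+1%:R 0 T))).
  by apply: le_measure; rewrite ?inE//; exact: bigcap_inf.
apply: prob_hit => //; first exact: ltW.
have k1 := @kp_near 1 ltr01; apply: filterS k1 => n k1 /=.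
rewrite grid0 subn0 gridT -mulrA [step D n * _]mulrC steps_step.
have CT : 0 <= C * T by rewrite mulr_ge0// ltW.
apply: (@le_trans _ _ (8 * (C * T) ^+ 2 + 3 * (C * T))).
  by rewrite lerD2l ler_wpM2r// ler_piMr.
have m1 : (1 : R) <= m.+1%:R by rewrite ler1n.
have := ltr0Sn R m; move: (m.+1%:R : R) m1 => y y1 y0.
set X := 8 * _ + _.
have X0 : 0 <= X by rewrite addr_ge0// mulr_ge0// sqr_ge0.
have -> : y ^+ 4 * (X / y) = X * y ^+ 3 by field; rewrite gt_eqF.
by rewrite ler_peMr// exprn_ege1.
Qed.

Let tt_le m j : tt m j <= tt m j.+2.
Proof. by rewrite ler_wpM2r ?divr_ge0 ?(ltW T0)// ler_nat ltnW. Qed.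

Let mbad_mesh p m : measurable (bad_mesh p m).
Proof. by apply: bigsetU_measurable => j _. Qed.

(** By the fourth moment each of the [m.+1] intervals is bad with probability of order [1 / m ^ 2],
    which leaves [1 / m] after summation. The jump term is harmless because [kp n ^+ 2 <= 1 / m.+1]
    for large [n]. *)
Let null_cont p : P (\bigcap_m bad_mesh p m) = 0%E.
Proof.
have mB : measurable (\bigcap_m bad_mesh p m) by exact: bigcapT_measurable.
(* An interval lasts two parts plus a rounding of at most one part, whence the factor 3. *)
pose K := 8 * (3 * (C * T)) ^+ 2 + 9 * (C * T).
have CT : 0 <= C * T by rewrite mulr_ge0// ltW.
apply: (@null_of_bounds _ _ _ _ _ (K * p.+1%:R ^+ 4)) => // m.
apply: (@le_trans _ _ (P (bad_mesh p m))).
  by apply: le_measure; rewrite ?inE//; exact: bigcap_inf.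
apply: le_trans (@le_mu_bigsetU _ _ _ P (fun j => A p.+1%:R^-1 (tt m j) (tt m j.+2)) m.+1 _) _ => //.
have m0 : (0 : R) < m.+1%:R by rewrite ltr0n.
apply: (@le_trans _ _ (\sum_(j < m.+1) (K * p.+1%:R ^+ 4 / m.+1%:R ^+ 2)%:E)); last first.
  rewrite sumEFin lee_fin sumr_const card_ord -[_ *+ m.+1]mulr_natr.
  rewrite expr2 invfM !mulrA divfK// gt_eqF//.
apply: lee_sum => j _; apply: prob_hit; [by rewrite invr_gt0|exact: tt_le|].
have k1 := @kp_near m.+1%:R^-1 ltac:(by rewrite invr_gt0).
have h1 := near_le0 (step_cvg D) (divr_gt0 T0 m0).
near=> n => /=.
have kn : kp n ^+ 2 <= m.+1%:R^-1 by near: n.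
have hn : step D n <= T / m.+1%:R by near: n.
rewrite (_ : _ ^+ 4 * _ = K / m.+1%:R ^+ 2); last first.
  have : p.+1%:R != 0 :> R by rewrite pnatr_eq0.
  by move: (m.+1%:R) m0 (p.+1%:R) => x x0 y y0; field; rewrite y0 gt_eqF.
set x := C * _ * _.
have x0 : 0 <= x by exact: inc_ge0.
have xle : x <= 3 * (C * T) / m.+1%:R.
  rewrite /x -mulrA (_ : 3 * _ / _ = C * (3 * (T / m.+1%:R))); last by ring.
  apply: ler_wpM2l => //.
  have := grid_increment D n (tt_le m j).
  have : clip D (tt m j.+2) - clip D (tt m j) <= 2 * (T / m.+1%:R).
    apply: le_trans (ler_norm _) _; apply: le_trans (clip_lip _ _ _) _.
    have -> : tt m j.+2 - tt m j = 2 * (T / m.+1%:R) by rewrite /tt -addn2 natrD; ring.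
    by rewrite ger0_norm// mulr_ge0// divr_ge0// ltW.
  move: hn; move: (step D n) (step D n * _) (clip D (tt m j.+2) - _) (T / _) => st a b e hn h2.
  by rewrite ler_norml => /andP[_ h3]; lra.
have y0 : 0 <= m.+1%:R^-1 :> R by rewrite invr_ge0.
rewrite -exprVn; move: (m.+1%:R^-1) kn xle y0 => y kn xle y0.
apply: (@le_trans _ _ (8 * (3 * (C * T) * y) ^+ 2 + 3 * y * (3 * (C * T) * y))); last by rewrite /K; lra.
apply: lerD.
  rewrite ler_wpM2l// ler_sqr ?nnegrE//.
  by rewrite mulr_ge0// mulr_ge0.
apply: ler_pM => //; first by rewrite mulr_ge0// sqr_ge0.
by rewrite ler_wpM2l.
Unshelve. all: by end_near. Qed.

Definition bad_paths := bad_size `|` (bad_bound `|` bad_cont).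

Lemma measurable_bad_paths : measurable bad_paths.
Proof.
apply: measurableU; first exact: (hP _).1.
apply: measurableU; first exact: bigcapT_measurable.
by apply: bigcupT_measurable => p; exact: bigcapT_measurable.
Qed.

Lemma null_bad_paths : P bad_paths = 0%E.
Proof.
apply: measure_negligible; first exact: measurable_bad_paths.
apply: negligibleU.
  by exists bad_size; split => //; exact: (hP _).1.
apply: negligibleU.
  by exists bad_bound; split => //; exact: bigcapT_measurable.
apply: negligible_bigcup => p; exists (\bigcap_m bad_mesh p m).
by split => //; [exact: bigcapT_measurable|exact: null_cont].
Qed.

Let not_iset B w : ~ iset U ev B w -> \forall n \near U, ~ B n (ev w n).
Proof. exact: near_neg. Qed.

Lemma good_paths w : ~ bad_paths w -> s_continuous w.
Proof.
move=> /not_orP[bs /not_orP[bb bc]].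
have ss : \forall n \near U, size (ev w n).2 = steps n.
  by apply: filterS (not_iset bs) => n /= /contrapT.
have inner eps t0 t1 : ~ A eps t0 t1 w -> \forall n \near U, forall j,
    (grid D n t0 <= j <= grid D n t1)%N ->
    `|M n (trunc j (ev w n)) - M n (trunc (grid D n t0) (ev w n))| < eps.
  move=> /not_iset h; near=> n => j jt.
  have sn : size (ev w n).2 = steps n by near: n.
  have /negP hn : ~ hitset eps t0 t1 n (ev w n) by near: n.
  have /andP[j0 j1] := jt.
  have := hitPn hn (j := j); rewrite size_trunc ?sn ?grid_le// => /(_ jt).
  by rewrite !trunc_trunc// (leq_trans j0).
split => //.
  have /existsNP[K /not_implyP[_ /inner h]] := bb.
  exists K.+1%:R; apply: filterS h => n h j jn.
  by have := h j; rewrite grid0 gridT => /(_ jn)/ltW.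
move=> eps e0.
(* Half of [eps], as [s] and [t] are both compared with the left end of a common interval. *)
have [p hp] : exists p : nat, p.+1%:R^-1 <= eps / 2.
  have e2 : 0 < eps / 2 by lra.
  exists (Num.truncn (eps / 2)^-1); rewrite -[leRHS]invrK lef_pV2 ?posrE ?invr_gt0//.
  have i0 : 0 <= (eps / 2)^-1 by rewrite invr_ge0 ltW.
  by have /andP[_ /ltW] := truncn_itv i0.
have /existsNP[m /not_implyP[_ hm]] : ~ (\bigcap_m bad_mesh p m) w.
  by move=> h; apply: bc; exists p.
have m0 : (0 : R) < m.+1%:R by rewrite ltr0n.
have r0 : 0 < T / m.+1%:R by rewrite divr_gt0.
exists (T / m.+1%:R) => // s t s0 st tT hts.
(* The time [T] would belong to a part of index [m.+1], beyond the range of [bad_mesh]; there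
   [s = t]. *)
have [sT|sT] := eqVneq s T.
  have -> : t = s by apply/eqP; rewrite eq_le st sT tT.
  by apply: nearW => n; rewrite subrr normr0 ltW.
have sT' : s < T by rewrite lt_neqAle sT (le_trans st).
have x0 : 0 <= s / (T / m.+1%:R) by rewrite divr_ge0// ltW.
pose j := Num.truncn (s / (T / m.+1%:R)).
have /andP[j1 j2] := truncn_itv x0.
have jm : (j < m.+1)%N.
  rewrite -(ltr_nat R); apply: le_lt_trans j1 _.
  by rewrite ltr_pdivrMr// mulrCA divff ?gt_eqF// mulr1.
have tj1 : tt m j <= s by rewrite /tt -ler_pdivlMr.
have tj2 : s < tt m j + T / m.+1%:R.
  by rewrite /tt -{2}(mul1r (T / m.+1%:R)) -mulrDl natr1 -ltr_pdivrMr.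
have tj3 : t <= tt m j.+2.
  have -> : tt m j.+2 = tt m j + T / m.+1%:R + T / m.+1%:R.
    by rewrite /tt -addn2 natrD; ring.
  by move: hts; rewrite lerBlDl => /le_trans; apply; rewrite lerD2r ltW.
have /inner h : ~ A p.+1%:R^-1 (tt m j) (tt m j.+2) w.
  move=> h; apply: hm; rewrite /bad_mesh.
  by rewrite -(bigcup_mkord _ (fun j => A p.+1%:R^-1 (tt m j) (tt m j.+2))); exists j.
apply: filterS h => n h.
have hs := h (grid D n s) ltac:(by rewrite !grid_mono ?(le_trans st)).
have ht := h (grid D n t) ltac:(by rewrite !grid_mono ?(le_trans tj1)).
have := ler_distD (M n (trunc (grid D n (tt m j)) (ev w n)))
  (M n (trunc (grid D n t) (ev w n))) (M n (trunc (grid D n s) (ev w n))).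
move/le_trans; apply; rewrite [X in _ + X]distrC.
apply: le_trans (lerD (ltW ht) (ltW hs)) _.
by apply: le_trans (lerD hp hp) _; rewrite -splitr.
Unshelve. all: by end_near. Qed.

Definition walk_at t n (h : history (E := move)) : R := M n (trunc (grid D n t) h).

Section regular_path.
Variable w : Omega.
Hypothesis sw : s_continuous w.
Hypothesis bw : ubounded U (fun n => M n (trunc 0 (ev w n))).

Lemma stbounded_walk t : stbounded U ev (walk_at t) w.
Proof.
have [_ [K hK] _] := sw; have [K' hK'] := bw.
exists (K + K'); near=> n; rewrite /walk_at.
have h1 : forall j, (j <= steps n)%N ->
    `|M n (trunc j (ev w n)) - M n (trunc 0 (ev w n))| <= K by near: n.
have h2 : `|M n (trunc 0 (ev w n))| <= K' by near: n.
rewrite -[M n _](subrK (M n (trunc 0 (ev w n)))); apply: le_trans (ler_normD _ _) _.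
by apply: lerD => //; apply: h1; exact: grid_le.
Unshelve. all: by end_near. Qed.

Lemma std_walk_continuous : continuous (fun t => std U ev (walk_at t) w).
Proof.
have [_ _ hc] := sw.
have gc n t : grid D n (clip D t) = grid D n t by rewrite /grid (clip_id (clip_itv D t)).
have main eps : 0 < eps -> exists2 rho : R, 0 < rho & forall s t, `|s - t| <= rho ->
    `|std U ev (walk_at s) w - std U ev (walk_at t) w| <= eps.
  move=> e0; have [rho r0 hr] := hc eps e0; exists rho => // s t.
  wlog st : s t / s <= t => [h hst|].
    by have [/h/(_ hst)//|/ltW/h] := leP s t; rewrite distrC => /(_ hst); rewrite distrC.
  move=> hst; rewrite !stdE; try exact: stbounded_walk.
  rewrite -ulimB ?(stbounded_walk s) ?(stbounded_walk t)//; try exact: stbounded_walk.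
  have ub : ubounded U (fun n => walk_at s n (ev w n) - walk_at t n (ev w n)).
    by apply: uboundedB => //; exact: stbounded_walk.
  rewrite -ulim_norm//; apply: ulim_le; first exact: ubounded_norm.
  have /andP[c0 _] := clip_itv D s; have /andP[_ cT] := clip_itv D t.
  have := hr (clip D s) (clip D t) c0 (clip_nd D st) cT.
  rewrite -(ger0_norm (x := clip D t - clip D s)) ?subr_ge0 ?clip_nd//.
  rewrite distrC => /(_ (le_trans (clip_lip _ _ _) hst)).
  by apply: filterS => n; rewrite !gc distrC.
move=> t; apply/cvgrPdist_le => eps /main[rho r0 hr].
near=> s; apply: hr; near: s.
by apply: filterS (nbhsx_ballx t rho r0) => s; rewrite /ball /= => /ltW.
Unshelve. all: by end_near. Qed.

End regular_path.

End one_walk.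

End s_continuity.

(** * The initial position of the walk *)

Section initial_position.
Context {R : realType}.
Variable D : porous_data R.
Implicit Types (n : nat) (A B eps : R).

Lemma Xwalk_init_law n (F : R -> R) :
  mean_at D n 0 (fun h => F (Xwalk D n h)) =
  \sum_(i < (cells n).+2) cell_mass (pf D) (mesh D n) (halfL D n) (cells n).+2 i *
    F (node (mesh D n) (halfL D n) i).
Proof.
apply: eq_bigr => i _; rewrite /chain_init natr_Zp mesh_u0d; congr (_ * F _).
by rewrite /Xwalk /node /site /= mulrC.
Qed.

Lemma Xwalk_init_window A B n :
  mean_at D n 0 (fun h => (A <= Xwalk D n h <= B)%R%:R) <=
  itv_mass (pf D) A (B + mesh D n) +
  (1 - itv_mass (pf D) (node (mesh D n) (halfL D n) 0) (node (mesh D n) (halfL D n) (cells n).+2)).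
Proof.
rewrite (Xwalk_init_law n (fun x => (A <= x <= B)%R%:R)).
exact: (cell_mass_window (pf_int D) (pf_ge0 D) (pf_mass D) _ _ _ _ (ltW (mesh_gt0 D n))).
Qed.

Lemma outside_window_near eps : 0 < eps -> \forall n \near \oo,
  1 - itv_mass (pf D) (node (mesh D n) (halfL D n) 0) (node (mesh D n) (halfL D n) (cells n).+2) <= eps.
Proof.
move=> e0; have [B B0 hB] := itv_mass_setT_cvg (pf_int D) (pf_ge0 D) e0.
near=> n.
have BL : B <= halfL D n by near: n; exact: halfL_near.
apply: (@le_trans _ _ (1 - itv_mass (pf D) (- B) B)); last by move: hB; rewrite pf_mass; lra.
apply: (tail_le (pf_int D) (pf_ge0 D) (ltW B0)).
  by rewrite /node mul0r addr0 lerN2.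
by rewrite /node cells_mesh; lra.
Unshelve. all: by end_near. Qed.

(** Each side is a window reaching the edge of the torus; it costs [eps / 4] for the tail of the
    density and [eps / 4] for the mass stored in the first cell. *)
Lemma Xwalk_init_tail eps : 0 < eps -> exists B : R, \forall n \near \oo,
  mean_at D n 0 (fun h => (B < `|Xwalk D n h|)%R%:R) <= eps.
Proof.
move=> e0; have e4 : 0 < eps / 4 by lra.
have [B B0 hB] := itv_mass_setT_cvg (pf_int D) (pf_ge0 D) e4; rewrite pf_mass in hB.
exists (B + 1); near=> n.
have m0 := mesh_gt0 D n.
have m1 : mesh D n <= 1 by near: n; exact: near_le0 (mesh_cvg D) ltr01.
have BL : B + 1 <= halfL D n by near: n; exact: halfL_near.
have ht : 1 - itv_mass (pf D) (node (mesh D n) (halfL D n) 0)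
    (node (mesh D n) (halfL D n) (cells n).+2) <= eps / 4 by near: n; exact: outside_window_near.
set L := halfL D n in BL ht *.
have split3 (a b : R) : a <= - B -> B <= b ->
    itv_mass (pf D) a (- B) + itv_mass (pf D) (- B) B + itv_mass (pf D) B b <= 1.
  move=> aB Bb; rewrite -!itv_massD ?pf_int//; try lra.
  by rewrite -(pf_mass D); exact: itv_mass_le_total (pf_int D) (pf_ge0 D).
apply: (@le_trans _ _ (mean_at D n 0 (fun h => (B + 1 <= Xwalk D n h <= L)%R%:R) +
    mean_at D n 0 (fun h => (- L <= Xwalk D n h <= - (B + 1))%R%:R))).
  rewrite (Xwalk_init_law n (fun x => (B + 1 < `|x|)%R%:R)).
  rewrite (Xwalk_init_law n (fun x => (B + 1 <= x <= L)%R%:R)).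
  rewrite (Xwalk_init_law n (fun x => (- L <= x <= - (B + 1))%R%:R)).
  rewrite -big_split /=; apply: ler_sum => i _; rewrite -mulrDr; apply: ler_wpM2l.
    exact: cell_mass_ge0 (pf_int D) (pf_ge0 D) (pf_mass D) _ _ _ _.
  have nL : node (mesh D n) L i <= L.
    rewrite /node; have := cells_mesh D n; rewrite -/L => cm.
    have : i%:R * mesh D n <= (cells n).+2%:R * mesh D n by rewrite ler_pM2r// ler_nat ltnW.
    by rewrite cm; lra.
  have nL' : - L <= node (mesh D n) L i by rewrite /node lerDl mulr_ge0// ltW.
  rewrite nL nL' andbT /=; case: (ltP (B + 1) `|_|) => //= h; last by rewrite addr_ge0.
  have [x0|x0] := leP 0 (node (mesh D n) L i).
    by move: h; rewrite ger0_norm// => /ltW->; rewrite lerDl.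
  by move: h; rewrite ltr0_norm// ltrNr => /ltW->; rewrite lerDr.
apply: le_trans (lerD (Xwalk_init_window _ _ _) (Xwalk_init_window _ _ _)) _.
rewrite -/L.
have h1 : itv_mass (pf D) (B + 1) (L + mesh D n) <= eps / 4.
  have := split3 (- B) (L + mesh D n) (lexx _) ltac:(lra).
  have := itv_massD (a := B) (b := B + 1) (c := L + mesh D n) (pf_int D) ltac:(lra) ltac:(lra).
  have := itv_mass_ge0 B (B + 1) (pf_ge0 D); have := itv_mass_ge0 (- B) (- B) (pf_ge0 D); lra.
have h2 : itv_mass (pf D) (- L) (- (B + 1) + mesh D n) <= eps / 4.
  have := split3 (- L) B ltac:(lra) (lexx _).
  have := itv_massD (a := - L) (b := - (B + 1) + mesh D n) (c := - B) (pf_int D) ltac:(lra) ltac:(lra).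
  have := itv_mass_ge0 (- (B + 1) + mesh D n) (- B) (pf_ge0 D).
  have := itv_mass_ge0 B B (pf_ge0 D); lra.
by lra.
Unshelve. all: by end_near. Qed.

End initial_position.

(** * The limit processes, their filtration and the Brownian motion *)

Section limit_processes.
Context {R : realType}.
Variable D : porous_data R.
Notation T := (pT D).
Context (U : set_system nat) {UU : UltraFilter U}.
Hypothesis U_cofinite : (\oo : set_system nat) `<=` U.
Context {d : measure_display} {Omega : measurableType d}.
Variables (P : probability Omega R) (ev : Omega -> nat -> history (E := move)).
Hypothesis hP : forall B, measurable (iset U ev B) /\
  P (iset U ev B) = (ulim U (fun n => Emean D n (\1_(B n))))%:E.
Implicit Types (n k : nat) (s t : R) (M : nat -> history (E := move) -> R).

Definition far_start : set Omega := ~` stbounded U ev (walk_at D (Xwalk D) 0).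
Definition irregular : set Omega :=
  bad_paths D U ev (Xwalk D) `|` (bad_paths D U ev (Wwalk D) `|` far_start).
Definition Good := ~` irregular.

Lemma null_far_start : P far_start = 0%E.
Proof.
have mF : measurable far_start by apply: measurableC; exact: (measurable_stbounded hP).
apply/eqP; rewrite eq_le measure_ge0 andbT; apply/lee_addgt0Pr => e e0; rewrite add0e.
have [B hB] := Xwalk_init_tail D e0.
pose S n := [set h : history (E := move) | B < `|walk_at D (Xwalk D) 0 n h|].
apply: (@le_trans _ _ (P (iset U ev S))).
  apply: le_measure; rewrite ?inE//; first exact: (hP _).1.
  move=> w fw; apply: contrapT => /near_neg h; apply: fw; exists B.
  by apply: filterS h => n /negP; rewrite /S /= -leNgt.
rewrite (hP _).2 lee_fin; apply: ulim_le.
  apply: (ubounded_expect (Emean_functional D) (K := 1)) => n s.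
  by rewrite indicE ger0_norm// lern1 leq_b1.
apply: near_oo_U => //; apply: filterS hB => n; apply: le_trans.
rewrite /Emean (_ : \1_(S n) = (fun h => (B < `|Xwalk D n h|)%R%:R) \o trunc (grid D n 0)).
  by rewrite grid0 mean_at_trunc.
apply: funext => h; rewrite indicE /=.
by have [hh|hh] := boolP (B < _)%R; [rewrite mem_set|rewrite memNset//; apply/negP].
Qed.

Lemma measurable_Good : measurable Good.
Proof.
apply: measurableC; apply: measurableU; first exact: (measurable_bad_paths hP).
apply: measurableU; first exact: (measurable_bad_paths hP).
by apply: measurableC; exact: (measurable_stbounded hP).
Qed.

Lemma null_irregular : P irregular = 0%E.
Proof.
have mG : measurable irregular by rewrite -[irregular]setCK; apply: measurableC; exact: measurable_Good.
apply: measure_negligible => //; apply: negligibleU.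
  exists (bad_paths D U ev (Xwalk D)); split => //; first exact: (measurable_bad_paths hP).
  apply: (null_bad_paths U_cofinite hP (pc_ge0 D) (mesh_cvg D)) => n eps k0 k.
  exact: Xwalk_hit.
apply: negligibleU.
  exists (bad_paths D U ev (Wwalk D)); split => //; first exact: (measurable_bad_paths hP).
  apply: (null_bad_paths U_cofinite hP ler01 (kap_cvg D)) => n eps k0 k.
  by rewrite mul1r; exact: Wwalk_hit.
exists far_start; split => //; last exact: null_far_start.
by apply: measurableC; exact: (measurable_stbounded hP).
Qed.

Lemma P_Good : P Good = 1%E.
Proof.
have mG : measurable irregular by rewrite -[irregular]setCK; apply: measurableC; exact: measurable_Good.
by rewrite /Good probability_setC// null_irregular sube0.
Qed.

Lemma ae_Good (Q : Omega -> Prop) : (forall w, Good w -> Q w) -> {ae P, forall w, Q w}.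
Proof.
move=> h; exists irregular; split; [|exact: null_irregular|].
  by rewrite -[irregular]setCK; apply: measurableC; exact: measurable_Good.
by move=> w; apply: contra_notP => nw; exact: h.
Qed.

(** Continuity of paths is required at every sample point, hence the value 0 off [Good]. Adaptedness
    is kept because [Good] belongs to every [Filt t]. *)
Definition limit_walk M t w : R := std U ev (walk_at D M t) w * \1_Good w.

Lemma limit_walk_good M t w : Good w -> limit_walk M t w = std U ev (walk_at D M t) w.
Proof. by move=> Gw; rewrite /limit_walk indicE mem_set// mulr1. Qed.

Lemma limit_walk_bad M t w : ~ Good w -> limit_walk M t w = 0.
Proof. by move=> Gw; rewrite /limit_walk indicE memNset// mulr0. Qed.

Definition regular_walk M := forall w, Good w -> s_continuous D U ev M w /\
  ubounded U (fun n => M n (trunc 0 (ev w n))).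

Lemma Xwalk_regular : regular_walk (Xwalk D).
Proof.
move=> w /not_orP[/good_paths h /not_orP[_ /contrapT h0]]; split; first exact: h.
have [K hK] := h0; exists K; apply: filterS hK => n.
by rewrite /walk_at grid0.
Qed.

Lemma Wwalk_regular : regular_walk (Wwalk D).
Proof.
move=> w /not_orP[_ /not_orP[/good_paths h _]]; split; first exact: h.
exists 0; have [hs _ _] := h; apply: filterS hs => n hs.
have : size (trunc 0 (ev w n)).2 = 0%N by rewrite size_trunc.
by rewrite /Wwalk /brownian_walk; case: (trunc 0 _) => a [|//] _; rewrite normr0.
Qed.

Lemma stbounded_Good M t : regular_walk M -> Good `<=` stbounded U ev (walk_at D M t).
Proof. by move=> hM w /hM[h1 h2]; exact: stbounded_walk. Qed.

Lemma limit_walk_continuous M : regular_walk M -> forall w, continuous (fun t => limit_walk M t w).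
Proof.
move=> hM w; have [Gw|Gw] := pselect (Good w).
  have -> : (fun t => limit_walk M t w) = (fun t => std U ev (walk_at D M t) w).
    by apply: funext => t; exact: limit_walk_good.
  by have [h1 h2] := hM w Gw; exact: std_walk_continuous.
have -> : (fun t => limit_walk M t w) = (fun=> 0 : R).
  by apply: funext => t; exact: limit_walk_bad.
by move=> t; exact: cst_continuous.
Qed.

Definition past t : set (set Omega) :=
  [set A | exists B, A = iset U ev (fun n => trunc (grid D n t) @^-1` B n)].
(* Approximability in probability absorbs the null sets as well as the infinitesimal
   differences between times. *)
Definition Filt t := approximable P (past t).

Let mpast t : past t `<=` measurable. Proof. by move=> A [B ->]; exact: (hP _).1. Qed.

Let past0 t : past t set0.
Proof.
exists (fun=> set0); apply/seteqP; split => // w /=.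
by move=> /filter_ex[n].
Qed.

Let pastC t A : past t A -> past t (~` A).
Proof. by move=> [B ->]; exists (fun n => ~` B n); rewrite -isetC. Qed.

Let pastU t A A' : past t A -> past t A' -> past t (A `|` A').
Proof.
move=> [B ->] [B' ->]; exists (fun n => B n `|` B' n); apply/seteqP; split => w.
  by move=> [] h; apply: filterS h => n ?; [left|right].
move=> h; apply: contrapT => /not_orP[/near_neg h1 /near_neg h2].
have : \forall n \near U, False.
  near=> n; have : (B n `|` B' n) (trunc (grid D n t) (ev w n)) by near: n.
  by case; [apply: (near h1)|apply: (near h2)].
by move=> /filter_ex[].
Unshelve. all: by end_near. Qed.

Lemma sigma_algebra_Filt t : sigma_algebra setT (Filt t).
Proof.
exact: (sigma_algebra_approximable P (@mpast t) (@past0 t) (@pastC t) (@pastU t)).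
Qed.

Lemma Filt_Good t : Filt t Good.
Proof.
by apply: (approximable_full (@past0 t) (@pastC t)); [exact: measurable_Good|exact: P_Good].
Qed.

Lemma Filt_mono s t : s <= t -> Filt s `<=` Filt t.
Proof.
move=> st; apply: sub_approximable_of => A [B ->].
exists (fun n => trunc (grid D n s) @^-1` B n); congr (iset U ev _); apply: funext => n.
by apply/seteqP; split => h /=; rewrite trunc_trunc// grid_mono.
Qed.

Lemma filtration_Filt : filtration Filt T.
Proof.
split => [t _|t _ A [mA _]//|s t _ st _]; [exact: sigma_algebra_Filt|exact: Filt_mono].
Qed.

Lemma limit_walk_adapted M t : regular_walk M -> measurable_wrt (Filt t) (limit_walk M t).
Proof.
move=> hM; have sF := sigma_algebra_Filt t; apply: measurable_wrt_rays => // a.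
have h1 : Filt t (Good `&` [set w | std U ev (walk_at D M t) w < a]).
  apply: std_lt => //; [exact: stbounded_Good|exact: Filt_Good|].
  move=> b; apply: sub_approximable => //.
  by exists (fun n => [set h | M n h < b]).
have [a0|a0] := ltP 0 a.
  rewrite (_ : [set w | _] = (Good `&` [set w | std U ev (walk_at D M t) w < a]) `|` ~` Good).
    by apply: sigma_algebra_union => //; apply: sigma_algebra_compl => //; exact: Filt_Good.
  apply/seteqP; split => w /=.
    by have [Gw|Gw] := pselect (Good w); [rewrite limit_walk_good//; left|right].
  by move=> [[Gw]|Gw]; [rewrite limit_walk_good|rewrite limit_walk_bad].
rewrite (_ : [set w | _] = (Good `&` [set w | std U ev (walk_at D M t) w < a])) //.
apply/seteqP; split => w /=.
  have [Gw|Gw] := pselect (Good w); first by rewrite limit_walk_good.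
  by rewrite limit_walk_bad// ltNge a0.
by move=> [Gw]; rewrite limit_walk_good.
Qed.

Lemma measurable_limit_walk M t : regular_walk M -> measurable_fun setT (limit_walk M t).
Proof.
move=> hM; apply: (measurable_std_on hP); first exact: measurable_Good.
exact: stbounded_Good.
Qed.

(** Allows an event of the filtration to be replaced under the integral by an internal event of the
    past. *)
Lemma expect_indicM (A S : set Omega) (f : Omega -> R) : measurable A -> measurable S ->
  measurable_fun setT f -> (forall w, 0 <= f w <= 1) ->
  (\int[P]_(w in A) (f w)%:E <= \int[P]_(w in S) (f w)%:E + P (symdiff A S))%E.
Proof.
move=> mA mS mf f01; have mAS := measurable_symdiff mA mS.
have mfE B : measurable_fun B (fun w => (f w)%:E).
  by apply/measurable_EFinP; exact: measurable_funTS.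
have f0 w : (0 <= (f w)%:E)%E by rewrite lee_fin; case/andP: (f01 w).
apply: (@le_trans _ _ (\int[P]_(w in S `|` symdiff A S) (f w)%:E)%E).
  apply: ge0_subset_integral => //; first exact: measurableU.
  by move=> w Aw; have [Sw|Sw] := pselect (S w); [left|right; left].
rewrite (_ : S `|` symdiff A S = S `|` (symdiff A S `\` S)); last first.
  by rewrite setUDr setDv setD0.
rewrite ge0_integral_setU//=; first last.
- by apply/disj_setPS => w [Sw []].
- exact: measurableD.
rewrite leeD2l//; apply: (@le_trans _ _ (\int[P]_(w in symdiff A S) (f w)%:E)%E).
  by apply: ge0_subset_integral => //; exact: measurableD.
rewrite -[leRHS]mul1e -integral_cst//; apply: ge0_le_integral => //= w _.
by rewrite lee_fin; case/andP: (f01 w).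
Qed.

Lemma integral_std_Good (Z : nat -> history (E := move) -> R) (f : Omega -> R) K :
  measurable_fun setT f -> (forall n h, 0 <= Z n h <= K) ->
  (forall w, Good w -> f w = std U ev Z w) ->
  (\int[P]_w (f w)%:E = (ulim U (fun n => Emean D n (Z n)))%:E)%E.
Proof.
move=> mf hZ fZ; rewrite -(integral_std (Emean_functional D) hP hZ).
apply: ae_eq_integral => //; [exact/measurable_EFinP| |].
  by apply/measurable_EFinP; exact: (measurable_std hP).
by apply: ae_Good => w Gw _; rewrite fZ.
Qed.

Lemma integral_std_sqr_Good (Z : nat -> history (E := move) -> R) (f : Omega -> R) K :
  measurable_fun setT f -> (\forall n \near U, Emean D n (fun h => Z n h ^+ 2) <= K) ->
  (forall w, Good w -> f w = std U ev Z w) ->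
  (\int[P]_w (f w ^+ 2)%:E <= K%:E)%E.
Proof.
move=> mf hZ fZ; apply: le_trans (integral_std_sqr (Emean_functional D) hP hZ).
rewrite le_eqVlt; apply/orP; left; apply/eqP; apply: ae_eq_integral => //.
- by apply/measurable_EFinP; exact: measurable_funX.
- by apply/measurable_EFinP; apply: measurable_funX; exact: (measurable_std hP).
by apply: ae_Good => w Gw _; rewrite fZ.
Qed.

Lemma symdiffC (A S : set Omega) : symdiff A S = symdiff S A.
Proof. by rewrite /symdiff setUC. Qed.

Let Wl := limit_walk (Wwalk D).
Let dWl s t w := Wl t w - Wl s w.

Let mdWl s t : measurable_fun setT (dWl s t).
Proof. by apply: measurable_funB; exact: measurable_limit_walk Wwalk_regular. Qed.

Let gaussian_past s t (sg c : R) (B : nat -> set (history (E := move))) :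
  0 <= s -> s < t -> t <= T -> 0 < sg ->
  let A := iset U ev (fun n => trunc (grid D n s) @^-1` B n) in
  (\int[P]_(w in A) (ncdf ((c - dWl s t w) / sg))%:E =
   P A * (ncdf (c / Num.sqrt (sg ^+ 2 + (t - s))))%:E)%E.
Proof.
move=> s0 st tT sg0 A.
have mA : measurable A by exact: (hP _).1.
pose Z n (h : history (E := move)) : R := \1_(B n) (trunc (grid D n s) h) *
  ncdf ((c - (walk_at D (Wwalk D) t n h - walk_at D (Wwalk D) s n h)) / sg).
have Z01 n h : 0 <= Z n h <= 1.
  have /andP[a0 a1] := ncdf_itv ((c - (walk_at D (Wwalk D) t n h - walk_at D (Wwalk D) s n h)) / sg).
  rewrite /Z mulr_ge0//= mulr_ile1// indicE lern1 leq_b1//.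
have stB := stbounded_Good _ Wwalk_regular.
have stdZ w : Good w -> std U ev Z w = \1_A w * ncdf ((c - dWl s t w) / sg).
  move=> Gw; rewrite stdE; last first.
    by apply: (@stbounded_bd _ _ _ _ _ _ _ _ 1) => n h; have /andP[z0 z1] := Z01 n h; rewrite ger0_norm.
  pose f x : R := ncdf ((c - x) / sg).
  have fc : continuous f.
    move=> x; apply: (continuous_comp (f := fun x => (c - x) / sg)); last exact: ncdf_continuous.
    by apply: cvgM; [apply: cvgB; [exact: cvg_cst|exact: cvg_id]|exact: cvg_cst].
  have ub : ubounded U (fun n => walk_at D (Wwalk D) t n (ev w n) - walk_at D (Wwalk D) s n (ev w n)).
    by apply: uboundedB; exact: stB.
  have u1 : ubounded U (fun n => \1_(trunc (grid D n s) @^-1` B n) (ev w n) : R).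
    exact: ubounded_indic.
  rewrite /Z [LHS](ulimM u1 (ubounded_continuous fc ub)).
  have -> : ulim U (fun n => \1_(trunc (grid D n s) @^-1` B n) (ev w n)) = \1_A w :> R.
    exact: ulim_indic.
  rewrite (ulim_continuous fc ub).
  rewrite ulimB; [|exact: stB..].
  by rewrite /dWl /Wl !limit_walk_good// !stdE//; exact: stB.
have mf : measurable_fun setT (fun w => \1_A w * ncdf ((c - dWl s t w) / sg)).
  apply: measurable_funM; first exact: measurable_indic.
  apply: (@measurableT_comp _ _ _ _ _ _ (@ncdf R)).
    by apply: continuous_measurable_fun; exact: ncdf_continuous.
  apply: measurable_funM => //; apply: measurable_funB => //; exact: mdWl.
rewrite integral_mkcond.
rewrite (_ : _ \_ A = fun w => (\1_A w * ncdf ((c - dWl s t w) / sg))%:E); last first.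
  apply: funext => w; rewrite patchE indicE; case: ifPn => wA; first by rewrite mul1r.
  by rewrite mul0r.
rewrite (integral_std_Good mf Z01); last by move=> w /stdZ.
rewrite (hP _).2 -EFinM; congr (_%:E).
pose q := ncdf (c / Num.sqrt (sg ^+ 2 + (t - s))).
pose dn n := step D n * (grid D n t - grid D n s)%:R.
have dncv : dn @ \oo --> t - s by apply: grid_increment_cvg => //; exact: ltW.
pose qn n := ncdf (c / Num.sqrt (sg ^+ 2 + dn n)).
have qncv : qn @ \oo --> q.
  apply: (cvg_comp (fun n => c / Num.sqrt (sg ^+ 2 + dn n)) (@ncdf R)); last exact: ncdf_continuous.
  apply: cvgM; first exact: cvg_cst.
  apply: cvgV; first by rewrite gt_eqF// sqrtr_gt0 addr_gt0 ?exprn_gt0// subr_gt0.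
  apply: (cvg_comp (fun n => sg ^+ 2 + dn n) Num.sqrt); last exact: sqrt_continuous.
  by apply: cvgD; [exact: cvg_cst|exact: dncv].
have [K K0 hK] := Wwalk_heat D sg0.
(* The accumulated Lindeberg error vanishes because the jumps of [Wwalk] do. *)
have bcv : (fun n => K * dn n * (kap D n + step D n)) @ \oo --> (0 : R).
  rewrite -[X in _ --> X](mulr0 (K * (t - s))); apply: cvgM.
    by apply: cvgM dncv; exact: cvg_cst.
  by rewrite -[X in _ --> X](addr0 0); apply: cvgD; [exact: kap_cvg|exact: step_cvg].
pose p n := mean_at D n (grid D n s) (\1_(B n)).
have pE n : Emean D n \1_(trunc (grid D n s) @^-1` B n) = p n.
  rewrite /p -(mean_at_trunc D n _ (grid_le D n s)) /Emean.
  by have -> : \1_(trunc (grid D n s) @^-1` B n) = \1_(B n) \o trunc (grid D n s) :> (_ -> R)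
    by apply: funext => h; rewrite /= !indicE.
have ZE n : Emean D n (Z n) = mean_at D n (grid D n t) (fun h => \1_(B n) (trunc (grid D n s) h) *
      ncdf ((c - (Wwalk D n h - Wwalk D n (trunc (grid D n s) h))) / sg)).
  rewrite -(mean_at_trunc D n _ (grid_le D n t)) /Emean; set f := _ \o _.
  suff -> : Z n = f by [].
  by apply: funext => h; rewrite /f /Z /walk_at /= !trunc_trunc// grid_mono// ltW.
have up : ubounded U (fun n => Emean D n \1_(trunc (grid D n s) @^-1` B n)).
  apply: (ubounded_expect (Emean_functional D) (K := 1)) => n h.
  by rewrite indicE ger0_norm// lern1 leq_b1.
have uZ : ubounded U (fun n => Emean D n (Z n)).
  apply: (ubounded_expect (Emean_functional D) (K := 1)) => n h.
  by have /andP[z0 z1] := Z01 n h; rewrite ger0_norm.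
have uq : ubounded U qn by exact: ubounded_cvg (cvg_oo_U U_cofinite qncv).
rewrite -/q -(ulim_eq (cvg_oo_U U_cofinite qncv)) -ulimM//.
apply/eqP; rewrite -subr_eq0 -ulimB//; last exact: uboundedM.
apply/eqP; apply: ulim_eq; apply: cvg_oo_U => //.
apply/norm_cvg0P; apply: (@squeeze_cvgr _ _ _ _ (fun=> 0) _ _ _ _ _ bcv); last exact: cvg_cst.
near=> n; rewrite normr_ge0 /= pE ZE; apply: hK.
  near: n; apply: near_le0 (step_cvg D) _; exact: exprn_gt0.
by apply: grid_mono; exact: ltW.
Unshelve. all: by end_near. Qed.

Let gaussian_Filt s t (sg c : R) A : 0 <= s -> s < t -> t <= T -> 0 < sg -> Filt s A ->
  (\int[P]_(w in A) (ncdf ((c - dWl s t w) / sg))%:E =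
   P A * (ncdf (c / Num.sqrt (sg ^+ 2 + (t - s))))%:E)%E.
Proof.
move=> s0 st tT sg0 [mA hA].
pose f w : R := ncdf ((c - dWl s t w) / sg).
have f01 w : 0 <= f w <= 1 by exact: ncdf_itv.
have mf : measurable_fun setT f.
  apply: (@measurableT_comp _ _ _ _ _ _ (@ncdf R)).
    by apply: continuous_measurable_fun; exact: ncdf_continuous.
  apply: measurable_funM => //; apply: measurable_funB => //; exact: mdWl.
pose q : R := ncdf (c / Num.sqrt (sg ^+ 2 + (t - s))).
have q01 : 0 <= q <= 1 by exact: ncdf_itv.
have Pq S S' : measurable S -> measurable S' -> (P S * q%:E <= P S' * q%:E + P (symdiff S S'))%E.
  move=> mS mS'; have := expect_indicM mS mS' (f := fun=> q) (@measurable_cst _ _ _ _ _ _) (fun=> q01).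
  by rewrite !integral_cst// ![(q%:E * _)%E]muleC.
apply/eqP; rewrite eq_le; apply/andP; split; apply/lee_addgt0Pr => e e0;
  have [S [B SB] hS] := hA (e / 2) ltac:(by rewrite divr_gt0);
  have mS : measurable S by (rewrite SB; exact: (hP _).1).
- apply: le_trans (expect_indicM mA mS mf f01) _.
  rewrite {1}SB gaussian_past// -SB.
  apply: le_trans (leeD (Pq S A mS mA) (lexx _)) _.
  rewrite -addeA leeD2l// symdiffC (splitr e) EFinD; exact: leeD.
- apply: le_trans (Pq A S mA mS) _; rewrite {1}SB -gaussian_past// -SB.
  apply: le_trans (leeD (expect_indicM mS mA mf f01) (lexx _)) _.
  rewrite -addeA leeD2l// symdiffC (splitr e) EFinD; exact: leeD.
Qed.

(** The smoothed identity on each event of [Filt s] gives, by [gaussian_law], the law of the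
    increment and its independence from the past at once. *)
Lemma brownian_limit : brownian_motion P Filt T Wl.
Proof.
split.
- by move=> t _; apply: limit_walk_adapted; exact: Wwalk_regular.
- move=> w; apply: continuous_subspaceT; exact: limit_walk_continuous Wwalk_regular w.
- apply: ae_Good => w Gw; rewrite /Wl limit_walk_good//.
  rewrite stdE; last exact: stbounded_Good Wwalk_regular _ Gw.
  rewrite -[RHS](@ulim_cst R U _ 0); apply: eq_ulim => //.
  have [[hs _ _] _] := Wwalk_regular Gw; apply: filterS hs => n hs.
  rewrite /walk_at grid0.
  have : size (trunc 0 (ev w n)).2 = 0%N by rewrite size_trunc.
  by rewrite /Wwalk /brownian_walk; case: (trunc 0 _) => a [|//].
move=> s t s0 st tT /=.
have law A : Filt s A -> forall B : set R, measurable B ->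
    P (A `&` (dWl s t) @^-1` B) = (P A * normal_prob 0 (Num.sqrt (t - s)) B)%E.
  move=> FA; apply: gaussian_law; [by case: FA|exact: mdWl|by rewrite subr_gt0|].
  by move=> sg c sg0; exact: gaussian_Filt.
have lawT (B : set R) : measurable B -> P ((dWl s t) @^-1` B) = normal_prob 0 (Num.sqrt (t - s)) B.
  move=> mB; have := law setT _ B mB; rewrite setTI probability_setT mul1e; apply.
  by rewrite -setC0; apply: sub_approximable => //; exact: pastC.
by split => // A B FA mB; rewrite law// lawT.
Qed.

End limit_processes.

(** * The law of the limit process *)

(** Rounding time down to a multiple of [1 / m.+1] gives a countable gluing of measurable sections,
    and continuity in time gives the pointwise limit. *)
Lemma measurable_of_sections (R : realType) (d : measure_display) (Omega : measurableType d)
    (f : R -> Omega -> R) :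
  (forall t, measurable_fun setT (f t)) -> (forall w, continuous (fun t => f t w)) ->
  measurable_fun setT (fun p : R * Omega => f p.1 p.2).
Proof.
move=> mf cf.
pose q m (k : int) : R := k%:~R / m.+1%:R.
pose fl m (t : R) : int := Num.floor (m.+1%:R * t).
apply: (@measurable_fun_cvg _ _ _ _ (fun m p => f (q m (fl m p.1)) p.2)).
  move=> m _ B mB; rewrite setTI.
  have -> : (fun p : R * Omega => f (q m (fl m p.1)) p.2) @^-1` B =
    \bigcup_(k : int) ([set t : R | fl m t = k] `*` (f (q m k) @^-1` B)).
    apply/seteqP; split => [[t w] /= h|[t w] [k _ [/= <-]]//].
    by exists (fl m t).
  apply: countable_bigcupT_measurable => [|k]; first exact: countableP.
  apply: measurableX; last by rewrite -[X in measurable X]setTI; exact: mf.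
  have -> : [set t : R | fl m t = k] = `[k%:~R / m.+1%:R, (k + 1)%:~R / m.+1%:R[%classic.
    apply/seteqP; split => t /=; rewrite in_itv /= ler_pdivrMr// ltr_pdivlMr// mulrC.
      by move=> <-; rewrite /fl floor_le floorD1_gt.
    by move=> h; exact: floor_def.
  exact: measurable_itv.
move=> [t w] _ /=.
apply: (cvg_comp (fun m => q m (fl m t)) (fun t => f t w)); last exact: cf.
apply/cvgrPdist_le => e e0; near=> m.
have m0 : (0 : R) < m.+1%:R by rewrite ltr0n.
have me : m.+1%:R^-1 <= e.
  near: m; apply: filterS (near_infty_natSinv_lt (PosNum e0)) => m /ltW.
  by [].
apply: le_trans me; rewrite /q.
have h1 := floor_le (m.+1%:R * t); have h2 := floorD1_gt (m.+1%:R * t).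
move: h1 h2; rewrite -/(fl m t) intrD; move: (m.+1%:R) m0 (fl m t)%:~R => y y0 z h1 h2.
have -> : t - z / y = (y * t - z) / y by field; rewrite gt_eqF.
rewrite normrM (gtr0_norm (x := y^-1)) ?invr_gt0// ler_piMl ?invr_ge0 ?(ltW y0)//.
by rewrite ler_norml; lra.
Unshelve. all: by end_near. Qed.

(** * A law identified by domination on segments *)

Section law_from_windows.
Context {R : realType} {d : measure_display} {Omega : measurableType d}.
Notation mu := (@lebesgue_measure R).
Variables (P : probability Omega R) (X : Omega -> R) (f : R -> R).
Hypothesis mX : measurable_fun setT X.
Hypothesis mf : measurable_fun setT f.
Hypothesis f0 : forall x, 0 <= f x.
Hypothesis f1 : (\int[mu]_x (f x)%:E <= 1)%E.
Hypothesis window : forall a b, a <= b ->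
  (P (X @^-1` `[a, b]) <= \int[mu]_(x in `[a, b]) (f x)%:E)%E.

Let m2 := density_law mf f0.

Let mXB (B : set R) : measurable B -> measurable (X @^-1` B).
Proof. by move=> mB; rewrite -[_ @^-1` _]setTI; exact: mX. Qed.

Let union_bound (I : set R) (J : nat -> set R) : measurable I -> (forall k, measurable (J k)) ->
  {homo J : n m / (n <= m)%N >-> (n <= m)%O} -> I `<=` \bigcup_k J k ->
  (forall k, (P (X @^-1` J k) <= m2 I)%E) -> (P (X @^-1` I) <= m2 I)%E.
Proof.
move=> mI mJ homoJ IJ h.
apply: (@le_trans _ _ (P (\bigcup_k X @^-1` J k))).
  apply: le_measure; rewrite ?inE; [exact: mXB|by apply: bigcupT_measurable => k; exact: mXB|].
  by move=> w /IJ[k _ Jk]; exists k.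
have cv : P (X @^-1` J k) @[k --> \oo] --> P (\bigcup_k X @^-1` J k).
  apply: (@nondecreasing_cvg_mu _ _ _ P (fun k => X @^-1` J k)).
  - by move=> k; exact: mXB.
  - by apply: bigcupT_measurable => k; exact: mXB.
  - by move=> n m /homoJ /subsetPset nm; apply/subsetPset => w; exact: nm.
rewrite -(cvg_lim _ cv)//; apply: lime_le; first by apply/cvg_ex; eexists; exact: cv.
by apply: nearW.
Qed.

Let m2_sub (I J : set R) : measurable I -> measurable J -> I `<=` J -> (m2 I <= m2 J)%E.
Proof. by move=> mI mJ IJ; apply: (le_measure m2); rewrite ?inE. Qed.

Let m2_close c : m2 `]-oo, c]%classic = m2 `]-oo, c[%classic.
Proof.
rewrite (_ : `]-oo, c]%classic = `]-oo, c[%classic `|` [set c]); last first.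
  by rewrite setUitv1.
rewrite measureU//=; last first.
  by apply/seteqP; split => // x /= [+ xc]; rewrite xc in_itv /= ltxx.
rewrite [X in (_ + X)%E](_ : _ = 0%E) ?adde0// /m2 /density_law /density_measure.
by rewrite integral_set1.
Qed.

(** One inequality suffices: it extends to the two complementary rays at [c], where the law has
    total mass 1 and the density at most 1, so both inequalities are equalities. *)
Lemma law_of_windows (B : set R) : measurable B ->
  P (X @^-1` B) = (\int[mu]_(x in B) (f x)%:E)%E.
Proof.
move=> mB; rewrite -[X @^-1` B]setTI.
apply: (restricted_law_rays measurableT mX (m2 := m2)) => // c; rewrite setTI.
have homoL : {homo (fun k => `[c - k%:R, c]%classic : set R) : n m / (n <= m)%N >-> (n <= m)%O}.
  move=> n m nm; apply/subsetPset => x /=; rewrite !in_itv /= => /andP[h ->]; rewrite andbT.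
  by apply: le_trans h; rewrite lerD2l lerN2 ler_nat.
have homoR : {homo (fun k => `[c, c + k%:R]%classic : set R) : n m / (n <= m)%N >-> (n <= m)%O}.
  move=> n m nm; apply/subsetPset => x /=; rewrite !in_itv /= => /andP[-> h] /=.
  by apply: le_trans h _; rewrite lerD2l ler_nat.
have L : (P (X @^-1` `]-oo, c[) <= m2 `]-oo, c[%classic)%E.
  apply: (union_bound (J := fun k => `[c - k%:R, c]%classic)) => //.
    move=> x /=; rewrite in_itv /= => xc; exists (Num.truncn (c - x)).+1 => //=.
    rewrite in_itv /= (ltW xc) andbT lerBlDl -lerBlDr.
    have cx : 0 <= c - x by rewrite subr_ge0 ltW.
    by have /andP[_ /ltW] := truncn_itv cx.
  move=> k; apply: le_trans (window _) _; first by rewrite gerBl.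
  rewrite -m2_close; apply: m2_sub => //.
  by move=> x /=; rewrite !in_itv /= => /andP[].
have Rr : (P (X @^-1` `[c, +oo[) <= m2 `[c, +oo[%classic)%E.
  apply: (union_bound (J := fun k => `[c, c + k%:R]%classic)) => //.
    move=> x /=; rewrite in_itv /= andbT => xc; exists (Num.truncn (x - c)).+1 => //=.
    rewrite in_itv /= xc /= -lerBlDl.
    have cx : 0 <= x - c by rewrite subr_ge0.
    by have /andP[_ /ltW] := truncn_itv cx.
  move=> k; apply: le_trans (window _) _; first by rewrite lerDl.
  apply: m2_sub => //.
  by move=> x /=; rewrite !in_itv /= andbT => /andP[].
have dis : `]-oo, c[%classic `&` `[c, +oo[%classic = set0 :> set R.
  apply/seteqP; split => // x /= []; rewrite !in_itv /= andbT => h1 h2.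
  by have := lt_le_trans h1 h2; rewrite ltxx.
have cov : `]-oo, c[%classic `|` `[c, +oo[%classic = setT :> set R.
  apply/seteqP; split => // x _ /=; rewrite !in_itv /= andbT.
  by have [h|h] := ltP x c; [left|right].
have sP : (P (X @^-1` `]-oo, c[) + P (X @^-1` `[c, +oo[) = 1)%E.
  rewrite -measureU//=; [|exact: mXB|exact: mXB|].
    by rewrite -preimage_setU cov preimage_setT probability_setT.
  by rewrite -preimage_setI dis preimage_set0.
have sm : (m2 `]-oo, c[%classic + m2 `[c, +oo[%classic <= 1)%E.
  by rewrite -measureU// cov.
apply/eqP; rewrite eq_le L /= leNgt; apply/negP => lt.
have finP (S : set R) : measurable S -> P (X @^-1` S) \is a fin_num.
  by move=> mS; apply: fin_num_measure; exact: mXB.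
have : (P (X @^-1` `]-oo, c[) + P (X @^-1` `[c, +oo[) <
        m2 `]-oo, c[%classic + m2 `[c, +oo[%classic)%E.
  by apply: lte_leD => //; exact: finP.
by rewrite sP => /lt_le_trans /(_ sm); rewrite ltxx.
Qed.

End law_from_windows.

(** * Integrals recognised from quadratic estimates *)

Section quadratic_estimate.
Context {R : realType}.
Notation mu := (@lebesgue_measure R).

Lemma derive_of_quadratic (F : R -> R) (x l K e : R) : 0 < e ->
  (forall y, `|y - x| < e -> `|F y - F x - (y - x) * l| <= K * (y - x) ^+ 2) ->
  is_derive x (1 : R) F l.
Proof.
move=> e0 h.
have cv : h^-1 *: ((F \o shift x) (h *: (1 : R)) - F x) @[h --> (0 : R)^'] --> l.
  apply/cvgrPdist_le => eps eps0.
  have K1 : 0 < `|K| + 1 by rewrite ltr_wpDl.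
  near=> z.
  have z0 : z != 0 by near: z; exact: nbhs_dnbhs_neq.
  have ze : `|z| < Num.min e (eps / (`|K| + 1)).
    near: z; apply: dnbhs0_lt; rewrite lt_min e0/= divr_gt0//.
  rewrite /= /shift /= scaler1 -[_ *: _]/(z^-1 * (F (z + x) - F x)).
  have zx : z + x - x = z by rewrite addrK.
  have := h (z + x); rewrite zx => /(_ (lt_le_trans ze _)); rewrite ge_min lexx => /(_ isT) hz.
  have zn0 : 0 < `|z| by rewrite normr_gt0.
  rewrite -(ler_pM2l zn0) -normrM mulrBr mulrA divff// mul1r.
  rewrite distrC; apply: le_trans hz _.
  apply: le_trans (ler_wpM2r (sqr_ge0 _) (ler_norm K)) _.
  rewrite -[z ^+ 2]real_normK ?num_real// expr2 mulrCA ler_wpM2l//.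
  have : `|z| <= eps / (`|K| + 1).
    by apply/ltW; apply: lt_le_trans ze _; rewrite ge_min lexx orbT.
  rewrite ler_pdivlMr// => /(le_trans _); apply.
  by rewrite mulrC ler_wpM2l// lerDl.
apply: DeriveDef; first by apply/cvg_ex; exists l.
exact: cvg_lim cv.
Unshelve. all: by end_near. Qed.

(* An additive interval function [S] which is close to [(y - x) * a x] up to a quadratic
   error is the integral of [a]. *)
Lemma integral_of_quadratic (a : R -> R) (S : R -> R -> R) (K A B : R) : 0 <= K ->
  (forall x y, `|a x - a y| <= K * `|x - y|) ->
  (forall x y z, x <= y -> y <= z -> S x z = S x y + S y z) ->
  (forall x y, x <= y -> `|S x y - (y - x) * a x| <= K * (y - x) ^+ 2) -> A < B ->
  (\int[mu]_(x in `[A, B]) (a x)%:E)%E = (S A B)%:E.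
Proof.
move=> K0 alip Sadd Sest AB.
(* Based at [A - 1] so that the primitive has a two-sided derivative at [A]. *)
pose F x := S (A - 1) x.
have quad x y : A - 1 <= x -> A - 1 <= y ->
    `|F y - F x - (y - x) * a x| <= 2 * K * (y - x) ^+ 2.
  move=> Ax Ay; have [xy|/ltW yx] := leP x y.
    rewrite /F (Sadd _ _ _ Ax xy) (addrC (S (A - 1) x)) addrK; apply: le_trans (Sest _ _ xy) _.
    by rewrite ler_wpM2r ?sqr_ge0//; lra.
  rewrite /F (Sadd _ _ _ Ay yx).
  have -> : S (A - 1) y - (S (A - 1) y + S y x) - (y - x) * a x =
     - (S y x - (x - y) * a y) + (x - y) * (a x - a y) by ring.
  apply: le_trans (ler_normD _ _) _; rewrite normrN.
  have h1 := Sest _ _ yx.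
  have xy0 : 0 <= x - y by rewrite subr_ge0.
  have h2 : `|(x - y) * (a x - a y)| <= (x - y) * (K * (x - y)).
    rewrite normrM (ger0_norm xy0) ler_wpM2l//.
    by apply: le_trans (alip _ _) _; rewrite ger0_norm.
  apply: le_trans (lerD h1 h2) _; rewrite le_eqVlt; apply/orP; left; apply/eqP; ring.
have der x : A - 1 < x -> is_derive x (1 : R) F (a x).
  move=> Ax; apply: (@derive_of_quadratic _ _ _ (2 * K) (x - (A - 1))).
    by rewrite subr_gt0.
  move=> y hy; apply: quad; first exact: ltW.
  by move: hy; rewrite ltr_norml => /andP[+ _]; lra.
have acont : continuous a.
  move=> x; apply/cvgrPdist_le => e e0.
  have K1 : 0 < K + 1 by rewrite ltr_wpDl.
  near=> y; apply: le_trans (alip _ _) _.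
  have : `|x - y| <= e / (K + 1).
    near: y; apply: filterS (nbhsx_ballx x (e / (K + 1)) _) => [y|]; last by rewrite divr_gt0.
    by rewrite /ball /= => /ltW.
  rewrite ler_pdivlMr// => /(le_trans _); apply.
  by rewrite mulrC ler_wpM2l// lerDl.
have Fc x : A - 1 < x -> {for x, continuous F}.
  move=> /der h; apply: differentiable_continuous; apply/derivable1_diffP.
  exact: ex_derive.
have AF : S A B = F B - F A.
  by rewrite /F (Sadd (A - 1) A B) ?gerBl// ?(ltW AB)// (addrC (S (A - 1) A)) addrK.
rewrite AF EFinB; apply: continuous_FTC2 => //.
- exact: continuous_subspaceT.
- split.
  + move=> x; rewrite in_itv /= => /andP[Ax _].
    have h : A - 1 < x by lra.
    exact: (@ex_derive _ _ _ _ _ _ _ (der x h)).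
  + by apply: cvg_at_right_filter; apply: Fc; lra.
  + by apply: cvg_at_left_filter; apply: Fc; lra.
- move=> x; rewrite in_itv /= => /andP[Ax _].
  have h : A - 1 < x by lra.
  by rewrite derive1E; exact: (@derive_val _ _ _ _ _ _ _ (der x h)).
Unshelve. all: by end_near. Qed.

End quadratic_estimate.

Lemma count_itv (R : realType) (M p q : nat) : (p <= q)%N -> (q <= M)%N ->
  \sum_(i < M) (p <= i < q)%N%:R = (q%:R - p%:R : R).
Proof.
move=> pq qM; rewrite -(big_mkord xpredT (fun i => (p <= i < q)%N%:R)).
rewrite (big_cat_nat_idem _ (n := p)) ?(leq_trans pq)//= ?addr0// (big_cat_nat_idem _ pq qM)/= ?addr0//.
rewrite big_nat big1 => [|i /= ip]; last by rewrite leqNgt ip.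
rewrite [X in _ + (_ + X)]big_nat [X in _ + (_ + X)]big1 => [|i /andP[qi _]]; last first.
  by rewrite ltnNge qi andbF.
rewrite add0r addr0 big_nat (eq_bigr (fun=> 1)) => [|i ->//].
by rewrite -big_nat sumr_const_nat -natrB.
Qed.

(** * Standard parts of Lipschitz lattice functions *)

Section lattice_limits.
Context {R : realType}.
Variable D : porous_data R.
Context (U : set_system nat) {UU : UltraFilter U}.
Hypothesis U_cofinite : (\oo : set_system nat) `<=` U.
Implicit Types (n k : nat) (x y : R).

Definition idx n x : nat := Num.truncn ((x + halfL D n) / mesh D n).

Lemma idx_itv n x : - halfL D n <= x ->
  (idx n x)%:R * mesh D n <= x + halfL D n < (idx n x)%:R * mesh D n + mesh D n.
Proof.
move=> Lx; have m0 := mesh_gt0 D n.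
have h : 0 <= (x + halfL D n) / mesh D n by rewrite divr_ge0 ?(ltW m0)//; lra.
have /andP[h1 h2] := truncn_itv h.
by rewrite -ler_pdivlMr// h1 /= -{2}(mul1r (mesh D n)) -mulrDl natr1 -ltr_pdivrMr.
Qed.

Lemma idx_mono n x y : x <= y -> (idx n x <= idx n y)%N.
Proof. by move=> xy; apply: le_truncn; rewrite ler_pM2r ?invr_gt0 ?mesh_gt0// lerD2r. Qed.

Lemma idx_le n x : - halfL D n <= x -> x < halfL D n -> (idx n x < (cells n).+2)%N.
Proof.
move=> x1 x2; have m0 := mesh_gt0 D n.
rewrite -(ltr_nat R) -(ltr_pM2r m0) cells_mesh.
by have /andP[h _] := idx_itv x1; lra.
Qed.

Lemma idx_node n k : idx n (- halfL D n + mesh D n * k%:R) = k.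
Proof. by rewrite /idx addrAC addNr add0r mulrAC divff ?mul1r ?natrK// gt_eqF// mesh_gt0. Qed.

Definition lat_fun := forall n, 'I_(cells n).+2 -> R.

Definition lat_regular (a : lat_fun) (K La : R) := \forall n \near U,
  (forall i, `|a n i| <= K) /\
  forall i (z : int), `|a n (i + z%:~R) - a n i| <= La * ((absz z)%:R * mesh D n).

Definition lat (a : lat_fun) x : R := ulim U (fun n => a n ((idx n x)%:R)).

Definition window_sum (a : lat_fun) n x y : R :=
  mesh D n * \sum_i a n i * (idx n x <= (i : nat) < idx n y)%N%:R.

Definition window_lim (a : lat_fun) x y : R := ulim U (fun n => window_sum a n x y).

Lemma near_window (B : R) : \forall n \near U, B < halfL D n.
Proof.
by apply: near_oo_U => //; apply: filterS (halfL_near D (B + 1)) => n; apply: lt_le_trans; lra.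
Qed.

Section one_lattice_function.
Variables (a : lat_fun) (K La : R).
Arguments a : clear implicits.
Hypothesis ha : lat_regular a K La.
Hypothesis La0 : 0 <= La.

Let K0 : 0 <= K.
Proof. by have /filter_ex[n [h _]] := ha; exact: le_trans (normr_ge0 _) (h 0). Qed.

Lemma lat_nat n (i j : nat) :
  (forall i (z : int), `|a n (i + z%:~R) - a n i| <= La * ((absz z)%:R * mesh D n)) ->
  `|a n i%:R - a n j%:R| <= La * `|i%:R * mesh D n - j%:R * mesh D n|.
Proof.
move=> h; have := h j%:R (Posz i - Posz j).
rewrite intrB -!pmulrn [j%:R + _]addrC subrK => /le_trans; apply.
rewrite -mulrBl normrM (gtr0_norm (mesh_gt0 D n)).
by rewrite -[X in _ <= La * (`|X| * _)]/(i%:R - j%:R) !pmulrn -intrB -intr_norm abszE.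
Qed.

Lemma lat_bounded x : ubounded U (fun n => a n ((idx n x)%:R)).
Proof. by exists K; apply: filterS ha => n [h _]. Qed.

(** By the uniform Lipschitz bound the standard part may be computed along any sites infinitely
    close to [y]. *)
Lemma lat_at (z : nat -> nat) y :
  (fun n => (z n)%:R * mesh D n - halfL D n) @ U --> y ->
  ulim U (fun n => a n (z n)%:R) = lat a y.
Proof.
move=> zy.
have ub : ubounded U (fun n => a n (z n)%:R) by exists K; apply: filterS ha => n [h _].
apply/eqP; rewrite -subr_eq0 -ulimB//; last exact: lat_bounded.
apply/eqP; apply: ulim_eq; apply/norm_cvg0P.
pose e n := La * (`|(z n)%:R * mesh D n - halfL D n - y| + mesh D n).
have e0 : e n @[n --> U] --> (0 : R).
  rewrite -[X in _ --> X](mulr0 La); apply: cvgM; first exact: cvg_cst.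
  rewrite -[X in _ --> X](addr0 0); apply: cvgD; last exact: (cvg_oo_U U_cofinite (mesh_cvg D)).
  by apply/norm_cvg0P; apply/subr_cvg0.
apply: (@squeeze_cvgr _ _ _ _ (fun=> 0) _ _ _ _ _ e0); last exact: cvg_cst.
have hL := near_window (- y); near=> n.
have Ln : - y < halfL D n by near: n.
have [_ hn] : (forall i, `|a n i| <= K) /\
  forall i (z : int), `|a n (i + z%:~R) - a n i| <= La * ((absz z)%:R * mesh D n) by near: n.
rewrite normr_ge0 /=; apply: le_trans (lat_nat _ _ hn) _; rewrite ler_wpM2l//.
have /andP[h1 h2] := @idx_itv n y ltac:(lra).
have -> : (z n)%:R * mesh D n - (idx n y)%:R * mesh D n =
  ((z n)%:R * mesh D n - halfL D n - y) + (y + halfL D n - (idx n y)%:R * mesh D n) by ring.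
apply: le_trans (ler_normD _ _) _; rewrite lerD2l ger0_norm; lra.
Unshelve. all: by end_near. Qed.

Lemma lat_lip x y : `|lat a x - lat a y| <= La * `|x - y|.
Proof.
rewrite /lat -ulimB; [|exact: lat_bounded..].
rewrite -ulim_norm; last by apply: uboundedB; exact: lat_bounded.
have cv : (fun n => La * (`|x - y| + mesh D n)) @ U --> La * `|x - y|.
  apply: cvgM; first exact: cvg_cst.
  rewrite -[X in _ --> X]addr0; apply: cvgD; first exact: cvg_cst.
  exact: (cvg_oo_U U_cofinite (mesh_cvg D)).
rewrite -(ulim_eq cv); apply: ler_ulim.
- by apply: ubounded_norm; apply: uboundedB; exact: lat_bounded.
- exact: ubounded_cvg cv.
have hx := near_window (- x); have hy := near_window (- y); near=> n.
have Lx : - x < halfL D n by near: n.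
have Ly : - y < halfL D n by near: n.
have [_ hn] : (forall i, `|a n i| <= K) /\
  forall i (z : int), `|a n (i + z%:~R) - a n i| <= La * ((absz z)%:R * mesh D n) by near: n.
apply: le_trans (lat_nat _ _ hn) _; rewrite ler_wpM2l//.
have /andP[h1 h2] := @idx_itv n y ltac:(lra).
have /andP[h3 h4] := @idx_itv n x ltac:(lra).
move: h1 h2 h3 h4; move: (mesh D n) (_ * mesh D n) (_ * mesh D n) (halfL D n) => m u v L *.
have h5 := ler_norm (x - y); have h6 := ler_norm (y - x); rewrite distrC in h6.
by rewrite ler_norml; lra.
Unshelve. all: by end_near. Qed.

Lemma window_sumD n x y z : x <= y -> y <= z ->
  window_sum a n x z = window_sum a n x y + window_sum a n y z.
Proof.
move=> xy yz; rewrite /window_sum -mulrDr -big_split /=; congr (_ * _).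
apply: eq_bigr => i _; rewrite -mulrDr -natrD; congr (_ * _%:R).
have h1 := idx_mono n xy; have h2 := idx_mono n yz.
have [h|h] := ltnP i (idx n y).
  by rewrite (leq_trans h h2); case: (_ <= _)%N.
by rewrite (leq_trans h1 h); case: (_ < _)%N.
Qed.

Let window_gap n x y : - halfL D n <= x -> x <= y ->
  `|((idx n y)%:R - (idx n x)%:R) * mesh D n - (y - x)| <= mesh D n.
Proof.
move=> Lx xy; have /andP[h1 h2] := idx_itv Lx.
have /andP[h3 h4] := @idx_itv n y (le_trans Lx xy).
rewrite mulrBl; move: h1 h2 h3 h4.
move: (mesh D n) (_ * mesh D n) (_ * mesh D n) (halfL D n) => m u v L *.
by rewrite ler_norml; lra.
Qed.

Let window_count n x y : - halfL D n <= x -> x <= y -> y < halfL D n ->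
  \sum_(i < (cells n).+2) (idx n x <= i < idx n y)%N%:R = (idx n y)%:R - (idx n x)%:R :> R.
Proof.
move=> Lx xy yL; apply: count_itv; first exact: idx_mono.
by apply: ltnW; apply: idx_le => //; exact: le_trans xy.
Qed.

Lemma window_sum_le n x y : (forall i, `|a n i| <= K) ->
  - halfL D n <= x -> x <= y -> y < halfL D n -> `|window_sum a n x y| <= K * (y - x + mesh D n).
Proof.
move=> h Lx xy yL; have m0 := mesh_gt0 D n.
rewrite normrM (gtr0_norm m0).
apply: (@le_trans _ _ (mesh D n * (K * ((idx n y)%:R - (idx n x)%:R)))).
  rewrite ler_pM2l// -window_count// mulr_sumr; apply: le_trans (ler_norm_sum _ _ _) _.
  by apply: ler_sum => i _; rewrite normrM [X in _ * X]ger0_norm// ler_wpM2r.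
rewrite mulrCA ler_wpM2l// mulrC; have := window_gap Lx xy; rewrite ler_norml => /andP[_]; lra.
Qed.

Lemma window_sum_estimate n x y : (forall i, `|a n i| <= K) ->
  (forall i (z : int), `|a n (i + z%:~R) - a n i| <= La * ((absz z)%:R * mesh D n)) ->
  - halfL D n <= x -> x <= y -> y < halfL D n ->
  `|window_sum a n x y - (y - x) * a n (idx n x)%:R| <=
  La * (y - x + mesh D n) ^+ 2 + K * mesh D n.
Proof.
move=> h hl Lx xy yL; have m0 := mesh_gt0 D n.
have gap := window_gap Lx xy; set p := idx n x; set q := idx n y.
have pq : (p <= q)%N by exact: idx_mono.
pose d := (q%:R - p%:R) * mesh D n.
have d0 : 0 <= d by rewrite mulr_ge0 ?(ltW m0)// subr_ge0 ler_nat.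
have dle : d <= y - x + mesh D n by move: gap; rewrite ler_norml -/p -/q -/d => /andP[_]; lra.
have -> : window_sum a n x y - (y - x) * a n p%:R =
    mesh D n * (\sum_i (a n i - a n p%:R) * (p <= (i : nat) < q)%N%:R) +
    (d - (y - x)) * a n p%:R.
  rewrite /window_sum -/p -/q.
  under [in RHS]eq_bigr do rewrite mulrBl.
  rewrite sumrB -mulr_sumr window_count// -/p -/q /d; ring.
apply: le_trans (ler_normD _ _) _; apply: lerD; last first.
  by rewrite normrM mulrC; apply: ler_pM.
rewrite normrM (gtr0_norm m0).
apply: (@le_trans _ _ (mesh D n * (La * d * (q%:R - p%:R)))).
  rewrite ler_pM2l// -window_count// mulr_sumr; apply: le_trans (ler_norm_sum _ _ _) _.
  apply: ler_sum => i _; rewrite normrM [X in _ * X]ger0_norm//.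
  have [/andP[pi iq]|_] := boolP (_ && _); last by rewrite !mulr0.
  rewrite !mulr1 -{1}(natr_Zp i); apply: le_trans (lat_nat _ _ hl) _; rewrite ler_wpM2l//.
  rewrite -mulrBl normrM (gtr0_norm m0) /d ler_pM2r// ger0_norm ?subr_ge0 ?ler_nat//.
  by rewrite lerD2r ler_nat ltnW.
have -> : mesh D n * (La * d * (q%:R - p%:R)) = La * d ^+ 2 by rewrite /d; ring.
by rewrite ler_wpM2l// ler_sqr ?nnegrE// (le_trans d0).
Qed.

Lemma window_bounded x y : x <= y -> ubounded U (fun n => window_sum a n x y).
Proof.
move=> xy; exists (K * (y - x + 1)).
have m1 := near_oo_U U_cofinite (near_le0 (mesh_cvg D) ltr01).
have hx := near_window (- x); have hy := near_window y; near=> n.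
have Lx : - x < halfL D n by near: n.
have [h _] : (forall i, `|a n i| <= K) /\
  forall i (z : int), `|a n (i + z%:~R) - a n i| <= La * ((absz z)%:R * mesh D n) by near: n.
apply: le_trans (window_sum_le h _ xy _) _; [lra|by near: n|].
by rewrite ler_wpM2l// lerD2l; near: n.
Unshelve. all: by end_near. Qed.

Lemma window_limD x y z : x <= y -> y <= z ->
  window_lim a x z = window_lim a x y + window_lim a y z.
Proof.
move=> xy yz; rewrite /window_lim -ulimD; [|exact: window_bounded..].
by apply: eq_ulim => //; apply: nearW => n; exact: window_sumD.
Qed.

Lemma window_lim_le x y : x <= y -> `|window_lim a x y| <= K * (y - x).
Proof.
move=> xy; have ub := window_bounded xy; rewrite /window_lim -ulim_norm//.
have cv : (fun n => K * (y - x + mesh D n)) @ U --> K * (y - x).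
  apply: cvgM; first exact: cvg_cst.
  rewrite -[X in _ --> X]addr0; apply: cvgD; first exact: cvg_cst.
  exact: (cvg_oo_U U_cofinite (mesh_cvg D)).
rewrite -(ulim_eq cv); apply: ler_ulim; [exact: ubounded_norm|exact: ubounded_cvg cv|].
have hx := near_window (- x); have hy := near_window y; near=> n.
have Lx : - x < halfL D n by near: n.
have [h _] : (forall i, `|a n i| <= K) /\
  forall i (z : int), `|a n (i + z%:~R) - a n i| <= La * ((absz z)%:R * mesh D n) by near: n.
by apply: window_sum_le => //; [lra|near: n].
Unshelve. all: by end_near. Qed.

Lemma window_lim_estimate x y : x <= y ->
  `|window_lim a x y - (y - x) * lat a x| <= La * (y - x) ^+ 2.
Proof.
move=> xy; have ub := window_bounded xy; have lb := lat_bounded x.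
have lb' : ubounded U (fun n => (y - x) * a n (idx n x)%:R).
  by apply: uboundedM => //; exact: ubounded_cst.
have -> : (y - x) * lat a x = ulim U (fun n => (y - x) * a n (idx n x)%:R).
  by rewrite (@ulimM _ _ _ (fun=> y - x)) ?ulim_cst//; exact: ubounded_cst.
rewrite /window_lim -ulimB// -ulim_norm; last exact: uboundedB.
have cv : (fun n => La * (y - x + mesh D n) ^+ 2 + K * mesh D n) @ U --> La * (y - x) ^+ 2.
  have mU := cvg_oo_U U_cofinite (mesh_cvg D).
  rewrite -[X in _ --> X]addr0; apply: cvgD; last first.
    by rewrite -[X in _ --> X](mulr0 K); apply: cvgM => //; exact: cvg_cst.
  have cv1 : (fun n => y - x + mesh D n) @ U --> y - x.
    by rewrite -[X in _ --> X]addr0; apply: cvgD => //; exact: cvg_cst.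
  by apply: cvgM; [exact: cvg_cst|exact: (cvg_comp _ _ cv1 (@exprn_continuous R 2 _))].
rewrite -(ulim_eq cv); apply: ler_ulim; [|exact: ubounded_cvg cv|].
  by apply: ubounded_norm; exact: uboundedB.
have hx := near_window (- x); have hy := near_window y; near=> n.
have Lx : - x < halfL D n by near: n.
have [h hl] : (forall i, `|a n i| <= K) /\
  forall i (z : int), `|a n (i + z%:~R) - a n i| <= La * ((absz z)%:R * mesh D n) by near: n.
by apply: window_sum_estimate => //; [lra|near: n].
Unshelve. all: by end_near. Qed.

(** The limit of the Riemann sums is additive and differentiable with derivative [lat a], hence it
    is the integral. *)
Lemma lat_integral A B : A <= B ->
  (\int[@lebesgue_measure R]_(x in `[A, B]) (lat a x)%:E)%E = (window_lim a A B)%:E.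
Proof.
rewrite le_eqVlt => /predU1P[<-|AB].
  have W0 : window_lim a A A = 0.
    by have := window_limD (lexx A) (lexx A); lra.
  by rewrite set_itv1 integral_set1 W0.
exact: (integral_of_quadratic La0 lat_lip window_limD window_lim_estimate AB).
Qed.

End one_lattice_function.

Lemma window_sum_l1 (a b : lat_fun) n x y (e : R) : \sum_i mesh D n * `|a n i - b n i| <= e ->
  window_sum a n x y <= window_sum b n x y + e.
Proof.
move=> h; rewrite -lerBlDl; apply: le_trans h; rewrite /window_sum -mulrBr -sumrB mulr_sumr.
apply: ler_sum => i _; rewrite ler_pM2l ?mesh_gt0// -mulrBl.
case: (_ && _); first by rewrite mulr1 ler_norm.
by rewrite mulr0.
Qed.

End lattice_limits.

(** * The limit density *)

Section limit_density.
Context {R : realType}.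
Variable D : porous_data R.
Notation g := (pg D).
Notation c := (pc D).
Notation T := (pT D).
Notation mu := (@lebesgue_measure R).
Context (U : set_system nat) {UU : UltraFilter U}.
Hypothesis U_cofinite : (\oo : set_system nat) `<=` U.
Implicit Types (n k m : nat) (s t x : R).

(** Geometric, so that the L1 distances of successive averages are summable and the averages
    converge almost everywhere. *)
Definition tol m : R := 2^-1 ^+ m.

Lemma tol_gt0 m : 0 < tol m. Proof. by rewrite exprn_gt0. Qed.

Lemma tol_cvg : tol @ \oo --> (0 : R).
Proof. by apply: cvg_expr; rewrite ger0_norm// invf_lt1// ltr1n. Qed.

Lemma radius_exists m : exists r, [/\ 0 < r,
  \forall n \near \oo, forall k, \sum_i mesh D n * `|vav D r n k i - dens D n k i| <= tol m &
  exists2 C : R, 0 <= C & \forall n \near \oo, forall k0 k, (k0 <= k)%N ->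
    mean_at D n k (fun h =>
      (Num.sqrt (g (vav D r n k0 (torus n (trunc k0 h)))) - sig D n h) ^+ 2) <=
    tol m + C * (step D n * (k - k0)%:R)].
Proof.
have [r1 r10 h1] := vav_l1 D (tol_gt0 m); have [r2 r20 h2] := coef_error D (tol_gt0 m).
have r0 : 0 < Num.min r1 r2 by rewrite lt_min r10.
exists (Num.min r1 r2); split => //.
  by apply: h1; rewrite r0 ge_min lexx.
by apply: h2; rewrite r0 ge_min lexx orbT.
Qed.

Definition ravg m : R := projT1 (cid (radius_exists m)).

Lemma ravg_gt0 m : 0 < ravg m. Proof. by rewrite /ravg; case: cid => r []. Qed.

Lemma ravg_l1 m : \forall n \near \oo, forall k,
  \sum_i mesh D n * `|vav D (ravg m) n k i - dens D n k i| <= tol m.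
Proof. by rewrite /ravg; case: cid => r []. Qed.

Lemma ravg_coef m : exists2 C : R, 0 <= C & \forall n \near \oo, forall k0 k, (k0 <= k)%N ->
  mean_at D n k (fun h =>
    (Num.sqrt (g (vav D (ravg m) n k0 (torus n (trunc k0 h)))) - sig D n h) ^+ 2) <=
  tol m + C * (step D n * (k - k0)%:R).
Proof. by rewrite /ravg; case: cid => r []. Qed.

Definition vloc m t : lat_fun := fun n i => vav D (ravg m) n (grid D n t) i.
Arguments vloc : clear implicits.

Lemma vloc_regular m t : lat_regular D U (vloc m t) (2 / ravg m) (4 / ravg m ^+ 2).
Proof.
apply: near_oo_U => //; apply: filterS (good_width_near D (ravg_gt0 m)) => n gw; split => [i|i z].
  by rewrite ger0_norm ?vav_ge0// vav_le// ravg_gt0.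
exact: (vav_space (ravg_gt0 m) gw).
Qed.

Let La0 m : 0 <= 4 / ravg m ^+ 2.
Proof. by rewrite divr_ge0// sqr_ge0. Qed.

Definition ravg_dens m t x : R := lat D U (vloc m t) x.

Lemma ravg_dens_ge0 m t x : 0 <= ravg_dens m t x.
Proof.
apply: ulim_ge; first exact: (lat_bounded (vloc_regular m t)).
by apply: nearW => n; exact: vav_ge0.
Qed.

Lemma ravg_dens_lip m t x y : `|ravg_dens m t x - ravg_dens m t y| <= 4 / ravg m ^+ 2 * `|x - y|.
Proof. exact: (lat_lip U_cofinite (vloc_regular m t)). Qed.

Lemma ravg_dens_time m s t x : `|ravg_dens m t x - ravg_dens m s x| <= 4 / ravg m ^+ 2 * Num.sqrt (c * `|t - s|).
Proof.
wlog st : s t / s <= t => [h|].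
  by have [/h//|/ltW/h] := leP s t; rewrite distrC (distrC s).
have b1 : ubounded U (fun n => vloc m t n (idx D n x)%:R) by exact: lat_bounded (vloc_regular m t) x.
have b2 : ubounded U (fun n => vloc m s n (idx D n x)%:R) by exact: lat_bounded (vloc_regular m s) x.
rewrite /ravg_dens /lat -ulimB// -ulim_norm; last exact: uboundedB.
have cv : (fun n => 4 / ravg m ^+ 2 * Num.sqrt (c * (`|t - s| + step D n))) @ U -->
    4 / ravg m ^+ 2 * Num.sqrt (c * `|t - s|).
  apply: cvg_oo_U => //; apply: cvgM; first exact: cvg_cst.
  apply: (cvg_comp (fun n => c * (`|t - s| + step D n)) Num.sqrt); last exact: sqrt_continuous.
  apply: cvgM; first exact: cvg_cst.
  by rewrite -[X in _ --> X]addr0; apply: cvgD; [exact: cvg_cst|exact: step_cvg].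
rewrite -(ulim_eq cv); apply: ler_ulim; [by apply: ubounded_norm; exact: uboundedB|exact: ubounded_cvg cv|].
apply: near_oo_U => //; apply: filterS (good_width_near D (ravg_gt0 m)) => n gw.
apply: le_trans (vav_time (ravg_gt0 m) gw _ (grid_mono D n st)) _.
rewrite ler_wpM2l// ler_wsqrtr// -mulrA ler_wpM2l ?pc_ge0//.
have := grid_increment D n st; have := clip_lip D t s.
rewrite (ger0_norm (x := clip D t - clip D s)) ?subr_ge0 ?clip_nd//.
move: (step D n) (step D n * _) (clip D t - clip D s) => st1 a b ab.
by rewrite ler_norml => /andP[_]; lra.
Qed.

Lemma ravg_dens_continuous m t : continuous (ravg_dens m t).
Proof.
move=> x; apply/cvgrPdist_le => e e0.
have K1 : 0 < 4 / ravg m ^+ 2 + 1 by rewrite ltr_wpDl.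
near=> y; apply: le_trans (ravg_dens_lip _ _ _ _) _.
have : `|x - y| <= e / (4 / ravg m ^+ 2 + 1).
  near: y; apply: filterS (nbhsx_ballx x (e / (4 / ravg m ^+ 2 + 1)) _) => [y|]; last by rewrite divr_gt0.
  by rewrite /ball /= => /ltW.
rewrite ler_pdivlMr// => /(le_trans _); apply.
by rewrite mulrC ler_wpM2l// lerDl.
Unshelve. all: by end_near. Qed.

Lemma ravg_dens_continuous_time m x : continuous (fun t => ravg_dens m t x).
Proof.
move=> t; apply/subr_cvg0/norm_cvg0P.
have cv : (fun s => 4 / ravg m ^+ 2 * Num.sqrt (c * `|s - t|)) @ t --> (0 : R).
  have -> : (0 : R) = 4 / ravg m ^+ 2 * Num.sqrt (c * `|t - t|).
    by rewrite subrr normr0 mulr0 sqrtr0 mulr0.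
  apply: cvgM; first exact: cvg_cst.
  apply: (cvg_comp (fun s => c * `|s - t|) Num.sqrt); last exact: sqrt_continuous.
  apply: cvgM; first exact: cvg_cst.
  by apply: cvg_norm; apply: cvgB; [exact: cvg_id|exact: cvg_cst].
apply: (@squeeze_cvgr _ _ _ _ (fun=> 0) _ _ _ _ _ cv); last exact: cvg_cst.
by apply: nearW => s; rewrite normr_ge0 ravg_dens_time.
Qed.

Lemma measurable_ravg_dens m t : measurable_fun setT (ravg_dens m t).
Proof. by apply: continuous_measurable_fun; exact: ravg_dens_continuous. Qed.

Lemma measurable_ravg_dens2 m : measurable_fun setT (fun p : R * R => ravg_dens m p.1 p.2).
Proof.
exact: (@measurable_of_sections R _ R (ravg_dens m) (measurable_ravg_dens m) (@ravg_dens_continuous_time m)).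
Qed.

Let mvelE m t (B : set R) : measurable_fun B (fun x => (ravg_dens m t x)%:E).
Proof. by apply/measurable_EFinP; apply: measurable_funTS; exact: measurable_ravg_dens. Qed.

Lemma ravg_dens_mass m t A B : A <= B -> (\int[mu]_(x in `[A, B]) (ravg_dens m t x)%:E <= (1 + tol m)%:E)%E.
Proof.
move=> AB; rewrite (lat_integral U_cofinite (vloc_regular m t) (La0 m) AB) lee_fin.
apply: ulim_le; first exact: (window_bounded U_cofinite (vloc_regular m t)).
apply: near_oo_U => //; apply: filterS (ravg_l1 m) => n /(_ (grid D n t)) h.
rewrite -(dens_sum D n (grid D n t)) -lerBlDl; apply: le_trans h.
rewrite /window_sum mulr_sumr -sumrB; apply: ler_sum => i _.
rewrite -mulrBr ler_wpM2l ?(ltW (mesh_gt0 D n))//.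
apply: le_trans (ler_norm _); rewrite lerD2r; case: (_ && _); rewrite ?mulr1// mulr0.
exact: vav_ge0.
Qed.

(** Both averages are l1-close to the same lattice density, and the modulus of their difference is
    again a regular lattice function, to which [lat_integral] applies. *)
Lemma ravg_dens_dist m k t A B : A <= B ->
  (\int[mu]_(x in `[A, B]) `|ravg_dens m t x - ravg_dens k t x|%:E <= (tol m + tol k)%:E)%E.
Proof.
move=> AB.
pose a : lat_fun := fun n i => `|vloc m t n i - vloc k t n i|.
have ha : lat_regular D U a (2 / ravg m + 2 / ravg k) (4 / ravg m ^+ 2 + 4 / ravg k ^+ 2).
  have h1 := vloc_regular m t; have h2 := vloc_regular k t; apply: filterS2 h1 h2 => n [p1 q1] [p2 q2].
  split => [i|i z].
    by rewrite /a normr_id; apply: le_trans (ler_normB _ _) _; exact: lerD.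
  rewrite /a mulrDl; apply: le_trans (ler_dist_dist _ _) _.
  have -> : vloc m t n (i + z%:~R) - vloc k t n (i + z%:~R) - (vloc m t n i - vloc k t n i) =
    (vloc m t n (i + z%:~R) - vloc m t n i) - (vloc k t n (i + z%:~R) - vloc k t n i) by ring.
  by apply: le_trans (ler_normB _ _) _; exact: lerD.
have aE x : lat D U a x = `|ravg_dens m t x - ravg_dens k t x|.
  have b1 : ubounded U (fun n => vloc m t n (idx D n x)%:R) by exact: lat_bounded (vloc_regular m t) x.
  have b2 : ubounded U (fun n => vloc k t n (idx D n x)%:R) by exact: lat_bounded (vloc_regular k t) x.
  by rewrite /lat ulim_norm ?ulimB//; exact: uboundedB.
under eq_integral do rewrite -aE.
rewrite (lat_integral U_cofinite ha (addr_ge0 (La0 m) (La0 k)) AB) lee_fin.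
apply: ulim_le; first exact: (window_bounded U_cofinite ha).
have h1 := near_oo_U U_cofinite (ravg_l1 m); have h2 := near_oo_U U_cofinite (ravg_l1 k); near=> n.
have p1 : forall j, \sum_i mesh D n * `|vav D (ravg m) n j i - dens D n j i| <= tol m by near: n.
have p2 : forall j, \sum_i mesh D n * `|vav D (ravg k) n j i - dens D n j i| <= tol k by near: n.
apply: le_trans (lerD (p1 (grid D n t)) (p2 (grid D n t))).
rewrite /window_sum mulr_sumr -big_split /=; apply: ler_sum => i _.
rewrite -mulrDr ler_wpM2l ?(ltW (mesh_gt0 D n))//.
apply: (@le_trans _ _ (a n i)); first by case: (_ && _); rewrite ?mulr1// mulr0 /a.
by rewrite /a [X in _ <= _ + X]distrC; exact: ler_distD.
Unshelve. all: by end_near. Qed.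

(** An upper limit is jointly measurable in time and space whether or not the sequence converges;
    [fine] sends infinite values to 0. *)
Definition lim_dens t x : R := fine (limn_esup (fun m => (ravg_dens m t x)%:E)).

Lemma lim_dens_ge0 t x : 0 <= lim_dens t x.
Proof.
apply: fine_ge0; rewrite limn_esup_lim; apply: lime_ge; first exact: is_cvg_esups.
apply: nearW => m; apply: le_ereal_sup_tmp; exists (ravg_dens m t x)%:E; last by rewrite lee_fin ravg_dens_ge0.
by exists m => /=.
Qed.

Lemma measurable_lim_dens2 : measurable_fun setT (fun p : R * R => lim_dens p.1 p.2).
Proof.
apply: (@measurableT_comp _ _ _ _ _ _ (@fine R)); first exact: fine_measurable.
apply: measurable_fun_limn_esup => m; apply/measurable_EFinP; exact: measurable_ravg_dens2.
Qed.

Lemma measurable_lim_dens t : measurable_fun setT (lim_dens t).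
Proof.
apply: (@measurableT_comp _ _ _ _ _ _ (@fine R)); first exact: fine_measurable.
by apply: measurable_fun_limn_esup => m; exact: mvelE.
Qed.

Let incr t x m : R := `|ravg_dens m.+1 t x - ravg_dens m t x|.
(** Its integral over a segment is at most 4, so it is finite almost everywhere: it yields both the
    convergence and the domination of the averages. *)
Let bound t x : \bar R := (\sum_(0 <= m <oo) (incr t x m)%:E)%E.

Let mincr t m (B : set R) : measurable_fun B (fun x => (incr t x m)%:E).
Proof.
apply/measurable_EFinP; apply: measurable_funTS; apply: measurableT_comp => //.
by apply: measurable_funB; exact: measurable_ravg_dens.
Qed.

Let mbound t (B : set R) : measurable B -> measurable_fun B (bound t).
Proof. by move=> mB; apply: ge0_emeasurable_sum => // m x _ _; rewrite lee_fin normr_ge0. Qed.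

Let bound_ge0 t x : (0 <= bound t x)%E.
Proof. by apply: nneseries_ge0 => m _ _; rewrite lee_fin normr_ge0. Qed.

Let tol2 m : tol m = 2 / (2 ^ m.+1)%:R.
Proof. by rewrite /tol exprVn natrX exprS invfM mulrA divff// mul1r. Qed.

Let int_bound t A B : A <= B -> (\int[mu]_(x in `[A, B]) bound t x <= 4%:E)%E.
Proof.
move=> AB; rewrite integral_nneseries//; [|by move=> m; exact: mincr|by move=> m x _; rewrite lee_fin normr_ge0].
apply: (@le_trans _ _ (\sum_(0 <= m <oo) (4 / (2 ^ m.+1)%:R)%:E)%E); last exact: epsilon_trick0.
apply: lee_nneseries => [m _ _|m _].
  by apply: integral_ge0 => x _; rewrite lee_fin normr_ge0.
apply: le_trans (ravg_dens_dist _ _ _ AB) _; rewrite lee_fin.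
have t1 : tol m.+1 <= tol m by rewrite /tol exprS ler_piMl ?exprn_ge0// invf_le1// ler1n.
have -> : 4 / (2 ^ m.+1)%:R = tol m + tol m by rewrite tol2; ring.
by rewrite lerD2r.
Qed.

Let bound_part t x n : (bound t x < +oo)%E -> \sum_(0 <= m < n) incr t x m <= fine (bound t x).
Proof.
move=> b; rewrite -lee_fin fineK; last by rewrite ge0_fin_numE ?bound_ge0.
rewrite -sumEFin; apply: nneseries_lim_ge => m _ _.
by rewrite lee_fin normr_ge0.
Qed.

Let ravg_dens_telescope t x n : `|ravg_dens n t x - ravg_dens 0 t x| <= \sum_(0 <= m < n) incr t x m.
Proof. by rewrite -(telescope_sumr (fun m => ravg_dens m t x))//; exact: ler_norm_sum. Qed.

Let ravg_dens_cvg t x : (bound t x < +oo)%E -> ravg_dens m t x @[m --> \oo] --> lim_dens t x.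
Proof.
move=> b.
have c1 : cvgn (series (telescope (fun m => ravg_dens m t x))).
  apply: normed_cvg; apply: nondecreasing_is_cvgn.
    by apply: nondecreasing_series => i _ _; exact: normr_ge0.
  exists (fine (bound t x)) => _ [n _ <-]; exact: bound_part.
have c2 : cvgn (fun m => ravg_dens m t x).
  move: c1; rewrite telescopeK => /cvg_ex[l cl]; apply/cvg_ex; exists (l + ravg_dens 0 t x).
  rewrite (_ : (fun m => ravg_dens m t x) = (fun n => (ravg_dens n t x - ravg_dens 0 t x) + ravg_dens 0 t x)).
    by apply: cvgD => //; exact: cvg_cst.
  by apply: funext => n; rewrite subrK.
have /cvg_ex[l cl] := c2.
suff -> : lim_dens t x = l by [].
have /cvg_esups : (ravg_dens m t x)%:E @[m --> \oo] --> l%:E by apply: cvg_EFin => //; exact: nearW.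
by rewrite /lim_dens limn_esup_lim => /cvg_lim ->.
Qed.

Lemma ravg_dens_dominated t x m : (`|(ravg_dens m t x)%:E| <= (ravg_dens 0 t x)%:E + bound t x)%E.
Proof.
have [b|] := ltP (bound t x) +oo%E; last by rewrite leye_eq => /eqP->; rewrite addey// leey.
rewrite -(fineK (x := bound t x)) ?ge0_fin_numE ?bound_ge0// -EFinD lee_fin.
have := le_trans (ravg_dens_telescope t x m) (bound_part m b).
by rewrite ger0_norm ?ravg_dens_ge0// ler_norml => /andP[_]; rewrite lerBlDl.
Qed.

Let fin_bound t A B : A <= B ->
  {ae mu, forall x, (`[A, B]%classic : set R) x -> (bound t x < +oo)%E}.
Proof.
move=> AB; have mI : measurable (`[A, B]%classic : set (measurableTypeR R)) by exact: measurable_itvR.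
have ib : mu.-integrable `[A, B] (bound t).
  apply/integrableP; split; first exact: mbound.
  under eq_integral do rewrite gee0_abs ?bound_ge0//.
  by apply: le_lt_trans (int_bound t AB) _; exact: ltry.
case: (integrable_ae mI ib) => N [mN N0 hN]; exists N; split => // x hx.
apply: hN => h; apply: hx => Ix; have := h Ix.
by rewrite ge0_fin_numE.
Qed.

Let neg_bound t : mu.-negligible [set x | ~ (bound t x < +oo)%E].
Proof.
have h n : mu.-negligible [set x | ~ ((`[- n%:R, n%:R]%classic : set R) x -> (bound t x < +oo)%E)].
  by apply: fin_bound; rewrite ge0_cp.
apply: negligibleS (negligible_bigcup h) => x /= bx.
exists (Num.truncn `|x|).+1 => //= h1; apply: bx; apply: h1.
rewrite in_itv /= -ler_norml.
by have /andP[_ /ltW] := truncn_itv (normr_ge0 x).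
Qed.

Lemma ravg_dens_cvg_ae t : mu.-negligible [set x | ~ (ravg_dens m t x @[m --> \oo] --> lim_dens t x)].
Proof. by apply: negligibleS (neg_bound t) => x /=; apply: contra_not; exact: ravg_dens_cvg. Qed.

Lemma lim_dens_integral t A B : A <= B ->
  (\int[mu]_(x in `[A, B]) (ravg_dens m t x)%:E)%E @[m --> \oo] -->
  (\int[mu]_(x in `[A, B]) (lim_dens t x)%:E)%E.
Proof.
move=> AB; have mI : measurable (`[A, B]%classic : set (measurableTypeR R)) by exact: measurable_itvR.
have := @dominated_convergence _ _ _ mu `[A, B]%classic mI (fun m x => (ravg_dens m t x)%:E)
  (fun x => (lim_dens t x)%:E) (fun x => (ravg_dens 0 t x)%:E + bound t x)%E.
case => //.
- by move=> m; exact: mvelE.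
- by apply/measurable_EFinP; apply: measurable_funTS; exact: measurable_lim_dens.
- case: (fin_bound t AB) => N [mN N0 hN]; exists N; split => // x hx.
  apply: hN => h; apply: hx => Ix; apply: cvg_EFin; first exact: nearW.
  exact: ravg_dens_cvg (h Ix).
- apply: integrableD => //.
    apply/integrableP; split; first exact: mvelE.
    under eq_integral do rewrite gee0_abs ?lee_fin ?ravg_dens_ge0//.
    by apply: le_lt_trans (ravg_dens_mass 0 t AB) _; exact: ltry.
  apply/integrableP; split; first exact: mbound.
  under eq_integral do rewrite gee0_abs ?bound_ge0//.
  by apply: le_lt_trans (int_bound t AB) _; exact: ltry.
- by apply: aeW => x m _; exact: ravg_dens_dominated.
Qed.

(** An upper bound is what [law_of_windows] asks for; the equality follows from it. *)
Lemma lim_dens_mass t : (\int[mu]_x (lim_dens t x)%:E <= 1)%E.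
Proof.
pose m2 := density_law (measurable_lim_dens t) (lim_dens_ge0 t).
rewrite -[leLHS]/(m2 setT).
have cov : \bigcup_n `[- n%:R, n%:R]%classic = setT :> set R.
  apply/seteqP; split => // x _; exists (Num.truncn `|x|).+1 => //=.
  rewrite in_itv /= -ler_norml; by have /andP[_ /ltW] := truncn_itv (normr_ge0 x).
have cv : m2 (`[- n%:R, n%:R]%classic : set R) @[n --> \oo] --> m2 setT.
  rewrite -cov; apply: (@nondecreasing_cvg_mu _ _ _ m2) => [n||n m nm].
  - exact: measurable_itvR.
  - by apply: bigcupT_measurable => n; exact: measurable_itvR.
  - apply/subsetPset => x /=; rewrite !in_itv /= => /andP[h1 h2].
    have nmR : n%:R <= m%:R :> R by rewrite ler_nat.
    by rewrite (le_trans h2)// andbT; apply: le_trans h1; rewrite lerN2.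
rewrite -(cvg_lim _ cv)//; apply: lime_le; first by apply/cvg_ex; eexists; exact: cv.
apply: nearW => n; have nn : - n%:R <= n%:R :> R by rewrite ge0_cp.
have cvn := lim_dens_integral (t := t) nn.
rewrite -[leLHS]/(\int[mu]_(x in `[(- n%:R)%R, n%:R]) (lim_dens t x)%:E)%E.
have cv1 : (1 + tol m)%:E @[m --> \oo] --> (1%:E : \bar R).
  apply: cvg_EFin; first exact: nearW.
  by rewrite -[X in _ --> X]addr0; apply: cvgD; [exact: cvg_cst|exact: tol_cvg].
rewrite -(cvg_lim _ cvn)// -(cvg_lim _ cv1)//; apply: lee_lim.
- by apply/cvg_ex; eexists; exact: cvn.
- by apply/cvg_ex; eexists; exact: cv1.
- by apply: nearW => m; exact: ravg_dens_mass.
Qed.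

End limit_density.
Arguments vloc {R} D m t n _.

(** * The law of the limit process *)

Section law_of_limit.
Context {R : realType}.
Variable D : porous_data R.
Notation T := (pT D).
Notation mu := (@lebesgue_measure R).
Context (U : set_system nat) {UU : UltraFilter U}.
Hypothesis U_cofinite : (\oo : set_system nat) `<=` U.
Context {d : measure_display} {Omega : measurableType d}.
Variables (P : probability Omega R) (ev : Omega -> nat -> history (E := move)).
Hypothesis hP : forall B, measurable (iset U ev B) /\
  P (iset U ev B) = (ulim U (fun n => Emean D n (\1_(B n))))%:E.
Implicit Types (n k m : nat) (s t x : R).

Let Y := limit_walk D U ev (Xwalk D).
Let La0 m : 0 <= 4 / ravg D m ^+ 2.
Proof. by rewrite divr_ge0// sqr_ge0. Qed.

Let mY t : measurable_fun setT (Y t).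
Proof. exact: (measurable_limit_walk hP t (Xwalk_regular (ev := ev))). Qed.

Let Xn t (w : Omega) n : R := walk_at D (Xwalk D) t n (ev w n).

Let Xn_cvg t w : Good D U ev w -> Xn t w @ U --> Y t w.
Proof.
move=> Gw; have sb : stbounded U ev (walk_at D (Xwalk D) t) w by apply: stbounded_Good => //; exact: Xwalk_regular.
by rewrite /Y limit_walk_good// stdE//; exact: ulim_cvg sb.
Qed.

(* Far inside the window the torus coordinate is the unwrapped site. *)
Lemma torus_site_nat n (h : history (E := move)) : - halfL D n <= Xwalk D n h ->
  torus n h = (absz (site h))%:R /\
  Xwalk D n h = - halfL D n + mesh D n * (absz (site h))%:R.
Proof.
rewrite /Xwalk lerDl pmulr_rge0 ?mesh_gt0// ler0z => s0.
have E : Posz (absz (site h)) = site h by exact: gez0_abs.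
by rewrite /torus /torus_site -{1 3}E.
Qed.

Lemma std_vloc m t w : Good D U ev w ->
  ulim U (fun n => vloc D m t n (torus n (trunc (grid D n t) (ev w n)))) = ravg_dens D U m t (Y t w).
Proof.
move=> Gw; have cv : Xn t w @ U --> Y t w by exact: Xn_cvg.
pose z n := absz (site (trunc (grid D n t) (ev w n))).
have near_in : \forall n \near U, - halfL D n <= Xn t w n.
  have hL := near_window D U_cofinite (1 - Y t w).
  have h1 : \forall n \near U, `|Y t w - Xn t w n| < 1 by apply: cvgr_dist_lt.
  apply: filterS2 hL h1 => n hL; rewrite ltr_norml => /andP[_ h2]; lra.
rewrite /ravg_dens -(lat_at U_cofinite (vloc_regular D U_cofinite m t) (La0 m) (z := z)).
  by apply: eq_ulim => //; apply: filterS near_in => n /torus_site_nat[-> _].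
apply: cvg_trans cv; apply: near_eq_cvg; apply: filterS near_in => n /torus_site_nat[_].
by rewrite /Xn /walk_at => ->; rewrite /z addrC mulrC.
Qed.

(** A standard part in [[a, b]] puts the walk only in the window enlarged by [dl], at almost every
    index. *)
Let prob_window t a b (dl : R) (q : nat -> R) (l : R) : 0 < dl -> q @ U --> l ->
  (\forall n \near U, mean_at D n (grid D n t)
    (fun h => (a - dl <= Xwalk D n h <= b + dl)%R%:R) <= q n) ->
  (P (Y t @^-1` `[a, b]) <= l%:E)%E.
Proof.
move=> dl0 ql hq.
pose S n := [set h : history (E := move) | a - dl <= walk_at D (Xwalk D) t n h <= b + dl].
have mI : measurable (irregular D U ev).
  by rewrite -[irregular _ _ _]setCK; apply: measurableC; exact: (measurable_Good hP).
apply: (@le_trans _ _ (P (iset U ev S))).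
  apply: (@le_trans _ _ (P (iset U ev S `|` irregular D U ev))).
    apply: le_measure; rewrite ?inE.
    - by rewrite -[_ @^-1` _]setTI; apply: mY => //; exact: measurable_itvR.
    - by apply: measurableU => //; exact: (hP _).1.
    move=> w; rewrite /= in_itv /= => /andP[aY Yb].
    have [Gw|] := pselect (Good D U ev w); last by move=> /contrapT; right.
    left; have h1 : \forall n \near U, `|Y t w - Xn t w n| < dl.
      by apply: cvgr_dist_lt => //; exact: Xn_cvg.
    apply: filterS h1 => n; rewrite ltr_norml -/(Xn t w n) => /andP[h1 h2].
    by rewrite /S /= -/(Xn t w n); apply/andP; split; lra.
  apply: le_trans (measureU2 _ _ _) _ => //; first exact: (hP _).1.
  by rewrite [X in (_ + X)%E](null_irregular U_cofinite hP) adde0.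
rewrite (hP _).2 lee_fin -(ulim_eq ql); apply: ler_ulim; [|exact: ubounded_cvg ql|].
  apply: (ubounded_expect (Emean_functional D) (K := 1)) => n h.
  by rewrite indicE ger0_norm// lern1 leq_b1.
apply: filterS hq => n; apply: le_trans.
rewrite -(mean_at_trunc D n _ (grid_le D n t)) /Emean; set f := _ \o _.
suff -> : \1_(S n) = f by [].
apply: funext => h; rewrite indicE /f /=.
by have [hh|/negP hh] := boolP (_ <= _ <= _)%R; [rewrite mem_set|rewrite memNset].
Qed.

Let window_dens n k (a b : R) (dl : R) : mesh D n <= dl -> 0 < dl -> - halfL D n <= a ->
  a <= b -> b < halfL D n ->
  mean_at D n k (fun h => (a <= Xwalk D n h <= b)%R%:R) <=
  window_sum D (fun n => dens D n k) n a (b + dl).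
Proof.
move=> mdl dl0 La ab bL; have m0 := mesh_gt0 D n.
pose f (i : 'I_(cells n).+2) : R := (idx D n a <= (i : nat) < idx D n (b + dl))%N%:R.
apply: (@le_trans _ _ (mean_at D n k (fun h => f (torus n h)))); last first.
  rewrite mean_at_law /window_sum mulr_sumr; apply: ler_sum => i _.
  by rewrite mulrA.
apply: (expect_le (mean_at_functional D n k)) => h.
have [/andP[aX Xb]|_] := boolP (_ <= _ <= _)%R; last by [].
have [tE XE] := torus_site_nat (le_trans La aX).
set z := absz (site h) in tE XE.
have zX : idx D n (Xwalk D n h) = z by rewrite XE idx_node.
have zM : (z < (cells n).+2)%N.
  rewrite -zX; apply: idx_le; first exact: le_trans aX.
  exact: le_lt_trans bL.
rewrite /f tE Zp_nat /= modn_small//.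
have -> // : (idx D n a <= z < idx D n (b + dl))%N.
apply/andP; split; first by rewrite -zX; exact: idx_mono.
rewrite -[(z < _)%N]/(z.+1 <= _)%N -(idx_node D n z.+1); apply: idx_mono.
rewrite -natr1 mulrDr mulr1 addrA -XE.
by apply: lerD.
Qed.

Lemma law_window m t a b : a <= b ->
  (P (Y t @^-1` `[a, b]) <= (window_lim D U (vloc D m t) a b + tol m)%:E)%E.
Proof.
move=> ab; pose K : R := 2 / ravg D m.
have reg := vloc_regular D U_cofinite m t.
have K0 : 0 <= K by rewrite divr_ge0// ltW// ravg_gt0.
apply/lee_addgt0Pr => e e0; rewrite -EFinD.
(* The window grows by [dl] on the left and [2 * dl] on the right, and the averages are at most
   [K]. *)
pose dl := e / (3 * K + 1).
have K1 : 0 < 3 * K + 1 by rewrite ltr_wpDl// mulr_ge0.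
have dl0 : 0 < dl by rewrite divr_gt0.
have ab' : a - dl <= b + dl + dl by lra.
apply: (@le_trans _ _ (window_lim D U (vloc D m t) (a - dl) (b + dl + dl) + tol m)%:E).
  apply: (prob_window dl0 (q := fun n => window_sum D (vloc D m t) n (a - dl) (b + dl + dl) + tol m)).
    apply: cvgD; last exact: cvg_cst.
    by apply: ulim_cvg; exact: (window_bounded U_cofinite reg).
  have hm := near_oo_U U_cofinite (near_le0 (mesh_cvg D) dl0).
  have h1 := near_window D U_cofinite (dl - a); have h2 := near_window D U_cofinite (b + dl).
  have h3 := near_oo_U U_cofinite (ravg_l1 D m); near=> n.
  have hm' : mesh D n <= dl by near: n.
  have h1' : dl - a < halfL D n by near: n.
  have h2' : b + dl < halfL D n by near: n.
  have h3' : forall k, \sum_i mesh D n * `|vav D (ravg D m) n k i - dens D n k i| <= tol m by near: n.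
  apply: le_trans (window_dens _ hm' dl0 _ _ h2') _; [lra|lra|].
  apply: (window_sum_l1 (b := vloc D m t)); apply: le_trans (h3' (grid D n t)).
  by apply: ler_sum => i _; rewrite distrC.
rewrite lee_fin.
have ha : a - dl <= a by lra.
have hb : b <= b + dl + dl by lra.
rewrite (window_limD U_cofinite reg ha (le_trans ab hb)) (window_limD U_cofinite reg ab hb).
have l1 : window_lim D U (vloc D m t) (a - dl) a <= K * (a - (a - dl)).
  exact: le_trans (ler_norm _) (window_lim_le U_cofinite reg ha).
have l2 : window_lim D U (vloc D m t) b (b + dl + dl) <= K * (b + dl + dl - b).
  exact: le_trans (ler_norm _) (window_lim_le U_cofinite reg hb).
have hK : 3 * K * dl <= e.
  rewrite /dl mulrA ler_pdivrMr// mulrC ler_pM2l//; lra.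
move: l1 l2; have -> : K * (a - (a - dl)) = K * dl by ring.
have -> : K * (b + dl + dl - b) = 2 * (K * dl) by ring.
by move: hK; rewrite -mulrA; move: (window_lim _ _ _ _ _) (window_lim _ _ _ _ _) (window_lim _ _ _ _ _) => x y z; lra.
Unshelve. all: by end_near. Qed.

Lemma law_limit t (B : set R) : measurable B ->
  P (Y t @^-1` B) = (\int[mu]_(x in B) (lim_dens D U t x)%:E)%E.
Proof.
apply: law_of_windows.
- exact: mY.
- exact: measurable_lim_dens.
- exact: lim_dens_ge0.
- exact: lim_dens_mass.
move=> a b ab.
have cv : (window_lim D U (vloc D m t) a b + tol m)%:E @[m --> \oo] -->
    (\int[mu]_(x in `[a, b]) (lim_dens D U t x)%:E)%E.
  have -> : (fun m => (window_lim D U (vloc D m t) a b + tol m)%:E) =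
      (fun m => (\int[mu]_(x in `[a, b]) (ravg_dens D U m t x)%:E + (tol m)%:E)%E).
    apply: funext => m; rewrite EFinD; congr (_ + _)%E; apply/esym.
    exact: (lat_integral U_cofinite (vloc_regular D U_cofinite m t) (La0 m) ab).
  rewrite -[X in _ --> X]adde0; apply: cvgeD.
  - by rewrite fin_num_adde_defl.
  - exact: lim_dens_integral.
  - apply: cvg_EFin; first exact: nearW.
    exact: tol_cvg.
rewrite -(cvg_lim _ cv)//; apply: lime_ge; first by apply/cvg_ex; eexists; exact: cv.
by apply: nearW => m; exact: law_window.
Qed.

Let mpf : measurable_fun setT (pf D).
Proof. by have := pf_int D => /integrableP[/measurable_EFinP]. Qed.

(** At time 0 the window probabilities are bounded by the cell masses themselves, without averages,
    which identifies the density as [pf D]. *)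
Lemma law_initial (B : set R) : measurable B ->
  P (Y 0 @^-1` B) = (\int[mu]_(x in B) (pf D x)%:E)%E.
Proof.
have i1 : (\int[mu]_x (pf D x)%:E = 1)%E.
  have f1 := pf_mass D; have fi := pf_int D.
  have fin : (\int[mu]_x (pf D x)%:E)%E \is a fin_num by exact: integrable_fin_num.
  by rewrite -(fineK fin) -[fine _]/(\int[mu]_x pf D x) f1.
apply: law_of_windows; [exact: mY|exact: mpf|exact: pf_ge0|by rewrite i1|].
move=> a b ab.
pose m2 := density_law mpf (pf_ge0 D).
rewrite -[leRHS]/(m2 `[a, b]%classic).
(* One [1 / k.+1] on each side enlarges the window; the second one on the right makes room for the
   last cell. *)
pose J k : set R := `[a - k.+1%:R^-1, b + 2 * k.+1%:R^-1[%classic.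
have capJ : \bigcap_k J k = `[a, b]%classic.
  apply/seteqP; split => x.
    move=> h; rewrite /= in_itv /=; apply/andP; split.
      apply/ler_addgt0Pr => e e0.
      have [k ke] : exists k, k.+1%:R^-1 < e.
        by have /filter_ex := near_infty_natSinv_lt (PosNum e0).
      have := h k I; rewrite /J /= in_itv /= => /andP[+ _].
      by move: ke; move: (k.+1%:R^-1) => z; lra.
    apply/ler_addgt0Pr => e e0.
    have e2 : 0 < e / 2 by lra.
    have [k ke] : exists k, k.+1%:R^-1 < e / 2.
      by have /filter_ex := near_infty_natSinv_lt (PosNum e2).
    have := h k I; rewrite /J /= in_itv /= => /andP[_].
    by move: ke; move: (k.+1%:R^-1) => z; lra.
  rewrite /= in_itv /= => /andP[ax xb] k _; rewrite /J /= in_itv /=.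
  have : (0 : R) < k.+1%:R^-1 by rewrite invr_gt0.
  by move: (k.+1%:R^-1) => z k0; apply/andP; split; lra.
have cv : (m2 (J k) + (k.+1%:R^-1)%:E)%E @[k --> \oo] --> m2 `[a, b]%classic.
  rewrite -[X in _ --> X]adde0; apply: cvgeD.
  - by rewrite fin_num_adde_defl.
  - rewrite -capJ; apply: (@nonincreasing_cvg_mu _ _ _ m2).
    + apply: (@le_lt_trans _ _ (m2 setT)); last by rewrite (i1 : m2 setT = 1%E) ltry.
      by apply: le_measure; rewrite ?inE//; exact: measurable_itvR.
    + by move=> k; exact: measurable_itvR.
    + by rewrite capJ; exact: measurable_itvR.
    + move=> k l kl; apply/subsetPset => x; rewrite /J /= !in_itv /=.
      have : l.+1%:R^-1 <= k.+1%:R^-1 :> R by rewrite lef_pV2 ?posrE// ler_nat.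
      by move: (k.+1%:R^-1) (l.+1%:R^-1) => y z h /andP[h1 h2]; apply/andP; split; lra.
  - apply: cvg_EFin; first exact: nearW.
    exact: cvg_harmonic.
rewrite -(cvg_lim _ cv)//; apply: lime_ge; first by apply/cvg_ex; eexists; exact: cv.
apply: nearW => k; have k0 : (0 : R) < k.+1%:R^-1 by rewrite invr_gt0.
have fJ : m2 (J k) = (itv_mass (pf D) (a - k.+1%:R^-1) (b + 2 * k.+1%:R^-1))%:E.
  rewrite /itv_mass /Rintegral fineK//; apply: integrable_fin_num => //.
  exact: integrable_itv (pf_int D).
rewrite fJ -EFinD.
apply: (prob_window k0 (q := fun=> itv_mass (pf D) (a - k.+1%:R^-1) (b + 2 * k.+1%:R^-1) + k.+1%:R^-1)).
  exact: cvg_cst.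
have h1 := near_oo_U U_cofinite (outside_window_near D k0).
have h2 := near_oo_U U_cofinite (near_le0 (mesh_cvg D) k0); near=> n; rewrite grid0.
have h1' : 1 - itv_mass (pf D) (node (mesh D n) (halfL D n) 0)
  (node (mesh D n) (halfL D n) (cells n).+2) <= k.+1%:R^-1 by near: n.
have h2' : mesh D n <= k.+1%:R^-1 by near: n.
apply: le_trans (Xwalk_init_window _ _ _ _) _; apply: lerD => //.
have m0 := mesh_gt0 D n.
move: h2' k0; move: (k.+1%:R^-1) => z h2' k0.
rewrite (itv_massD (a := a - z) (b := b + z + mesh D n) (c := b + 2 * z) (pf_int D)); [|lra|lra].
by rewrite lerDl; exact: itv_mass_ge0 (pf_ge0 D).
Unshelve. all: by end_near. Qed.

End law_of_limit.

(** * The stochastic integral *)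

Section ito_limit.
Context {R : realType}.
Variable D : porous_data R.
Notation g := (pg D).
Notation c := (pc D).
Notation T := (pT D).
Notation mu := (@lebesgue_measure R).
Context (U : set_system nat) {UU : UltraFilter U}.
Hypothesis U_cofinite : (\oo : set_system nat) `<=` U.
Context {d : measure_display} {Omega : measurableType d}.
Variables (P : probability Omega R) (ev : Omega -> nat -> history (E := move)).
Hypothesis hP : forall B, measurable (iset U ev B) /\
  P (iset U ev B) = (ulim U (fun n => Emean D n (\1_(B n))))%:E.
Implicit Types (n k m : nat) (s t x : R).

Let Y := limit_walk D U ev (Xwalk D).
Let W := limit_walk D U ev (Wwalk D).
Let F := Filt D U P ev.
Let T0 : 0 < T := pT_gt0 D.

Let Xreg : regular_walk D U ev (Xwalk D). Proof. exact: Xwalk_regular. Qed.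
Let Wreg : regular_walk D U ev (Wwalk D). Proof. exact: Wwalk_regular. Qed.
Let mY t : measurable_fun setT (Y t). Proof. exact: (measurable_limit_walk hP t Xreg). Qed.
Let mW t : measurable_fun setT (W t). Proof. exact: (measurable_limit_walk hP t Wreg). Qed.

(** The value at time 0 is imposed, so that the initial condition holds for [pf] itself. *)
Definition usol t x : R := if t == 0 then pf D x else lim_dens D U t x.
Definition vol x : R := Num.sqrt (g x).
Definition Hsol s w : R := vol (usol s (Y s w)).
Definition Msol t w : R := Y t w - Y 0 w.

Lemma vol_continuous : continuous vol.
Proof. by move=> x; apply: continuous_comp; [exact: pg_cont|exact: sqrt_continuous]. Qed.

Lemma measurable_vol : measurable_fun setT vol.
Proof. by apply: continuous_measurable_fun; exact: vol_continuous. Qed.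

Lemma vol_itv x : 0 <= vol x <= Num.sqrt c.
Proof. by rewrite sqrtr_ge0 ler_wsqrtr ?pg_le. Qed.

Lemma vol_dist_sqr x y : (vol x - vol y) ^+ 2 <= `|g x - g y|.
Proof. by apply: sqrt_dist_sqr; exact: pg_ge0. Qed.

Lemma pg_dist_le x y : `|g x - g y| <= c.
Proof.
have := pg_ge0 D x; have := pg_ge0 D y; have := pg_le D x; have := pg_le D y.
by rewrite ler_norml; lra.
Qed.

Lemma measurable_pg : measurable_fun setT g.
Proof. by apply: continuous_measurable_fun; exact: pg_cont. Qed.

Let mpf : measurable_fun setT (pf D).
Proof. by have := pf_int D => /integrableP[/measurable_EFinP]. Qed.

Lemma measurable_usol2 : measurable_fun setT (fun p : R * R => usol p.1 p.2).
Proof.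
apply: measurable_fun_ifT.
- have -> : (fun p : R * R => p.1 == 0) = (fun t => t == 0) \o (fun p : R * R => p.1) by [].
  apply: measurableT_comp; last exact: measurable_fst.
  by apply: measurable_fun_eqr => //; exact: measurable_cst.
- exact: (measurableT_comp mpf measurable_snd).
- exact: measurable_lim_dens2.
Qed.

Lemma measurable_usol t : measurable_fun setT (usol t).
Proof. by rewrite /usol; case: eqP => _; [exact: mpf|exact: measurable_lim_dens]. Qed.

Lemma usol_ge0 t x : 0 <= usol t x.
Proof. by rewrite /usol; case: ifP => _; [exact: pf_ge0|exact: lim_dens_ge0]. Qed.

Lemma measurable_Y2 : measurable_fun setT (fun p : R * Omega => Y p.1 p.2).
Proof. by apply: measurable_of_sections => //; exact: limit_walk_continuous Xreg. Qed.

Lemma measurable_Hsol2 : measurable_fun setT (fun p : R * Omega => Hsol p.1 p.2).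
Proof.
apply: (measurableT_comp measurable_vol).
exact: (measurableT_comp measurable_usol2 (measurable_fun_pair measurable_fst measurable_Y2)).
Qed.

(** The number of parts is chosen after the radius [ravg D m], on which the constants depend. The
    factor 3 is [tol m] from the averages, one for the length of a part and one for rounding to the
    grid. *)
Lemma partition_exists m : exists q : nat, [/\ (0 < q)%N,
  \forall n \near \oo, forall k0 k, (k0 <= k)%N ->
    step D n * (k - k0)%:R <= T / q%:R + step D n ->
    mean_at D n k (fun h =>
      (vol (vav D (ravg D m) n k0 (torus n (trunc k0 h))) - sig D n h) ^+ 2) <= 3 * tol m &
  \forall n \near \oo, forall k0 k, (k0 <= k)%N ->
    step D n * (k - k0)%:R <= T / q%:R + step D n ->
    mean_at D n k (fun h => `|g (vav D (ravg D m) n k0 (torus n (trunc k0 h))) -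
      g (vav D (ravg D m) n k (torus n h))|) <= 3 * tol m].
Proof.
have t0 := @tol_gt0 R m.
have [C1 C10 h1] := ravg_coef D m; have [C2 C20 h2] := vav_increment D (ravg_gt0 D m) t0.
pose C := C1 + C2; have C0 : 0 <= C by rewrite addr_ge0.
pose q := (Num.truncn (C * T / tol m)).+1.
have q0 : (0 : R) < q%:R by rewrite ltr0n.
have CT0 : 0 <= C * T / tol m by rewrite !mulr_ge0 ?invr_ge0 ?(ltW T0) ?(ltW t0).
have Cq : C * (T / q%:R) <= tol m.
  rewrite mulrA ler_pdivrMr// -ler_pdivrMl// mulrC.
  by have /andP[_ /ltW] := truncn_itv CT0.
have hs : \forall n \near \oo, C * step D n <= tol m.
  apply: near_le0 => //; rewrite -[X in _ --> X](mulr0 C); apply: cvgM; first exact: cvg_cst.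
  exact: step_cvg.
have est x y : 0 <= x -> x <= T / q%:R + y -> C * y <= tol m -> C1 * x <= 2 * tol m /\ C2 * x <= 2 * tol m.
  move=> x0 xy Cy; have Cx : C * x <= 2 * tol m.
    by apply: le_trans (ler_wpM2l C0 xy) _; rewrite mulrDr; lra.
  have := mulr_ge0 C10 x0; have := mulr_ge0 C20 x0; move: Cx; rewrite /C mulrDl => *.
  by split; lra.
exists q; split => //.
  apply: filterS2 h1 hs => n h1n hsn k0 k kk hst; apply: le_trans (h1n _ _ kk) _.
  have x0 : 0 <= step D n * (k - k0)%:R by rewrite mulr_ge0 ?(ltW (step_gt0 D n)).
  by have [] := est _ _ x0 hst hsn; lra.
apply: filterS2 (good_width_near D (ravg_gt0 D m)) hs => n gw hsn k0 k kk hst.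
apply: le_trans (h2 n gw _ _ kk) _.
have x0 : 0 <= step D n * (k - k0)%:R by rewrite mulr_ge0 ?(ltW (step_gt0 D n)).
by have [] := est _ _ x0 hst hsn; lra.
Qed.

Definition parts m : nat := projT1 (cid (partition_exists m)).
Definition tpt m (i : nat) : R := i%:R * (T / (parts m)%:R).

Let parts_spec m := projT2 (cid (partition_exists m)).

Lemma parts_gt0 m : (0 < parts m)%N. Proof. by have [] := parts_spec m. Qed.

Let pq m : (0 : R) < (parts m)%:R. Proof. by rewrite ltr0n parts_gt0. Qed.

Lemma tpt_le m (i j : nat) : (i <= j)%N -> tpt m i <= tpt m j.
Proof. by move=> ij; rewrite ler_wpM2r ?divr_ge0 ?(ltW T0)// ler_nat. Qed.

Lemma tpt_ge0 m i : 0 <= tpt m i.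
Proof. by rewrite mulr_ge0// divr_ge0// ltW. Qed.

Lemma tpt_last m : tpt m (parts m) = T.
Proof. by rewrite /tpt mulrCA divff ?mulr1// gt_eqF. Qed.

Lemma tptS m i : tpt m i.+1 = tpt m i + T / (parts m)%:R.
Proof. by rewrite /tpt -(natr1 i) mulrDl mul1r. Qed.

Let step_gap n m i s : tpt m i <= s -> s <= tpt m i.+1 ->
  step D n * (grid D n s - grid D n (tpt m i))%:R <= T / (parts m)%:R + step D n.
Proof.
move=> h1 h2; have := grid_increment D n h1; have := clip_lip D s (tpt m i).
rewrite (ger0_norm (x := s - _)) ?subr_ge0// (ger0_norm (x := clip D s - _)) ?subr_ge0 ?clip_nd//.
move: h2; rewrite tptS; move: (step D n) (step D n * _) (clip D s - _) (T / _) => st a b e h2 h3.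
by rewrite ler_norml => /andP[_ h4]; lra.
Qed.

Definition scoef m (i : nat) w : R := vol (ravg_dens D U m (tpt m i) (Y (tpt m i) w)).

Let scoef_measurable m i : measurable_wrt (F (tpt m i)) (scoef m i).
Proof.
apply: (@measurable_wrt_comp _ _ _ _ (Y (tpt m i)) (fun x => vol (ravg_dens D U m (tpt m i) x))).
  by apply: (measurableT_comp measurable_vol); exact: measurable_ravg_dens.
exact: limit_walk_adapted Xreg.
Qed.

Let tpt0 m : 0 <= tpt m 0%N. Proof. exact: tpt_ge0. Qed.
Let tptT m : tpt m (parts m) <= T. Proof. by rewrite tpt_last. Qed.
Let tptle m i : (i < parts m)%N -> tpt m i <= tpt m i.+1. Proof. by move=> _; exact: tpt_le. Qed.
Let scoefb m i : (i < parts m)%N -> exists b : R, forall w, `|scoef m i w| <= b.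
Proof. by move=> _; exists (Num.sqrt c) => w; have /andP[v0 v1] := vol_itv (ravg_dens D U m (tpt m i) (Y (tpt m i) w)); rewrite ger0_norm. Qed.

Definition simple_approx m : simple_process F T :=
  @SimpleProcess R d Omega F T (parts m) (tpt m) (scoef m) (tpt0 m) (tptT m)
    (@tptle m) (fun i _ => scoef_measurable m i) (@scoefb m).

Definition lcoef n m (i : nat) (h : history (E := move)) : R :=
  vol (vloc D m (tpt m i) n (torus n h)).

Let kk n m i := grid D n (tpt m i).

Let ulim_lcoef m i w : Good D U ev w ->
  ubounded U (fun n => lcoef n m i (trunc (kk n m i) (ev w n))) /\
  ulim U (fun n => lcoef n m i (trunc (kk n m i) (ev w n))) = scoef m i w.
Proof.
move=> Gw.
have ub : ubounded U (fun n => vloc D m (tpt m i) n (torus n (trunc (kk n m i) (ev w n)))).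
  exists (2 / ravg D m); apply: filterS (vloc_regular D U_cofinite m (tpt m i)) => n [h _].
  exact: h.
split; first exact: (ubounded_continuous vol_continuous ub).
by rewrite /scoef /Y -(std_vloc U_cofinite m (tpt m i) Gw) -(ulim_continuous vol_continuous ub).
Qed.

Let walk_ulim M t w : regular_walk D U ev M -> Good D U ev w ->
  ubounded U (fun n => M n (trunc (grid D n t) (ev w n))) /\
  ulim U (fun n => M n (trunc (grid D n t) (ev w n))) = limit_walk D U ev M t w.
Proof.
move=> rM Gw; have sb : stbounded U ev (walk_at D M t) w by apply: stbounded_Good.
by split => //; rewrite limit_walk_good// stdE.
Qed.

Let discrete_error t m n (h : history (E := move)) : R :=
  let h' := trunc (grid D n t) h in
  ito_sum D n (parts m) (kk n m) (lcoef n m) (grid D n t) h' -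
  (Xwalk D n h' - Xwalk D n (trunc 0 h')).

Let discrete_errorE t m n h : discrete_error t m n h =
  \sum_(i < parts m) lcoef n m i (trunc (kk n m i) h) *
    (Wwalk D n (trunc (grid D n (Num.min (tpt m i.+1) t)) h) -
     Wwalk D n (trunc (grid D n (Num.min (tpt m i) t)) h)) -
  (Xwalk D n (trunc (grid D n t) h) - Xwalk D n (trunc (grid D n 0) h)).
Proof.
rewrite /discrete_error /ito_sum grid0 trunc_trunc//; congr (_ - _); apply: eq_bigr => i _.
rewrite !grid_min -/(kk n m i) -/(kk n m i.+1) !(trunc_trunc _ (geq_minr _ _)).
(* If interval [i] begins after [t], both walks are stopped at [t] and the term is 0, whatever the
   coefficient read on the truncated history. *)
have [le|lt] := leqP (kk n m i) (grid D n t).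
  by rewrite trunc_trunc.
have lt' : (grid D n t <= kk n m i.+1)%N.
  by apply: leq_trans (ltnW lt) _; apply: grid_mono; exact: tpt_le.
by rewrite (minn_idPr lt') subrr !mulr0.
Qed.

Let std_error t m w : Good D U ev w ->
  sp_integral (simple_approx m) W t w - Msol t w = std U ev (discrete_error t m) w.
Proof.
move=> Gw.
pose a i n := lcoef n m i (trunc (kk n m i) (ev w n)) *
    (Wwalk D n (trunc (grid D n (Num.min (tpt m i.+1) t)) (ev w n)) -
     Wwalk D n (trunc (grid D n (Num.min (tpt m i) t)) (ev w n))).
have aub i : ubounded U (a i).
  apply: uboundedM => //; first exact: (ulim_lcoef m i Gw).1.
  by apply: uboundedB; exact: (walk_ulim _ Wreg Gw).1.
have alim i : ulim U (a i) = scoef m i w * (W (Num.min (tpt m i.+1) t) w - W (Num.min (tpt m i) t) w).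
  have [u1 l1] := ulim_lcoef m i Gw.
  have [u2 l2] := walk_ulim (Num.min (tpt m i.+1) t) Wreg Gw.
  have [u3 l3] := walk_ulim (Num.min (tpt m i) t) Wreg Gw.
  by rewrite /a ulimM ?ulimB ?l1 ?l2 ?l3//; exact: uboundedB.
have [u4 l4] := walk_ulim t Xreg Gw; have [u5 l5] := walk_ulim 0 Xreg Gw.
have e (n : nat) : discrete_error t m n (ev w n) = \sum_(i < parts m) a i n -
  (Xwalk D n (trunc (grid D n t) (ev w n)) - Xwalk D n (trunc (grid D n 0) (ev w n))).
  exact: discrete_errorE.
have sub : ubounded U (fun n => \sum_(i < parts m) a i n) by apply: ubounded_sum => i; exact: aub.
have xub : ubounded U (fun n => Xwalk D n (trunc (grid D n t) (ev w n)) -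
  Xwalk D n (trunc (grid D n 0) (ev w n))) by exact: uboundedB.
have bd : stbounded U ev (discrete_error t m) w.
  rewrite /stbounded /= (_ : (fun n => _) = fun n => \sum_(i < parts m) a i n -
    (Xwalk D n (trunc (grid D n t) (ev w n)) - Xwalk D n (trunc (grid D n 0) (ev w n)))).
    exact: uboundedB.
  by apply: funext => n; exact: e.
rewrite stdE// (_ : (fun n => _) = fun n => \sum_(i < parts m) a i n -
    (Xwalk D n (trunc (grid D n t) (ev w n)) - Xwalk D n (trunc (grid D n 0) (ev w n)))); last first.
  by apply: funext => n; exact: e.
rewrite ulimB// ulimB// l4 l5 /Msol; congr (_ - _).
have -> : ulim U (fun n => \sum_(i < parts m) a i n) = \sum_(i < parts m) ulim U (a i).
  exact: ulim_sum.
by apply: eq_bigr => i _; rewrite alim.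
Qed.

Let msp t m : measurable_fun setT (fun w => sp_integral (simple_approx m) W t w).
Proof.
apply: measurable_sum => i; apply: measurable_funM; last exact: measurable_funB.
by apply/measurable_fun_wrt => A mA; have [] := @scoef_measurable m i A mA.
Qed.

(** [mixed_isometry] with [B = 3 * tol m] and [cutoff n ^+ 2 <= tol m] gives [2 * 3 + 3 = 9]. *)
Lemma ito_error t m :
  (\int[P]_w ((sp_integral (simple_approx m) W t w - Msol t w) ^+ 2)%:E <= (T * (9 * tol m))%:E)%E.
Proof.
apply: (integral_std_sqr_Good U_cofinite hP (Z := discrete_error t m)); last exact: std_error.
  by apply: measurable_funB; [exact: msp|exact: measurable_funB].
have [_ hc _] := parts_spec m.
have hcut : \forall n \near \oo, @cutoff R n ^+ 2 <= tol m.
  apply: near_le0; last exact: tol_gt0.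
  by rewrite -[X in _ --> X](mulr0 0); apply: cvgM; exact: cutoff_cvg.
apply: near_oo_U => //; apply: filterS2 hc hcut => n hcn hcutn.
have -> : Emean D n (fun h => discrete_error t m n h ^+ 2) =
    mean_at D n (grid D n t) (fun h => (ito_sum D n (parts m) (kk n m) (lcoef n m) (grid D n t) h -
      (Xwalk D n h - Xwalk D n (trunc 0 h))) ^+ 2).
  by rewrite -(mean_at_trunc D n _ (grid_le D n t)).
have kkq : (grid D n t <= kk n m (parts m))%N by rewrite /kk tpt_last gridT grid_le.
have kkS i : (kk n m i <= kk n m i.+1)%N by apply: grid_mono; exact: tpt_le.
have kk0 : kk n m 0 = 0%N by rewrite /kk /tpt mul0r grid0.
apply: le_trans (mixed_isometry (B := 3 * tol m) kk0 kkS _ kkq) _.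
  move=> i j iq /andP[ij ji]; apply: hcn => //.
  apply: le_trans (@step_gap n m i (tpt m i.+1) (tpt_le _ (leqnSn i)) (lexx _)).
  by rewrite ler_wpM2l ?(ltW (step_gt0 D n))// ler_nat leq_sub2r// ltnW.
apply: ler_pM.
- by rewrite mulr_ge0// ltW// step_gt0.
- by rewrite addr_ge0// mulr_ge0// ?sqr_ge0// mulr_ge0// ltW// tol_gt0.
- by rewrite -(steps_step D n) mulrC ler_wpM2r ?(ltW (step_gt0 D n))// ler_nat grid_le.
- by move: hcutn; lra.
Qed.

Let gap_mean m i s : tpt m i <= s -> s <= tpt m i.+1 ->
  (\int[P]_w `|g (ravg_dens D U m (tpt m i) (Y (tpt m i) w)) - g (ravg_dens D U m s (Y s w))|%:E <=
   (3 * tol m)%:E)%E.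
Proof.
move=> h1 h2.
pose Z n (h : history (E := move)) : R :=
  `|g (vloc D m (tpt m i) n (torus n (trunc (grid D n (tpt m i)) h))) -
    g (vloc D m s n (torus n (trunc (grid D n s) h)))|.
rewrite (integral_std_Good U_cofinite hP (Z := Z) (K := c)).
- rewrite lee_fin; apply: ulim_le.
    apply: (ubounded_expect (Emean_functional D) (K := c)) => n h.
    by rewrite /Z normr_id pg_dist_le.
  have [_ _ hc] := parts_spec m.
  apply: near_oo_U => //; apply: filterS hc => n hc.
  have kks := grid_mono D n h1.
  have := hc _ _ kks (step_gap n h1 h2); rewrite -(mean_at_trunc D n _ (grid_le D n s)).
  rewrite /Emean /Z /vloc /comp; congr (mean_at _ _ _ _ <= _).
  by apply: funext => h; rewrite trunc_trunc.
- apply: measurableT_comp => //; apply: measurable_funB.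
    apply: (measurableT_comp measurable_pg).
    exact: (measurableT_comp (measurable_ravg_dens _ _ _ _)).
  apply: (measurableT_comp measurable_pg).
  exact: (measurableT_comp (measurable_ravg_dens _ _ _ _)).
- by move=> n h; rewrite /Z normr_ge0 pg_dist_le.
move=> w Gw.
have ub r : ubounded U (fun n => vloc D m r n (torus n (trunc (grid D n r) (ev w n)))).
  exists (2 / ravg D m); apply: filterS (vloc_regular D U_cofinite m r) => n [h _].
  exact: h.
have ugb r : ubounded U (fun n => g (vloc D m r n (torus n (trunc (grid D n r) (ev w n))))).
  exact: (ubounded_continuous (@pg_cont _ D) (ub r)).
have gE r : ulim U (fun n => g (vloc D m r n (torus n (trunc (grid D n r) (ev w n))))) =
    g (ravg_dens D U m r (Y r w)).
  by rewrite /Y -(std_vloc U_cofinite m r Gw) -(ulim_continuous (@pg_cont _ D) (ub r)).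
rewrite stdE; last first.
  by apply: (@stbounded_bd _ _ _ _ _ _ _ _ c) => n h; rewrite /Z normr_id pg_dist_le.
by rewrite /Z ulim_norm ?ulimB ?gE//; exact: uboundedB.
Qed.

(** The averages fail to converge only on a Lebesgue null set, which [Y s] avoids almost surely
    because its law has a density. *)
Let density_gap_cvg s : 0 < s ->
  (\int[P]_w `|g (ravg_dens D U m s (Y s w)) - g (usol s (Y s w))|%:E)%E @[m --> \oo] --> 0%E.
Proof.
move=> s0; have us x : usol s x = lim_dens D U s x by rewrite /usol gt_eqF.
rewrite [X in _ --> X](_ : 0%E = (\int[P]_w (cst 0%E w))%E); last by rewrite integral0.
have := @dominated_convergence _ _ _ P setT measurableT
  (fun m w => `|g (ravg_dens D U m s (Y s w)) - g (usol s (Y s w))|%:E) (cst 0%E) (cst c%:E).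
case => //.
- move=> m; apply/measurable_EFinP; apply: measurableT_comp => //; apply: measurable_funB.
    apply: (measurableT_comp measurable_pg).
    exact: (measurableT_comp (measurable_ravg_dens _ _ _ _)).
  apply: (measurableT_comp measurable_pg).
  exact: (measurableT_comp (measurable_usol _)).
- have [N [mN N0 hN]] := ravg_dens_cvg_ae D U_cofinite s.
  exists (Y s @^-1` N); split.
  + by rewrite -[_ @^-1` _]setTI; exact: mY.
  + transitivity (P (Y s @^-1` N)); first by [].
    rewrite (law_limit U_cofinite hP s mN); apply: null_set_integral => //.
    by apply/measurable_EFinP; apply: measurable_funTS; exact: measurable_lim_dens.
  move=> w /= hw; apply: hN => /= cv; apply: hw => _.
  apply: cvg_EFin; first exact: nearW.
  rewrite us; apply/norm_cvg0P; apply/subr_cvg0.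
  exact: (cvg_comp _ _ cv (@pg_cont _ D _)).
- exact: finite_measure_integrable_cst.
- by apply: aeW => w m _; rewrite /= normr_id lee_fin pg_dist_le.
Qed.

Let sp_val_at m i s w : (i < parts m)%N -> tpt m i < s <= tpt m i.+1 ->
  sp_val (simple_approx m) s w = scoef m i w.
Proof.
move=> ip hs; rewrite /sp_val /= (bigD1 (Ordinal ip))//= hs mulr1 big1 ?addr0// => j ji.
have /andP[s1 s2] := hs.
suff -> : (tpt m j < s <= tpt m j.+1)%R = false by rewrite mulr0.
apply/negbTE/negP => /andP[j1 j2].
move: ji => /eqP; apply; apply: val_inj => /=; apply/eqP; rewrite eqn_leq.
apply/andP; split; rewrite leqNgt; apply/negP => /(tpt_le m) h.
  by have := lt_le_trans (le_lt_trans h j1) s2; rewrite ltxx.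
by have := lt_le_trans (le_lt_trans h s1) j2; rewrite ltxx.
Qed.

Let find_part m s : 0 < s -> s <= T -> exists2 i, (i < parts m)%N & tpt m i < s <= tpt m i.+1.
Proof.
move=> s0 sT.
have ex p : s <= tpt m p -> exists2 i, (i < p)%N & tpt m i < s <= tpt m i.+1.
  elim: p => [|p IH]; first by rewrite /tpt mul0r leNgt s0.
  have [/IH[i ip h] _|h1 h2] := leP s (tpt m p); first by exists i => //; exact: leqW.
  by exists p => //; rewrite h1 h2.
by apply: ex; rewrite tpt_last.
Qed.

Let err m (p : R * Omega) : R := (sp_val (simple_approx m) p.1 p.2 - Hsol p.1 p.2) ^+ 2.

Let measurable_err m : measurable_fun setT (err m).
Proof.
apply: measurable_funX; apply: measurable_funB; last exact: measurable_Hsol2.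
rewrite /sp_val; apply: measurable_sum => i; apply: measurable_funM.
  have mc : measurable_fun setT (sp_coef (simple_approx m) i).
    by apply/measurable_fun_wrt => A mA; have [] := @scoef_measurable m i A mA.
  exact: (measurableT_comp mc measurable_snd).
pose I : set R := `]tpt m i, tpt m i.+1]%classic.
rewrite (_ : (fun p : R * Omega => _) = (\1_I \o fst)); last first.
  apply: funext => p; rewrite /= indicE /I; congr (_%:R).
  by rewrite mem_setE in_itv.
apply: measurableT_comp; last exact: measurable_fst.
by apply: measurable_indic; exact: measurable_itv.
Qed.

Let slice m (p : R * Omega) : \bar R := (err m p * \1_(`[0, T]%classic : set R) p.1)%:E.

Let measurable_time_indic : measurable_fun setT (fun p : R * Omega => \1_(`[0, T]%classic : set R) p.1 : R).
Proof.
rewrite (_ : (fun p : R * Omega => _) = (\1_(`[0, T]%classic : set R) : R -> R) \o fst)//.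
apply: measurableT_comp; last exact: measurable_fst.
by apply: measurable_indic; exact: measurable_itv.
Qed.

Let measurable_slice m : measurable_fun setT (slice m).
Proof.
apply/measurable_EFinP; apply: measurable_funM; first exact: measurable_err.
exact: measurable_time_indic.
Qed.

Let slice_ge0 m p : (0 <= slice m p)%E.
Proof. by rewrite lee_fin mulr_ge0 ?sqr_ge0. Qed.

Let mean_slice m (s : R) : \bar R := (\int[P]_w slice m (s, w))%E.

Let mean_slice_out m s : ~ (`[0, T]%classic : set R) s -> mean_slice m s = 0%E.
Proof.
move=> h; rewrite /mean_slice -[RHS](integral0 P setT); apply: eq_integral => w _.
by rewrite /slice /= indicE memNset// mulr0.
Qed.

(** The first bound gives convergence for each [s], the second one domination. Time 0 is excluded
    since the intervals of a simple process are open on the left. *)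
Let mean_slice_le m s : 0 < s -> s <= T ->
  (mean_slice m s <= (3 * tol m)%:E + \int[P]_w `|g (ravg_dens D U m s (Y s w)) - g (usol s (Y s w))|%:E)%E
  /\ (mean_slice m s <= c%:E)%E.
Proof.
move=> s0 sT; have [i ip hs] := find_part m s0 sT; have /andP[s1 s2] := hs.
have inT : (`[0, T]%classic : set R) s by rewrite /= in_itv /= sT ltW.
have mg (f : Omega -> R) : measurable_fun setT f -> measurable_fun setT (fun w => (g (f w))).
  by move=> mf; exact: (measurableT_comp measurable_pg).
have m1 : measurable_fun setT (fun w => g (ravg_dens D U m (tpt m i) (Y (tpt m i) w))).
  by apply: mg; exact: (measurableT_comp (measurable_ravg_dens _ _ _ _)).
have m2 : measurable_fun setT (fun w => g (ravg_dens D U m s (Y s w))).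
  by apply: mg; exact: (measurableT_comp (measurable_ravg_dens _ _ _ _)).
have m3 : measurable_fun setT (fun w => g (usol s (Y s w))).
  by apply: mg; exact: (measurableT_comp (measurable_usol _)).
have sE w : slice m (s, w) = ((scoef m i w - Hsol s w) ^+ 2)%:E.
  by rewrite /slice /err /= indicE mem_set// mulr1 (sp_val_at w ip hs).
have ms : measurable_fun setT (fun w => slice m (s, w)).
  exact: (measurableT_comp (measurable_slice m) (pair1_measurable s)).
split.
  apply: le_trans _ (leeD (gap_mean (ltW s1) s2) (lexx _)).
  have m12 : measurable_fun setT (fun w =>
      `|g (ravg_dens D U m (tpt m i) (Y (tpt m i) w)) - g (ravg_dens D U m s (Y s w))|%:E).
    by apply/measurable_EFinP; apply: measurableT_comp => //; exact: measurable_funB.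
  have m23 : measurable_fun setT (fun w => `|g (ravg_dens D U m s (Y s w)) - g (usol s (Y s w))|%:E).
    by apply/measurable_EFinP; apply: measurableT_comp => //; exact: measurable_funB.
  rewrite -ge0_integralD//=.
  apply: ge0_le_integral => //.
  - exact: emeasurable_funD.
  move=> w _; rewrite sE lee_fin; apply: le_trans (vol_dist_sqr _ _) _; exact: ler_distD.
rewrite -[leRHS]mule1 -(probability_setT P) -integral_cst//; apply: ge0_le_integral => //.
by move=> w _; rewrite /= sE lee_fin; apply: le_trans (vol_dist_sqr _ _) _; exact: pg_dist_le.
Qed.

Let c0 : 0 <= c := pc_ge0 D.

Let mItv : measurable (`[0, T]%classic : set (measurableTypeR R)).
Proof. exact: measurable_itvR. Qed.

(** Tonelli exchanges time and expectation, and dominated convergence is then applied in time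
    only. *)
Lemma simple_approx_cvg :
  (\int[P]_w \int[mu]_(s in `[0%R, T])
     ((sp_val (simple_approx m) s w - Hsol s w) ^+ 2)%:E)%E @[m --> \oo] --> 0%E.
Proof.
have swap m : (\int[P]_w \int[mu]_(s in `[0%R, T])
     ((sp_val (simple_approx m) s w - Hsol s w) ^+ 2)%:E)%E = (\int[mu]_s mean_slice m s)%E.
  rewrite /mean_slice (@fubini_tonelli _ _ _ _ R mu P (slice m) (measurable_slice m) (slice_ge0 m)).
  apply: eq_integral => w _; rewrite integral_mkcond; apply: eq_integral => s _.
  rewrite patchE /slice /= indicE; case: ifPn => h; first by rewrite mulr1.
  by rewrite mulr0.
rewrite (_ : (fun m => _) = (fun m => \int[mu]_s mean_slice m s)%E); last exact: funext.
rewrite [X in _ --> X](_ : 0%E = (\int[mu]_s (cst 0%E s))%E); last by rewrite integral0.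
pose gd (s : R) : \bar R := (c * \1_(`[0, T]%classic : set R) s)%:E.
have n0 (Q : R -> Prop) : (forall s, s != 0 -> Q s) -> {ae mu, forall s, Q s}.
  move=> h; exists [set 0]; split; [exact: measurable_set1|exact: lebesgue_measure_set1|].
  by move=> s /=; apply: contra_notP => /eqP; exact: h.
have := @dominated_convergence _ _ _ mu setT measurableT mean_slice (cst 0%E) gd; case => //.
- by move=> m; exact: (@measurable_fun_fubini_tonelli_F _ _ _ _ R P (slice m) (measurable_slice m) (slice_ge0 m)).
- apply: n0 => s sn0 _.
  have [sin|sout] := pselect ((`[0, T]%classic : set R) s); last first.
    rewrite (_ : (fun m => mean_slice m s) = (fun=> 0%E)); first exact: cvg_cst.
    by apply: funext => m; exact: mean_slice_out.
  move: sin; rewrite /= in_itv /= => /andP[s0 sT].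
  have s0' : 0 < s by rewrite lt_neqAle eq_sym sn0.
  have cv : ((3 * tol m)%:E + \int[P]_w `|g (ravg_dens D U m s (Y s w)) - g (usol s (Y s w))|%:E)%E
      @[m --> \oo] --> 0%E.
    rewrite -[X in _ --> X](adde0 0%E); apply: cvgeD => //; last exact: density_gap_cvg.
    apply: cvg_EFin; first exact: nearW.
    by rewrite -[X in _ --> X](mulr0 3); apply: cvgM; [exact: cvg_cst|exact: tol_cvg].
  apply: (squeeze_cvge _ (@cvg_cst _ 0%E _ _ _) cv); apply: nearW => m.
  rewrite (mean_slice_le m s0' sT).1 andbT.
  by apply: integral_ge0 => w _; exact: slice_ge0.
- rewrite (_ : gd = (cst c%:E) \_ (`[0, T]%classic : set (measurableTypeR R))).
    apply/(integrable_mkcond _ mItv); apply/integrableP; split => //.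
    rewrite (_ : (\int[mu]_(s in _) _)%E = (\int[mu]_(s in `[0%R, T]) cst c%:E s)%E).
      by rewrite integral_cst//= lebesgue_measure_itv /= lte_fin T0 -EFinB -EFinM ltry.
    by apply: eq_integral => s _; rewrite /= ger0_norm.
  apply: funext => s; rewrite patchE /gd indicE; case: ifPn => h; first by rewrite mulr1.
  by rewrite mulr0.
- apply: n0 => s sn0 m _; rewrite gee0_abs; last by apply: integral_ge0 => w _; exact: slice_ge0.
  have [sin|sout] := pselect ((`[0, T]%classic : set R) s); last first.
    by rewrite mean_slice_out// lee_fin mulr_ge0.
  rewrite /gd indicE mem_set// mulr1; move: sin; rewrite /= in_itv /= => /andP[s0 sT].
  have s0' : 0 < s by rewrite lt_neqAle eq_sym sn0.
  exact: (mean_slice_le m s0' sT).2.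
Qed.

Lemma Msol_continuous w : {within `[0, T], continuous (fun t => Msol t w)}.
Proof.
have Yc : continuous (fun t => Y t w) by exact: limit_walk_continuous Xreg w.
by apply: continuous_subspaceT => t; apply: cvgB; [exact: Yc|exact: cvg_cst].
Qed.

Let Hsol_sqr_le s w : Hsol s w ^+ 2 <= c.
Proof. by rewrite /Hsol /vol sqr_sqrtr ?pg_ge0// pg_le. Qed.

Lemma Hsol_integrand : ito_integrand P F T Hsol.
Proof.
split.
- by apply: measurable_funS measurable_Hsol2.
- move=> t _; apply: (@measurable_wrt_comp _ _ _ _ (Y t) (fun x => vol (usol t x))).
    by apply: (measurableT_comp measurable_vol); exact: measurable_usol.
  exact: limit_walk_adapted Xreg.
have mH w : measurable_fun setT (fun s => Hsol s w).
  exact: (measurableT_comp measurable_Hsol2 (pair2_measurable w)).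
apply: (@le_lt_trans _ _ (\int[P]_w cst (c * T)%:E w)%E); last first.
  have -> : (\int[P]_w cst (c * T)%:E w = (c * T)%:E * P setT)%E by exact: integral_cst.
  by rewrite probability_setT mule1 ltry.
apply: ge0_le_integral => //.
- by move=> w _; apply: integral_ge0 => s _; rewrite lee_fin sqr_ge0.
- pose f (p : R * Omega) : \bar R := (Hsol p.1 p.2 ^+ 2 * \1_(`[0, T]%classic : set R) p.1)%:E.
  have mf : measurable_fun setT f.
    apply/measurable_EFinP; apply: measurable_funM; first by apply: measurable_funX; exact: measurable_Hsol2.
    exact: measurable_time_indic.
  have f0 p : (0 <= f p)%E by rewrite lee_fin mulr_ge0 ?sqr_ge0.
  rewrite (_ : (fun w => _) = fubini_G mu f).
    exact: measurable_fun_fubini_tonelli_G.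
  apply: funext => w; rewrite /fubini_G [LHS]integral_mkcond; apply: eq_integral => s _.
  rewrite patchE /f /= indicE; case: ifPn => h; first by rewrite mulr1.
  by rewrite mulr0.
move=> w _; apply: (@le_trans _ _ (\int[mu]_(s in `[0%R, T]) cst c%:E s)%E).
  apply: ge0_le_integral => //.
  - by move=> s _; rewrite lee_fin sqr_ge0.
  - by apply/measurable_EFinP; apply: measurable_funTS; apply: measurable_funX; exact: mH.
  - by move=> s _; rewrite lee_fin.
by rewrite integral_cst//= lebesgue_measure_itv /= lte_fin T0 -EFinB -EFinM subr0.
Qed.

Lemma ito_solution : ito_integral P F T W Hsol Msol.
Proof.
split; [exact: Hsol_integrand|by move=> t _; exact: measurable_funB|exact: Msol_continuous|].
exists simple_approx; split; first exact: simple_approx_cvg.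
move=> t _.
have cv : (T * (9 * tol m))%:E @[m --> \oo] --> 0%E.
  apply: cvg_EFin; first exact: nearW.
  rewrite -[X in _ --> X](mulr0 T); apply: cvgM; first exact: cvg_cst.
  by rewrite -[X in _ --> X](mulr0 9); apply: cvgM; [exact: cvg_cst|exact: tol_cvg].
apply: (squeeze_cvge _ (@cvg_cst _ 0%E _ _ _) cv); apply: nearW => m.
by rewrite ito_error andbT; apply: integral_ge0 => w _; rewrite lee_fin sqr_ge0.
Qed.

End ito_limit.

(** * The coefficient and the theorem *)

Lemma porous_solvable (R : realType) (D : porous_data R) (phi u0 : R -> R) :
  (forall u, 0 <= u -> phi u = Num.sqrt (pg D u)) -> measurable_fun setT u0 ->
  {ae lebesgue_measure, forall x, pf D x = u0 x} -> solvable_in_law phi u0 (pT D).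
Proof.
move=> phiE mu0 fu0; have [U [UU U_cofinite]] := free_ultrafilter.
have [d [S [P [ev hP]]]] := loeb_probability U_cofinite
  ((0%N, [::]) : history (E := move)) (Emean_functional D).
have Xr : regular_walk D U ev (Xwalk D) by exact: Xwalk_regular.
exists d, S, P, (Filt D U P ev), (limit_walk D U ev (Wwalk D)),
  (limit_walk D U ev (Xwalk D)), (usol D U); split.
  split; [exact: filtration_Filt|exact: brownian_limit| |].
  - by move=> t _; exact: limit_walk_adapted.
  - by move=> w; apply: continuous_subspaceT; exact: limit_walk_continuous.
have us0 : usol D U 0 = pf D by apply: funext => x; rewrite /usol eqxx.
split.
- exact: (measurable_funS measurableT (@subsetT _ _) (measurable_usol2 D U_cofinite)).
- by move=> t x _; exact: usol_ge0.
- move=> t /andP[t0 _] A mA; rewrite (_ : usol D U t = lim_dens D U t); first exact: law_limit.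
  by apply: funext => x; rewrite /usol gt_eqF.
- rewrite us0; split => // A mA; rewrite (law_initial U_cofinite hP mA).
  apply: ae_eq_integral => //.
  + apply: measurable_funTS; exact: measurable_int (pf_int D).
  + by apply/measurable_EFinP; exact: measurable_funTS.
  + have [N [mN N0 hN]] := fu0; exists N; split => // x hx; apply: hN => /= e; apply: hx => _.
    by rewrite /= e.
exists (Msol D U ev); last by apply: aeW => w t _; rewrite /Msol addrC subrK.
have -> : (fun s w => phi (usol D U s (limit_walk D U ev (Xwalk D) s w))) = Hsol D U ev.
  by apply: funext => s; apply: funext => w; rewrite phiE// usol_ge0.
exact: ito_solution.
Qed.

Section coefficient.
Context {R : realType}.
Variables (beta : R -> R) (C : R).
Hypothesis (hA : assumptionA beta) (hB : assumptionB beta).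
Hypothesis hPhi : {within `[0, +oo[, continuous (Phi beta C)}.

Let Phi_pos u : 0 < u -> Phi beta C u = Num.sqrt (beta u / u).
Proof. by move=> u0; rewrite /Phi /beta0 gt_eqF// ltW. Qed.

Let beta_ge0 u : 0 <= u -> 0 <= beta u.
Proof. by case: hA => nd b0 _ _ u0; rewrite -b0; exact: nd. Qed.

Let Phi_pos_sqr u : 0 < u -> u * Phi beta C u ^+ 2 = beta u.
Proof.
move=> u0; rewrite Phi_pos// sqr_sqrtr ?divr_ge0 ?beta_ge0 ?ltW//.
by rewrite mulrCA divff ?mulr1// gt_eqF.
Qed.

Let Phi_cvg0 : Phi beta C u @[u --> 0^'+] --> C.
Proof.
have /(continuous_within_itvcyP _ _)[_] := hPhi.
by rewrite {2}/Phi eqxx.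
Qed.

Let C_ge0 : 0 <= C.
Proof.
apply: (cvgr_to_ge Phi_cvg0); near=> u; rewrite Phi_pos ?sqrtr_ge0//.
Unshelve. all: by end_near.
Qed.

(** Extended by its value at 0 to the negative half-line, which makes it continuous on the whole
    line. *)
Definition coef u : R := Phi beta C (Num.max u 0) ^+ 2.

Lemma Phi_ge0 u : 0 <= Phi beta C u.
Proof. by rewrite /Phi; case: ifP => // _; exact: sqrtr_ge0. Qed.

Lemma Phi_coef u : 0 <= u -> Phi beta C u = Num.sqrt (coef u).
Proof. by move=> u0; rewrite /coef max_l// sqrtr_sqr ger0_norm// Phi_ge0. Qed.

Lemma coef_ge0 u : 0 <= coef u. Proof. exact: sqr_ge0. Qed.

Lemma coef_continuous : continuous coef.
Proof.
move=> x; have -> : coef = (fun y => y ^+ 2) \o (fun u => Phi beta C (Num.max u 0)) by [].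
apply: continuous_comp; last exact: exprn_continuous.
  have /subspace_continuousP h := hPhi.
  have xp : (`[0, +oo[%classic : set R) (Num.max x 0) by rewrite /= in_itv /= andbT le_max lexx orbT.
  apply: cvg_comp (h _ xp) => B /= hB'.
  have mc : Num.max u 0 @[u --> x] --> Num.max x 0.
    by apply: continuous_max => //; exact: cvg_cst.
  have {hB' mc} : \forall u \near x, (`[0, +oo[%classic : set R) (Num.max u 0) -> B (Num.max u 0).
    exact: mc _ hB'.
  change ((\forall u \near x, (`[0, +oo[%classic : set R) (Num.max u 0) -> B (Num.max u 0)) ->
    \forall u \near x, B (Num.max u 0)).
  apply: filterS => u /=; apply.
  by rewrite in_itv /= andbT le_max lexx orbT.
Qed.

(** Assumption (B) bounds [beta u / u] for [u > 0]; the value at 0 inherits the bound by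
    continuity. *)
Lemma coef_bounded : exists c, forall u, coef u <= c.
Proof.
have [c c0 hc] := hB.
have cp u : 0 < u -> Phi beta C u <= Num.sqrt c.
  move=> u0; rewrite Phi_pos// ler_wsqrtr// ler_pdivrMr//.
  by have := hc u; rewrite !ger0_norm ?beta_ge0// ltW.
have Cc : C <= Num.sqrt c.
  apply: (cvgr_to_le Phi_cvg0); near=> u; exact: cp.
exists c => u; rewrite /coef -[leRHS](sqr_sqrtr (ltW c0)) ler_sqr ?nnegrE ?Phi_ge0 ?sqrtr_ge0//.
have [u0|u0] := ltP 0 u; first exact: cp.
by rewrite /Phi eqxx.
Unshelve. all: by end_near.
Qed.

Lemma coef_flux_nd u v : 0 <= u -> u <= v -> u * coef u <= v * coef v.
Proof.
have e x : 0 <= x -> x * coef x = beta x.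
  rewrite le_eqVlt => /predU1P[<-|x0]; first by have [_ -> _ _] := hA; rewrite mul0r.
  by rewrite /coef max_l ?ltW// Phi_pos_sqr.
move=> u0 uv; rewrite !e// ?(le_trans u0)//; by have [nd _ _ _] := hA; exact: nd.
Qed.

End coefficient.

Theorem theorem2p9 (R : realType) (beta : R -> R) (C : R)
    (hA : assumptionA beta) (hB : assumptionB beta)
    (hC : admissible_value0 beta C)
    (hPhi : {within `[0, +oo[, continuous (Phi beta C)})
    (u0 : R -> R) (hu0 : probability_density u0)
    (D0 : set R) (hD0 : locally_finite D0) (hBV : locally_BV_except D0 u0)
    (T : R) (hT : 0 < T) :
  solvable_in_law (Phi beta C) u0 T.
Proof.
have [c gc] := coef_bounded hA hB hPhi.
have [ui u_ge0 u1] := hu0.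
have mu0 : measurable_fun setT u0 by apply/measurable_EFinP; exact: measurable_int ui.
(* A version of [u0] that is nonnegative everywhere, as the cell masses require. *)
pose f x := Num.max (u0 x) 0.
have fu : {ae lebesgue_measure, forall x, f x = u0 x}.
  have [N [mN N0 hN]] := u_ge0; exists N; split => // x hx; apply: hN => /= h; apply: hx.
  by rewrite /= /f max_l.
have mf : measurable_fun setT f by apply: measurable_maxr.
have f0 x : 0 <= f x by rewrite le_max lexx orbT.
have f1 : (\int[lebesgue_measure]_x (f x)%:E = 1)%E.
  rewrite -u1; apply: ae_eq_integral => //; [exact/measurable_EFinP|exact/measurable_EFinP|].
  have [N [mN N0 hN]] := fu; exists N; split => // x hx; apply: hN => /= e; apply: hx => _.
  by rewrite /= e.
have fi : (@lebesgue_measure R).-integrable setT (EFin \o f).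
  apply/integrableP; split; first exact/measurable_EFinP.
  under eq_integral do rewrite /= ger0_norm//.
  by rewrite f1 ltry.
have fm : \int[@lebesgue_measure R]_x f x = 1 by rewrite /Rintegral f1.
pose D := PorousData (coef_continuous hPhi) (coef_ge0 beta C) gc (coef_flux_nd C hA) fi f0 fm hT.
apply: (@porous_solvable R D) => // u u_pos; exact: Phi_coef.
Qed.
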